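(* Let $V=\mathbb C^{0|2}$ with $\omega=\begin{pmatrix}0&1\\-1&0\end{pmatrix}$, so $\mathfrak{osp}(V;\omega)=\mathfrak{sp}_2(\mathbb C)$ and $\mathrm{sdim}(V)=-2$. Let $M_\lambda$ be the Verma module for $\mathfrak{sp}_2$ with highest weight $\lambda\in\mathbb C\setminus\{-2,-3,-4,\dots\}$. Then the functor $\mathcal F^{TLB}_\lambda:\mathcal{TLB}(-2,\lambda)\to\mathcal T_{M_\lambda}(V)$ is an isomorphism of categories.
   Context: **Lie theory.** $V=\mathbb C^{0|2}$ is purely odd. For the matrix form $\omega$ on a basis $e^1,e^2$, $g^{ab}=\omega(e^a,e^b)$, $(g_{ab})=(g^{ab})^{-1}$, $\{e_a\}$ is the basis with $\omega(e_a,e^b)=\delta_a^b$, $E^a_b$ the matrix units $E^c_b(e^a)=\delta^a_be^c$, and $X^a_b\in\mathfrak g=\mathfrak{sp}_2$ is the element $E^a_b+\sum_{a',b'}g^{aa'}g_{bb'}E^{b'}_{a'}$ of $\mathrm{End}(V)$. The tempered Casimir is $t=-\frac12\sum_{a,b}X^a_b\otimes X^b_a$; in terms of a standard basis $x,y,h$ of $\mathfrak{sp}_2=\mathfrak{sl}_2$ ($[h,x]=2x$, $[h,y]=-2y$, $[x,y]=h$), $t=-2(\frac12h\otimes h+x\otimes y+y\otimes x)$. Highest weight $\lambda$ means $h$ acts on the highest weight vector by $\lambda$. $\mu_M,\mu$ are the representations on $M,V$. On $V\otimes V$ the graded flip is $\tau(w\otimes w')=-w'\otimes w$; $\hat C(v\otimes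 v')=\omega(v,v')$; $\check C(1)=\sum_ae^a\otimes e_a$. $\mathcal T_M(V)$ is the full subcategory of $\mathfrak{sp}_2$-modules with objects $M\otimes V^{\otimes r}$, $r\in\mathbb N$ (one object for each $r$). **The category $\mathcal{MPB}(\delta)$.** Words are finite (possibly empty) sequences in the letters $m,v$; $v^r$ denotes $r$ copies of $v$. A coloured Brauer diagram from a word $s$ to a word $t$ is a perfect matching of the set of bottom points (one per letter of $s$, left to right) and top points (one per letter of $t$) such that matched points carry the same letter and two points in the same row are matched only if their letter is $v$. Let $\mathcal{C}$ be the $\mathbb C$-linear strict monoidal category with words as objects, these diagrams as a basis of $\mathrm{Hom}(s,t)$, composition $BA$ given by stacking $B$ on top of $A$ and replacing each closed loop by the factor $\delta$, and $\otimes$ given by concatenation/juxtaposition. Write $I(s)$ for identities, $\mathbb I=I(m)$, $I=I(v)$, $X_{a,b}:(a,b)\to(b,a)$ for the crossing, $X(s,t):(s,t)\to(t,s)$ for the crossing of two blocks of parallel strands, $X=X_{v,v}$, $\cup:\emptyset\to(v,v)$, $\cap:(v,v)\to\emptyset$, $E=\cup\cap$. The multi-polar Brauer category $\mathcal{MPB}(\delta)$ is the $\mathbb C$-linear strict monoidal category obtained from $\mathcal C$ by freely adjoining morphisms $\mathbb H(a,b):(a,b)\to(a,b)$, $a,b\in\{m,v\}$, subject to, for all letters $a,b,c$ and words $w$: (i) $X(w,(a,b))(I(w)\otimes\mathbb H(a,b))=(\mathbb H(a,b)\otimes I(w))X(w,(a,b))$ and $X((a,b),w)(\mathbb H(a,b)\otimes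 I(w))=(I(w)\otimes\mathbb H(a,b))X((a,b),w)$; (ii) $X_{b,a}\mathbb H(b,a)=\mathbb H(a,b)X_{b,a}$; (iii) $(I\otimes\cap\otimes I(a))(X\otimes\mathbb H(v,a))(I\otimes\cup\otimes I(a))=-\mathbb H(v,a)$ and $(I(a)\otimes\cap\otimes I)(\mathbb H(a,v)\otimes X)(I(a)\otimes\cup\otimes I)=-\mathbb H(a,v)$; (iv) with $\mathbb H_{12}=\mathbb H(a,b)\otimes I(c)$, $\mathbb H_{23}=I(a)\otimes\mathbb H(b,c)$, $\mathbb H_{13}=(I(a)\otimes X_{c,b})(\mathbb H(a,c)\otimes I(b))(I(a)\otimes X_{b,c})$, one has $[\mathbb H_{12},\mathbb H_{13}+\mathbb H_{23}]=0=[\mathbb H_{12}+\mathbb H_{13},\mathbb H_{23}]$; (v) $\mathbb H(v,v)=X-E$. For $\delta\neq0$, $\mathcal{MTL}(\delta)=\mathcal{MPB}(\delta)/\langle\Theta\rangle$, where $\langle\Theta\rangle$ is the tensor ideal generated by $\Theta=X+I\otimes I-\frac2\delta E\in\mathrm{End}(v^2)$; $\mathcal{PTL}(\delta)$ is the full subcategory of $\mathcal{MTL}(\delta)$ with objects $(m,v^r)$, $r\in\mathbb N$. Put $Z_2=(\mathbb I\otimes\cap)(\mathbb H(m,v)^2\otimes I)(\mathbb I\otimes\cup)\in\mathrm{End}(m)$, which is central in $\mathcal{PTL}(\delta)$: $D(Z_2\otimes I(v^r))=(Z_2\otimes I(v^s))D$ for $D:(m,v^r)\to(m,v^s)$. $\mathcal{TLB}(\delta,\lambda)$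 is the quotient category of $\mathcal{PTL}(\delta)$ obtained by setting $\frac{Z_2}\delta=-\lambda\left(\frac{\delta-2}2-\lambda\right)$ (that is, $Z_2\otimes I(v^r)$ is set equal to this scalar times $\delta$, for all $r$). **The functor $\mathcal F^{TLB}_\lambda$.** There is a monoidal functor from $\mathcal{MPB}(-2)$ to $\mathfrak{sp}_2$-modules with $m\mapsto M_\lambda$, $v\mapsto V$, crossings $\mapsto$ graded flips, $\cup\mapsto\check C$, $\cap\mapsto\hat C$, $\mathbb H(a,b)\mapsto(\mu_A\otimes\mu_B)(t)$, where $A,B\in\{M_\lambda,V\}$ are the images of $a,b$. Its restriction to the full subcategory with objects $(m,v^r)$ factors uniquely through $\mathcal{PTL}(-2)$ and then through $\mathcal{TLB}(-2,\lambda)$; the resulting functor is $\mathcal F^{TLB}_\lambda$, sending $(m,v^r)$ to $M_\lambda\otimes V^{\otimes r}$. *)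

(* Defs.v *)
From HB Require Import structures.
From mathcomp Require Import all_boot all_order all_algebra.
From mathcomp Require Import generic_quotient.
From mathcomp Require Import boolp ring.

Set Implicit Arguments.
Unset Strict Implicit.
Unset Printing Implicit Defensive.

Import GRing.Theory.
Local Open Scope ring_scope.
Local Open Scope quotient_scope.

Record category := Category {
  ob : Type;
  hom : ob -> ob -> Type;
  idm : forall x, hom x x;
  cmp : forall x y z, hom y z -> hom x y -> hom x z;
  cmp1m : forall x y (f : hom x y), cmp (idm y) f = f;
  cmpm1 : forall x y (f : hom x y), cmp f (idm x) = f;
  cmpA : forall x y z t (h : hom z t) (g : hom y z) (f : hom x y),
    cmp h (cmp g f) = cmp (cmp h g) f }.

Arguments idm {c} x.
Arguments cmp {c x y z} g f.

Record functor (C D : category) := Functor {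
  fob : ob C -> ob D;
  fmor : forall x y, hom x y -> hom (fob x) (fob y);
  fmor1 : forall x, fmor (idm x) = idm (fob x);
  fmorM : forall x y z (g : hom y z) (f : hom x y),
    fmor (cmp g f) = cmp (fmor g) (fmor f) }.

Definition functor_id (C : category) : functor C C :=
  @Functor C C id (fun x y f => f) (fun=> erefl) (fun x y z g f => erefl).

Definition functor_comp (C D E : category) (G : functor D E) (F : functor C D) :
  functor C E.
Proof.
refine (@Functor C E (fob G \o fob F) (fun x y f => fmor G (fmor F f)) _ _).
- by move=> x; rewrite !fmor1.
- by move=> x y z g f; rewrite !fmorM.
Defined.

Definition is_isomorphism (C D : category) (F : functor C D) : Prop :=
  exists G : functor D C,
    functor_comp G F = functor_id C /\ functor_comp F G = functor_id D.

Section PropQuotient.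
Variables (T : choiceType) (e : T -> T -> Prop).
Hypotheses (e_refl : forall x, e x x) (e_sym : forall x y, e x y -> e y x).
Hypothesis (e_trans : forall y x z, e x y -> e y z -> e x z).

Let eb : rel T := fun x y => `[< e x y >].

Lemma prop_equiv_refl : reflexive eb.
Proof. by move=> x; apply/asboolP. Qed.

Lemma prop_equiv_sym : symmetric eb.
Proof. by move=> x y; apply/asboolP/asboolP; exact: e_sym. Qed.

Lemma prop_equiv_trans : transitive eb.
Proof. by move=> y x z /asboolP xy /asboolP yz; apply/asboolP/(e_trans xy). Qed.

Definition prop_equiv : equiv_rel T :=
  EquivRel eb prop_equiv_refl prop_equiv_sym prop_equiv_trans.

Lemma prop_equivP x y :
  (\pi_({eq_quot prop_equiv}) x = \pi_({eq_quot prop_equiv}) y) <-> e x y.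
Proof. by split=> [/eqmodP/asboolP //|xy]; apply/eqmodP/asboolP. Qed.

End PropQuotient.

(* The tensor product is the set of formal sums of pairs, two of them being
   identified when every bilinear map takes the same value on both. *)

Section Tensor.
Variables (K : fieldType) (U W : lmodType K).

Definition bilinear_map (Z : lmodType K) (b : U -> W -> Z) : Prop :=
  (forall u, linear (b u)) /\ (forall w, linear (fun u => b u w)).

Definition formal_val (Z : lmodType K) (b : U -> W -> Z) (l : seq (U * W)) : Z :=
  \sum_(p <- l) b p.1 p.2.

Definition tens_eq (l l' : seq (U * W)) : Prop :=
  forall (Z : lmodType K) (b : U -> W -> Z), bilinear_map b ->
    formal_val b l = formal_val b l'.

Lemma tens_eq_refl l : tens_eq l l. Proof. by []. Qed.

Lemma tens_eq_sym l l' : tens_eq l l' -> tens_eq l' l.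
Proof. by move=> h Z b hb; rewrite h. Qed.

Lemma tens_eq_trans l' l l'' : tens_eq l l' -> tens_eq l' l'' -> tens_eq l l''.
Proof. by move=> h h' Z b hb; rewrite h // h'. Qed.

Definition tens : Type :=
  {eq_quot (prop_equiv tens_eq_refl tens_eq_sym tens_eq_trans)}.

HB.instance Definition _ := Choice.on tens.
HB.instance Definition _ : EqQuotient _ _ tens := EqQuotient.on tens.

Definition tens_lift (Z : lmodType K) (b : U -> W -> Z) (x : tens) : Z :=
  formal_val b (repr x).

Lemma tens_lift_pi (Z : lmodType K) (b : U -> W -> Z) l :
  bilinear_map b -> tens_lift b (\pi_tens l) = formal_val b l.
Proof.
move=> hb; rewrite /tens_lift.
have /prop_equivP h : \pi_tens (repr (\pi_tens l)) = \pi_tens l by rewrite reprK.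
exact: h.
Qed.

Lemma tens_lift_inj (x y : tens) :
  (forall (Z : lmodType K) (b : U -> W -> Z), bilinear_map b ->
     tens_lift b x = tens_lift b y) -> x = y.
Proof.
by move=> h; rewrite -[x]reprK -[y]reprK; apply/prop_equivP => Z b; apply: h.
Qed.

Definition tens_zero : tens := \pi_tens [::].
Definition tens_add (x y : tens) : tens := \pi_tens (repr x ++ repr y).
Definition tens_scale (a : K) (x : tens) : tens :=
  \pi_tens [seq (a *: p.1, p.2) | p <- repr x].
Definition tens_opp : tens -> tens := tens_scale (- 1).

Section Lift.
Variables (Z : lmodType K) (b : U -> W -> Z) (hb : bilinear_map b).

Lemma tens_lift0 : tens_lift b tens_zero = 0.
Proof. by rewrite tens_lift_pi // /formal_val big_nil. Qed.

Lemma tens_liftD x y : tens_lift b (tens_add x y) = tens_lift b x + tens_lift b y.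
Proof. by rewrite tens_lift_pi // /formal_val big_cat. Qed.

Lemma tens_liftZ a x : tens_lift b (tens_scale a x) = a *: tens_lift b x.
Proof.
rewrite tens_lift_pi // /formal_val big_map scaler_sumr; apply: eq_bigr => p _ /=.
have h0 : b 0 p.2 = 0.
  by have := hb.2 p.2 (- 1) 0 0; rewrite scaler0 addr0 scaleN1r addNr.
by have := hb.2 p.2 a p.1 0; rewrite addr0 h0 addr0.
Qed.

End Lift.

Let liftE := (tens_lift0, tens_liftD, tens_liftZ).

Lemma tens_addA : associative tens_add.
Proof. by move=> x y z; apply: tens_lift_inj => Z b hb; rewrite !liftE ?addrA. Qed.

Lemma tens_addC : commutative tens_add.
Proof. by move=> x y; apply: tens_lift_inj => Z b hb; rewrite !liftE // addrC. Qed.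

Lemma tens_add0 : left_id tens_zero tens_add.
Proof. by move=> x; apply: tens_lift_inj => Z b hb; rewrite !liftE // add0r. Qed.

Lemma tens_addN : left_inverse tens_zero tens_opp tens_add.
Proof.
by move=> x; apply: tens_lift_inj => Z b hb; rewrite !liftE // scaleN1r addNr.
Qed.

HB.instance Definition _ :=
  GRing.isZmodule.Build tens tens_addA tens_addC tens_add0 tens_addN.

Lemma tens_scaleA a b x : tens_scale a (tens_scale b x) = tens_scale (a * b) x.
Proof. by apply: tens_lift_inj => Z c hc; rewrite !liftE // scalerA. Qed.

Lemma tens_scale1 : left_id 1 tens_scale.
Proof. by move=> x; apply: tens_lift_inj => Z c hc; rewrite !liftE // scale1r. Qed.

Lemma tens_scaleDr : right_distributive tens_scale +%R.
Proof.
by move=> a x y; apply: tens_lift_inj => Z c hc; rewrite !liftE // scalerDr.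
Qed.

Lemma tens_scaleDl x : {morph tens_scale^~ x : a b / a + b}.
Proof.
by move=> a b; apply: tens_lift_inj => Z c hc; rewrite !liftE // scalerDl.
Qed.

HB.instance Definition _ := GRing.Zmodule_isLmodule.Build K tens
  tens_scaleA tens_scale1 tens_scaleDr tens_scaleDl.

Definition pure (u : U) (w : W) : tens := \pi_tens [:: (u, w)].

Lemma tens_lift_pure (Z : lmodType K) (b : U -> W -> Z) u w :
  bilinear_map b -> tens_lift b (pure u w) = b u w.
Proof. by move=> hb; rewrite tens_lift_pi // /formal_val big_seq1. Qed.

Lemma pure_bilinear : bilinear_map pure.
Proof.
split=> [u a w w'|w a u u']; apply: tens_lift_inj => Z b hb;
  rewrite /= tens_liftD // tens_liftZ // !tens_lift_pure //.
- exact: hb.1.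
- exact: hb.2.
Qed.

Lemma tens_lift_linear (Z : lmodType K) (b : U -> W -> Z) :
  bilinear_map b -> linear (tens_lift b : tens -> Z).
Proof. by move=> hb a x y; rewrite tens_liftD // tens_liftZ. Qed.

Lemma tens_span (x : tens) : x = \sum_(p <- repr x) pure p.1 p.2.
Proof.
apply: tens_lift_inj => Z b hb; rewrite /tens_lift -/(tens_lift b _).
pose f := tens_lift b : tens -> Z.
have fD u v : f (u + v) = f u + f v by exact: tens_liftD.
have f0 : f 0 = 0 by exact: tens_lift0.
rewrite (_ : tens_lift b _ = f (\sum_(p <- repr x) pure p.1 p.2)) //.
rewrite (big_morph f fD f0) /formal_val; apply: eq_bigr => p _.
by rewrite /f tens_lift_pure.
Qed.

Lemma tens_ext (Z : lmodType K) (f g : {linear tens -> Z}) :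
  (forall u w, f (pure u w) = g (pure u w)) -> f =1 g.
Proof.
by move=> h x; rewrite (tens_span x) !linear_sum; apply: eq_bigr => p _; apply: h.
Qed.

End Tensor.

Section TensorMap.
Variables (K : fieldType) (U W U' W' : lmodType K).
Variables (f : {linear U -> U'}) (g : {linear W -> W'}).

Lemma tens_map_bilinear : bilinear_map (fun u w => pure (f u) (g w)).
Proof.
have [h1 h2] := @pure_bilinear K U' W'.
by split=> [u a w w'|w a u u']; rewrite linearP ?h1 ?h2.
Qed.

Definition tens_map : tens U W -> tens U' W' :=
  tens_lift (fun u w => pure (f u) (g w)).

Lemma tens_map_linear : linear tens_map.
Proof. exact: tens_lift_linear tens_map_bilinear. Qed.

HB.instance Definition _ :=
  GRing.isLinear.Build K (tens U W) (tens U' W') *:%R tens_map tens_map_linear.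

Lemma tens_mapE u w : tens_map (pure u w) = pure (f u) (g w).
Proof. by rewrite /tens_map tens_lift_pure //; exact: tens_map_bilinear. Qed.

End TensorMap.

Section Sp2.
Variable K : fieldType.

(* E^c_b sends e^b to e^c: it is [delta_mx c b] acting on column vectors. *)
Definition gup : 'M[K]_2 := delta_mx 0 1 - delta_mx 1 0.
Definition glow : 'M[K]_2 := invmx gup.

Definition basisV (a : 'I_2) : 'cV[K]_2 := delta_mx a 0.
Definition omega (v w : 'cV[K]_2) : K := (v^T *m gup *m w) 0 0.
Definition dual_basisV (a : 'I_2) : 'cV[K]_2 := \sum_c glow a c *: basisV c.

Lemma gup_unit : gup \in unitmx.
Proof.
have h : gup *m (- gup) = 1%:M.
  apply/matrixP => i j; rewrite mxE !big_ord_recl big_ord0 !mxE.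
  by case: i => [[|[|//]] ?]; case: j => [[|[|//]] ?];
    rewrite /= ?(subr0, sub0r, addr0, add0r, mul0r, mulr0, oppr0, opprK, mulrNN, mulr1).
by have [] := mulmx1_unit h.
Qed.

Lemma omega_basis a b : omega (basisV a) (basisV b) = gup a b.
Proof. by rewrite /omega /basisV trmx_delta -rowE -colE !mxE. Qed.

Lemma omega_dual a b : omega (dual_basisV a) (basisV b) = (a == b)%:R.
Proof.
have -> : omega (dual_basisV a) (basisV b) = (glow *m gup) a b.
  rewrite /omega /dual_basisV linear_sum !mulmx_suml summxE mxE.
  by apply: eq_bigr => c _; rewrite linearZ -!scalemxAl mxE -omega_basis.
by rewrite mulVmx ?gup_unit // mxE.
Qed.

Definition sp2 : pred 'M[K]_2 := fun A => A^T *m gup + gup *m A == 0.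

Definition spX (a b : 'I_2) : 'M[K]_2 :=
  delta_mx a b + \sum_a' \sum_b' (gup a a' * glow b b') *: delta_mx b' a'.

Lemma spX_sp2 a b : spX a b \in sp2.
Proof.
have glowE : glow = - gup.
  have h : gup *m (- gup) = 1%:M.
    apply/matrixP => i j; rewrite mxE !big_ord_recl big_ord0 !mxE.
    by case: i => [[|[|//]] ?]; case: j => [[|[|//]] ?];
      rewrite /= ?(subr0, sub0r, addr0, add0r, mul0r, mulr0, oppr0, opprK, mulrNN, mulr1).
  by rewrite -[RHS]mul1mx -(mulVmx gup_unit) -mulmxA h mulmx1.
rewrite /spX glowE; apply/eqP/matrixP => i j.
rewrite !big_ord_recl !big_ord0 !mxE !big_ord_recl !big_ord0 !mxE.
by case: a => [[|[|//]] ?]; case: b => [[|[|//]] ?];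
  case: i => [[|[|//]] ?]; case: j => [[|[|//]] ?]; rewrite /=; ring.
Qed.

(* [act] is constrained, and used, only on matrices in sp2; its values elsewhere
   are irrelevant. *)
Record sp2mod := Sp2Mod {
  carrier :> lmodType K;
  act : 'M[K]_2 -> {linear carrier -> carrier};
  act_lin : forall (a : K) A B u, A \in sp2 -> B \in sp2 ->
    act (a *: A + B) u = a *: act A u + act B u;
  act_bracket : forall A B u, A \in sp2 -> B \in sp2 ->
    act (A *m B - B *m A) u = act A (act B u) - act B (act A u) }.

Record mod_hom (M N : sp2mod) := ModHom {
  mfun :> M -> N;
  mfun_linear : linear mfun;
  mfun_act : forall A u, A \in sp2 -> mfun (act M A u) = act N A (mfun u) }.

Lemma mod_hom_ext (M N : sp2mod) (f g : mod_hom M N) : f =1 g -> f = g.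
Proof.
case: f g => [f fl fa] [g gl ga] /= /funext fg; move: fl fa gl ga; rewrite fg.
by move=> fl fa gl ga; congr ModHom; exact: Prop_irrelevance.
Qed.

Definition mod_id (M : sp2mod) : mod_hom M M :=
  @ModHom M M id (fun _ _ _ => erefl) (fun _ _ _ => erefl).

Definition mod_comp (M N P : sp2mod) (g : mod_hom N P) (f : mod_hom M N) :
  mod_hom M P.
Proof.
refine (@ModHom M P (g \o f) _ _).
- by move=> a x y /=; rewrite !mfun_linear.
- by move=> A u hA /=; rewrite !mfun_act.
Defined.

Definition triv_mod : sp2mod.
Proof.
refine (@Sp2Mod K^o (fun=> \0) _ _) => * /=.
- by rewrite scaler0 addr0.
- by rewrite subr0.
Defined.

Definition natural_mod : sp2mod.
Proof.
refine (@Sp2Mod 'cV[K]_2 (fun A => mulmx A) _ _).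
- by move=> a A B u _ _ /=; rewrite mulmxDl scalemxAl.
- by move=> A B u _ _ /=; rewrite mulmxBl !mulmxA.
Defined.

Section TensorModule.
Variables M N : sp2mod.

Definition tens_act (A : 'M[K]_2) : {linear tens M N -> tens M N} :=
  tens_map (act M A) idfun \+ tens_map idfun (act N A).

Lemma tens_actE A u w :
  tens_act A (pure u w) = pure (act M A u) w + pure u (act N A w).
Proof. by rewrite /= !tens_mapE. Qed.

Lemma tens_act_lin (a : K) A B u : A \in sp2 -> B \in sp2 ->
  tens_act (a *: A + B) u = a *: tens_act A u + tens_act B u.
Proof.
move=> hA hB; have [h1 h2] := @pure_bilinear K M N.
pose rhs : {linear tens M N -> tens M N} := (a \*: tens_act A) \+ tens_act B.
apply: (@tens_ext _ _ _ _ (tens_act (a *: A + B)) rhs) => {}u w.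
have -> : rhs (pure u w) = a *: tens_act A (pure u w) + tens_act B (pure u w) by [].
by rewrite !tens_actE !act_lin // h1 h2 scalerDr addrACA.
Qed.

Lemma tens_act_bracket A B u : A \in sp2 -> B \in sp2 ->
  tens_act (A *m B - B *m A) u =
    tens_act A (tens_act B u) - tens_act B (tens_act A u).
Proof.
move=> hA hB; have [h1 h2] := @pure_bilinear K M N.
have pureBr x y z : pure x (y - z) = pure x y - pure x z :> tens M N.
  by rewrite -[y - z]addrC -scaleN1r h1 scaleN1r addrC.
have pureBl x y z : pure (y - z) x = pure y x - pure z x :> tens M N.
  by rewrite -[y - z]addrC -scaleN1r h2 scaleN1r addrC.
pose rhs : {linear tens M N -> tens M N} :=
  (tens_act A \o tens_act B) \- (tens_act B \o tens_act A).
apply: (@tens_ext _ _ _ _ (tens_act (A *m B - B *m A)) rhs) => {}u w.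
have -> : rhs (pure u w) = tens_act A (tens_act B (pure u w)) -
  tens_act B (tens_act A (pure u w)) by [].
rewrite !tens_actE !(linearD (tens_act _)) !tens_actE !act_bracket // pureBr pureBl.
set p := pure (act M A (act M B u)) w; set q := pure (act M B (act M A u)) w.
set x := pure u (act N A (act N B w)); set y := pure u (act N B (act N A w)).
set s := pure (act M A u) _; set t := pure (act M B u) _.
rewrite [s + x]addrC [t + y]addrC (addrACA p t) (addrACA q s) [s + t]addrC.
by rewrite opprD [RHS]addrACA subrr addr0 opprD addrACA.
Qed.

Definition tens_mod : sp2mod :=
  @Sp2Mod (tens M N) tens_act tens_act_lin tens_act_bracket.

End TensorModule.
Definition sp2x : 'M[K]_2 := delta_mx 0 1.
Definition sp2y : 'M[K]_2 := delta_mx 1 0.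
Definition sp2h : 'M[K]_2 := delta_mx 0 0 - delta_mx 1 1.

Definition highest_weight_vector (lambda : K) (M : sp2mod) (v : M) : Prop :=
  act M sp2x v = 0 /\ act M sp2h v = lambda *: v.

(* Universal property of U(g) (x)_{U(b)} K_lambda, b spanned by x and h. *)
Definition is_verma (lambda : K) (M : sp2mod) : Prop :=
  exists v : M, highest_weight_vector lambda v /\
    forall (N : sp2mod) (w : N), highest_weight_vector lambda w ->
      exists! f : mod_hom M N, f v = w.

End Sp2.

Inductive letter := Lm | Lv.

Definition letter_eqb (a b : letter) : bool :=
  match a, b with Lm, Lm | Lv, Lv => true | _, _ => false end.

Lemma letter_eqP : Equality.axiom letter_eqb.
Proof. by do 2!case; constructor. Qed.

HB.instance Definition _ := hasDecEq.Build letter letter_eqP.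

Notation word := (seq letter).

Section Diagrams.

(* Left summand: bottom points; right summand: top points. *)
Definition point (s t : word) : finType := ('I_(size s) + 'I_(size t))%type.

Definition colour (s t : word) (p : point s t) : letter :=
  match p with inl i => nth Lm s i | inr j => nth Lm t j end.

Definition same_row (s t : word) (p q : point s t) : bool :=
  match p, q with inl _, inl _ | inr _, inr _ => true | _, _ => false end.

Definition is_matching (s t : word) (d : {ffun point s t -> point s t}) : bool :=
  [forall p, [&& d p != p, d (d p) == p, colour (d p) == colour p
               & same_row p (d p) ==> (colour p == Lv)]].

Record diagram (s t : word) := Diagram {
  mate :> {ffun point s t -> point s t};
  mateP : is_matching mate }.

Lemma mate_spec s t (d : diagram s t) p :
  [/\ d p != p, d (d p) = p, colour (d p) = colour p
    & same_row p (d p) -> colour p = Lv].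
Proof.
have /forallP/(_ p)/and4P[h1 /eqP h2 /eqP h3 /implyP h4] := mateP d.
by split=> // /h4/eqP.
Qed.

Lemma matchingP s t (d : point s t -> point s t) :
  (forall p, [/\ d p != p, d (d p) = p, colour (d p) = colour p
               & same_row p (d p) -> colour p = Lv]) ->
  is_matching [ffun p => d p].
Proof.
move=> h; apply/forallP => p; rewrite !ffunE.
by have [-> -> -> h4] := h p; rewrite !eqxx; apply/implyP => /h4 ->.
Qed.

Definition id_mate (s : word) (p : point s s) : point s s :=
  match p with inl i => inr i | inr i => inl i end.

Lemma id_mateP s : is_matching [ffun p => @id_mate s p].
Proof. by apply: matchingP; case. Qed.

Definition id_diagram (s : word) : diagram s s := Diagram (id_mateP s).

Definition cup_mate (p : point [::] [:: Lv; Lv]) : point [::] [:: Lv; Lv] :=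
  match p with inl i => inl i | inr j => inr (rev_ord j) end.

Lemma cup_mateP : is_matching [ffun p => cup_mate p].
Proof. by apply: matchingP; case=> [[//]|[[|[|//]] ?]]; split=> //; congr inr; apply/val_inj. Qed.

Definition cup_diagram : diagram [::] [:: Lv; Lv] := Diagram cup_mateP.

Definition cap_mate (p : point [:: Lv; Lv] [::]) : point [:: Lv; Lv] [::] :=
  match p with inl i => inl (rev_ord i) | inr j => inr j end.

Lemma cap_mateP : is_matching [ffun p => cap_mate p].
Proof. by apply: matchingP; case=> [[[|[|//]] ?]|[//]]; split=> //; congr inl; apply/val_inj. Qed.

Definition cap_diagram : diagram [:: Lv; Lv] [::] := Diagram cap_mateP.

(* The positions of s ++ t, viewed as those of s followed by those of t. *)
Definition cutp (s t : word) (i : 'I_(size (s ++ t))) : 'I_(size s) + 'I_(size t) :=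
  split (cast_ord (size_cat s t) i).

Definition gluep (s t : word) (p : 'I_(size s) + 'I_(size t)) : 'I_(size (s ++ t)) :=
  cast_ord (esym (size_cat s t)) (unsplit p).

Arguments cutp : clear implicits.
Arguments gluep : clear implicits.

Lemma cutpK s t : cancel (cutp s t) (gluep s t).
Proof. by move=> i; rewrite /cutp /gluep splitK cast_ordK. Qed.

Lemma gluepK s t : cancel (gluep s t) (cutp s t).
Proof. by move=> i; rewrite /cutp /gluep cast_ordKV unsplitK. Qed.

Lemma nth_gluep s t p : nth Lm (s ++ t) (gluep s t p) = colour p.
Proof.
by case: p => i /=; rewrite nth_cat ?ltn_ord //= -ltn_subRL subnn ltn0 addKn.
Qed.

Definition swap_sum (A B : Type) (p : A + B) : B + A :=
  match p with inl a => inr a | inr b => inl b end.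

Definition crossing_mate (s t : word) (p : point (s ++ t) (t ++ s)) :
  point (s ++ t) (t ++ s) :=
  match p with
  | inl i => inr (gluep t s (swap_sum (cutp s t i)))
  | inr j => inl (gluep s t (swap_sum (cutp t s j)))
  end.

Lemma crossing_mateP s t : is_matching [ffun p => @crossing_mate s t p].
Proof.
apply: matchingP; case=> i; split=> //=.
- by rewrite gluepK; case: (cutp s t i) (cutpK i) => j /= ->.
- by rewrite -[i in RHS]cutpK !nth_gluep; case: (cutp s t i).
- by rewrite gluepK; case: (cutp t s i) (cutpK i) => j /= ->.
- by rewrite -[i in RHS]cutpK !nth_gluep; case: (cutp t s i).
Qed.

Definition crossing_diagram (s t : word) : diagram (s ++ t) (t ++ s) :=
  Diagram (crossing_mateP s t).

Section Juxtaposition.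
Variables (s t s' t' : word) (d : diagram s t) (d' : diagram s' t').

Definition embl (p : point s t) : point (s ++ s') (t ++ t') :=
  match p with
  | inl i => inl (gluep s s' (inl i))
  | inr j => inr (gluep t t' (inl j))
  end.

Definition embr (p : point s' t') : point (s ++ s') (t ++ t') :=
  match p with
  | inl i => inl (gluep s s' (inr i))
  | inr j => inr (gluep t t' (inr j))
  end.

Definition juxt_mate (p : point (s ++ s') (t ++ t')) : point (s ++ s') (t ++ t') :=
  match p with
  | inl i => match cutp s s' i with
             | inl k => embl (d (inl k))
             | inr k => embr (d' (inl k))
             end
  | inr j => match cutp t t' j with
             | inl k => embl (d (inr k))
             | inr k => embr (d' (inr k))
             end
  end.

Lemma emb_cases (P : point (s ++ s') (t ++ t') -> Prop) :
  (forall p, P (embl p)) -> (forall p, P (embr p)) -> forall p, P p.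
Proof.
move=> hl hr [i|j].
- by rewrite -(cutpK i); case: (cutp s s' i) => k; [exact: hl (inl k)|exact: hr (inl k)].
- by rewrite -(cutpK j); case: (cutp t t' j) => k; [exact: hl (inr k)|exact: hr (inr k)].
Qed.

Lemma juxt_embl p : juxt_mate (embl p) = embl (d p).
Proof. by case: p => i /=; rewrite gluepK. Qed.

Lemma juxt_embr p : juxt_mate (embr p) = embr (d' p).
Proof. by case: p => i /=; rewrite gluepK. Qed.

Lemma embl_inj : injective embl.
Proof. by case=> i [] j //= [] /eqP; rewrite ?eqn_add2l => /eqP/val_inj ->. Qed.

Lemma embr_inj : injective embr.
Proof. by case=> i [] j //= [] /eqP; rewrite ?eqn_add2l => /eqP/val_inj ->. Qed.

Lemma colour_embl p : colour (embl p) = colour p.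
Proof. by case: p => i; exact: nth_gluep. Qed.

Lemma colour_embr p : colour (embr p) = colour p.
Proof. by case: p => i; exact: nth_gluep. Qed.

Lemma same_row_embl p q : same_row (embl p) (embl q) = same_row p q.
Proof. by case: p q => i []. Qed.

Lemma same_row_embr p q : same_row (embr p) (embr q) = same_row p q.
Proof. by case: p q => i []. Qed.

Lemma juxt_mateP : is_matching [ffun p => juxt_mate p].
Proof.
apply: matchingP; apply: emb_cases => p.
- rewrite !juxt_embl (inj_eq embl_inj) !colour_embl.
  by have [h1 -> -> h4] := mate_spec d p; split=> //; rewrite same_row_embl.
- rewrite !juxt_embr (inj_eq embr_inj) !colour_embr.
  by have [h1 -> -> h4] := mate_spec d' p; split=> //; rewrite same_row_embr.
Qed.

Definition juxt_diagram : diagram (s ++ s') (t ++ t') := Diagram juxt_mateP.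

End Juxtaposition.

(* Stacking B on top of A: the vertices are the bottom points of A, the middle
   points and the top points of B.  The composite D joins the two outer points
   of each connected component having outer points; the other components are
   the closed loops. *)
Section Stacking.
Variables (s t u : word) (A : diagram s t) (B : diagram t u).

Definition stack_vertex : finType :=
  (('I_(size s) + 'I_(size t)) + 'I_(size u))%type.

Definition lower (p : point s t) : stack_vertex := inl p.

Definition upper (p : point t u) : stack_vertex :=
  match p with inl j => inl (inr j) | inr k => inr k end.

Definition outer (p : point s u) : stack_vertex :=
  match p with inl i => inl (inl i) | inr k => inr k end.

Definition stack_edge : rel stack_vertex := fun x y =>
  [exists p, (x == lower p) && (y == lower (A p))]
  || [exists p, (x == upper p) && (y == upper (B p))].

Definition is_stacking (D : diagram s u) : Prop :=
  forall p, connect stack_edge (outer p) (outer (D p)).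

Definition nb_loops : nat :=
  n_comp stack_edge [pred x | [forall p, ~~ connect stack_edge (outer p) x]].

End Stacking.

End Diagrams.

Arguments id_diagram : clear implicits.
Arguments crossing_diagram : clear implicits.

(* Formal expressions in diagrams and the morphisms H(a,b); MPB(delta) is their
   quotient by the smallest congruence containing the axioms of strict linear
   monoidal categories, the composition and juxtaposition of diagrams, and the
   defining relations of H. *)
Inductive term (K : fieldType) : word -> word -> Type :=
| tdg s t : diagram s t -> term K s t
| tH a b : term K [:: a; b] [:: a; b]
| tcomp s t u : term K t u -> term K s t -> term K s u
| ttens s t s' t' : term K s t -> term K s' t' -> term K (s ++ s') (t ++ t')
| tzero s t : term K s t
| tadd s t : term K s t -> term K s t -> term K s t
| tscale s t : K -> term K s t -> term K s t.

Arguments tdg {K s t} d.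
Arguments tH {K} a b.
Arguments tzero {K s t}.

HB.instance Definition _ (K : fieldType) (s t : word) := gen_eqMixin (term K s t).
HB.instance Definition _ (K : fieldType) (s t : word) := gen_choiceMixin (term K s t).

Declare Scope term_scope.
Delimit Scope term_scope with T.
Bind Scope term_scope with term.
Notation "g \oc f" := (tcomp g f) (at level 45, right associativity) : term_scope.
Notation "f \ox g" := (ttens f g) (at level 40, left associativity) : term_scope.
Notation "f + g" := (tadd f g) : term_scope.
Notation "a *: f" := (tscale a f) : term_scope.

Definition tcast (K : fieldType) s s' t t' (es : s = s') (et : t = t')
  (f : term K s t) : term K s' t' :=
  ecast w (term K w t') es (ecast w (term K s w) et f).

Section Relations.
Variables (K : fieldType) (delta : K).
Local Open Scope term_scope.

Local Notation term := (term K).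

Definition tid (s : word) : term s s := tdg (id_diagram s).
Definition tX (a b : letter) : term [:: a; b] [:: b; a] :=
  tdg (crossing_diagram [:: a] [:: b]).
Definition tXX (s t : word) : term (s ++ t) (t ++ s) := tdg (crossing_diagram s t).
Definition tcup : term [::] [:: Lv; Lv] := tdg cup_diagram.
Definition tcap : term [:: Lv; Lv] [::] := tdg cap_diagram.

Definition tH12 (a b c : letter) : term [:: a; b; c] [:: a; b; c] :=
  tH a b \ox tid [:: c].
Definition tH23 (a b c : letter) : term [:: a; b; c] [:: a; b; c] :=
  tid [:: a] \ox tH b c.
Definition tH13 (a b c : letter) : term [:: a; b; c] [:: a; b; c] :=
  (tid [:: a] \ox tX c b) \oc (tH a c \ox tid [:: b]) \oc (tid [:: a] \ox tX b c).

Definition left_bend (a : letter) : term [:: Lv; a] [:: Lv; a] :=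
  (tid [:: Lv] \ox (tcap \ox tid [:: a])) \oc (tX Lv Lv \ox tH Lv a)
    \oc (tid [:: Lv] \ox (tcup \ox tid [:: a])).

Definition right_bend (a : letter) : term [:: a; Lv] [:: a; Lv] :=
  (tid [:: a] \ox (tcap \ox tid [:: Lv])) \oc (tH a Lv \ox tX Lv Lv)
    \oc (tid [:: a] \ox (tcup \ox tid [:: Lv])).

Inductive mpb_eq : forall s t, term s t -> term s t -> Prop :=
| mpb_refl s t (f : term s t) : mpb_eq f f
| mpb_sym s t (f g : term s t) : mpb_eq f g -> mpb_eq g f
| mpb_trans s t (g f h : term s t) : mpb_eq f g -> mpb_eq g h -> mpb_eq f h
| mpb_comp s t u (g g' : term t u) (f f' : term s t) :
    mpb_eq g g' -> mpb_eq f f' -> mpb_eq (g \oc f) (g' \oc f')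
| mpb_tens s t s' t' (f f' : term s t) (g g' : term s' t') :
    mpb_eq f f' -> mpb_eq g g' -> mpb_eq (f \ox g) (f' \ox g')
| mpb_add s t (f f' g g' : term s t) :
    mpb_eq f f' -> mpb_eq g g' -> mpb_eq (f + g) (f' + g')
| mpb_scale s t (a : K) (f f' : term s t) :
    mpb_eq f f' -> mpb_eq (a *: f) (a *: f')
| mpb_addA s t (f g h : term s t) : mpb_eq (f + (g + h)) (f + g + h)
| mpb_addC s t (f g : term s t) : mpb_eq (f + g) (g + f)
| mpb_add0 s t (f : term s t) : mpb_eq (tzero + f) f
| mpb_addN s t (f : term s t) : mpb_eq ((-1)%R *: f + f) tzero
| mpb_scaleA s t (a b : K) (f : term s t) : mpb_eq (a *: (b *: f)) ((a * b)%R *: f)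
| mpb_scale1 s t (f : term s t) : mpb_eq (1%R *: f) f
| mpb_scaleDr s t (a : K) (f g : term s t) : mpb_eq (a *: (f + g)) (a *: f + a *: g)
| mpb_scaleDl s t (a b : K) (f : term s t) :
    mpb_eq ((a + b)%R *: f) (a *: f + b *: f)
| mpb_compDl s t u (g g' : term t u) (f : term s t) :
    mpb_eq ((g + g') \oc f) ((g \oc f) + (g' \oc f))
| mpb_compDr s t u (g : term t u) (f f' : term s t) :
    mpb_eq (g \oc (f + f')) ((g \oc f) + (g \oc f'))
| mpb_compZl s t u a (g : term t u) (f : term s t) :
    mpb_eq ((a *: g) \oc f) (a *: (g \oc f))
| mpb_compZr s t u a (g : term t u) (f : term s t) :
    mpb_eq (g \oc (a *: f)) (a *: (g \oc f))
| mpb_tensDl s t s' t' (f f' : term s t) (g : term s' t') :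
    mpb_eq ((f + f') \ox g) ((f \ox g) + (f' \ox g))
| mpb_tensDr s t s' t' (f : term s t) (g g' : term s' t') :
    mpb_eq (f \ox (g + g')) ((f \ox g) + (f \ox g'))
| mpb_tensZl s t s' t' a (f : term s t) (g : term s' t') :
    mpb_eq ((a *: f) \ox g) (a *: (f \ox g))
| mpb_tensZr s t s' t' a (f : term s t) (g : term s' t') :
    mpb_eq (f \ox (a *: g)) (a *: (f \ox g))
(* id_s (x) id_t = id_(s ++ t) follows from mpb_juxt; [::] ++ s is convertible
   to s, so the left unit law needs no cast. *)
| mpb_compA s t u v (h : term u v) (g : term t u) (f : term s t) :
    mpb_eq (h \oc (g \oc f)) ((h \oc g) \oc f)
| mpb_id_comp s t (f : term s t) : mpb_eq (tid t \oc f) f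
| mpb_comp_id s t (f : term s t) : mpb_eq (f \oc tid s) f
| mpb_interchange s t u s' t' u' (g : term t u) (f : term s t)
    (g' : term t' u') (f' : term s' t') :
    mpb_eq ((g \oc f) \ox (g' \oc f')) ((g \ox g') \oc (f \ox f'))
| mpb_tensA s1 t1 s2 t2 s3 t3 (f : term s1 t1) (g : term s2 t2) (h : term s3 t3) :
    mpb_eq (tcast (catA s1 s2 s3) (catA t1 t2 t3) (f \ox (g \ox h))) (f \ox g \ox h)
| mpb_id_tens s t (f : term s t) : mpb_eq (tid [::] \ox f) f
| mpb_tens_id s t (f : term s t) :
    mpb_eq (tcast (cats0 s) (cats0 t) (f \ox tid [::])) f
| mpb_stack s t u (A : diagram s t) (B : diagram t u) (D : diagram s u) :
    is_stacking A B D ->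
    mpb_eq (tdg B \oc tdg A) ((delta ^+ nb_loops A B)%R *: tdg D)
| mpb_juxt s t s' t' (A : diagram s t) (B : diagram s' t') :
    mpb_eq (tdg A \ox tdg B) (tdg (juxt_diagram A B))
| mpb_H_slide_r (w : word) a b :
    mpb_eq (tXX w [:: a; b] \oc (tid w \ox tH a b))
           ((tH a b \ox tid w) \oc tXX w [:: a; b])
| mpb_H_slide_l (w : word) a b :
    mpb_eq (tXX [:: a; b] w \oc (tH a b \ox tid w))
           ((tid w \ox tH a b) \oc tXX [:: a; b] w)
| mpb_H_sym a b : mpb_eq (tX b a \oc tH b a) (tH a b \oc tX b a)
| mpb_H_bend_l a : mpb_eq (left_bend a) ((-1)%R *: tH Lv a)
| mpb_H_bend_r a : mpb_eq (right_bend a) ((-1)%R *: tH a Lv)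
| mpb_H_4term_l a b c :
    mpb_eq (tH12 a b c \oc (tH13 a b c + tH23 a b c))
           ((tH13 a b c + tH23 a b c) \oc tH12 a b c)
| mpb_H_4term_r a b c :
    mpb_eq ((tH12 a b c + tH13 a b c) \oc tH23 a b c)
           (tH23 a b c \oc (tH12 a b c + tH13 a b c))
| mpb_H_vv : mpb_eq (tH Lv Lv) (tX Lv Lv + (-1)%R *: (tcup \oc tcap)).

End Relations.

Section MPB.
Variables (K : fieldType) (delta : K).

Section Hom.
Variables s t : word.

Definition mpb : Type := {eq_quot (prop_equiv
  (@mpb_refl K delta s t) (@mpb_sym K delta s t) (@mpb_trans K delta s t))}.

HB.instance Definition _ := Choice.on mpb.
HB.instance Definition _ : EqQuotient _ _ mpb := EqQuotient.on mpb.

Definition cls (f : term K s t) : mpb := \pi_mpb f.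

Lemma clsP f g : cls f = cls g <-> mpb_eq delta f g.
Proof. exact: prop_equivP. Qed.

Lemma cls_repr (x : mpb) : cls (repr x) = x. Proof. exact: reprK. Qed.

Lemma repr_cls f : mpb_eq delta (repr (cls f)) f.
Proof. by apply/clsP; rewrite cls_repr. Qed.

Definition mpb_zero : mpb := cls tzero.
Definition mpb_addm (x y : mpb) : mpb := cls (tadd (repr x) (repr y)).
Definition mpb_scalem (a : K) (x : mpb) : mpb := cls (tscale a (repr x)).
Definition mpb_oppm : mpb -> mpb := mpb_scalem (- 1).

Lemma cls_add f g : cls (tadd f g) = mpb_addm (cls f) (cls g).
Proof. by apply/clsP; apply: mpb_add; apply: mpb_sym; exact: repr_cls. Qed.

Lemma cls_scale a f : cls (tscale a f) = mpb_scalem a (cls f).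
Proof. by apply/clsP; apply: mpb_scale; apply: mpb_sym; exact: repr_cls. Qed.

Lemma mpb_addmA : associative mpb_addm.
Proof.
move=> x y z; rewrite -[x]cls_repr -[y]cls_repr -[z]cls_repr -!cls_add.
exact/clsP/mpb_addA.
Qed.

Lemma mpb_addmC : commutative mpb_addm.
Proof. by move=> x y; apply/clsP; exact: mpb_addC. Qed.

Lemma mpb_add0m : left_id mpb_zero mpb_addm.
Proof. by move=> x; rewrite -[x]cls_repr -cls_add; exact/clsP/mpb_add0. Qed.

Lemma mpb_addNm : left_inverse mpb_zero mpb_oppm mpb_addm.
Proof.
by move=> x; rewrite /mpb_oppm -[x]cls_repr -cls_scale -cls_add; exact/clsP/mpb_addN.
Qed.

HB.instance Definition _ :=
  GRing.isZmodule.Build mpb mpb_addmA mpb_addmC mpb_add0m mpb_addNm.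

Lemma mpb_scalemA a b x : mpb_scalem a (mpb_scalem b x) = mpb_scalem (a * b) x.
Proof. by rewrite -[x]cls_repr -!cls_scale; exact/clsP/mpb_scaleA. Qed.

Lemma mpb_scale1m : left_id 1 mpb_scalem.
Proof. by move=> x; rewrite -[x]cls_repr -cls_scale; exact/clsP/mpb_scale1. Qed.

Lemma mpb_scalemDr : right_distributive mpb_scalem +%R.
Proof.
move=> a x y; rewrite -[x]cls_repr -[y]cls_repr -[LHS]/(mpb_scalem a (mpb_addm _ _)).
rewrite -[RHS]/(mpb_addm _ _) -cls_add -!cls_scale -cls_add.
exact/clsP/mpb_scaleDr.
Qed.

Lemma mpb_scalemDl x : {morph mpb_scalem^~ x : a b / a + b}.
Proof.
move=> a b; rewrite -[x]cls_repr -[RHS]/(mpb_addm _ _) -!cls_scale -cls_add.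
exact/clsP/mpb_scaleDl.
Qed.

HB.instance Definition _ := GRing.Zmodule_isLmodule.Build K mpb
  mpb_scalemA mpb_scale1m mpb_scalemDr mpb_scalemDl.

Lemma clsD f g : cls (tadd f g) = cls f + cls g. Proof. exact: cls_add. Qed.
Lemma clsZ a f : cls (tscale a f) = a *: cls f. Proof. exact: cls_scale. Qed.
Lemma cls0 : cls tzero = 0. Proof. by []. Qed.

End Hom.

Definition mcomp s t u (g : mpb t u) (f : mpb s t) : mpb s u :=
  cls (tcomp (repr g) (repr f)).

Definition mtens s t s' t' (f : mpb s t) (g : mpb s' t') : mpb (s ++ s') (t ++ t') :=
  cls (ttens (repr f) (repr g)).

Definition mid (s : word) : mpb s s := cls (tid K s).
Definition mdg s t (d : diagram s t) : mpb s t := cls (tdg d).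
Definition mX (a b : letter) : mpb [:: a; b] [:: b; a] := cls (tX K a b).
Definition mcup : mpb [::] [:: Lv; Lv] := cls (tcup K).
Definition mcap : mpb [:: Lv; Lv] [::] := cls (tcap K).
Definition mH (a b : letter) : mpb [:: a; b] [:: a; b] := cls (tH a b).

Lemma cls_comp s t u (g : term K t u) (f : term K s t) :
  cls (tcomp g f) = mcomp (cls g) (cls f).
Proof. by apply/clsP; apply: mpb_comp; apply: mpb_sym; exact: repr_cls. Qed.

Lemma cls_tens s t s' t' (f : term K s t) (g : term K s' t') :
  cls (ttens f g) = mtens (cls f) (cls g).
Proof. by apply/clsP; apply: mpb_tens; apply: mpb_sym; exact: repr_cls. Qed.

Lemma mcompA s t u v (h : mpb u v) (g : mpb t u) (f : mpb s t) :
  mcomp h (mcomp g f) = mcomp (mcomp h g) f.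
Proof.
rewrite -[h]cls_repr -[g]cls_repr -[f]cls_repr -!cls_comp.
exact/clsP/mpb_compA.
Qed.

Lemma mcomp1m s t (f : mpb s t) : mcomp (mid t) f = f.
Proof. by rewrite -[f]cls_repr -cls_comp; exact/clsP/mpb_id_comp. Qed.

Lemma mcompm1 s t (f : mpb s t) : mcomp f (mid s) = f.
Proof. by rewrite -[f]cls_repr -cls_comp; exact/clsP/mpb_comp_id. Qed.

Lemma mcompPl s t u a (g g' : mpb t u) (f : mpb s t) :
  mcomp (a *: g + g') f = a *: mcomp g f + mcomp g' f.
Proof.
rewrite -[g]cls_repr -[g']cls_repr -[f]cls_repr -clsZ -clsD -!cls_comp -clsZ -clsD.
apply/clsP; apply: mpb_trans (mpb_compDl _ _ _ _) _.
by apply: mpb_add; [exact: mpb_compZl|exact: mpb_refl].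
Qed.

Lemma mcompPr s t u a (g : mpb t u) (f f' : mpb s t) :
  mcomp g (a *: f + f') = a *: mcomp g f + mcomp g f'.
Proof.
rewrite -[g]cls_repr -[f']cls_repr -[f]cls_repr -clsZ -clsD -!cls_comp -clsZ -clsD.
apply/clsP; apply: mpb_trans (mpb_compDr _ _ _ _) _.
by apply: mpb_add; [exact: mpb_compZr|exact: mpb_refl].
Qed.

Lemma mcompBl s t u (g g' : mpb t u) (f : mpb s t) :
  mcomp (g - g') f = mcomp g f - mcomp g' f.
Proof. by rewrite addrC -scaleN1r mcompPl scaleN1r addrC. Qed.

Lemma mcompBr s t u (g : mpb t u) (f f' : mpb s t) :
  mcomp g (f - f') = mcomp g f - mcomp g f'.
Proof. by rewrite addrC -scaleN1r mcompPr scaleN1r addrC. Qed.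

Definition Theta : mpb [:: Lv; Lv] [:: Lv; Lv] :=
  mX Lv Lv + mid [:: Lv; Lv] - (2 / delta) *: mcomp mcup mcap.

(* The tensor ideal generated by Theta; MTL(delta) is its quotient. *)
Inductive theta_ideal : forall s t, mpb s t -> Prop :=
| theta_gen : theta_ideal Theta
| theta_zero s t : theta_ideal (0 : mpb s t)
| theta_lin s t a (f g : mpb s t) :
    theta_ideal f -> theta_ideal g -> theta_ideal (a *: f + g)
| theta_comp s t u v (h : mpb u v) (f : mpb t u) (g : mpb s t) :
    theta_ideal f -> theta_ideal (mcomp h (mcomp f g))
| theta_tens_l s t s' t' (h : mpb s' t') (f : mpb s t) :
    theta_ideal f -> theta_ideal (mtens h f)
| theta_tens_r s t s' t' (f : mpb s t) (h : mpb s' t') :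
    theta_ideal f -> theta_ideal (mtens f h).

Definition pole (r : nat) : word := Lm :: nseq r Lv.

Definition Z2 : mpb [:: Lm] [:: Lm] :=
  mcomp (mtens (mid [:: Lm]) mcap)
    (mcomp (mtens (mcomp (mH Lm Lv) (mH Lm Lv)) (mid [:: Lv]))
           (mtens (mid [:: Lm]) mcup)).

Definition Z2_at (r : nat) : mpb (pole r) (pole r) := mtens Z2 (mid (nseq r Lv)).

Section TLB.
Variable lambda : K.

(* Preimage in MPB(delta) of the ideal of PTL(delta) generated by the morphisms
   Z_2 (x) I(v^r) - delta c, where c is the prescribed value of Z_2 / delta. *)
Inductive tlb_ideal : forall r s, mpb (pole r) (pole s) -> Prop :=
| tlb_theta r s (f : mpb (pole r) (pole s)) : theta_ideal f -> tlb_ideal f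
| tlb_gen r : tlb_ideal
    (Z2_at r - (delta * - (lambda * ((delta - 2) / 2 - lambda))) *: mid (pole r))
| tlb_lin r s a (f g : mpb (pole r) (pole s)) :
    tlb_ideal f -> tlb_ideal g -> tlb_ideal (a *: f + g)
| tlb_comp r s t u (h : mpb (pole t) (pole u)) (f : mpb (pole s) (pole t))
    (g : mpb (pole r) (pole s)) :
    tlb_ideal f -> tlb_ideal (mcomp h (mcomp f g)).

Section TLBHom.
Variables r s : nat.

Definition tlb_eq (f g : mpb (pole r) (pole s)) : Prop := tlb_ideal (f - g).

Lemma tlb_refl f : tlb_eq f f.
Proof. by rewrite /tlb_eq subrr; apply: tlb_theta; exact: theta_zero. Qed.

Lemma tlb_sym f g : tlb_eq f g -> tlb_eq g f.
Proof.
move=> h; rewrite /tlb_eq -opprB -scaleN1r -[_ *: _]addr0.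
by apply: tlb_lin => //; apply: tlb_theta; exact: theta_zero.
Qed.

Lemma tlb_trans g f h : tlb_eq f g -> tlb_eq g h -> tlb_eq f h.
Proof.
move=> fg gh; rewrite /tlb_eq -(subrKA g f (- h)) -[f - g]scale1r.
exact: tlb_lin.
Qed.

Definition tlb_hom : Type := {eq_quot (prop_equiv tlb_refl tlb_sym tlb_trans)}.

HB.instance Definition _ := Choice.on tlb_hom.
HB.instance Definition _ : EqQuotient _ _ tlb_hom := EqQuotient.on tlb_hom.

Definition tlb_cls (f : mpb (pole r) (pole s)) : tlb_hom := \pi_tlb_hom f.

Lemma tlb_clsP f g : tlb_cls f = tlb_cls g <-> tlb_eq f g.
Proof. exact: prop_equivP. Qed.

Lemma tlb_cls_repr x : tlb_cls (repr x) = x. Proof. exact: reprK. Qed.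

End TLBHom.

Definition tlb_compose (r s t : nat) (g : tlb_hom s t) (f : tlb_hom r s) :
  tlb_hom r t := tlb_cls (mcomp (repr g) (repr f)).

Lemma tlb_cls_comp r s t (g : mpb (pole s) (pole t)) (f : mpb (pole r) (pole s)) :
  tlb_cls (mcomp g f) = tlb_compose (tlb_cls g) (tlb_cls f).
Proof.
apply/tlb_clsP; set g' := repr _; set f' := repr _.
have hg : tlb_eq g g' by apply/tlb_clsP; rewrite tlb_cls_repr.
have hf : tlb_eq f f' by apply/tlb_clsP; rewrite tlb_cls_repr.
apply: (@tlb_trans _ _ (mcomp g' f)).
- rewrite /tlb_eq -mcompBl -[mcomp _ _]mcomp1m; exact: tlb_comp.
- rewrite /tlb_eq -mcompBr -[f - f']mcompm1; exact: tlb_comp.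
Qed.

Definition TLB : category.
Proof.
refine (@Category nat tlb_hom (fun r => tlb_cls (mid (pole r))) tlb_compose _ _ _).
- by move=> r s f; rewrite -[f]tlb_cls_repr -tlb_cls_comp mcomp1m.
- by move=> r s f; rewrite -[f]tlb_cls_repr -tlb_cls_comp mcompm1.
- move=> r s t u h g f; rewrite -[h]tlb_cls_repr -[g]tlb_cls_repr -[f]tlb_cls_repr.
  by rewrite -!tlb_cls_comp mcompA.
Defined.

End TLB.

End MPB.

Section Functor.
Variables (K : fieldType) (M : sp2mod K).

Definition letter_mod (a : letter) : sp2mod K :=
  match a with Lm => M | Lv => natural_mod K end.

(* a_1 (x) (a_2 (x) (... (x) K)); in particular the object (m, v^r) goes to
   the tensor product of M with V^(x)r. *)
Fixpoint word_mod (s : word) : sp2mod K :=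
  match s with
  | [::] => triv_mod K
  | a :: s' => tens_mod (letter_mod a) (word_mod s')
  end.

Definition scale_by (W : lmodType K) (y : W) (c : K^o) : W := c *: y.

Lemma scale_by_linear (W : lmodType K) (y : W) : linear (scale_by y).
Proof. by move=> a b c; rewrite /scale_by scalerDl scalerA. Qed.

HB.instance Definition _ (W : lmodType K) (y : W) :=
  GRing.isLinear.Build K K^o W *:%R (scale_by y) (scale_by_linear y).

(* The canonical isomorphism F(s) (x) F(t) -> F(s ++ t) on x (x) y. *)
Fixpoint join (s t : word) (y : word_mod t) : {linear word_mod s -> word_mod (s ++ t)} :=
  match s with
  | [::] => scale_by y
  | a :: s' => tens_map (idfun : {linear letter_mod a -> letter_mod a}) (join s' y)
  end.

Definition pure2 (a b : letter) (u : letter_mod a) (w : letter_mod b) :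
  word_mod [:: a; b] := pure u (pure w (1 : K^o)).

Definition graded_sign (a b : letter) : K :=
  if (a == Lv) && (b == Lv) then -1 else 1.

Local Notation mpb := (mpb (-2 : K)).

Definition is_F_MPB (F : forall s t, mpb s t -> mod_hom (word_mod s) (word_mod t)) :
  Prop :=
  [/\ (forall s x, F s s (mid _ s) x = x)
      /\ (forall s t u (g : mpb t u) (f : mpb s t) x,
            F _ _ (mcomp g f) x = F _ _ g (F _ _ f x)),
      (forall s t a (f g : mpb s t) x,
         F _ _ (a *: f + g) x = a *: F _ _ f x + F _ _ g x)
      /\ (forall s t s' t' (f : mpb s t) (g : mpb s' t') x y,
            F _ _ (mtens f g) (join s y x) = join t (F _ _ g y) (F _ _ f x)),
      forall a b (u : letter_mod a) (w : letter_mod b),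
        F _ _ (mX _ a b) (pure2 u w) = graded_sign a b *: pure2 w u,
      F _ _ (mcup _) (1 : K^o)
        = \sum_a @pure2 Lv Lv (basisV K a) (dual_basisV K a)
      /\ (forall v w : 'cV[K]_2, F _ _ (mcap _) (@pure2 Lv Lv v w) = omega v w)
    & forall a b (u : letter_mod a) (w : letter_mod b),
        F _ _ (mH _ a b) (pure2 u w)
        = - 2^-1 *: \sum_c \sum_d
            pure2 (act (letter_mod a) (spX K c d) u) (act (letter_mod b) (spX K d c) w)].

Definition TM : category.
Proof.
refine (@Category nat (fun r s => mod_hom (word_mod (pole r)) (word_mod (pole s)))
  (fun r => mod_id _) (fun r s t g f => mod_comp g f) _ _ _);
  by move=> *; exact: mod_hom_ext.
Defined.

(* The object map is the identity of nat, both categories having one object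
   for each r. *)
Definition is_F_TLB (lambda : K) (F : functor (TLB (-2) lambda) TM) : Prop :=
  exists2 F0, is_F_MPB F0 &
  exists Fm F1 FM, F = @Functor (TLB (-2) lambda) TM id Fm F1 FM /\
    forall r s (f : mpb (pole r) (pole s)), Fm r s (tlb_cls lambda f) = F0 _ _ f.

End Functor.

(* Main.v *)
From HB Require Import structures.
From mathcomp Require Import all_boot all_order all_algebra.
From mathcomp Require Import reals complex.
From mathcomp Require Import generic_quotient boolp ring.
Require Import Defs.

(** Why the functor exists. A coloured Brauer diagram acts on tensor products of M
    and V by a signed state sum: the strands are labelled by basis vectors, each
    chord contributes the value of a form (the identity on the pole, omega or its
    inverse on V), and the sign counts crossings of odd strands. Gluing two such
    sums along a common row contracts chords and evaluates loops at sdim V = -2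
    (csum_state, dgmap_stack); the same theorem for boolean labels without signs
    constructs the composite of two diagrams (composite, nb_loopsE). The chords
    H(a,b) act by the tempered Casimir operator and their relations are identities
    between commutators of h, x, y (teval_eq). The ideal is killed because Theta
    vanishes on V (x) V and because closing the square of the chord traces out V,
    leaving the quadratic Casimir of M, which is a scalar (F_tlb_ideal).

    Why it is bijective on morphisms. Bending strands reduces both injectivity and
    surjectivity to morphisms out of the bare pole (faithful, full). For those, two
    consequences of the relations are decisive. Modulo Theta a crossing is minus
    the identity minus cup-cap; with the bending relation this makes the chord
    closed by a single loop vanish (Z1_theta), and with the four-term relation it
    makes the square of the chord a combination of the chord, the identity and Z_2
    (quadratic). Hence every morphism out of the pole is a combination of words in
    cups and dotted cups, a dotted cup being a cup next to the pole followed by a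
    chord (pole_span), and these can be sorted into cap-free planar morphisms
    applied to stacks of dotted cups (pole_normal).

    On the other side, a homomorphism out of M is a highest weight vector of weight
    lambda in M (x) V^r. Expand such a vector in powers of y on the first factor.
    A dotted cup raises the degree by one, with leading coefficient -2 e_0 (x) e_0
    (dots_height), and the leading coefficient of a vector of degree j has weight
    2j in V^r. So everything is reduced to the fact that the cap-free morphisms from
    k to r strands, applied to e_0 (x) ... (x) e_0, correspond bijectively to the
    highest weight vectors of weight k in V^r; their recursion on the first strand is the
    branching rule of V (x) V^(r-1) (noncap_inj, noncap_surj). Descending and
    ascending induction on the degree give injectivity and surjectivity
    (dot_sum_inj, hw_surj). *)

Set Implicit Arguments.
Unset Strict Implicit.
Unset Printing Implicit Defensive.

Import GRing.Theory.
Local Open Scope ring_scope.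

(** * Signed state sums of perfect matchings *)

Fixpoint label_seqs (I : Type) (cs : seq I) (n : nat) : seq (seq I) :=
  if n is n'.+1 then [seq c :: ms | c <- cs, ms <- label_seqs cs n'] else [:: [::]].

Lemma big_label_seqsS (V : nmodType) (I : Type) (cs : seq I) n (F : seq I -> V) :
  \sum_(ms <- label_seqs cs n.+1) F ms =
  \sum_(c <- cs) \sum_(ms <- label_seqs cs n) F (c :: ms).
Proof. by rewrite /= big_flatten big_map; apply: eq_bigr => c _; rewrite big_map. Qed.

Section Pairing.
Variables (P : eqType) (col : P -> letter).

Definition matched (d : P -> P) (w : seq P) : Prop :=
  uniq w /\ forall p, p \in w ->
    [/\ d p \in w, d p != p, d (d p) = p & col (d p) = col p].

(** The matching seen after the points p and q have been glued to each other:
    their former partners become partners. *)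
Definition contract (d : P -> P) (p q : P) : P -> P := fun z =>
  if z == d p then d q else if z == d q then d p else d z.

Fixpoint contract_all (d : P -> P) (ks : seq (P * P)) : P -> P :=
  match ks with [::] => d | pq :: ks' => contract_all (contract d pq.1 pq.2) ks' end.

(** Gluing p to its own partner closes a loop, which disappears from the matching. *)
Fixpoint loop_letters (d : P -> P) (ks : seq (P * P)) : seq letter :=
  match ks with
  | [::] => [::]
  | pq :: ks' => (if d pq.1 == pq.2 then [:: col pq.1] else [::])
                 ++ loop_letters (contract d pq.1 pq.2) ks'
  end.

(** The pairs in ks are nested around the middle of the word, as the common row of
    two stacked diagrams is when the boundary of each is read around the circle. *)
Definition glue_word (L : seq P) (ks : seq (P * P)) (R : seq P) : seq P :=
  (L ++ rev (unzip1 ks)) ++ unzip2 ks ++ R.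

Lemma glue_word_cons L pq ks R : glue_word L (pq :: ks) R =
  (L ++ rev (unzip1 ks)) ++ pq.1 :: pq.2 :: unzip2 ks ++ R.
Proof. by rewrite /glue_word /= rev_cons -rcons_cat cat_rcons. Qed.

Section Form.
Variables (K : fieldType) (X : Type).
Variables (s : K) (g : letter -> X -> X -> K).

(** With s = -1 the letter v is odd and the pole is even. *)
Definition gsign (a b : letter) : K := if (a == Lv) && (b == Lv) then s else 1.

Definition sign_past (p : P) (w : seq P) : K :=
  \prod_(b <- w) gsign (col p) (col b).

(** A matching of the letters of a word is evaluated by pairing each letter with its
    partner through the form g, after moving the partner next to it; sign_past is the
    price of that move. *)
Fixpoint state_fuel (d : P -> P) (n : nat) (w : seq P) (x : P -> X) : K :=
  match n, w with
  | n'.+1, a :: w' =>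
      sign_past a (take (index (d a) w') w') * g (col a) (x a) (x (d a))
      * state_fuel d n' (rem (d a) w') x
  | _, _ => 1
  end.

Definition state d w x := state_fuel d (size w) w x.

Lemma size_rem_leq (T : eqType) (b : T) w : (size (rem b w) <= size w)%N.
Proof. by elim: w => //= c w IH; case: ifP => //= _; exact: leqW. Qed.

Lemma rem_mid (T : eqType) (w1 w2 : seq T) b :
  b \notin w1 -> rem b (w1 ++ b :: w2) = w1 ++ w2.
Proof.
elim: w1 => [|c w1 IH] /=; first by rewrite eqxx.
by rewrite inE negb_or eq_sym => /andP[/negbTE -> /IH ->].
Qed.

Lemma state_nil d x : state d [::] x = 1. Proof. by []. Qed.

Lemma state_fuel_ge d n w x : (size w <= n)%N -> state_fuel d n w x = state d w x.
Proof.
rewrite /state; have [k] := ubnP (size w); elim: k w n => // k IH [|a w] [|n] //= wk wn.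
have h : (size (rem (d a) w) <= size w)%N.
  by rewrite size_rem_leq.
have hk : (size (rem (d a) w) < k)%N := leq_ltn_trans h wk.
by congr (_ * _); rewrite (IH _ n hk (leq_trans h wn)) (IH _ (size w) hk h).
Qed.

(** Removing the pair of the first letter is the recursion that defines the state;
    it is used in this shape because the partner is rarely in the second place. *)
Lemma state_split d a w1 w2 x : d a \notin w1 ->
  state d (a :: w1 ++ d a :: w2) x =
  sign_past a w1 * g (col a) (x a) (x (d a)) * state d (w1 ++ w2) x.
Proof.
move=> nb; rewrite /state /=.
rewrite rem_mid // index_cat (negbTE nb) /= eqxx addn0 take_size_cat //.
by congr (_ * _); apply: state_fuel_ge; rewrite !size_cat /= addnS.
Qed.

Lemma mem_split (T : eqType) (b : T) w : b \in w -> exists w1 w2, w = w1 ++ b :: w2.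
Proof. by case/splitPr => w1 w2; exists w1, w2. Qed.

Lemma sign_past_cat p w1 w2 : sign_past p (w1 ++ w2) = sign_past p w1 * sign_past p w2.
Proof. exact: big_cat. Qed.

Lemma sign_past_cons p b w : sign_past p (b :: w) = gsign (col p) (col b) * sign_past p w.
Proof. exact: big_cons. Qed.

Lemma sign_past_nil p : sign_past p [::] = 1.
Proof. exact: big_nil. Qed.

Lemma sign_past_col p q w : col p = col q -> sign_past p w = sign_past q w.
Proof. by move=> pq; rewrite /sign_past pq. Qed.

Hypothesis ss : s * s = 1.

Lemma gsign2 a b : gsign a b * gsign a b = 1.
Proof. by rewrite /gsign; case: ifP; rewrite ?mulr1. Qed.

Lemma gsignC a b : gsign a b = gsign b a.
Proof. by rewrite /gsign andbC. Qed.

Lemma sign_past2 p w : sign_past p w * sign_past p w = 1.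
Proof. by rewrite -big_split /= big1 // => b _; exact: gsign2. Qed.

Lemma matched_uniq d w : matched d w -> uniq w. Proof. by case. Qed.

Lemma matched_cons d a w : matched d (a :: w) ->
  exists w1 w2, [/\ w = w1 ++ d a :: w2, d a \notin w1 & matched d (w1 ++ w2)].
Proof.
move=> [u m]; have [da dna dda _] := m a (mem_head _ _).
move: da; rewrite inE (negbTE dna) /= => /mem_split [w1 [w2 wE]].
exists w1, w2; move: u; rewrite wE /= cat_uniq /= negb_or mem_cat inE !negb_or.
case/andP=> /and3P[aw1 _ aw2] /and3P[u1 /andP[naw1 h12] /andP[naw2 u2]].
split=> //; split; first by rewrite cat_uniq u1 h12 u2.
move=> p; rewrite mem_cat => pw.
have pw' : p \in a :: w by rewrite wE inE mem_cat inE; case/orP: pw => ->; rewrite !orbT.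
have [dp dnp ddp cp] := m p pw'; split=> //.
move: dp; rewrite wE inE !mem_cat inE.
case/or3P=> [/eqP dpa|->|/orP[/eqP dpa|->]]; rewrite ?orbT //.
- have := pw; rewrite -ddp dpa => /orP[] h; first by rewrite h in naw1.
  by rewrite h in naw2.
- have := pw; rewrite -ddp dpa dda => /orP[] h; first by rewrite h in aw1.
  by rewrite h in aw2.
Qed.

Lemma state_ext d d' w x x' : matched d w ->
  {in w, d =1 d'} -> {in w, x =1 x'} -> state d w x = state d' w x'.
Proof.
have [n] := ubnP (size w); elim: n w => // n IH [|a w] // /ltnSE wn m dd xx.
have [w1 [w2 [wE nda m']]] := matched_cons m.
have daw : d a \in a :: w by rewrite wE inE mem_cat mem_head !orbT.
have da : d a = d' a by apply: dd; exact: mem_head.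
have sub : {subset w1 ++ w2 <= a :: w}.
  by move=> p; rewrite wE inE !mem_cat inE => /orP[] ->; rewrite !orbT.
rewrite wE state_split // (xx _ daw) (xx _ (mem_head _ _)).
rewrite (IH (w1 ++ w2)) //; last 2 first.
- by move=> p /sub; exact: dd.
- by move=> p /sub; exact: xx.
- by rewrite da state_split // -da.
by move: wn; rewrite wE /= !size_cat /= addnS; apply: leq_trans.
Qed.

Hypothesis gsym : forall a x y, g a x y = gsign a a * g a y x.

Lemma matched_perm d w w' : perm_eq w w' -> matched d w -> matched d w'.
Proof.
move=> pw [u m]; split; first by rewrite -(perm_uniq pw).
by move=> p; rewrite -(perm_mem pw) => /m[]; rewrite (perm_mem pw).
Qed.

Lemma perm_swap (T : eqType) (w1 w2 : seq T) p q :
  perm_eq (w1 ++ p :: q :: w2) (w1 ++ q :: p :: w2).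
Proof. by rewrite perm_cat2l (perm_catCA [:: p] [:: q] w2). Qed.

Lemma perm_mid (T : eqType) (w1 w2 : seq T) b : perm_eq (w1 ++ b :: w2) (b :: w1 ++ w2).
Proof. exact/permEl/(perm_catCA w1 [:: b] w2). Qed.

Lemma matched_drop d a w1 w2 : matched d (a :: w1 ++ d a :: w2) -> matched d (w1 ++ w2).
Proof.
move=> m; have [v1 [v2 [e _ m']]] := matched_cons m.
apply: matched_perm m'; rewrite -(perm_cons (d a)).
apply: perm_trans (perm_mid w1 w2 _); rewrite e perm_sym; exact: perm_mid.
Qed.

(** Exchanging two neighbours costs their sign whatever their partners are. When they
    are partners of each other this is the graded symmetry of g; when the two chords
    are disjoint, the crossing number of the chords changes by one. The remaining
    cases follow by removing the pair of the first letter. *)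
Lemma state_swap d w1 p q w2 x : matched d (w1 ++ p :: q :: w2) ->
  state d (w1 ++ p :: q :: w2) x =
  gsign (col p) (col q) * state d (w1 ++ q :: p :: w2) x.
Proof.
have [n] := ubnP (size w1 + size w2); elim: n w1 w2 => // n IH [|a w1] w2 /ltnSE wn m.
- rewrite /=; have [pq|pq] := eqVneq (d p) q.
    have dq : d q = p by rewrite -pq; have [] := m.2 p (mem_head _ _).
    have cp : col q = col p by rewrite -pq; have [] := m.2 p (mem_head _ _).
    have := @state_split d p [::] w2 x isT; rewrite pq /= => ->.
    have := @state_split d q [::] w2 x isT; rewrite dq /= => ->.
    by rewrite !sign_past_nil !mul1r gsym cp mulrA.
  have u := m.1.
  have [db dbn ddb cb] := m.2 p (mem_head _ _).
  have qin : q \in p :: q :: w2 by rewrite !inE eqxx orbT.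
  have [de den dde ce] := m.2 q qin.
  move: db; rewrite !inE (negbTE dbn) (negbTE pq) /= => db.
  have qp : d q != p by apply: contraNneq pq => e; rewrite -e dde.
  move: de; rewrite !inE (negbTE den) (negbTE qp) /= => de.
  have bne : d p != d q.
    apply/eqP => e; have : p = q by rewrite -ddb e dde.
    by move=> e2; move: u; rewrite e2 /= inE eqxx.
  have [u1 [u2 wE]] := mem_split db.
  have uw : uniq w2 by move: u => /= /and3P[].
  have pw2 : p \notin w2 by move: u; rewrite /= inE negb_or => /andP[/andP[]].
  have qw2 : q \notin w2 by move: u; rewrite /= => /and3P[].
  have : d q \in u1 ++ u2.
    by move: de; rewrite wE !mem_cat inE eq_sym (negbTE bne).
  rewrite mem_cat => /orP[] /mem_split [t1 [t2 uE]].
  + (* d q before d p *)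
    move: wE uw pw2 qw2; rewrite uE -catA /= => wE; rewrite wE.
    rewrite !cat_uniq /= !mem_cat !inE !cat_uniq /= !mem_cat !inE !negb_or => U pw2 qw2.
    have [nq1 np1 nq2 np2] : [/\ d q \notin t1, d p \notin t1, d p \notin t2 & d p != d q].
      split=> //.
      - by case/and3P: U => _ /andP[].
      - case/and3P: U => _ + _; rewrite has_cat /= !negb_or.
        by case/and3P => _ _ /andP[].
      - case/and3P: U => _ _ /andP[_ /and3P[_ + _]] /=.
        by case/andP.
    have e1 : q :: t1 ++ d q :: t2 ++ d p :: u2 = (q :: t1 ++ d q :: t2) ++ d p :: u2.
      by rewrite /= -catA.
    rewrite e1 state_split; last first.
      by rewrite inE mem_cat inE !negb_or pq np1 nq2 bne.
    rewrite /= -catA /= state_split //.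
    have e2 : p :: t1 ++ d q :: t2 ++ d p :: u2 = (p :: t1) ++ d q :: (t2 ++ d p :: u2).
      by [].
    rewrite e2 state_split; last by rewrite inE negb_or qp nq1.
    rewrite cat_cons (catA t1 t2 (d p :: u2)) state_split; last by rewrite mem_cat negb_or np1 nq2.
    rewrite !sign_past_cons !sign_past_cat !sign_past_cons ce -!catA.
    rewrite (gsignC (col q) (col p)).
    have := gsign2 (col p) (col q); set ε := gsign _ _ => E.
    ring.
  + (* d p before d q *)
    move: wE uw pw2 qw2; rewrite uE => wE; rewrite wE.
    rewrite !cat_uniq /= !mem_cat !inE !cat_uniq /= !mem_cat !inE !negb_or => U pw2 qw2.
    have [nq1 np1 nq2] : [/\ d p \notin u1, d q \notin u1 & d q \notin t1].
      split=> //.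
      - by case/and3P: U => _ /andP[].
      - case/and3P: U => _ + _; rewrite has_cat /= !negb_or.
        by case/andP => _ /and3P[].
      - by case/and3P: U => _ _ /andP[_ /and3P[_ + _]] /=; case/andP.
    have e1 : q :: u1 ++ d p :: t1 ++ d q :: t2 = (q :: u1) ++ d p :: t1 ++ d q :: t2.
      by [].
    rewrite e1 state_split; last by rewrite inE negb_or pq nq1.
    rewrite cat_cons (catA u1 t1 (d q :: t2)) state_split; last by rewrite mem_cat negb_or np1 nq2.
    have e2 : p :: u1 ++ d p :: t1 ++ d q :: t2 = (p :: u1 ++ d p :: t1) ++ d q :: t2.
      by rewrite /= -catA.
    rewrite e2 state_split; last first.
      by rewrite inE mem_cat inE !negb_or qp np1 eq_sym bne nq2.
    have -> : (p :: u1 ++ d p :: t1) ++ t2 = p :: u1 ++ d p :: (t1 ++ t2).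
      by rewrite /= -catA.
    rewrite state_split //.
    rewrite !sign_past_cons !sign_past_cat !sign_past_cons cb -!catA.
    rewrite (gsignC (col q) (col p)).
    have := gsign2 (col p) (col q); set ε := gsign _ _ => E.
    transitivity (ε * ε * (sign_past p u1 * g (col p) (x p) (x (d p)) *
      (sign_past q u1 * sign_past q t1 * g (col q) (x q) (x (d q)) * state d (u1 ++ t1 ++ t2) x)) * ε).
      by rewrite E; ring.
    ring.
- rewrite cat_cons in m *.
  have [v1 [v2 [vE nda m']]] := matched_cons m.
  have [da dna dda ca] := m.2 a (mem_head _ _).
  have um : uniq (a :: w1 ++ p :: q :: w2) := m.1.
  have pqn : p != q.
    move: um; rewrite /= cat_uniq => /andP[_ /and3P[_ _]] /=.
    by rewrite inE negb_or => /andP[/andP[]].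
  have dain : d a \in w1 ++ p :: q :: w2 by rewrite vE mem_cat mem_head orbT.
  move: dain; rewrite mem_cat !inE => /orP[|/or3P[]].
  + case/mem_split => [t1 [t2 tE]].
    have nd1 : d a \notin t1.
      by move: um; rewrite tE /= !cat_uniq /= !negb_or => /andP[_ /and3P[/and3P[_ /andP[]]]].
    have e r r' : (a :: w1) ++ [:: r, r' & w2] = a :: t1 ++ d a :: t2 ++ [:: r, r' & w2].
      by rewrite tE /= -catA.
    move: m; rewrite -cat_cons e => m; rewrite e !state_split // !catA IH.
    * by rewrite mulrCA.
    * by move: wn; rewrite tE /= !size_cat /= addnS addSn; apply: leq_trans.
    * by rewrite -catA; exact: matched_drop m.
  + move/eqP => dap.
    have nd1 : d a \notin w1.
      by move: um; rewrite dap /= !cat_uniq /= !negb_or => /andP[_ /and3P[_ /andP[]]].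
    have := @state_split d a w1 (q :: w2) x nd1; rewrite dap => ->.
    have : d a \notin w1 ++ [:: q].
      by rewrite mem_cat inE negb_or nd1 dap.
    move=> /(@state_split d a _ w2 x); rewrite dap -!catA /= => ->.
    rewrite sign_past_cat sign_past_cons sign_past_nil -ca dap mulr1 !mulrA.
    by rewrite [gsign _ _ * sign_past _ _]mulrC -[_ * gsign _ _ * gsign _ _]mulrA gsign2 mulr1.
  + move/eqP => dap.
    have nd1 : d a \notin w1.
      by move: um; rewrite dap /= !cat_uniq /= !negb_or => /andP[_ /and3P[_ /and3P[]]].
    have := @state_split d a w1 (p :: w2) x nd1; rewrite dap => ->.
    have : d a \notin w1 ++ [:: p].
      by rewrite mem_cat inE negb_or nd1 dap /= eq_sym.
    move=> /(@state_split d a _ w2 x); rewrite dap -!catA /= => ->.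
    rewrite sign_past_cat sign_past_cons sign_past_nil -ca dap mulr1 !mulrA.
    by rewrite (gsignC (col q) (col p)) [sign_past _ _ * gsign _ _]mulrC.
  + case/mem_split => [t1 [t2 tE]].
    have hp r r' : perm_eq (w1 ++ [:: r, r' & t1]) (w1 ++ [:: r', r & t1]) by exact: perm_swap.
    have nd1 : d a \notin w1 ++ [:: p, q & t1].
      by move: um; rewrite tE -(cat_cons q) -(cat_cons p) catA /= cat_uniq /= => /andP[_ /and3P[_ /norP[]]].
    have nd2 : d a \notin w1 ++ [:: q, p & t1] by rewrite -(perm_mem (hp p q)).
    have e r r' : w1 ++ [:: r, r' & w2] = (w1 ++ [:: r, r' & t1]) ++ d a :: t2.
      by rewrite tE -catA.
    rewrite e in m; rewrite cat_cons !e !state_split // -!catA /= IH.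
    * have -> : sign_past a (w1 ++ [:: p, q & t1]) = sign_past a (w1 ++ [:: q, p & t1]).
        exact: perm_big.
      by rewrite mulrCA.
    * by move: wn; rewrite tE /= !size_cat /= !addnS addSn => /ltnW.
    * by move/matched_drop: m; rewrite -catA.
Qed.

Lemma perm_move (T : eqType) (w0 w1 w2 : seq T) q :
  perm_eq (w0 ++ w1 ++ q :: w2) (w0 ++ q :: w1 ++ w2).
Proof. by rewrite perm_cat2l perm_mid. Qed.

Lemma state_move d w0 w1 q w2 x : matched d (w0 ++ w1 ++ q :: w2) ->
  state d (w0 ++ w1 ++ q :: w2) x = sign_past q w1 * state d (w0 ++ q :: w1 ++ w2) x.
Proof.
elim: w1 w0 => [|a w1 IH] w0 m; first by rewrite sign_past_nil mul1r.
rewrite cat_cons -cat_rcons IH; last by rewrite cat_rcons.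
rewrite cat_rcons state_swap.
  by rewrite mulrA sign_past_cons gsignC [sign_past _ _ * _]mulrC.
rewrite -cat_rcons; apply: matched_perm (perm_move _ _ _ _) _.
by rewrite cat_rcons.
Qed.

Lemma state_front b w : b \in w -> exists σ r, perm_eq w (b :: r) /\
  forall d w0 x, matched d (w0 ++ w) -> state d (w0 ++ w) x = σ * state d (w0 ++ b :: r) x.
Proof.
case/mem_split => w1 [w2 ->]; exists (sign_past b w1), (w1 ++ w2).
by split=> [|d w0 x m]; [exact: perm_mid|exact: state_move].
Qed.

(** The sign of bringing two letters to the front depends on the word and not on the
    matching, so it cancels when two matchings of the same word are compared. *)
Lemma state_front2 b e w : b \in w -> e \in w -> e != b ->
  exists σ r, perm_eq w (b :: e :: r) /\
  forall d w0 x, matched d (w0 ++ w) ->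
    state d (w0 ++ w) x = σ * state d (w0 ++ b :: e :: r) x.
Proof.
move=> bw ew eb; have [σ [r [pr h]]] := state_front bw.
have er : e \in r by move: ew; rewrite (perm_mem pr) inE (negbTE eb).
have [τ [r' [pr' h']]] := state_front er.
exists (σ * τ), r'; split; first by apply: perm_trans pr _; rewrite perm_cons.
move=> d w0 x m; rewrite h // -cat_rcons h' ?cat_rcons ?mulrA //.
by apply: matched_perm m; rewrite perm_cat2l.
Qed.

Variables (I : eqType) (cs : seq I) (J E : letter -> I -> X) (ok : X -> Prop).
Variable loop : letter -> K.
Hypothesis contraction : forall a x y, ok x -> ok y ->
  \sum_(c <- cs) g a x (J a c) * g a (E a c) y = g a x y.
Hypothesis loopE : forall a, \sum_(c <- cs) g a (J a c) (E a c) = loop a.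

Definition upd (x : P -> X) (p q : P) (c : I) : P -> X := fun z =>
  if z == p then J (col p) c else if z == q then E (col q) c else x z.

Lemma matched_contract d p q w : matched d (p :: q :: w) -> col p = col q ->
  matched (contract d p q) w.
Proof.
move=> [u m] cpq; move: (u) => /= /and3P[]; rewrite inE negb_or => /andP[pq pw] qw uw.
split=> // z zw.
have zpq : z \in [:: p, q & w] by rewrite !inE zw !orbT.
have zp : z != p by apply: contraNneq pw => <-.
have zq : z != q by apply: contraNneq qw => <-.
have [p1 p2 p3 p4] := m p (mem_head _ _).
have [|q1 q2 q3 q4] := m q; first by rewrite !inE eqxx orbT.
have [z1 z2 z3 z4] := m z zpq.
rewrite /contract.
have [zdp|zdp] := eqVneq z (d p).
  have dpq : d p != q by rewrite -zdp.
  have dqp : d q != p by apply: contraNneq dpq => e; rewrite -q3 e.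
  have dd : d q != d p by apply: contraNneq pq => e; rewrite -p3 -e q3.
  rewrite (negbTE dd) eqxx zdp; split=> //; last by rewrite q4 p4.
  by move: q1; rewrite !inE (negbTE q2) (negbTE dqp).
have [zdq|zdq] := eqVneq z (d q).
  have dqp : d q != p by rewrite -zdq.
  have dpq : d p != q by apply: contraNneq dqp => e; rewrite -e p3.
  have dd : d p != d q by apply: contraNneq pq => e; rewrite -p3 e q3.
  rewrite eqxx zdq; split=> //; last by rewrite q4 p4.
  by move: p1; rewrite !inE (negbTE p2) (negbTE dpq).
have dzp : d z != p by apply: contraNneq zdp => e; rewrite -e z3.
have dzq : d z != q by apply: contraNneq zdq => e; rewrite -e z3.
have -> : (d z == d p) = false.
  by apply/negP => /eqP e; move/eqP: zp; apply; rewrite -z3 e p3.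
have -> : (d z == d q) = false.
  by apply/negP => /eqP e; move/eqP: zq; apply; rewrite -z3 e q3.
by split=> //; move: z1; rewrite !inE (negbTE dzp) (negbTE dzq).
Qed.

(** Summing over the labels of the two glued points merges two chords into one by the
    contraction identity of g, or evaluates a closed loop if the two points are
    partners. The two chords have to be brought side by side first, and state_front2
    does it with the same sign on both sides. *)
Lemma state_contract_head d p q w x : matched d (p :: q :: w) -> col p = col q ->
  (forall z, z \in w -> ok (x z)) ->
  \sum_(c <- cs) state d (p :: q :: w) (upd x p q c) =
  (if d p == q then loop (col p) else 1) * state (contract d p q) w x.
Proof.
move=> m cpq okx; have mc := matched_contract m cpq.
move: (m.1) => /= /and3P[]; rewrite inE negb_or => /andP[pq pw] qw uw.
have [p1 p2 p3 p4] := m.2 p (mem_head _ _).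
have [|q1 q2 q3 q4] := m.2 q; first by rewrite !inE eqxx orbT.
have updw c : {in w, upd x p q c =1 x}.
  move=> z zw; rewrite /upd.
  have -> : (z == p) = false by apply/negP => /eqP e; rewrite -e zw in pw.
  by have -> : (z == q) = false by apply/negP => /eqP e; rewrite -e zw in qw.
have updp c : upd x p q c p = J (col p) c by rewrite /upd eqxx.
have updq c : upd x p q c q = E (col p) c.
  by rewrite /upd eq_sym (negbTE pq) eqxx cpq.
have [dpq|dpq] := eqVneq (d p) q.
  have md : matched d w by apply: (@matched_drop d p [::] w); rewrite /= dpq.
  rewrite -loopE mulr_suml; apply: eq_bigr => c _.
  have := @state_split d p [::] w (upd x p q c) isT; rewrite dpq /= => ->.
  rewrite sign_past_nil mul1r updp updq; congr (_ * _).
  apply: state_ext => // z zw.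
  rewrite /contract dpq.
  have -> : (z == q) = false by apply/negP => /eqP e; rewrite -e zw in qw.
  have -> : (z == d q) = false.
    by apply/negP => /eqP e; rewrite -dpq p3 in e; rewrite -e zw in pw.
  by [].
have dqp : d q != p by apply: contraNneq dpq => e; rewrite -q3 e.
have dd : d q != d p by apply: contraNneq pq => e; rewrite -p3 -e q3.
have bw : d p \in w by move: p1; rewrite !inE (negbTE p2) (negbTE dpq).
have ew : d q \in w by move: q1; rewrite !inE (negbTE q2) (negbTE dqp).
have cE : contract d p q (d p) = d q by rewrite /contract eqxx.
have [σ [r [pr frontE]]] := state_front2 bw ew dd.
have mr : matched d (p :: q :: d p :: d q :: r).
  by apply: matched_perm m; rewrite !perm_cons.
have mr2 : matched (contract d p q) (d p :: d q :: r) by exact: matched_perm mc.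
have mdr : matched d r.
  have m1 : matched d (q :: d q :: r) by apply: (@matched_drop d p [:: q] (d q :: r)).
  exact: (@matched_drop d q [::] r).
have rw z : z \in r -> z \in w by move=> zr; rewrite (perm_mem pr) !inE zr !orbT.
rewrite mul1r (frontE (contract d p q) [::]) //=.
have := @state_split (contract d p q) (d p) [::] r x isT.
rewrite cE sign_past_nil mul1r => ->.
rewrite -(@state_ext d (contract d p q) r x x mdr) //; last first.
  move=> z zr; rewrite /contract.
  have := (matched_uniq mr); rewrite /= !inE !negb_or => /and5P[_ _ /andP[_ bn] en _].
  have -> : (z == d p) = false by apply/negP => /eqP e; rewrite -e zr in bn.
  by have -> : (z == d q) = false by apply/negP => /eqP e; rewrite -e zr in en.
rewrite -contraction; [|exact: okx|exact: okx].
rewrite mulr_suml mulr_sumr; apply: eq_bigr => c _.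
rewrite (frontE d [:: p; q]) //=.
have nqp : d p \notin [:: q] by rewrite inE.
have := @state_split d p [:: q] (d q :: r) (upd x p q c) nqp => /= ->.
have := @state_split d q [::] r (upd x p q c) isT => /= ->.
rewrite sign_past_nil mul1r sign_past_cons sign_past_nil mulr1 updp updq !updw //.
rewrite (@state_ext d d r (upd x p q c) x) // => [|z zr]; last exact/updw/rw.
rewrite p4 -cpq [in RHS]gsym; ring.
Qed.

Lemma state_contract d w1 p q w2 x : matched d (w1 ++ p :: q :: w2) ->
  col p = col q -> (forall z, z \in w1 ++ w2 -> ok (x z)) ->
  \sum_(c <- cs) state d (w1 ++ p :: q :: w2) (upd x p q c) =
  (if d p == q then loop (col p) else 1) * state (contract d p q) (w1 ++ w2) x.
Proof.
move=> m cpq okx; rewrite -state_contract_head //; last first.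
  apply: matched_perm m; apply: perm_trans (perm_mid _ _ _) _.
  by rewrite perm_cons perm_mid.
apply: eq_bigr => c _.
rewrite (@state_move d [::] w1 p) // (@state_move d [:: p] w1 q) /=; last first.
  by apply: matched_perm m; exact: perm_mid.
by rewrite (sign_past_col _ cpq) mulrA sign_past2 mul1r.
Qed.

Hypothesis okJ : forall a c, c \in cs -> ok (J a c).
Hypothesis okE : forall a c, c \in cs -> ok (E a c).

(** The labels are summed one glued pair at a time, so that each step meets a word in
    which the pair is adjacent. *)
Fixpoint csum (ks : seq (P * P)) (Phi : (P -> X) -> K) (x : P -> X) : K :=
  match ks with
  | [::] => Phi x
  | pq :: ks' => csum ks' (fun y => \sum_(c <- cs) Phi (upd y pq.1 pq.2 c)) x
  end.

Definition glue_points (ks : seq (P * P)) := unzip1 ks ++ unzip2 ks.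

Lemma csum_eq ks Phi Psi x :
  (forall y, (forall z, z \in glue_points ks -> ok (y z)) ->
     (forall z, z \notin glue_points ks -> y z = x z) -> Phi y = Psi y) ->
  csum ks Phi x = csum ks Psi x.
Proof.
elim: ks Phi Psi => [|[p q] ks IH] Phi Psi h /=; first exact: h.
apply: IH => y oky outy; rewrite big_seq [RHS]big_seq; apply: eq_bigr => c ccs.
have inE2 z : (z \in glue_points ((p, q) :: ks)) =
    [|| z == p, z == q | z \in glue_points ks].
  by rewrite /glue_points /= inE !mem_cat inE; case: (z == p); case: (z == q) => //=;
     rewrite orbT.
apply: h => z; rewrite inE2 /upd.
- by case: eqP => [_ _|_]; [exact: okJ|case: eqP => [_ _|_ /oky //]; exact: okE].
- by rewrite !negb_or => /and3P[/negbTE -> /negbTE -> /outy].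
Qed.

Lemma csum_scale ks a Phi x : csum ks (fun y => a * Phi y) x = a * csum ks Phi x.
Proof.
elim: ks Phi => [|pq ks IH] Phi //=; rewrite -IH; congr (csum ks _ x).
by apply: boolp.funext => y; rewrite mulr_sumr.
Qed.

Lemma matched_glue d L pq ks R : matched d (glue_word L (pq :: ks) R) ->
  col pq.1 = col pq.2 -> matched (contract d pq.1 pq.2) (glue_word L ks R).
Proof.
rewrite glue_word_cons => m c; apply: matched_contract => //.
apply: matched_perm m; apply: perm_trans (perm_mid _ _ _) _.
by rewrite perm_cons perm_mid.
Qed.

(** Gluing two state sums along a row gives a state sum: each glued pair is removed by
    state_contract, from the innermost outwards. *)
Theorem csum_state d L ks R x : matched d (glue_word L ks R) ->
  (forall pq, pq \in ks -> col pq.1 = col pq.2) ->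
  (forall z, z \in L ++ R -> ok (x z)) ->
  csum ks (state d (glue_word L ks R)) x =
  (\prod_(a <- loop_letters d ks) loop a) * state (contract_all d ks) (L ++ R) x.
Proof.
elim: ks d => [|[p q] ks IH] d m ck okx /=.
  by rewrite big_nil mul1r /glue_word /= cats0.
have cpq : col p = col q by apply: (ck (p, q)); exact: mem_head.
have m' := matched_glue m cpq.
transitivity (csum ks (fun y => (if d p == q then loop (col p) else 1) *
    state (contract d p q) (glue_word L ks R) y) x).
  apply: csum_eq => y oky outy; rewrite glue_word_cons in m *.
  rewrite state_contract // => z.
  have [zk _|zk] := boolP (z \in glue_points ks); first exact: oky.
  rewrite outy // !mem_cat mem_rev => h; apply: okx.
  move: zk; rewrite /glue_points !mem_cat negb_or => /andP[/negbTE z1 /negbTE z2].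
  by move: h; rewrite z1 z2 orbF.
rewrite csum_scale IH //; last by move=> pq h; apply: ck; rewrite inE h orbT.
rewrite mulrA; congr (_ * _).
by case: ifP => _; rewrite ?big_cons ?mul1r.
Qed.

Fixpoint updl (ks : seq (P * P)) (ms : seq I) (x : P -> X) : P -> X :=
  match ks, ms with
  | pq :: ks', c :: ms' => upd (updl ks' ms' x) pq.1 pq.2 c
  | _, _ => x
  end.

Lemma csumE ks Phi x :
  csum ks Phi x = \sum_(ms <- label_seqs cs (size ks)) Phi (updl ks ms x).
Proof.
elim: ks Phi => [|pq ks IH] Phi /=; first by rewrite big_seq1.
by rewrite IH big_label_seqsS exchange_big.
Qed.

(** The iterated update used by csum is the labelling of the glued row by ms, which
    turns a nested sum over pairs into one sum over label sequences. *)
Lemma updl_map (T : eqType) (r : seq T) (f h : T -> P) (m : T -> I) x z :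
  uniq ([seq f i | i <- r] ++ [seq h i | i <- r]) ->
  injective f -> injective h ->
  [/\ forall i, i \in r -> updl [seq (f i, h i) | i <- r] [seq m i | i <- r] x (f i)
         = J (col (f i)) (m i),
     forall i, i \in r -> updl [seq (f i, h i) | i <- r] [seq m i | i <- r] x (h i)
         = E (col (h i)) (m i)
   & z \notin [seq f i | i <- r] ++ [seq h i | i <- r] ->
     updl [seq (f i, h i) | i <- r] [seq m i | i <- r] x z = x z].
Proof.
move=> + fi hi; elim: r => [//|a r IH] u.
have fh i : i \in a :: r -> (f i == h a) = false.
  move=> ir; apply/negP => /eqP e; move: u.
  rewrite cat_uniq => /and3P[_ /hasP nh _]; apply: nh.
  by exists (h a); [exact: mem_head|rewrite -e; exact: map_f].
have hf i : i \in a :: r -> (h i == f a) = false.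
  move=> ir; apply/negP => /eqP e; move: u.
  rewrite cat_uniq => /and3P[_ /hasP nh _]; apply: nh.
  by exists (h i); [exact: map_f|rewrite e; exact: mem_head].
have ur : uniq ([seq f i | i <- r] ++ [seq h i | i <- r]).
  move: u => /= /andP[_]; rewrite !cat_uniq /= negb_or.
  by case/and3P => -> /andP[_ ->] /andP[_ ->].
have [h1 h2 h3] := IH ur; split=> /=.
- move=> i; rewrite inE /upd; have [->|ia /=] := eqVneq i a; first by rewrite eqxx.
  move=> ir; have -> : (f i == f a) = false by rewrite (inj_eq fi) (negbTE ia).
  by rewrite fh ?inE ?ir ?orbT // h1.
- move=> i; rewrite inE /upd; have [->|ia /=] := eqVneq i a.
    by rewrite hf ?mem_head // eqxx.
  move=> ir; have -> : (h i == h a) = false by rewrite (inj_eq hi) (negbTE ia).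
  by rewrite hf ?inE ?ir ?orbT // h2.
- rewrite inE mem_cat inE !negb_or /upd => /and4P[/negbTE -> zf /negbTE -> zh].
  by rewrite h3 // mem_cat negb_or zf.
Qed.

Section Derivation.
Variables (alpha : letter -> X -> I -> K) (iota : X -> I -> X).
Hypothesis invariance : forall a x y, ok x -> ok y ->
  \sum_(c <- cs) alpha a x c * g a (iota x c) y
  + \sum_(c <- cs) alpha a y c * g a x (iota y c) = 0.

Definition upd1 (x : P -> X) (p : P) (u : X) : P -> X :=
  fun z => if z == p then u else x z.

Definition derive_at d w x p : K :=
  \sum_(c <- cs) alpha (col p) (x p) c * state d w (upd1 x p (iota (x p) c)).

(** If an element of a Lie algebra annihilates the form, as expressed by invariance, it
    annihilates every state: the two terms coming from the ends of a chord cancel. *)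
Lemma state_derivation d w x : matched d w -> (forall z, z \in w -> ok (x z)) ->
  \sum_(p <- w) derive_at d w x p = 0.
Proof.
have [n] := ubnP (size w); elim: n w => // n IH [|a w] /ltnSE wn m okx.
  by rewrite big_nil.
have [w1 [w2 [wE nda m']]] := matched_cons m.
have [p1 p2 p3 p4] := m.2 a (mem_head _ _).
have u := matched_uniq m; rewrite wE in u.
have aw : a \notin w1 ++ w2.
  move: u; rewrite /= mem_cat inE !negb_or => /andP[/and3P[]].
  by rewrite mem_cat negb_or => -> _ ->.
have bw : d a \notin w1 ++ w2.
  move: u => /= /andP[_]; rewrite (perm_uniq (perm_mid _ _ _)) /=.
  by case/andP.
have okw z : z \in w1 ++ w2 -> ok (x z).
  move=> zw; apply: okx; rewrite wE inE mem_cat inE.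
  by move: zw; rewrite mem_cat => /orP[] ->; rewrite !orbT.
have out p v : p \notin w1 ++ w2 -> {in w1 ++ w2, upd1 x p v =1 x}.
  by move=> pw z zw; rewrite /upd1; case: eqP => // e; rewrite -e zw in pw.
rewrite wE big_cons (perm_big _ (perm_mid w1 w2 (d a))) big_cons addrA.
have -> : derive_at d (a :: w1 ++ d a :: w2) x a + derive_at d (a :: w1 ++ d a :: w2) x (d a) = 0.
  rewrite /derive_at.
  transitivity (sign_past a w1 * state d (w1 ++ w2) x *
    (\sum_(c <- cs) alpha (col a) (x a) c * g (col a) (iota (x a) c) (x (d a)) +
     \sum_(c <- cs) alpha (col a) (x (d a)) c * g (col a) (x a) (iota (x (d a)) c))).
    rewrite mulrDr !mulr_sumr; congr (_ + _); apply: eq_bigr => c _.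
      rewrite state_split // (@state_ext d d _ _ x m') //; last exact: out.
      by rewrite /upd1 eqxx (negbTE p2); ring.
    rewrite state_split // (@state_ext d d _ _ x m') //; last exact: out.
    by rewrite /upd1 eqxx eq_sym (negbTE p2) p4; ring.
  by rewrite invariance ?mulr0 //; apply: okx; rewrite ?mem_head.
rewrite add0r; transitivity (\sum_(p <- w1 ++ w2) sign_past a w1 *
    g (col a) (x a) (x (d a)) * derive_at d (w1 ++ w2) x p).
  rewrite big_seq [RHS]big_seq; apply: eq_bigr => p pw.
  rewrite /derive_at mulr_sumr; apply: eq_bigr => c _.
  rewrite state_split // /upd1.
  have -> : (a == p) = false by apply/negP => /eqP e; rewrite e pw in aw.
  have -> : (d a == p) = false by apply/negP => /eqP e; rewrite e pw in bw.
  by ring.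
rewrite -mulr_sumr IH ?mulr0 //.
by move: wn; rewrite wE /= !size_cat /= addnS => /ltnW.
Qed.

End Derivation.

(** Chords nested around M1 only meet M1, hence the product of signs. *)
Lemma state_nest d r M1 M2 x : matched d (r ++ M1 ++ rev (map d r) ++ M2) ->
  state d (r ++ M1 ++ rev (map d r) ++ M2) x =
  (\prod_(a <- r) (sign_past a M1 * g (col a) (x a) (x (d a)))) * state d (M1 ++ M2) x.
Proof.
elim: r M2 => [|a r IH] M2; first by rewrite /= big_nil mul1r.
have -> : (a :: r) ++ M1 ++ rev (map d (a :: r)) ++ M2 =
  a :: (r ++ M1 ++ rev (map d r)) ++ d a :: M2.
  by rewrite map_cons rev_cons -cats1 /= -!catA.
move=> m; have u := matched_uniq m.
have nd : d a \notin r ++ M1 ++ rev (map d r).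
  by move: u; rewrite /= cat_uniq /= negb_or => /andP[_ /and3P[_ /andP[]]].
have m' := matched_drop m; rewrite -!catA in m'.
rewrite state_split // -!catA (IH _ m') big_cons !mulrA.
congr (_ * _ * _ * _).
rewrite sign_past_cat sign_past_cat mulrCA; rewrite -[RHS]mulr1; congr (_ * _).
have -> : sign_past a (rev (map d r)) = sign_past a r.
  rewrite /sign_past (perm_big (map d r)) ?perm_rev //= big_map big_seq [RHS]big_seq.
  apply: eq_bigr => b br; have [|_ _ _ ->//] := m.2 b.
  by rewrite inE !mem_cat br !orbT.
by rewrite sign_past2.
Qed.

(** A matched word contains each letter an even number of times, so moving past it
    costs nothing. *)
Lemma sign_past_matched d a w : matched d w -> sign_past a w = 1.
Proof.
have [n] := ubnP (size w); elim: n w => // n IH [|b w] /ltnSE wn m.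
  by rewrite sign_past_nil.
have [w1 [w2 [wE nda m']]] := matched_cons m.
have [p1 p2 p3 p4] := m.2 b (mem_head _ _).
rewrite wE sign_past_cons sign_past_cat sign_past_cons p4 mulrA mulrACA gsign2 mul1r.
rewrite -sign_past_cat IH //.
by move: wn; rewrite wE /= !size_cat /= addnS => /ltnW.
Qed.

(** A block closed under the matching can be evaluated on its own: an outer chord
    crosses all of it or nothing, at no cost by sign_past_matched. *)
Lemma state_block d L M R x : matched d (L ++ M ++ R) ->
  (forall p, p \in M -> d p \in M) ->
  state d (L ++ M ++ R) x = state d M x * state d (L ++ R) x.
Proof.
have [n] := ubnP (size L + size M + size R); elim: n L M R => // n IH [|a L] M R /ltnSE wn m cl.
- have mM : matched d M.
    split; first by move: (m.1); rewrite /= cat_uniq => /andP[].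
    move=> p pM; have [|_ h2 h3 h4] := m.2 p; first by rewrite !mem_cat pM orbT.
    by split=> //; exact: cl.
  move: M => [|b M] in wn m cl mM *; first by rewrite state_nil mul1r.
  have [w1 [w2 [wE nda m']]] := matched_cons mM.
  have m2 : matched d ((w1 ++ w2) ++ R).
    move: m; rewrite wE /= -catA /= => /matched_drop.
    by rewrite -catA.
  rewrite wE /= -catA /= !state_split //.
  have e := IH [::] (w1 ++ w2) R; rewrite /= -catA in e; rewrite e ?mulrA //.
  + by move: wn; rewrite wE /= !size_cat /= add0n addnS addSn => /ltnW.
  + by rewrite -catA in m2.
  + by move=> p pw; have [] := m'.2 p pw.
- have mM : matched d M.
    split; first by move: (m.1); rewrite cat_uniq cat_uniq => /and3P[_ _ /andP[]].
    move=> p pM; have [|_ h2 h3 h4] := m.2 p; first by rewrite !mem_cat pM orbT.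
    by split=> //; exact: cl.
  have [p1 p2 p3 p4] := m.2 a (mem_head _ _).
  have aM : a \notin M.
    by move: (m.1) => /= /andP[]; rewrite !mem_cat !negb_or => /and3P[].
  have daM : d a \notin M by apply: contraNN aM => /cl; rewrite p3.
  have u := m.1.
  move: p1; rewrite !inE (negbTE p2) !mem_cat (negbTE daM) /= => /orP[] /mem_split [t1 [t2 tE]].
  + have nt : d a \notin t1.
      by move: u; rewrite tE /= -catA cat_uniq /= negb_or => /andP[_ /and3P[_ /andP[]]].
    have e1 : a :: L ++ M ++ R = a :: t1 ++ d a :: (t2 ++ M ++ R).
      by rewrite tE /= -!catA.
    have e2 : a :: L ++ R = a :: t1 ++ d a :: (t2 ++ R) by rewrite tE /= -!catA.
    rewrite /= e1 in m; rewrite e1 e2 !state_split //.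
    have m' := matched_drop m; rewrite (catA t1 t2 (M ++ R)) in m' *.
    rewrite IH //; last by move: wn; rewrite tE /= !size_cat /= !addnS !addSn => /ltnW.
    by rewrite -catA mulrCA.
  + have nt w : w = L ++ t1 \/ w = L ++ M ++ t1 -> d a \notin w.
      move=> h; have {}h : {subset w <= L ++ M ++ t1}.
        by case: h => -> // z; rewrite !mem_cat => /orP[] ->; rewrite ?orbT.
      apply: (contra (h _)); move: u; rewrite tE /= !catA cat_uniq /= negb_or.
      by rewrite -!catA => /andP[_ /and3P[_ /andP[]]].
    have e1 : a :: L ++ M ++ R = a :: (L ++ M ++ t1) ++ d a :: t2.
      by rewrite tE /= -!catA.
    have e2 : a :: L ++ R = a :: (L ++ t1) ++ d a :: t2 by rewrite tE /= -!catA.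
    rewrite /= e1 in m; have n1 := nt _ (or_introl erefl); have n2 := nt _ (or_intror erefl).
    rewrite e1 e2 !state_split //.
    have m' := matched_drop m; rewrite -!catA in m'.
    rewrite -!catA IH //.
    * rewrite !sign_past_cat (sign_past_matched a mM) mul1r.
      by rewrite mulrCA.
    * by move: wn; rewrite tE /= !size_cat /= !addnS !addSn => /ltnW.
Qed.

End Form.
End Pairing.

Lemma state_map (P P' : eqType) (col : P -> letter) (col' : P' -> letter)
    (f : P' -> P) (K : fieldType) (X : Type) (s : K) (g : letter -> X -> X -> K)
    d d' w x :
  injective f -> (forall p, p \in w -> col (f p) = col' p) ->
  (forall p, p \in w -> d (f p) = f (d' p)) -> matched col' d' w ->
  state col s g d (map f w) x = state col' s g d' w (x \o f).
Proof.
move=> fi; have [n] := ubnP (size w); elim: n w => // n IH [|a w] // /ltnSE wn cE dE m.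
have [w1 [w2 [wE nda m']]] := matched_cons m.
have sub : {subset w1 ++ w2 <= a :: w}.
  by move=> p; rewrite wE inE !mem_cat inE => /orP[] ->; rewrite !orbT.
rewrite wE /= map_cat /= -dE ?mem_head // state_split; last first.
  by rewrite dE ?mem_head // mem_map.
rewrite state_split // -map_cat IH //.
- rewrite cE ?mem_head // dE ?mem_head //=; congr (_ * _ * _).
  rewrite /sign_past big_map big_seq [RHS]big_seq; apply: eq_bigr => b bw.
  by rewrite !cE ?mem_head // sub // mem_cat bw.
- by move: wn; rewrite wE /= !size_cat /= addnS => /ltnW.
- by move=> p /sub; exact: cE.
- by move=> p /sub; exact: dE.
Qed.

(** * State sums of stacked diagrams *)

Lemma contract_all_matched (P : eqType) (col : P -> letter) d L ks R :
  matched col d (glue_word L ks R) -> (forall pq, pq \in ks -> col pq.1 = col pq.2) ->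
  matched col (contract_all d ks) (L ++ R).
Proof.
elim: ks d => [|pq ks IH] d m c /=; first by move: m; rewrite /glue_word /= cats0.
apply: IH => [|pq' h]; last by apply: c; rewrite inE h orbT.
by apply: matched_glue m _; apply: c; exact: mem_head.
Qed.

Lemma loop_letters_Lv (P : eqType) (col : P -> letter) d L ks R :
  matched col d (glue_word L ks R) -> (forall pq, pq \in ks -> col pq.1 = col pq.2) ->
  (forall pq, pq \in ks -> col pq.1 = Lm -> d pq.1 \in L) ->
  loop_letters col d ks = nseq (size (loop_letters col d ks)) Lv.
Proof.
elim: ks d => [//|[p q] ks IH] d m c h /=.
have u := matched_uniq m; rewrite glue_word_cons /= in u.
have uL z : z \in [:: p, q & glue_points ks] -> z \notin L.
  move=> zin; apply/negP => zL; move: u; rewrite -!catA cat_uniq => /and3P[_ /hasP n _].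
  apply: n; exists z => //; move: zin; rewrite /glue_points !inE !mem_cat !inE !mem_cat mem_rev.
  by case/or3P => [->|->|/orP[->|->]]; rewrite ?orbT.
have -> : loop_letters col (contract d p q) ks =
    nseq (size (loop_letters col (contract d p q) ks)) Lv.
  apply: IH; first exact: matched_glue m (c _ (mem_head _ _)).
    by move=> pq' h'; apply: c; rewrite inE h' orbT.
  move=> [p' q'] h' /= lm.
  have h2 : (p', q') \in (p, q) :: ks by rewrite inE h' orbT.
  have dp' := h _ h2 lm; rewrite /= in dp'.
  have p'g : p' \in glue_points ks by rewrite /glue_points mem_cat (map_f fst h').
  have p'w : p' \in glue_word L ((p, q) :: ks) R.
    by rewrite glue_word_cons !mem_cat mem_rev (map_f fst h') orbT.
  have [_ _ dd _] := m.2 p' p'w.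
  rewrite /contract; case: eqP => [e|_].
    have pw : p \in glue_word L ((p, q) :: ks) R.
      by rewrite glue_word_cons !mem_cat inE eqxx !orbT.
    have [_ _ ddp cp] := m.2 p pw.
    have := h _ (mem_head _ _); rewrite /= -cp -e => /(_ lm).
    by move=> pL; move: (uL p'); rewrite !inE p'g !orbT pL => /(_ isT).
  case: eqP => [e|_] //.
    have qw : q \in glue_word L ((p, q) :: ks) R.
      by rewrite glue_word_cons !mem_cat !inE eqxx !orbT.
    have [_ _ ddq cq] := m.2 q qw.
    move: dp'; rewrite e ddq => qL.
    by move: (uL q); rewrite !inE eqxx orbT qL => /(_ isT).
case: eqP => [e|] //=; last by rewrite size_nseq.
rewrite size_nseq; congr (_ :: _); case E : (col p) => //.
by move: (h _ (mem_head _ _) E) => /=; rewrite e => qL; move: (uL q); rewrite !inE eqxx orbT qL => /(_ isT).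
Qed.

(** The boundary is read around the diagram: the bottom row from left to right, then
    the top row from right to left. In this order a planar diagram has nested chords. *)
Definition boundary (s t : word) : seq (point s t) :=
  [seq inl i | i <- enum 'I_(size s)] ++ rev [seq inr j | j <- enum 'I_(size t)].

Lemma mem_boundary s t (p : point s t) : p \in boundary s t.
Proof.
by rewrite mem_cat mem_rev; case: p => i; rewrite map_f ?orbT ?mem_enum.
Qed.

Lemma uniq_boundary s t : uniq (boundary s t).
Proof.
rewrite cat_uniq rev_uniq; apply/and3P; split.
- by rewrite map_inj_uniq ?enum_uniq // => ? ? [].
- by apply/hasPn => p; rewrite mem_rev => /mapP[j _ ->]; apply/mapP => -[].
- by rewrite map_inj_uniq ?enum_uniq // => ? ? [].
Qed.

Lemma matched_diagram s t (d : diagram s t) : matched (@colour s t) d (boundary s t).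
Proof.
split=> [|p _]; first exact: uniq_boundary.
by rewrite mem_boundary; have [? ? ? ?] := mate_spec d p.
Qed.

Section Stack.
Variables (s t u : word) (A : diagram s t) (B : diagram t u).

Definition stack_point : eqType := (point s t + point t u)%type.

Definition stack_colour (p : stack_point) : letter :=
  match p with inl p => colour p | inr p => colour p end.

Definition stack_mate (p : stack_point) : stack_point :=
  match p with inl p => inl (A p) | inr p => inr (B p) end.

Definition middle_pairs : seq (stack_point * stack_point) :=
  [seq (inl (inr j), inr (inl j)) | j <- enum 'I_(size t)].

Definition outer_point (p : point s u) : stack_point :=
  match p with inl i => inl (inl i) | inr k => inr (inr k) end.

Lemma outer_point_inj : injective outer_point.
Proof. by case=> i [] j //= [->]. Qed.

Let L : seq stack_point := [seq inl (inl i) | i <- enum 'I_(size s)].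
Let R : seq stack_point := rev [seq inr (inr k) | k <- enum 'I_(size u)].

Lemma stack_wordE :
  [seq inl p | p <- boundary s t] ++ [seq inr p | p <- boundary t u] =
  glue_word L middle_pairs R :> seq stack_point.
Proof.
rewrite /glue_word /boundary /L /R /middle_pairs.
move: (enum 'I_(size s)) (enum 'I_(size t)) (enum 'I_(size u)) => a b c.
by rewrite !map_cat !map_rev /unzip1 /unzip2 -!map_comp -!catA.
Qed.

Lemma outer_wordE : [seq outer_point p | p <- boundary s u] = L ++ R.
Proof.
rewrite /boundary /L /R; move: (enum 'I_(size s)) (enum 'I_(size u)) => a b.
by rewrite map_cat map_rev -!map_comp.
Qed.

Lemma matched_stack : matched stack_colour stack_mate (glue_word L middle_pairs R).
Proof.
rewrite -stack_wordE; split.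
  rewrite cat_uniq; apply/and3P; split.
  - by rewrite map_inj_uniq ?uniq_boundary // => ? ? [].
  - by apply/hasPn => p /mapP[j _ ->]; apply/mapP => -[].
  - by rewrite map_inj_uniq ?uniq_boundary // => ? ? [].
case=> p _ /=; rewrite mem_cat.
- by rewrite map_f ?mem_boundary //; have [h1 -> -> _] := mate_spec A p.
- by rewrite orbC map_f ?mem_boundary //; have [h1 -> -> _] := mate_spec B p.
Qed.

Lemma middle_colour pq : pq \in middle_pairs -> stack_colour pq.1 = stack_colour pq.2.
Proof. by case/mapP => j _ ->. Qed.

(** The last branch is never taken: after all middle points have been glued, an outer
    point is matched to an outer point. It keeps the function total. *)
Definition composite_mate (p : point s u) : point s u :=
  match contract_all stack_mate middle_pairs (outer_point p) with
  | inl (inl i) => inl i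
  | inr (inr k) => inr k
  | _ => p
  end.

Lemma matched_outer :
  matched stack_colour (contract_all stack_mate middle_pairs)
    [seq outer_point p | p <- boundary s u].
Proof. by rewrite outer_wordE; apply: contract_all_matched matched_stack middle_colour. Qed.

Lemma composite_mateE p :
  contract_all stack_mate middle_pairs (outer_point p) = outer_point (composite_mate p).
Proof.
have [|h _ _ _] := matched_outer.2 (outer_point p).
  by apply: map_f; exact: mem_boundary.
by case/mapP: h => q _; rewrite /composite_mate => ->; case: q.
Qed.

Lemma colour_outer p : stack_colour (outer_point p) = colour p.
Proof. by case: p. Qed.

Lemma composite_matched : matched (@colour s u) composite_mate (boundary s u).
Proof.
split=> [|p _]; first exact: uniq_boundary.
have [|_ h2 h3 h4] := matched_outer.2 (outer_point p).
  by apply: map_f; exact: mem_boundary.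
rewrite mem_boundary; split=> //.
- by apply: contraNneq h2 => e; rewrite composite_mateE e.
- by apply: outer_point_inj; rewrite -!composite_mateE h3.
- by rewrite -!colour_outer -composite_mateE h4.
Qed.

Lemma middle_uniq : uniq ([seq inl (inr j) | j <- enum 'I_(size t)] ++
  [seq inr (inl j) | j <- enum 'I_(size t)] : seq stack_point).
Proof.
rewrite cat_uniq; apply/and3P; split.
- by rewrite map_inj_uniq ?enum_uniq // => ? ? [].
- by apply/hasPn => p /mapP[j _ ->]; apply/mapP => -[].
- by rewrite map_inj_uniq ?enum_uniq // => ? ? [].
Qed.

(** The boundary of A followed by that of B is a word in which the two copies of the
    middle row face each other, so csum_state applies; only the letter v can close a
    loop because the pole letters of the middle row lead to the bottom row. *)
Lemma state_stack (K : fieldType) (X : Type) (sg : K) (g : letter -> X -> X -> K)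
    (I : eqType) (c0 : I) (cs : seq I) (J E : letter -> I -> X) (ok : X -> Prop)
    (loop : letter -> K) (x : point s u -> X) :
  sg * sg = 1 -> (forall a x y, g a x y = gsign sg a a * g a y x) ->
  (forall a x y, ok x -> ok y -> \sum_(c <- cs) g a x (J a c) * g a (E a c) y = g a x y) ->
  (forall a, \sum_(c <- cs) g a (J a c) (E a c) = loop a) ->
  (forall a c, c \in cs -> ok (J a c)) -> (forall a c, c \in cs -> ok (E a c)) ->
  (forall p, ok (x p)) ->
  \sum_(ms <- label_seqs cs (size t))
     state (@colour s t) sg g A (boundary s t)
       (fun p => match p with
                 | inl i => x (inl i) | inr j => J (nth Lm t j) (nth c0 ms j) end) *
     state (@colour t u) sg g B (boundary t u)
       (fun p => match p with
                 | inl j => E (nth Lm t j) (nth c0 ms j) | inr k => x (inr k) end) =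
  loop Lv ^+ size (loop_letters stack_colour stack_mate middle_pairs) *
  state (@colour s u) sg g composite_mate (boundary s u) x.
Proof.
move=> ss gsym hc hl okJ okE okx.
pose y : stack_point -> X := fun p => match p with
  | inl (inl i) => x (inl i) | inr (inr k) => x (inr k)
  | inl (inr j) => J (nth Lm t j) c0 | inr (inl j) => E (nth Lm t j) c0 end.
have yo p : y (outer_point p) = x p by case: p.
have okz z : z \in L ++ R -> ok (y z).
  by rewrite -outer_wordE => /mapP[p _ ->]; rewrite yo.
have := csum_state ss gsym hc hl okJ okE matched_stack middle_colour okz.
rewrite csumE -outer_wordE (@state_map _ _ _ (@colour s u) _ _ _ _ _ _ composite_mate); first last.
- exact: composite_matched.
- by move=> p _; exact: composite_mateE.
- by move=> p _; exact: colour_outer.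
- exact: outer_point_inj.
rewrite (_ : y \o outer_point = x); last by apply: boolp.funext => p; exact: yo.
rewrite (@loop_letters_Lv _ _ _ L _ R matched_stack middle_colour) ?size_nseq; last first.
  case=> a b /mapP[j _ [-> _]] /= cj.
  have [_ _ cA rA] := mate_spec A (inr j).
  case e : (A (inr j)) rA => [i|k] rA; first by apply/mapP; exists i; rewrite ?mem_enum.
  by move: rA; rewrite /= cj => /(_ isT).
have -> n : \prod_(a <- nseq n Lv) loop a = loop Lv ^+ n.
  by elim: n => [|n IH]; rewrite ?big_nil // big_cons IH exprS.
move=> <-; rewrite /middle_pairs size_map size_enum_ord.
rewrite big_seq [RHS]big_seq; apply: eq_bigr => ms msin.
have sms : size ms = size t.
  elim: (size t) ms msin => [|n IH] ms /=; first by rewrite inE => /eqP ->.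
  by case/allpairsP => -[c l] /= [_ /IH <- ->].
have e : ms = [seq nth c0 ms j | j : 'I_(size t) <- enum 'I_(size t)].
  apply: (@eq_from_nth _ c0) => [|i il]; first by rewrite size_map size_enum_ord.
  rewrite sms in il; rewrite (nth_map (Ordinal il)) ?size_enum_ord //.
  by rewrite nth_enum_ord.
set Y := updl _ _ _ _ _ _.
have finj : injective (fun j : 'I_(size t) => inl (inr j) : stack_point) by move=> ? ? [].
have hinj : injective (fun j : 'I_(size t) => inr (inl j) : stack_point) by move=> ? ? [].
have H z := @updl_map _ stack_colour X _ J E _ (enum 'I_(size t)) _ _
  (fun j => nth c0 ms j) y z middle_uniq finj hinj.
have Y1 p : Y (inl p) = match p with
   | inl i => x (inl i) | inr j => J (nth Lm t j) (nth c0 ms j) end.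
  rewrite /Y [in updl _ _ _ _ ms _]e; case: p => i.
    have [_ _ ->//] := H (inl (inl i)).
    by rewrite mem_cat; apply/norP; split; apply/mapP => -[].
  by have [-> //] := H (inl (inr i)); rewrite mem_enum.
have Y2 p : Y (inr p) = match p with
   | inl j => E (nth Lm t j) (nth c0 ms j) | inr k => x (inr k) end.
  rewrite /Y [in updl _ _ _ _ ms _]e; case: p => i.
    by have [_ -> //] := H (inr (inl i)); rewrite mem_enum.
  have [_ _ ->//] := H (inr (inr i)).
  by rewrite mem_cat; apply/norP; split; apply/mapP => -[].
rewrite -stack_wordE.
have := @state_block _ stack_colour _ _ sg g ss stack_mate [::]
  [seq inl p | p <- boundary s t] [seq inr p | p <- boundary t u] Y.
rewrite stack_wordE => -> //; last 2 first.
- exact: matched_stack.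
- by move=> p /mapP[q _ ->] /=; apply: map_f; exact: mem_boundary.
congr (_ * _).
- rewrite (@state_map _ _ _ (@colour s t) _ _ _ _ _ _ A) //; last 2 first.
  + by move=> ? ? [].
  + exact: matched_diagram.
  by congr state; apply: boolp.funext => p; rewrite /= Y1.
- rewrite /= (@state_map _ _ _ (@colour t u) _ _ _ _ _ _ B) //; last 2 first.
  + by move=> ? ? [].
  + exact: matched_diagram.
  by congr state; apply: boolp.funext => p; rewrite /= Y2.
Qed.

End Stack.

(** * The composite of two diagrams and its closed loops *)

Section StackTheory.
Import Order.TTheory Num.Theory.
Variables (s t u : word) (A : diagram s t) (B : diagram t u).

Definition stack_loops : seq letter := loop_letters (@stack_colour s t u) (stack_mate A B) (middle_pairs s t u).

(** With the equality of booleans as form and no signs, the state of a matching counts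
    whether a labelling is constant along its chords. This instance of the gluing
    theorem computes the composite and its loops. *)
Lemma state_unsigned (P : eqType) (col : P -> letter) d w (x : P -> bool) :
  matched col d w ->
  state col 1 (fun _ a b => (a == b)%:R) d w x = (all (fun p => x p == x (d p)) w)%:R :> rat.
Proof.
have [n] := ubnP (size w); elim: n w => // n IH [|a w] // /ltnSE wn m.
have [w1 [w2 [wE nda m']]] := matched_cons m.
have [p1 p2 p3 p4] := m.2 a (mem_head _ _).
rewrite wE state_split // /sign_past big1 => [|b _]; last by rewrite /gsign; case: ifP.
rewrite mul1r IH //; last by move: wn; rewrite wE /= !size_cat /= addnS => /ltnW.
rewrite /= !all_cat /= p3 (eq_sym (x (d a))).
by case: (x a == x (d a)); rewrite ?mul1r ?mul0r.
Qed.

Definition vertex_label (x : point s u -> bool) (ms : seq bool) (v : stack_vertex s t u) :=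
  match v with
  | inl (inl i) => x (inl i)
  | inl (inr j) => nth false ms j
  | inr k => x (inr k)
  end.

Definition edge_constant (f : stack_vertex s t u -> bool) : bool :=
  [forall v, forall w, stack_edge A B v w ==> (f v == f w)].

Lemma edge_constantP (f : stack_vertex s t u -> bool) :
  reflect ((forall p, f (lower u p) = f (lower u (A p))) /\
           (forall p, f (upper s p) = f (upper s (B p)))) (edge_constant f).
Proof.
apply: (iffP forallP) => [h|[hA hB] v].
  split=> p.
  - have /forallP/(_ (lower u (A p)))/implyP := h (lower u p).
    move=> /(_ _)/eqP; apply; apply/orP; left; apply/existsP; exists p.
    by rewrite !eqxx.
  - have /forallP/(_ (upper s (B p)))/implyP := h (upper s p).
    move=> /(_ _)/eqP; apply; apply/orP; right; apply/existsP; exists p.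
    by rewrite !eqxx.
apply/forallP => w; apply/implyP => /orP[] /existsP[p /andP[/eqP -> /eqP ->]].
- by rewrite hA.
- by rewrite hB.
Qed.

Lemma edge_constant_connect f v w : edge_constant f ->
  connect (stack_edge A B) v w -> f v = f w.
Proof.
move=> /forallP h /connectP[p]; elim: p v => [|z p IH] v /=; first by move=> _ ->.
case/andP => vz zp wl; rewrite -(IH z zp wl).
by have /forallP/(_ z)/implyP/(_ vz)/eqP := h v.
Qed.

(** The labellings of the middle row by booleans that are constant along the edges of
    the stack are counted in two ways: each closed loop contributes a free label. *)
Lemma count_labels x :
  \sum_(ms <- label_seqs [:: false; true] (size t)) (edge_constant (vertex_label x ms))%:R =
  2 ^+ size stack_loops * ([forall p, x p == x (composite_mate A B p)])%:R :> rat.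
Proof.
have := @state_stack s t u A B rat bool 1 (fun _ a b => (a == b)%:R) bool false [:: false; true]
  (fun _ c => c) (fun _ c => c) (fun=> True) (fun=> 2) x.
rewrite mul1r => /(_ erefl) H.
rewrite state_unsigned in H; last exact: composite_matched.
have -> : [forall p, x p == x (composite_mate A B p)] =
          all (fun p => x p == x (composite_mate A B p)) (boundary s u).
  apply/forallP/allP => [h p _|h p]; first exact: h.
  by apply: h; exact: mem_boundary.
rewrite -H //; first last.
- by move=> _; rewrite !big_cons big_nil.
- by move=> _ y z _ _; rewrite !big_cons big_nil; case: y; case: z; rewrite ?mul0r ?mul1r ?addr0 ?add0r.
- by move=> a y z; rewrite /gsign eq_sym; case: ifP; rewrite mul1r.
apply: eq_bigr => ms _.
do 2![rewrite state_unsigned; last exact: matched_diagram].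
rewrite -natrM mulnb; congr (_ %:R); congr nat_of_bool.
apply/edge_constantP/andP => [[hA hB]|[/allP hA /allP hB]]; split.
- by apply/allP => p _; apply/eqP; have := hA p; case: p => ?; case: (A _).
- by apply/allP => p _; apply/eqP; have := hB p; case: p => ?; case: (B _).
- by move=> p; have /eqP := hA p (mem_boundary _); case: p => ?; case: (A _).
- by move=> p; have /eqP := hB p (mem_boundary _); case: p => ?; case: (B _).
Qed.

Lemma vertex_label_outer x ms p : vertex_label x ms (outer t p) = x p.
Proof. by case: p. Qed.

(** An edge-constant labelling of the whole stack exists if and only if the outer labels
    agree along the composite. This separates the connected components that contain
    outer points. *)
Lemma composite_labels x : reflect (exists2 f : stack_vertex s t u -> bool,
    edge_constant f & forall p, f (outer t p) = x p)
  [forall p, x p == x (composite_mate A B p)].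
Proof.
have H := count_labels x.
apply: (iffP idP) => [xD|[f fe fx]].
- have : 0 < \sum_(ms <- label_seqs [:: false; true] (size t))
      (edge_constant (vertex_label x ms))%:R :> rat.
    by rewrite H xD mulr1 exprn_gt0.
  rewrite lt_neqAle eq_sym => /andP[/eqP n0 _].
  have [/hasP[ms _ h]|/hasPn h] := boolP (has (fun ms => edge_constant (vertex_label x ms))
    (label_seqs [:: false; true] (size t))).
    by exists (vertex_label x ms) => // p; exact: vertex_label_outer.
  by case: n0; rewrite big_seq big1 // => ms /h /negbTE ->.
- apply: contraT => nx; move: H; rewrite (negbTE nx) mulr0 => /eqP.
  rewrite psumr_eq0 // => /allP h.
  pose ms := [seq f (inl (inr j)) | j <- enum 'I_(size t)].
  have msin : ms \in label_seqs [:: false; true] (size t).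
    have : size ms = size t by rewrite size_map size_enum_ord.
    elim: (size t) ms => [|n IH] [|b ms] //= [/IH h2].
    by rewrite cats0 mem_cat; case: b; rewrite map_f ?orbT.
  have := h _ msin; rewrite /= pnatr_eq0 eqb0 => /negP[].
  rewrite (_ : vertex_label x ms = f) //; apply: boolp.funext => -[[i|j]|k] /=.
  + by rewrite -(fx (inl i)).
  + rewrite (nth_map j) ?size_enum_ord //; congr (f (inl (inr _))).
    by apply: val_inj; rewrite /= nth_enum_ord.
  + by rewrite -(fx (inr k)).
Qed.

Lemma stack_edge_sym : connect_sym (stack_edge A B).
Proof.
apply: sym_connect_sym => v w; apply/orP/orP => -[] /existsP[p /andP[/eqP -> /eqP ->]].
- left; apply/existsP; exists (A p); have [_ -> _ _] := mate_spec A p; by rewrite !eqxx.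
- right; apply/existsP; exists (B p); have [_ -> _ _] := mate_spec B p; by rewrite !eqxx.
- left; apply/existsP; exists (A p); have [_ -> _ _] := mate_spec A p; by rewrite !eqxx.
- right; apply/existsP; exists (B p); have [_ -> _ _] := mate_spec B p; by rewrite !eqxx.
Qed.

Lemma composite_connect p :
  connect (stack_edge A B) (outer t p) (outer t (composite_mate A B p)).
Proof.
pose f v := connect (stack_edge A B) (outer t p) v.
have fe : edge_constant f.
  apply/forallP => v; apply/forallP => w; apply/implyP => vw; apply/eqP.
  rewrite /f; apply/idP/idP => h; apply: connect_trans h _; first exact: connect1.
  by rewrite stack_edge_sym; exact: connect1.
have /forallP/(_ p)/eqP : [forall q, f (outer t q) == f (outer t (composite_mate A B q))].
  by apply/composite_labels; exists f.
by rewrite -/(f (outer t (composite_mate A B p))) => <-; exact: connect0.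
Qed.

(** The indicator of the two ends of one chord of the composite extends to an
    edge-constant labelling, so no third outer point lies on that path. *)
Lemma outer_connect p q : connect (stack_edge A B) (outer t p) (outer t q) ->
  q = p \/ q = composite_mate A B p.
Proof.
move=> pq; have [_ m] := composite_matched A B.
have [_ _ dd _] := m p (mem_boundary _).
pose x z := (z == p) || (z == composite_mate A B p).
have : [forall z, x z == x (composite_mate A B z)].
  apply/forallP => z; apply/eqP; rewrite /x.
  have [_ _ ddz _] := m z (mem_boundary _).
  have -> : (composite_mate A B z == p) = (z == composite_mate A B p).
    by apply/eqP/eqP => [<-|->].
  have -> : (composite_mate A B z == composite_mate A B p) = (z == p).
    by apply/eqP/eqP => [e|->//]; rewrite -ddz e dd.
  exact: orbC.
case/composite_labels => f fe fx.
have : x q by rewrite -fx -(edge_constant_connect fe pq) fx /x eqxx.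
by case/orP => /eqP ->; [left|right].
Qed.

Lemma composite_matching : is_matching [ffun p => composite_mate A B p].
Proof.
have [_ m] := composite_matched A B.
apply: matchingP => p; have [_ h2 h3 h4] := m p (mem_boundary _); split=> //.
case E : (colour p) => // sr; exfalso.
have edA p' : connect (stack_edge A B) (lower u p') (lower u (A p')).
  by apply/connect1/orP; left; apply/existsP; exists p'; rewrite !eqxx.
have edB p' : connect (stack_edge A B) (upper s p') (upper s (B p')).
  by apply/connect1/orP; right; apply/existsP; exists p'; rewrite !eqxx.
case: p => [i|k] in E sr h2 h3 h4 *.
- have [_ _ cA rA] := mate_spec A (inl i); have := edA (inl i).
  case e : (A (inl i)) cA rA => [i'|j] cA rA pA.
    by move: E (rA isT) => /= ->.
  have [_ _ cB rB] := mate_spec B (inl j); have := edB (inl j).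
  case e' : (B (inl j)) cB rB => [i'|k] cB rB pB.
    by move: E (rB isT) cA => /= -> ->.
  have [//|ek] := @outer_connect (inl i) (inr k) (connect_trans pA pB).
  by move: sr; rewrite -ek.
- have [_ _ cB rB] := mate_spec B (inr k); have := edB (inr k).
  case e : (B (inr k)) cB rB => [j|i'] cB rB pB; last by move: E (rB isT) => /= ->.
  have [_ _ cA rA] := mate_spec A (inr j); have := edA (inr j).
  case e' : (A (inr j)) cA rA => [i|i'] cA rA pA; last first.
    by move: E (rA isT) cB => /= -> ->.
  have [//|ek] := @outer_connect (inr k) (inl i) (connect_trans pB pA).
  by move: sr; rewrite -ek.
Qed.

Definition composite : diagram s u := Diagram composite_matching.

Lemma compositeE p : composite p = composite_mate A B p.
Proof. by rewrite /= ffunE. Qed.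

Lemma composite_stacking : is_stacking A B composite.
Proof. by move=> p; rewrite compositeE; exact: composite_connect. Qed.

Lemma stacking_unique (D : diagram s u) : is_stacking A B D ->
  forall p, D p = composite_mate A B p.
Proof.
move=> h p; have [dp _ _ _] := mate_spec D p.
by have [e|//] := outer_connect (h p); rewrite e eqxx in dp.
Qed.

(** The edge-constant labellings that vanish on the outer points are the subsets of the
    set of loops. Both numbers of loops are therefore the logarithm of the same count. *)
Lemma nb_loopsE : nb_loops A B = size stack_loops.
Proof.
set e := stack_edge A B.
pose a := [pred v | [forall p, ~~ connect e (outer t p) v]].
pose D := [predI roots e & a].
have key : #|D| = size stack_loops; last exact: key.
have := count_labels (fun=> false).
have -> : [forall p : point s u, false == false] by apply/forallP.
rewrite mulr1 => H.
have {}H : (\sum_(ms <- label_seqs [:: false; true] (size t))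
    edge_constant (vertex_label (fun=> false) ms) = 2 ^ size stack_loops)%N.
  by apply/eqP; rewrite -(eqr_nat rat) natr_sum natrX H.
apply/eqP; rewrite -(@eqn_exp2l 2) // -H -card_bool -(card_pffun_on false); apply/eqP.
have symE := stack_edge_sym; rewrite -/e in symE.
pose good (ms : seq bool) := edge_constant (vertex_label (fun=> false) ms).
pose phi (ms : seq bool) : {ffun stack_vertex s t u -> bool} :=
  [ffun v => (v \in D) && vertex_label (fun=> false) ms v].
have labeled ms : ms \in label_seqs [:: false; true] (size t) <-> size ms = size t.
  elim: (size t) ms => [|n IH] [|b ms] /=; rewrite ?inE ?cats0 ?mem_cat //.
    by split=> // /orP[] /mapP[].
  split=> [/orP[] /mapP[z /IH <- [_ ->]] //|[/IH h]].
  by case: b; rewrite map_f ?orbT.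
have uniq_labels : uniq (label_seqs [:: false; true] (size t)).
  elim: (size t) => //= n IH; rewrite cats0 cat_uniq !map_inj_uniq ?IH //; try by move=> ? ? [].
  by rewrite andbT; apply/hasPn => z /mapP[y _ ->]; apply/mapP => -[].
have const ms v w : good ms -> connect e v w ->
    vertex_label (fun=> false) ms v = vertex_label (fun=> false) ms w.
  by move=> h; exact: edge_constant_connect.
have out ms v : good ms -> v \notin a -> vertex_label (fun=> false) ms v = false.
  move=> h; rewrite inE negb_forall => /existsP[p]; rewrite negbK => /(const _ _ _ h) <-.
  by rewrite vertex_label_outer.
have aroot v : (fingraph.root e v \in a) = (v \in a).
  rewrite !inE; apply/forallP/forallP => h p; apply: contra (h p) => c.
    by apply: connect_trans c _; exact: connect_root.
  by apply: connect_trans c _; rewrite symE; exact: connect_root.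
have phi_val ms v : good ms -> v \in a -> vertex_label (fun=> false) ms v = phi ms (fingraph.root e v).
  move=> h va; have rr := roots_root symE v.
  have -> : phi ms (fingraph.root e v) = vertex_label (fun=> false) ms (fingraph.root e v).
    by rewrite ffunE (_ : _ \in D = true) // inE aroot va andbT.
  exact: const (connect_root e v).
have -> : (\sum_(ms <- label_seqs [:: false; true] (size t)) good ms)%N =
    size [seq phi ms | ms <- [seq ms <- label_seqs [:: false; true] (size t) | good ms]].
  rewrite size_map size_filter -sum1_count [RHS]big_mkcond; by apply: eq_bigr => ms _; case: (good ms).
have /card_uniqP <- : uniq [seq phi ms | ms <- [seq ms <- label_seqs [:: false; true] (size t) | good ms]].
  rewrite map_inj_in_uniq ?filter_uniq // => ms ms'; rewrite !mem_filter.
  case/andP=> gm /labeled sm /andP[gm' /labeled sm'] e12.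
  apply: (@eq_from_nth _ false); rewrite ?sm ?sm' // => j jt.
  pose v : stack_vertex s t u := inl (inr (Ordinal jt)).
  rewrite -[LHS]/(vertex_label (fun=> false) ms v) -[RHS]/(vertex_label (fun=> false) ms' v).
  by have [va|va] := boolP (v \in a); [rewrite !phi_val // e12|rewrite !out].
apply: eq_card => g; apply/pffun_onP/mapP => [[gD _]|[ms]].
- pose f v := (v \in a) && g (fingraph.root e v).
  have fx p : f (outer t p) = false.
    by rewrite /f inE; case: forallP => // /(_ p); rewrite connect0.
  pose ms := [seq f (inl (inr j)) | j <- enum 'I_(size t)].
  have lf : vertex_label (fun=> false) ms = f.
    apply: boolp.funext => -[[i|j]|k] /=.
    + by rewrite -(fx (inl i)).
    + rewrite (nth_map j) ?size_enum_ord //; congr (f (inl (inr _))).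
      by apply: val_inj; rewrite /= nth_enum_ord.
    + by rewrite -(fx (inr k)).
  exists ms.
    rewrite mem_filter /good lf; apply/andP; split.
      apply/forallP => v; apply/forallP => w; apply/implyP => vw.
      have vw' : connect e v w by exact: connect1.
      by rewrite /f -aroot -(aroot w) (fingraph.rootP symE vw').
    by apply/labeled; rewrite size_map size_enum_ord.
  apply/ffunP => v; rewrite ffunE lf /f inE /=.
  have [vD|vD] := boolP (v \in D).
    move: vD => /andP[rv va].
    have e1 : fingraph.root e v = v by apply/eqP; exact: rv.
    have -> : (v \in a) = true by exact: va.
    have -> : (v \in roots e) = true by exact: rv.
    by rewrite e1.
  have -> : g v = false.
    by apply: contraNF vD => gv; apply: (subsetP gD); rewrite inE gv.
  by move: vD; rewrite inE => /negbTE ->.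
- rewrite mem_filter => /andP[gm _] ->; split=> // .
  by apply/subsetP => v; rewrite inE ffunE; case: (v \in D).
Qed.

End StackTheory.

(** * Modules over sp_2 and the polynomial model of the Verma module *)

Section PolyLin.
Variables (K : fieldType) (V : lmodType K).

(** Polynomials are used as the free module on the powers of the variable: this is the
    linear map that sends 'X^i to f i. *)
Definition poly_comb (f : nat -> V) (p : {poly K}) : V := \sum_(i < size p) p`_i *: f i.

Lemma poly_comb_ge f n (p : {poly K}) : (size p <= n)%N -> poly_comb f p = \sum_(i < n) p`_i *: f i.
Proof.
move=> h; rewrite /poly_comb (big_ord_widen n (fun i => p`_i *: f i) h) big_mkcond.
apply: eq_bigr => i _; case: ltnP => // hi.
by rewrite nth_default ?scale0r.
Qed.

Lemma poly_comb_linear f : linear (poly_comb f).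
Proof.
move=> a p q; pose n := maxn (size p) (size q).
have hp : (size p <= n)%N by rewrite leq_maxl.
have hq : (size q <= n)%N by rewrite leq_maxr.
rewrite (@poly_comb_ge f n p) // (@poly_comb_ge f n q) // (@poly_comb_ge f n); last first.
  apply: leq_trans (size_polyD _ _) _; rewrite geq_max hq andbT.
  exact: leq_trans (size_scale_leq _ _) hp.
rewrite scaler_sumr -big_split; apply: eq_bigr => i _ /=.
by rewrite coefD coefZ scalerDl scalerA.
Qed.

HB.instance Definition _ f :=
  GRing.isLinear.Build K {poly K} V *:%R (poly_comb f) (poly_comb_linear f).

Lemma poly_combXn f k : poly_comb f 'X^k = f k.
Proof.
rewrite (@poly_comb_ge f k.+1) ?size_polyXn // big_ord_recr /= coefXn eqxx scale1r.
by rewrite big1 ?add0r // => i _; rewrite coefXn (ltn_eqF (ltn_ord i)) scale0r.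
Qed.

Lemma poly_linear_ext (f g : {linear {poly K} -> V}) :
  (forall k, f 'X^k = g 'X^k) -> f =1 g.
Proof.
move=> h p; rewrite -[p]coefK poly_def !linear_sum; apply: eq_bigr => i _.
by rewrite !linearZ /= h.
Qed.

End PolyLin.

(** A case analysis that leaves the two elements of the index type in closed form. *)
Lemma ord2P (i : 'I_2) : i = 0 \/ i = 1.
Proof. by case: i => [[|[|//]] ?]; [left|right]; exact: val_inj. Qed.

Section Sp2Facts.
Variable K : fieldType.

Lemma sp2_in (A : 'M[K]_2) : (A \in sp2 (K:=K)) = (A^T *m gup K + gup K *m A == 0).
Proof. by []. Qed.

Lemma sp2E (A : 'M[K]_2) : A \in sp2 (K:=K) -> A 1 1 = - A 0 0.
Proof.
rewrite sp2_in => /eqP/matrixP/(_ 0 1); rewrite !mxE !big_ord_recl !big_ord0 !mxE /=.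
have -> : lift ord0 ord0 = 1 :> 'I_2 by apply/val_inj.
move=> h; have {}h : A 0 0 + A 1 1 = 0 by rewrite -h; ring.
by apply/eqP; rewrite -addr_eq0 addrC h.
Qed.

Lemma sp2_mem (A : 'M[K]_2) : A 1 1 = - A 0 0 -> A \in sp2 (K:=K).
Proof.
move=> h; rewrite sp2_in; apply/eqP/matrixP => i j.
rewrite !mxE !big_ord_recl !big_ord0 !mxE /=.
have -> : lift ord0 ord0 = 1 :> 'I_2 by apply/val_inj.
by case: (ord2P i) => ->; case: (ord2P j) => ->; rewrite /= ?h; ring.
Qed.

Lemma mx2_ext (A B : 'M[K]_2) : A 0 0 = B 0 0 -> A 0 1 = B 0 1 -> A 1 0 = B 1 0 ->
  A 1 1 = B 1 1 -> A = B.
Proof.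
move=> h1 h2 h3 h4; apply/matrixP => i j.
by case: (ord2P i) => ->; case: (ord2P j) => ->.
Qed.

Lemma sp2x_mem : sp2x K \in sp2 (K:=K).
Proof. by apply: sp2_mem; rewrite !mxE /= oppr0. Qed.
Lemma sp2y_mem : sp2y K \in sp2 (K:=K).
Proof. by apply: sp2_mem; rewrite !mxE /= oppr0. Qed.
Lemma sp2h_mem : sp2h K \in sp2 (K:=K).
Proof. by apply: sp2_mem; rewrite !mxE /= sub0r subr0. Qed.

Lemma sp2_mem0 : (0 : 'M[K]_2) \in sp2 (K:=K).
Proof. by apply: sp2_mem; rewrite !mxE oppr0. Qed.

Lemma sp2_decomp (A : 'M[K]_2) : A \in sp2 (K:=K) ->
  A = A 0 0 *: sp2h K + (A 0 1 *: sp2x K + (A 1 0 *: sp2y K + 0)).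
Proof.
by move=> h; apply: mx2_ext; rewrite !mxE /= ?(sp2E h); ring.
Qed.

Lemma sp2_lin (a : K) (A B : 'M[K]_2) : A \in sp2 (K:=K) -> B \in sp2 (K:=K) ->
  a *: A + B \in sp2 (K:=K).
Proof.
move=> /sp2E hA /sp2E hB; apply: sp2_mem; rewrite !mxE hA hB; ring.
Qed.

Variable M : sp2mod K.

Lemma act0 u : act M 0 u = 0.
Proof.
have := @act_lin K M 1 0 0 u sp2_mem0 sp2_mem0.
rewrite scaler0 addr0 scale1r -[LHS]addr0 => h.
symmetry; exact: (addrI (act M 0 u) h).
Qed.

(** Every element of sp_2 is a combination of h, x and y, so an action is known from
    those three operators. *)
Lemma act_sp2E A u : A \in sp2 (K:=K) -> act M A u =
  A 0 0 *: act M (sp2h K) u + (A 0 1 *: act M (sp2x K) u + A 1 0 *: act M (sp2y K) u).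
Proof.
move=> h; have my := sp2_lin (A 1 0) sp2y_mem sp2_mem0.
have mx := sp2_lin (A 0 1) sp2x_mem my.
rewrite [in LHS](sp2_decomp h) act_lin ?sp2h_mem // act_lin ?sp2x_mem //.
by rewrite act_lin ?sp2y_mem ?sp2_mem0 // act0 addr0.
Qed.

Lemma bracket_xy : sp2x K *m sp2y K - sp2y K *m sp2x K = sp2h K.
Proof. by apply: mx2_ext; rewrite !mxE !big_ord_recl !big_ord0 !mxE /=; ring. Qed.
Lemma bracket_hx : sp2h K *m sp2x K - sp2x K *m sp2h K = 2 *: sp2x K + 0.
Proof. by apply: mx2_ext; rewrite !mxE !big_ord_recl !big_ord0 !mxE /=; ring. Qed.
Lemma bracket_hy : sp2h K *m sp2y K - sp2y K *m sp2h K = - 2 *: sp2y K + 0.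
Proof. by apply: mx2_ext; rewrite !mxE !big_ord_recl !big_ord0 !mxE /=; ring. Qed.

Lemma act_xy u : act M (sp2x K) (act M (sp2y K) u) =
  act M (sp2y K) (act M (sp2x K) u) + act M (sp2h K) u.
Proof. by rewrite -bracket_xy act_bracket ?sp2x_mem ?sp2y_mem // addrC subrK. Qed.

Lemma act_hx u : act M (sp2h K) (act M (sp2x K) u) =
  act M (sp2x K) (act M (sp2h K) u) + 2 *: act M (sp2x K) u.
Proof.
have e : 2 *: act M (sp2x K) u = act M (sp2h K *m sp2x K - sp2x K *m sp2h K) u.
  by rewrite bracket_hx act_lin ?sp2x_mem ?sp2_mem0 // act0 addr0.
by rewrite e act_bracket ?sp2x_mem ?sp2h_mem // addrC subrK.
Qed.

Lemma act_hy u : act M (sp2h K) (act M (sp2y K) u) =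
  act M (sp2y K) (act M (sp2h K) u) - 2 *: act M (sp2y K) u.
Proof.
have e : - 2 *: act M (sp2y K) u = act M (sp2h K *m sp2y K - sp2y K *m sp2h K) u.
  by rewrite bracket_hy act_lin ?sp2y_mem ?sp2_mem0 // act0 addr0.
by rewrite -scaleNr e act_bracket ?sp2y_mem ?sp2h_mem // addrC subrK.
Qed.

End Sp2Facts.

Section VermaModel.
Variables (K : fieldType) (lambda : K).

(** The monomial 'X^k stands for y^k v: then y is multiplication by 'X, and h and x
    become first and second order differential operators. *)
Definition verma_act_fun (A : 'M[K]_2) (p : {poly K}) : {poly K} :=
  A 0 0 *: (lambda *: p - 2 *: ('X * p^`())) +
  (A 0 1 *: (lambda *: p^`() - 'X * p^`()^`()) + A 1 0 *: ('X * p)).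

Lemma verma_act_linear A : linear (verma_act_fun A).
Proof.
move=> a p q; rewrite /verma_act_fun !(derivD, derivZ).
rewrite -!mul_polyC; ring.
Qed.

HB.instance Definition _ A :=
  GRing.isLinear.Build K {poly K} {poly K} *:%R (verma_act_fun A) (verma_act_linear A).

Definition verma_act (A : 'M[K]_2) : {linear {poly K} -> {poly K}} := verma_act_fun A.

Lemma verma_act_lin (a : K) A B p : A \in sp2 (K:=K) -> B \in sp2 (K:=K) ->
  verma_act (a *: A + B) p = a *: verma_act A p + verma_act B p.
Proof.
move=> _ _; rewrite /= /verma_act_fun !mxE -!mul_polyC !polyCD !polyCM; ring.
Qed.

Lemma verma_act_bracket A B p : A \in sp2 (K:=K) -> B \in sp2 (K:=K) ->
  verma_act (A *m B - B *m A) p =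
    verma_act A (verma_act B p) - verma_act B (verma_act A p).
Proof.
move=> /sp2E hA /sp2E hB.
rewrite /= /verma_act_fun !mxE !big_ord_recl !big_ord0 /=.
have -> : lift ord0 ord0 = 1 :> 'I_2 by apply/val_inj.
rewrite hA hB -![ord0]/(0 : 'I_2).
rewrite !(derivD, derivN, derivZ, derivM, derivX, mul1r) -!mul_polyC.
move: (A 0 0) (A 0 1) (A 1 0) (B 0 0) (B 0 1) (B 1 0) => a b c a' b' c'.
rewrite !(polyCD, polyCN, polyCM); ring.
Qed.

Definition verma_model : sp2mod K := Sp2Mod verma_act_lin verma_act_bracket.

Lemma verma_hwv : highest_weight_vector lambda (1 : verma_model).
Proof.
split; rewrite /= /verma_act_fun !mxE /=.
  by rewrite !derivE; rewrite -!mul_polyC; ring.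
by rewrite !derivE -!mul_polyC; ring.
Qed.

Lemma verma_actXn A k : verma_act_fun A 'X^k =
  (A 0 0 * (lambda - k.*2%:R)) *: 'X^k +
  ((A 0 1 * (k%:R * (lambda - k.-1%:R))) *: 'X^(k.-1) + A 1 0 *: 'X^(k.+1)).
Proof.
rewrite /verma_act_fun -exprS; congr (_ + (_ + _)).
  rewrite -scalerA; congr (_ *: _); rewrite derivXn scalerBl; congr (_ - _).
  case: k => [|k]; first by rewrite mulr0n mulr0 scaler0 scale0r.
  by rewrite mulrnAr -exprS /= -[X in 2 *: X]scaler_nat scalerA -natrM mul2n.
rewrite -scalerA; congr (_ *: _); rewrite derivXn derivMn derivXn.
case: k => [|[|k]] /=; first by rewrite !mulr0n mulr0 scaler0 mul0r scale0r subr0.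
  by rewrite mulr0n mul0rn mulr0 !subr0 mul1r mulr1n.
rewrite !mulrnAr -exprS -!scaler_nat !scalerA -scalerBl; congr (_ *: _); ring.
Qed.

Variables (M : sp2mod K) (v : M) (hv : highest_weight_vector lambda v).

Definition ypow (k : nat) : M := iter k (act M (sp2y K)) v.

Lemma act_h_ypow k : act M (sp2h K) (ypow k) = (lambda - k.*2%:R) *: ypow k.
Proof.
elim: k => [|k IH]; first by rewrite subr0; exact: hv.2.
rewrite /= act_hy IH linearZ /= -scalerBl; congr (_ *: _).
by rewrite doubleS -addn2 natrD; ring.
Qed.

Lemma act_x_ypow k : act M (sp2x K) (ypow k) = (k%:R * (lambda - k.-1%:R)) *: ypow k.-1.
Proof.
elim: k => [|k IH]; first by rewrite mul0r scale0r; exact: hv.1.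
rewrite /= act_xy IH act_h_ypow linearZ /=.
case: k IH => [|k] _ /=.
  by rewrite !mul0r scale0r add0r; congr (_ *: _); rewrite !subr0 mul1r.
rewrite -scalerDl; congr (_ *: _).
rewrite -muln2 !natrM -!natr1; ring.
Qed.

(** The map sends y^k v to y^k w; it commutes with x and h because both act on powers
    of y applied to a highest weight vector by the same scalars. *)
Lemma verma_to_act A p : A \in sp2 (K:=K) ->
  poly_comb ypow (act verma_model A p) = act M A (poly_comb ypow p).
Proof.
move=> hA; pose f : {linear {poly K} -> M} := poly_comb ypow \o verma_act A.
pose g : {linear {poly K} -> M} := act M A \o poly_comb ypow.
apply: (@poly_linear_ext _ _ f g) => k; rewrite /f /g /= poly_combXn act_sp2E //.
rewrite verma_actXn !linearD !linearZ /= !poly_combXn act_h_ypow act_x_ypow.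
by rewrite !scalerA.
Qed.

Definition verma_to : mod_hom verma_model M :=
  @ModHom _ verma_model M (poly_comb ypow) (poly_comb_linear ypow)
    (fun A p hA => verma_to_act p hA).

Lemma verma_to1 : verma_to (1 : {poly K}) = v.
Proof. by rewrite /= -(expr0 'X) poly_combXn. Qed.

End VermaModel.

Lemma mod_homP (K : fieldType) (M N : sp2mod K) (f : mod_hom M N) (a : K) x y :
  f (a *: x + y) = a *: f x + f y.
Proof. exact: mfun_linear. Qed.

(** Both the given module and the polynomial model satisfy the universal property: the
    map out of the former comes from its definition, the map out of the latter is
    verma_to, and uniqueness forces the composites to be identities. *)
Lemma verma_coordinates (K : fieldType) (lambda : K) (M : sp2mod K) :
  is_verma lambda M ->
  exists (c : mod_hom M (verma_model lambda)) (b : mod_hom (verma_model lambda) M),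
    [/\ highest_weight_vector lambda (b (1 : {poly K})), cancel c b & cancel b c].
Proof.
case=> v [hv uv].
have [c [cv _]] := uv _ _ (@verma_hwv K lambda).
exists c, (verma_to hv); have h := verma_to1 hv; split; first by rewrite h.
- have [f [_ fu]] := uv _ _ hv.
  have e1 : f = mod_comp (verma_to hv) c by apply: fu; rewrite /= cv; exact: h.
  have e2 : f = mod_id M by apply: fu.
  by move=> x; move: e2; rewrite e1 => /(congr1 (fun f => mfun f x)).
- pose g : {poly K} -> {poly K} := c \o verma_to hv.
  have gl : linear g by move=> a x y; rewrite /g /= poly_comb_linear mod_homP.
  pose gL : {linear {poly K} -> {poly K}} := HB.pack g (GRing.isLinear.Build _ _ _ _ g gl).
  apply: (@poly_linear_ext _ _ gL idfun) => k; rewrite /gL /g /= poly_combXn.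
  elim: k => [|k IH] /=; first by rewrite cv.
  rewrite mfun_act ?sp2y_mem // IH /= verma_actXn !mxE /= !mul0r !scale0r !add0r.
  by rewrite scale1r.
Qed.

(** * Bases of the word modules *)

Definition mk_linear (K : fieldType) (U V : lmodType K) (f : U -> V) (hf : linear f) :
  {linear U -> V} := HB.pack f (GRing.isLinear.Build K U V *:%R f hf).

Lemma linear_sumP (K : fieldType) (U V : lmodType K) (f : U -> V) (hf : linear f)
    (I : Type) (r : seq I) (a : I -> K) (F : I -> U) :
  f (\sum_(i <- r) a i *: F i) = \sum_(i <- r) a i *: f (F i).
Proof.
rewrite -[LHS]/(mk_linear hf _) linear_sum; apply: eq_bigr => i _.
by rewrite linearZ.
Qed.

Lemma linear_prop (K : fieldType) (U V : lmodType K) (f : {linear U -> V}) : linear f.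
Proof. by move=> a x y; rewrite linearP. Qed.

Lemma tens_extP (K : fieldType) (U W Z : lmodType K) (f g : tens U W -> Z) :
  linear f -> linear g -> (forall u w, f (pure u w) = g (pure u w)) -> f =1 g.
Proof.
by move=> hf hg h; exact: (@tens_ext _ _ _ _ (mk_linear hf) (mk_linear hg)).
Qed.

Lemma pureDl (K : fieldType) (U W : lmodType K) a (u u' : U) (w : W) :
  pure (a *: u + u') w = a *: pure u w + pure u' w.
Proof. by have [_ h] := @pure_bilinear K U W; exact: h. Qed.

Lemma pureDr (K : fieldType) (U W : lmodType K) a (u : U) (w w' : W) :
  pure u (a *: w + w') = a *: pure u w + pure u w'.
Proof. by have [h _] := @pure_bilinear K U W; exact: h. Qed.

Lemma pure0l (K : fieldType) (U W : lmodType K) (w : W) : pure (0 : U) w = 0.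
Proof. by have := @pureDl K U W (-1) 0 0 w; rewrite scaler0 addr0 scaleN1r addNr. Qed.
Lemma pure0r (K : fieldType) (U W : lmodType K) (u : U) : pure u (0 : W) = 0.
Proof. by have := @pureDr K U W (-1) u 0 0; rewrite scaler0 addr0 scaleN1r addNr. Qed.
Lemma pureZl (K : fieldType) (U W : lmodType K) a (u : U) (w : W) :
  pure (a *: u) w = a *: pure u w.
Proof. by rewrite -[a *: u]addr0 pureDl pure0l addr0. Qed.
Lemma pureZr (K : fieldType) (U W : lmodType K) a (u : U) (w : W) :
  pure u (a *: w) = a *: pure u w.
Proof. by rewrite -[a *: w]addr0 pureDr pure0r addr0. Qed.
Lemma pureAl (K : fieldType) (U W : lmodType K) (u u' : U) (w : W) :
  pure (u + u') w = pure u w + pure u' w.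
Proof. by rewrite -[u]scale1r pureDl !scale1r. Qed.
Lemma pureAr (K : fieldType) (U W : lmodType K) (u : U) (w w' : W) :
  pure u (w + w') = pure u w + pure u w'.
Proof. by rewrite -[w]scale1r pureDr !scale1r. Qed.

Lemma sum_iota_delta (V : nmodType) (B k : nat) (F : nat -> V) :
  (k < B)%N -> (forall r, r != k -> F r = 0) -> \sum_(r <- iota 0 B) F r = F k.
Proof.
move=> kB h; rewrite (bigD1_seq k) ?mem_iota ?iota_uniq //=.
by rewrite big1 ?addr0 // => r /h.
Qed.

Lemma sum_iota2 (V : nmodType) (B : nat) (F : nat -> V) :
  (1 < B)%N -> (forall r, (1 < r)%N -> F r = 0) -> \sum_(r <- iota 0 B) F r = F 0 + F 1.
Proof.
case: B => [|[|B]] // _ h; rewrite /= !big_cons; congr (_ + _).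
rewrite big_seq big1 ?addr0 // => r; rewrite mem_iota => /andP[r2 _]; exact: h.
Qed.

Section Coordinates.
Variables (K : fieldType) (lambda : K) (M : sp2mod K).
Variables (c : mod_hom M (verma_model lambda)) (b : mod_hom (verma_model lambda) M).
Hypotheses (cK : cancel c b) (bK : cancel b c).

Local Notation lmod := (letter_mod M).
Local Notation wmod := (word_mod M).

(** Both letters get a basis indexed by all natural numbers, extended by zero for v;
    a label of a strand is then a natural number whatever its colour. *)
Definition lbasis (a : letter) (k : nat) : lmod a :=
  match a with
  | Lm => b ('X^k : {poly K})
  | Lv => if (k < 2)%N then delta_mx (inord k) 0 else 0
  end.

(** The linear extension of a family of values on the basis of one letter. Only the
    first two values count for v. *)
Definition lext (Z : lmodType K) (a : letter) (phi : nat -> Z) : lmod a -> Z :=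
  match a with
  | Lm => fun u => poly_comb phi (c u)
  | Lv => fun u => u 0 0 *: phi 0 + u 1 0 *: phi 1
  end.

Lemma lext_linear (Z : lmodType K) a (phi : nat -> Z) : linear (@lext Z a phi).
Proof.
case: a => r x y /=; first by rewrite mod_homP poly_comb_linear.
by rewrite !mxE !scalerDl !scalerDr !scalerA addrACA.
Qed.

Lemma lextP (Z : lmodType K) a r (phi psi : nat -> Z) u :
  @lext Z a (fun k => r *: phi k + psi k) u = r *: lext phi u + lext psi u.
Proof.
case: a u => u /=.
  rewrite /poly_comb scaler_sumr -big_split; apply: eq_bigr => i _ /=.
  by rewrite scalerDr !scalerA mulrC.
by rewrite !scalerDr !scalerA !(mulrC r) addrACA.
Qed.

Lemma lext_basis (Z : lmodType K) a (phi : nat -> Z) k :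
  (a == Lm) || (k < 2)%N -> lext phi (lbasis a k) = phi k.
Proof.
case: a => /= [_|k2]; first by rewrite bK poly_combXn.
rewrite k2 !mxE.
have -> : (0 == inord k :> 'I_2) = (k == 0)%N by rewrite -val_eqE /= inordK // eq_sym.
have -> : (1 == inord k :> 'I_2) = (k == 1)%N by rewrite -val_eqE /= inordK // eq_sym.
by case: k k2 => [|[|k]] //= _; rewrite scale1r scale0r ?addr0 ?add0r.
Qed.

Lemma letter_ext (Z : lmodType K) a (f g : lmod a -> Z) : linear f -> linear g ->
  (forall k, f (lbasis a k) = g (lbasis a k)) -> f =1 g.
Proof.
case: a f g => f g hf hg h u.
  have lb : linear (fun p : {poly K} => b p) by move=> ? ? ?; rewrite mod_homP.
  pose f' := mk_linear hf \o mk_linear lb; pose g' := mk_linear hg \o mk_linear lb.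
  have : f' =1 g' by apply: poly_linear_ext => k; exact: h.
  by move/(_ (c u)); rewrite /f' /g' /= cK.
have -> : u = u 0 0 *: lbasis Lv 0 + u 1 0 *: lbasis Lv 1.
  apply/matrixP => i j; rewrite !mxE (ord1 j) eqxx !andbT.
  have -> : inord 0 = 0 :> 'I_2 by apply: val_inj; rewrite /= inordK.
  have -> : inord 1 = 1 :> 'I_2 by apply: val_inj; rewrite /= inordK.
  by case: (ord2P i) => ->; rewrite /= ?mulr1 ?mulr0 ?addr0 ?add0r.
rewrite -[f _]/(mk_linear hf _) -[g _]/(mk_linear hg _) !linearD !linearZ.
by congr (_ *: _ + _ *: _); exact: h.
Qed.

Fixpoint ext (Z : lmodType K) (s : word) (phi : seq nat -> Z) : wmod s -> Z :=
  match s return wmod s -> Z with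
  | [::] => fun z : K => z *: phi [::]
  | a :: s' => @tens_lift K (lmod a) (wmod s') Z
      (fun u w => lext (fun k => ext (fun ks => phi (k :: ks)) w) u)
  end.

Lemma ext_bilinear (Z : lmodType K) a (s : word) (phi : seq nat -> Z) :
  (forall psi : seq nat -> Z, linear (@ext Z s psi)) ->
  bilinear_map (fun (u : lmod a) (w : wmod s) =>
    lext (fun k => ext (fun ks => phi (k :: ks)) w) u).
Proof.
move=> h; split=> [u r w w'|w]; last exact: lext_linear.
by rewrite -lextP; congr (lext _ _); apply: boolp.funext => k; rewrite h.
Qed.

Lemma ext_linear (Z : lmodType K) (s : word) (phi : seq nat -> Z) : linear (@ext Z s phi).
Proof.
elim: s phi => [|a s IH] phi; first by move=> r x y /=; rewrite scalerDl scalerA.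
exact/tens_lift_linear/ext_bilinear.
Qed.

Fixpoint bvec (s : word) (ks : seq nat) : wmod s :=
  match s return wmod s with
  | [::] => (1 : K^o)
  | a :: s' => @pure K (lmod a) (wmod s') (lbasis a (head 0 ks)) (bvec s' (behead ks))
  end.

Fixpoint valid (s : word) (ks : seq nat) : bool :=
  match s with
  | [::] => true
  | a :: s' => ((a == Lm) || (head 0 ks < 2)%N) && valid s' (behead ks)
  end.

(** A label that is at least 2 on a strand v gives the zero vector. *)
Lemma bvec_invalid s ks : ~~ valid s ks -> bvec s ks = 0.
Proof.
elim: s ks => [|a s IH] ks //=; rewrite negb_and => /orP[h|/IH ->]; last exact: pure0r.
by case: a h => //= h; rewrite -[(_ < 2)%N]negbK h /= pure0l.
Qed.

Lemma ext_bvec (Z : lmodType K) s (phi : seq nat -> Z) ks : size ks = size s -> valid s ks ->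
  ext phi (bvec s ks) = phi ks.
Proof.
elim: s phi ks => [|a s IH] phi [|k ks] //=; first by rewrite scale1r.
move=> [sz] /andP[va vs]; rewrite tens_lift_pure; last exact/ext_bilinear/ext_linear.
by rewrite lext_basis // IH.
Qed.

Lemma word_ext (Z : lmodType K) s (f g : wmod s -> Z) : linear f -> linear g ->
  (forall ks, size ks = size s -> f (bvec s ks) = g (bvec s ks)) -> f =1 g.
Proof.
elim: s f g => [|a s IH] f g hf hg h.
  move=> x; have -> : x = (x : K) *: (1 : K^o) by rewrite -[RHS]/(_ * _) mulr1.
  rewrite -[f _]/(mk_linear hf _) -[g _]/(mk_linear hg _) !linearZ /=.
  by have := h [::] erefl => /= ->.
apply: tens_extP => // u w.
have lw (k : {linear _ -> Z}) u' : linear (fun w : wmod s => k (pure (u' : lmod a) w)).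
  by move=> r x y; rewrite pureDr linearP.
have lu (k : {linear _ -> Z}) w' : linear (fun u : lmod a => k (pure u (w' : wmod s))).
  by move=> r x y; rewrite pureDl linearP.
apply: (letter_ext (lu (mk_linear hf) w) (lu (mk_linear hg) w)) => k.
apply: (IH _ _ (lw (mk_linear hf) _) (lw (mk_linear hg) _)) => ks sz.
by have /= := h (k :: ks); rewrite sz => /(_ erefl).
Qed.

(** The entries of the matrix of A in the basis lbasis. On the pole they are read off
    the action of A on the powers 'X^k. *)
Definition amat (a : letter) (A : 'M[K]_2) (r k : nat) : K :=
  match a with
  | Lm => (r == k)%:R * (A 0 0 * (lambda - k.*2%:R))
          + (r.+1 == k)%:R * (A 0 1 * (k%:R * (lambda - k.-1%:R)))
          + (r == k.+1)%:R * A 1 0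
  | Lv => if (r < 2)%N && (k < 2)%N then A (inord r) (inord k) else 0
  end.

(** The image of a basis vector has labels at most one above, so a finite range of
    labels contains it; B is any such range. *)
Lemma act_lbasis a A k B : A \in sp2 (K:=K) -> (k.+1 < B)%N ->
  act (lmod a) A (lbasis a k) = \sum_(r <- iota 0 B) amat a A r k *: lbasis a r.
Proof.
move=> hA kB; case: a => /=.
  under eq_bigr do rewrite !scalerDl -!scalerA.
  rewrite !big_split /= -mfun_act //= verma_actXn.
  rewrite (@sum_iota_delta _ B k) ?(ltnW kB) //; last first.
    by move=> r /negbTE ->; rewrite scale0r.
  rewrite [X in _ = _ + X](@sum_iota_delta _ B k.+1) //; last first.
    by move=> r /negbTE ->; rewrite scale0r.
  rewrite !eqxx !scale1r.
  have lb : linear (fun p : {poly K} => b p) by move=> ? ? ?; rewrite mod_homP.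
  rewrite -[b _]/(mk_linear lb _) !linearD !linearZ /= addrA.
  congr (_ + _ + _); first by rewrite scalerA mulrC.
  case: k kB => [|k] kB.
    by rewrite mul0r mulr0 scale0r big1 // => r _; rewrite scale0r.
  rewrite (@sum_iota_delta _ B k) //; first by rewrite eqxx scale1r !scalerA mulrA.
    exact: ltn_trans (ltnW kB).
  by move=> r rk; rewrite eqSS (negbTE rk) scale0r.
rewrite (@sum_iota2 _ B); last 2 first.
- exact: leq_ltn_trans kB.
- by case=> [|[|r]] // _; rewrite scale0r.
case: ltnP => k2 /=; last by rewrite mulmx0 !scale0r addr0.
apply/matrixP => i j; rewrite (ord1 j) !mxE !andbT.
rewrite (bigD1 (inord k)) //= big1 => [|i' ik].
  rewrite mxE !eqxx mulr1 addr0.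
  have -> : inord 0 = 0 :> 'I_2 by apply: val_inj; rewrite /= inordK.
  have -> : inord 1 = 1 :> 'I_2 by apply: val_inj; rewrite /= inordK.
  by case: (ord2P i) => ->; rewrite /= ?mulr1 ?mulr0 ?addr0 ?add0r.
by rewrite mxE (negbTE ik) mulr0.
Qed.

End Coordinates.

(** * The linear map of a Brauer diagram *)

Section StateMore.
Variables (P : eqType) (col : P -> letter) (K : fieldType) (X : Type) (s : K).

Lemma state_neq0 (g : letter -> X -> X -> K) d w x p :
  (forall a y z, g a y z = gsign s a a * g a z y) ->
  matched col d w -> state col s g d w x != 0 -> p \in w ->
  g (col p) (x p) (x (d p)) != 0.
Proof.
move=> gsym; have [n] := ubnP (size w); elim: n w => // n IH [|a w] // /ltnSE wn m.
have [w1 [w2 [wE nda m']]] := matched_cons m.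
have [p1 p2 p3 p4] := m.2 a (mem_head _ _).
rewrite wE state_split // !mulf_eq0 !negb_or => /andP[/andP[_ ga] sr].
rewrite inE => /orP[/eqP -> //|]; rewrite mem_cat inE => pw.
have [->|pd] := eqVneq p (d a).
  rewrite p3 p4; move: ga; rewrite gsym mulf_eq0 negb_or => /andP[]//.
apply: (IH (w1 ++ w2)) => //.
- by move: wn; rewrite wE /= !size_cat /= addnS => /ltnW.
- by move: pw; rewrite (negbTE pd) mem_cat.
Qed.

Lemma state_form_ext (g g' : letter -> X -> X -> K) d w x : matched col d w ->
  (forall p, p \in w -> g (col p) (x p) (x (d p)) = g' (col p) (x p) (x (d p))) ->
  state col s g d w x = state col s g' d w x.
Proof.
have [n] := ubnP (size w); elim: n w => // n IH [|a w] // /ltnSE wn m h.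
have [w1 [w2 [wE nda m']]] := matched_cons m.
rewrite wE !state_split // h ?mem_head // IH //.
- by move: wn; rewrite wE /= !size_cat /= addnS => /ltnW.
- move=> p; rewrite mem_cat => pw; apply: h; rewrite wE inE mem_cat inE.
  by case/orP: pw => ->; rewrite !orbT.
Qed.

End StateMore.

Section LabelSums.
Variable V : nmodType.

Lemma label_seqsP (B n : nat) ls :
  ls \in label_seqs (iota 0 B) n <-> size ls = n /\ all (fun l => l < B)%N ls.
Proof.
elim: n ls => [|n IH] ls.
  by rewrite inE; split=> [/eqP ->|[]] //; case: ls.
split=> [/allpairsP[[l m] /= [lB /IH[<- al] ->]]|[]].
  by split=> //=; rewrite al andbT; move: lB; rewrite mem_iota.
case: ls => [|l ls] //= [sz] /andP[lB al]; apply/allpairsP; exists (l, ls).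
by split=> //=; [rewrite mem_iota|apply/IH].
Qed.

(** The state sums are over a finite range of labels, and enlarging it adds only zeros. *)
Lemma sum_label_widen B B' n (F : seq nat -> V) : (B <= B')%N ->
  (forall ls, size ls = n -> ~~ all (fun l => l < B)%N ls -> F ls = 0) ->
  \sum_(ls <- label_seqs (iota 0 B') n) F ls = \sum_(ls <- label_seqs (iota 0 B) n) F ls.
Proof.
move=> BB; elim: n F => [|n IH] F h; first by rewrite /= !big_seq1.
rewrite !big_label_seqsS; set G := (X in \sum_(i <- iota 0 B') X i).
have -> : iota 0 B' = iota 0 B ++ iota B (B' - B) by rewrite -iotaD subnKC.
rewrite big_cat /= [X in _ + X]big1_seq ?addr0.
  apply: eq_big_seq => l; rewrite mem_iota add0n => /andP[_ lB].
  rewrite /G; apply: (IH (fun ls => F (l :: ls))) => ls sz nl.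
  by apply: h; rewrite /= ?sz // lB.
move=> l /=; rewrite mem_iota => /andP[Bl _]; rewrite /G big1_seq // => ls /=.
by move/label_seqsP=> [sz _]; apply: h; rewrite /= ?sz // ltnNge Bl.
Qed.

Lemma big_label_seqs_cat (I : Type) (cs : seq I) m n (F : seq I -> V) :
  \sum_(ls <- label_seqs cs (m + n)) F ls =
  \sum_(ls <- label_seqs cs m) \sum_(ls' <- label_seqs cs n) F (ls ++ ls').
Proof.
elim: m F => [|m IH] F; first by rewrite /= big_seq1.
by rewrite addSn !big_label_seqsS; apply: eq_bigr => c _; rewrite IH.
Qed.

(** Summing over the old value of an entry and its new value is symmetric in the two. *)
Lemma sum_label_swap B n i (F : seq nat -> nat -> nat -> V) : (i < n)%N ->
  \sum_(ls <- label_seqs (iota 0 B) n) \sum_(r <- iota 0 B)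
     F (set_nth 0 ls i r) (nth 0 ls i) r =
  \sum_(ls <- label_seqs (iota 0 B) n) \sum_(r <- iota 0 B) F ls r (nth 0 ls i).
Proof.
elim: n i F => // n IH [|i] F lin; rewrite !big_label_seqsS.
  rewrite /=; under eq_bigr do rewrite exchange_big.
  rewrite exchange_big; apply: eq_bigr => r _.
  by rewrite exchange_big.
by apply: eq_bigr => c _; rewrite (IH i (fun ls x r => F (c :: ls) x r)).
Qed.

End LabelSums.

Section DiagramMap.
Variables (K : fieldType) (lambda : K) (M : sp2mod K).
Variables (c : mod_hom M (verma_model lambda)) (b : mod_hom (verma_model lambda) M).
Hypotheses (cK : cancel c b) (bK : cancel b c).

Local Notation wmod := (word_mod M).
Local Notation bvec := (@bvec K lambda M b).
Local Notation ext := (@ext K lambda M c).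

Definition om (i j : nat) : K :=
  match i, j with 0%N, 1%N => 1 | 1%N, 0%N => -1 | _, _ => 0 end.

(** The form that labels a chord. The boolean tells a top point from a bottom point: a
    through strand carries the identity, a cap the form omega, and a cup its inverse,
    because its two points are read in the opposite order. The sign in front of the
    Kronecker symbol makes the form skew, as the oddness of v requires. *)
Definition gform (a : letter) (x y : bool * nat) : K :=
  match a with
  | Lm => (x.2 == y.2)%:R
  | Lv => if (x.2 < 2)%N && (y.2 < 2)%N then
            if x.1 == y.1 then om x.2 y.2
            else (if x.1 then -1 else 1) * (x.2 == y.2)%:R
          else 0
  end.

Lemma gform_sym a x y : gform a x y = gsign (-1) a a * gform a y x.
Proof.
case: a; rewrite /gsign /= ?mul1r; first by rewrite eq_sym.
case: x => -[] [|[|i]]; case: y => -[] [|[|j]] //=; ring.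
Qed.

(** Composition through the middle row is the matrix product of the pairings, and omega
    composed with its inverse straightens a snake. *)
Lemma gform_contraction B a x y : (1 < B)%N -> (x.2 < B)%N -> (y.2 < B)%N ->
  \sum_(l <- iota 0 B) gform a x (true, l) * gform a (false, l) y = gform a x y.
Proof.
move=> B1 xB yB; case: a.
  rewrite (@sum_iota_delta _ B x.2) //=; first by rewrite eqxx mul1r.
  by move=> r rx; rewrite eq_sym (negbTE rx) mul0r.
rewrite (@sum_iota2 _ B) //; last first.
  by case=> [|[|r]] // _; rewrite /= andbF mul0r.
case: x xB => -[] [|[|i]] _; case: y yB => -[] [|[|j]] _ //=; ring.
Qed.

(** A closed v-loop is the graded dimension of the natural module. A pole loop
    would count the labels in the range. *)
Lemma gform_loop B a : (1 < B)%N ->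
  \sum_(l <- iota 0 B) gform a (true, l) (false, l) =
  match a with Lm => B%:R | Lv => -2 end.
Proof.
move=> B1; case: a.
  under eq_bigr do rewrite /= eqxx.
  by rewrite big_const_seq count_predT size_iota iter_addr addr0.
rewrite (@sum_iota2 _ B) //=; last by case=> [|[|r]].
by ring.
Qed.

Section OneDiagram.
Variables (s t : word) (d : diagram s t).

Definition end_label (ks ls : seq nat) (p : point s t) : bool * nat :=
  match p with inl i => (false, nth 0%N ks i) | inr j => (true, nth 0%N ls j) end.

(** The matrix coefficient of a diagram between two basis vectors, as the signed state of
    its chords. *)
Definition dgcoef (ks ls : seq nat) : K :=
  state (@colour s t) (-1) gform d (boundary s t) (end_label ks ls).

Lemma dgcoef_chord ks ls p : dgcoef ks ls != 0 ->
  gform (colour p) (end_label ks ls p) (end_label ks ls (d p)) != 0.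
Proof.
move=> h; apply: (state_neq0 gform_sym _ h) (mem_boundary p).
exact: matched_diagram.
Qed.

(** Only finitely many labels of the top row occur for given labels of the bottom row:
    a pole label is copied and a strand has two labels. Hence the sums are finite
    although the Verma module has infinite dimension. *)
Lemma dgcoef_bound B ks ls : (1 < B)%N -> all (fun l => l < B)%N ks ->
  size ks = size s -> size ls = size t -> dgcoef ks ls != 0 ->
  all (fun l => l < B)%N ls.
Proof.
move=> B1 /all_nthP ak sk sl h; apply/(all_nthP 0%N) => j; rewrite sl => jt.
have := @dgcoef_chord ks ls (inr (Ordinal jt)) h.
have [_ _ dc dr] := mate_spec d (inr (Ordinal jt)).
case E : (colour _) dr => dr /=.
  case e : (d (inr (Ordinal jt))) dr => [i|j'] dr /=; last by move: (dr isT).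
  have [-> _|_] := eqVneq (nth 0%N ls j) (nth 0%N ks i); last by rewrite eqxx.
  by apply: ak; rewrite sk.
by case: ltnP => [h2 _|_ /=]; [exact: leq_trans h2 B1|rewrite eqxx].
Qed.

Lemma validP s' ks : (forall i : 'I_(size s'), nth Lm s' i = Lv -> (nth 0%N ks i < 2)%N) ->
  valid s' ks.
Proof.
elim: s' ks => [|a s' IH] ks //= h; apply/andP; split.
  by have := h ord0 => /=; case: a h => //= _; rewrite nth0; apply.
apply: IH => i; have := h (lift ord0 i) => /=; rewrite /bump /= add1n.
by rewrite nth_behead.
Qed.

Lemma dgcoef_invalid ks ls : ~~ valid s ks -> dgcoef ks ls = 0.
Proof.
apply: contraNeq => h; apply: validP => i si.
have := @dgcoef_chord ks ls (inl i) h; rewrite /= si.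
by have [//|k2] := ltnP (nth 0%N ks i) 2; rewrite /= ltnNge k2 /= eqxx.
Qed.

Definition bound (ks : seq nat) : nat := (\max_(k <- ks) k).+2.

Lemma boundP ks : all (fun k => k < bound ks)%N ks.
Proof.
by apply/allP => k kk; rewrite /bound ltnS ltnW // ltnS; apply: leq_bigmax_seq.
Qed.

Definition dgmap : wmod s -> wmod t := @ext (wmod t) s (fun ks =>
  \sum_(ls <- label_seqs (iota 0 (bound ks)) (size t)) dgcoef ks ls *: bvec t ls).

Lemma dgmap_linear : linear dgmap. Proof. exact: ext_linear. Qed.

(** The sum does not depend on the range of labels as long as it contains the support. *)
Lemma dgmap_bvec B ks : (1 < B)%N -> all (fun l => l < B)%N ks -> size ks = size s ->
  dgmap (bvec s ks) = \sum_(ls <- label_seqs (iota 0 B) (size t)) dgcoef ks ls *: bvec t ls.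
Proof.
move=> B1 ak sz; have [v|v] := boolP (valid s ks); last first.
  rewrite bvec_invalid // -[dgmap 0]/(mk_linear dgmap_linear 0) linear0.
  by rewrite big1 // => ls _; rewrite dgcoef_invalid // scale0r.
rewrite /dgmap ext_bvec //.
have w B1' B2' : (1 < B1')%N -> all (fun l => l < B1')%N ks -> (B1' <= B2')%N ->
   \sum_(ls <- label_seqs (iota 0 B2') (size t)) dgcoef ks ls *: bvec t ls =
   \sum_(ls <- label_seqs (iota 0 B1') (size t)) dgcoef ks ls *: bvec t ls.
  move=> h1 h2 h3; apply: sum_label_widen => // ls sl nl.
  by rewrite [dgcoef _ _](_ : _ = 0) ?scale0r //; apply: contraNeq nl => h; exact: dgcoef_bound h.
have [h|h] := leqP (bound ks) B; first by rewrite (w _ _ _ _ h) // boundP.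
by rewrite -(w _ _ B1 ak (ltnW h)).
Qed.

End OneDiagram.

(** Stacking of diagrams is the gluing theorem for state sums with s = -1, and each loop
    gives the factor -2. *)
Lemma dgmap_stack s t u (A : diagram s t) (B : diagram t u) (D : diagram s u) x :
  is_stacking A B D -> dgmap B (dgmap A x) = (-2) ^+ nb_loops A B *: dgmap D x.
Proof.
move=> st.
have lin1 : linear (fun x => dgmap B (dgmap A x)) by move=> r y z; rewrite !dgmap_linear.
have lin2 : linear (fun x => (-2) ^+ nb_loops A B *: dgmap D x).
  by move=> r y z; rewrite dgmap_linear scalerDr !scalerA mulrC.
move: x; apply: (word_ext cK lin1 lin2) => ks sz.
have B1 : (1 < bound ks)%N by [].
rewrite (dgmap_bvec A B1 (boundP ks) sz) (dgmap_bvec D B1 (boundP ks) sz).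
rewrite (linear_sumP (dgmap_linear B)) nb_loopsE.
under eq_big_seq => ms /label_seqsP[sm am] do rewrite (dgmap_bvec B B1 am sm) scaler_sumr.
rewrite exchange_big scaler_sumr; apply: eq_big_seq => ls /label_seqsP[sl al] /=.
under eq_bigr do rewrite scalerA.
rewrite -scaler_suml scalerA; congr (_ *: _).
have := @state_stack s t u A B K (bool * nat) (-1) gform nat 0%N (iota 0 (bound ks))
  (fun _ l => (true, l)) (fun _ l => (false, l)) (fun x => (x.2 < bound ks)%N)
  (fun a => match a with Lm => (bound ks)%:R | Lv => -2 end) (end_label ks ls).
rewrite mulrNN mulr1 => /(_ erefl gform_sym) -> //.
- by rewrite /dgcoef; congr (_ * state _ _ _ _ _ _); apply: boolp.funext => p;
    rewrite (stacking_unique st).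
- by move=> a x y xo yo; exact: gform_contraction.
- by move=> a; exact: gform_loop.
- by move=> a l; rewrite mem_iota.
- by move=> a l; rewrite mem_iota.
- have h l i : (i < size l)%N -> all (fun k => k < bound ks)%N l -> (nth 0%N l i < bound ks)%N.
    by move=> il /all_nthP; apply.
  by case=> i /=; apply: h; rewrite ?sz ?sl ?boundP.
Qed.

End DiagramMap.

(** * Equivariance of the diagram maps *)

Lemma big_boundary (V : nmodType) s t (F : point s t -> V) :
  \sum_(p <- boundary s t) F p = \sum_(i < size s) F (inl i) + \sum_(j < size t) F (inr j).
Proof.
rewrite /boundary big_cat /= (perm_big _ (permEl (perm_rev _))).
by congr (_ + _); rewrite big_map big_enum.
Qed.

Section Equivariance.
Variables (K : fieldType) (lambda : K) (M : sp2mod K).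
Variables (c : mod_hom M (verma_model lambda)) (b : mod_hom (verma_model lambda) M).
Hypotheses (cK : cancel c b) (bK : cancel b c).

Local Notation lmod := (letter_mod M).
Local Notation wmod := (word_mod M).
Local Notation bvec := (@bvec K lambda M b).
Local Notation dgmap := (@dgmap K lambda M c b _ _).
Local Notation amat := (@amat K lambda).
Local Notation gform := (@gform K).

(** The Leibniz rule: A acts on one tensor factor at a time. *)
Lemma act_bvec s ks A B : A \in sp2 (K:=K) -> size ks = size s ->
  all (fun k => k.+1 < B)%N ks ->
  act (wmod s) A (bvec s ks) = \sum_(i < size s) \sum_(r <- iota 0 B)
    amat (nth Lm s i) A r (nth 0%N ks i) *: bvec s (set_nth 0%N ks i r).
Proof.
move=> hA; elim: s ks => [|a s IH] [|k ks] //=; first by rewrite big_ord0.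
move=> [sz] /andP[kB ak]; rewrite [LHS](@tens_actE K (lmod a) (wmod s)) big_ord_recl.
rewrite (act_lbasis b a hA kB) (IH ks sz ak); congr (_ + _).
  have pl : linear (fun u : lmod a => pure u (bvec s ks)) by move=> ? ? ?; rewrite pureDl.
  by rewrite (linear_sumP pl).
have pr : linear (fun w : wmod s => pure (lbasis b a k) w) by move=> ? ? ?; rewrite pureDr.
rewrite -[LHS]/(mk_linear pr _) linear_sum; apply: eq_bigr => i _.
by rewrite [LHS](linear_sumP pr).
Qed.

(** On a chord of a diagram this has the same value as gform, but it is also invariant
    under sp_2 for all arguments: two pole points of the same row must pair to zero. *)
Definition gform' (a : letter) (x y : bool * nat) : K :=
  match a with Lm => ((x.1 != y.1) && (x.2 == y.2))%:R | Lv => gform Lv x y end.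

Lemma dgcoefE' s t (d : diagram s t) ks ls :
  dgcoef K d ks ls = state (@colour s t) (-1) gform' d (boundary s t) (end_label ks ls).
Proof.
apply: state_form_ext; first exact: matched_diagram.
move=> p _; have [_ _ _ dr] := mate_spec d p; case E : (colour p) dr => //= dr.
suff -> : (end_label ks ls p).1 != (end_label ks ls (d p)).1 by [].
by move: (d p) dr {E}; case: p => ? [?|?] //= h; move: (h isT).
Qed.

(** At a top point the action is that on the dual, hence the transposed matrix with a
    sign. *)
Definition label_weight (A : 'M[K]_2) (a : letter) (x : bool * nat) (r : nat) : K :=
  if x.1 then - amat a A x.2 r else amat a A r x.2.

(** Invariance under A of the identity of the pole and of the form omega. *)
Lemma amat_invariance A B a x y : A \in sp2 (K:=K) -> (1 < B)%N ->
  (x.2 < B)%N -> (y.2 < B)%N ->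
  \sum_(r <- iota 0 B) label_weight A a x r * gform' a (x.1, r) y
  + \sum_(r <- iota 0 B) label_weight A a y r * gform' a x (y.1, r) = 0.
Proof.
move=> hA B1; case: x => [u k]; case: y => [v l] kB lB; case: a.
  rewrite (@sum_iota_delta _ B l) //=; last first.
    by move=> r /negbTE rl; rewrite rl andbF mulr0.
  rewrite (@sum_iota_delta _ B k) //=; last first.
    by move=> r rk; rewrite [k == r]eq_sym (negbTE rk) andbF mulr0.
  rewrite !eqxx !andbT /label_weight /=.
  clear kB lB; by case: u; case: v; rewrite /= ?mulr0 ?mulr1 ?addr0 ?addrN ?addNr.
rewrite !(@sum_iota2 _ B) //; last 2 first.
- by case=> [|[|r]] // _; rewrite /= ?andbF mulr0.
- by case=> [|[|r]] // _; rewrite /= ?andbF mulr0.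
rewrite /label_weight /=.
have -> : inord 0 = 0 :> 'I_2 by apply: val_inj; rewrite /= inordK.
have -> : inord 1 = 1 :> 'I_2 by apply: val_inj; rewrite /= inordK.
have hh := sp2E hA.
have i0 : inord 0 = 0 :> 'I_2 by apply: val_inj; rewrite /= inordK.
have i1 : inord 1 = 1 :> 'I_2 by apply: val_inj; rewrite /= inordK.
clear kB lB; by case: u; case: v; case: k => [|[|k]]; case: l => [|[|l]];
  rewrite /= ?i0 ?i1 ?hh; ring.
Qed.

Lemma dgcoef_derivation s t (d : diagram s t) A B ks ls : A \in sp2 (K:=K) ->
  (1 < B)%N -> size ks = size s -> size ls = size t ->
  all (fun k => k < B)%N ks -> all (fun k => k < B)%N ls ->
  \sum_(i < size s) \sum_(r <- iota 0 B)
    amat (nth Lm s i) A r (nth 0%N ks i) * dgcoef K d (set_nth 0%N ks i r) ls =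
  \sum_(j < size t) \sum_(r <- iota 0 B)
    amat (nth Lm t j) A (nth 0%N ls j) r * dgcoef K d ks (set_nth 0%N ls j r).
Proof.
move=> hA B1 sk sl ak al.
have okz p : p \in boundary s t -> ((end_label ks ls p).2 < B)%N.
  by case: p => i _ /=; [apply: (all_nthP 0%N ak)|apply: (all_nthP 0%N al)]; rewrite ?sk ?sl.
have := @state_derivation _ _ K _ (-1) gform' _ (iota 0 B) (fun x => (x.2 < B)%N)
  (label_weight A) (fun x r => (x.1, r)) (fun a x y hx hy => amat_invariance a hA B1 hx hy)
  d _ _ (matched_diagram d) okz.
rewrite [LHS]big_boundary.
have e1 (i : 'I_(size s)) : derive_at (colour (t:=t)) (-1) gform' (iota 0 B) (label_weight A)
    (fun x r => (x.1, r)) d (boundary s t) (end_label ks ls) (inl i) =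
    \sum_(r <- iota 0 B) amat (nth Lm s i) A r (nth 0%N ks i) * dgcoef K d (set_nth 0%N ks i r) ls.
  apply: eq_bigr => r _; rewrite dgcoefE'; congr (_ * state _ _ _ _ _ _).
  apply: boolp.funext => -[i'|j'] //; rewrite /upd1.
  have -> : (inl i' == inl i :> point s t) = (i' == i :> nat) by [].
  by rewrite /= nth_set_nth /=; case: (_ == _).
have e2 (j : 'I_(size t)) : derive_at (colour (t:=t)) (-1) gform' (iota 0 B) (label_weight A)
    (fun x r => (x.1, r)) d (boundary s t) (end_label ks ls) (inr j) =
    - \sum_(r <- iota 0 B) amat (nth Lm t j) A (nth 0%N ls j) r * dgcoef K d ks (set_nth 0%N ls j r).
  rewrite -sumrN; apply: eq_bigr => r _; rewrite dgcoefE' -mulNr.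
  congr (_ * state _ _ _ _ _ _).
  apply: boolp.funext => -[i'|j'] //; rewrite /upd1.
  have -> : (inr j' == inr j :> point s t) = (j' == j :> nat) by [].
  by rewrite /= nth_set_nth /=; case: (_ == _).
under eq_bigr do rewrite e1; under [X in _ + X]eq_bigr do rewrite e2.
by rewrite sumrN => /eqP; rewrite subr_eq0 => /eqP.
Qed.

(** The derivation property of the state sum says that A acting on the bottom labels
    equals A acting on the top labels. The range of labels is enlarged by one to leave
    room for y. *)
Lemma dgmap_act s t (d : diagram s t) A x : A \in sp2 (K:=K) ->
  dgmap d (act (wmod s) A x) = act (wmod t) A (dgmap d x).
Proof.
move=> hA.
have lin1 : linear (fun x => dgmap d (act (wmod s) A x)).
  by move=> r y z; rewrite linearP (dgmap_linear c b d).
have lin2 : linear (fun x => act (wmod t) A (dgmap d x)).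
  by move=> r y z; rewrite (dgmap_linear c b d) linearP.
move: x; apply: (word_ext cK lin1 lin2) => ks sz.
have [B BE] : exists B, B = (bound ks).+1 by exists (bound ks).+1.
have ak := boundP ks; have B1 : (1 < B)%N by rewrite BE.
have akB : all (fun k => k < B)%N ks.
  by rewrite BE; apply: sub_all ak => k kb; exact: ltnW.
rewrite (@act_bvec s ks A B) //; last by rewrite BE.
have lind := dgmap_linear c b d.
transitivity (\sum_(ls <- label_seqs (iota 0 B) (size t)) (\sum_(i < size s)
    \sum_(r <- iota 0 B) amat (nth Lm s i) A r (nth 0%N ks i) *
      dgcoef K d (set_nth 0%N ks i r) ls) *: bvec t ls).
  rewrite -[LHS]/(mk_linear lind _) linear_sum.
  under [RHS]eq_bigr do rewrite scaler_suml.
  rewrite exchange_big; apply: eq_bigr => i _ /=.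
  under [RHS]eq_bigr do rewrite scaler_suml.
  rewrite exchange_big [LHS](linear_sumP lind); apply: eq_big_seq => r rB /=.
  rewrite (dgmap_bvec bK d B1); last 2 first.
  - apply/(all_nthP 0%N) => j; rewrite size_set_nth => _; rewrite nth_set_nth /=.
    case: eqP => _; first by move: rB; rewrite mem_iota.
    have [jk|jk] := ltnP j (size ks); first exact: (all_nthP 0%N akB).
    by rewrite nth_default // BE.
  - by rewrite size_set_nth sz; apply/maxn_idPr; exact: ltn_ord.
  rewrite scaler_sumr; apply: eq_bigr => ls _; by rewrite scalerA.
rewrite (dgmap_bvec bK d _ ak) //.
transitivity (\sum_(ls <- label_seqs (iota 0 B) (size t)) \sum_(j < size t)
    \sum_(r <- iota 0 B) (dgcoef K d ks ls * amat (nth Lm t j) A r (nth 0%N ls j)) *: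
      bvec t (set_nth 0%N ls j r)); last first.
  rewrite linear_sum (@sum_label_widen _ (bound ks) B); first last.
  - move=> ls sl nl; rewrite big1 // => j _; rewrite big1 // => r _.
    rewrite [dgcoef _ _ _ _](_ : _ = 0) ?mul0r ?scale0r //.
    by apply: contraNeq nl => h; apply: dgcoef_bound h.
  - by rewrite BE.
  apply: eq_big_seq => ls /label_seqsP[sl al]; rewrite linearZ (@act_bvec t ls A B) //=; last by rewrite BE.
  rewrite scaler_sumr; apply: eq_bigr => j _; rewrite scaler_sumr; apply: eq_bigr => r _.
  by rewrite scalerA.
rewrite exchange_big /=.
transitivity (\sum_(j < size t) \sum_(ls <- label_seqs (iota 0 B) (size t))
    \sum_(r <- iota 0 B) (dgcoef K d ks (set_nth 0%N ls j r) * amat (nth Lm t j) A (nth 0%N ls j) r)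
      *: bvec t ls); last first.
  apply: eq_bigr => j _; rewrite -(@sum_label_swap _ B (size t) j (fun ls x r =>
    (dgcoef K d ks (set_nth 0%N ls j x) * amat (nth Lm t j) A r x) *: bvec t ls)) //.
  apply: eq_big_seq => ls /label_seqsP[sl al]; apply: eq_bigr => r _.
  rewrite set_set_nth eqxx; congr ((dgcoef K d ks _ * _) *: _).
  apply: (@eq_from_nth _ 0%N) => [|i _].
    by rewrite size_set_nth; apply/maxn_idPr; rewrite sl.
  by rewrite nth_set_nth /=; case: eqP => [->|].
rewrite exchange_big; apply: eq_big_seq => ls /label_seqsP[sl al] /=.
rewrite (@dgcoef_derivation s t d A B) // scaler_suml; apply: eq_bigr => j _.
by rewrite scaler_suml; apply: eq_bigr => r _; rewrite mulrC.
Qed.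

End Equivariance.

(** * Diagram maps and juxtaposition; elementary diagrams *)

Lemma enum_cat (s t : word) : enum 'I_(size (s ++ t)) =
  [seq @gluep s t (inl i) | i <- enum 'I_(size s)] ++
  [seq @gluep s t (inr j) | j <- enum 'I_(size t)].
Proof.
apply: (inj_map val_inj); rewrite map_cat.
have e1 (r : seq 'I_(size s)) : map val [seq @gluep s t (inl i) | i <- r] = map val r.
  by rewrite -map_comp; apply: eq_map.
have e2 (r : seq 'I_(size t)) :
    map val [seq @gluep s t (inr j) | j <- r] = map (addn (size s)) (map val r).
  by rewrite -!map_comp; apply: eq_map.
by rewrite e1 e2 !val_enum_ord size_cat iotaD -iotaDl addn0 add0n.
Qed.

Section LinearFacts.
Variables (K : fieldType) (U V W : lmodType K).

Lemma linear_scaleP (f : U -> V) r : linear f -> linear (fun x => r *: f x).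
Proof. by move=> hf q u v; rewrite hf scalerDr !scalerA mulrC. Qed.

Lemma linear_addP (f g : U -> V) : linear f -> linear g -> linear (fun x => f x + g x).
Proof. by move=> hf hg q u v; rewrite hf hg scalerDr addrACA. Qed.

Lemma linear_compP (f : U -> V) (g : V -> W) : linear f -> linear g ->
  linear (fun x => g (f x)).
Proof. by move=> hf hg q u v; rewrite hf hg. Qed.

End LinearFacts.

Section Join.
Variables (K : fieldType) (M : sp2mod K).

Lemma join_linear_l s t (x : word_mod M s) : linear (fun y : word_mod M t => join s y x).
Proof.
move=> r y y'; elim: s x => [|a s IH] x.
  by rewrite /= /scale_by !scalerDr !scalerA mulrC.
have l1 : linear (join (a :: s) (r *: y + y')) by exact: linear_prop.
have l2 : linear (fun x => r *: join (a :: s) y x + join (a :: s) y' x).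
  exact: linear_addP (linear_scaleP _ (linear_prop _)) (linear_prop _).
by move: x; apply: (tens_extP l1 l2) => u w /=; rewrite !tens_mapE /= IH pureDr.
Qed.

Lemma act_join s t A (x : word_mod M s) (y : word_mod M t) :
  act (word_mod M (s ++ t)) A (join s y x) =
  join s y (act (word_mod M s) A x) + join s (act (word_mod M t) A y) x.
Proof.
elim: s x => [|a s IH] x.
  by rewrite /= /scale_by scale0r add0r linearZ.
have l1 : linear (fun x => act (word_mod M ((a :: s) ++ t)) A (join (a :: s) y x)).
  exact: linear_compP (linear_prop _) (linear_prop _).
have l2 : linear (fun x => join (a :: s) y (act (word_mod M (a :: s)) A x) +
    join (a :: s) (act (word_mod M t) A y) x).
  exact: linear_addP (linear_compP (linear_prop _) (linear_prop _)) (linear_prop _).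
move: x; apply: (tens_extP l1 l2) => u w.
rewrite [join (a :: s) y _]/= tens_mapE /=.
rewrite [LHS](@tens_actE K (letter_mod M a) (word_mod M (s ++ t))) IH.
rewrite [X in tens_map _ _ X + _](@tens_actE K (letter_mod M a) (word_mod M s)).
by rewrite linearD /= !tens_mapE /= pureAr addrA.
Qed.

End Join.

Section BoundaryCat.
Variables (s t s' t' : word).
Local Notation embl := (@embl s t s' t').
Local Notation embr := (@embr s t s' t').

Definition left_bottoms := [seq embl (inl i) | i <- enum 'I_(size s)].
Definition left_tops := rev [seq embl (inr j) | j <- enum 'I_(size t)].

(** Reading a juxtaposition around its boundary, the right diagram is a block inside the
    word of the left one. *)
Lemma boundary_cat : boundary (s ++ s') (t ++ t') =
  left_bottoms ++ [seq embr p | p <- boundary s' t'] ++ left_tops.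
Proof.
rewrite /boundary !enum_cat /left_bottoms /left_tops.
move: (enum 'I_(size s)) (enum 'I_(size t)) (enum 'I_(size s')) (enum 'I_(size t')) => a b c d.
by rewrite !map_cat rev_cat !map_rev -!map_comp -!catA.
Qed.

Lemma boundary_left : left_bottoms ++ left_tops = [seq embl p | p <- boundary s t].
Proof.
rewrite /boundary /left_bottoms /left_tops.
move: (enum 'I_(size s)) (enum 'I_(size t)) => a b.
by rewrite !map_cat !map_rev -!map_comp.
Qed.

Lemma end_label_embl ks ks' ls ls' p : size ks = size s -> size ls = size t ->
  end_label (ks ++ ks') (ls ++ ls') (embl p) = end_label ks ls p.
Proof. by move=> sk sl; case: p => i; rewrite /= nth_cat ?sk ?sl ltn_ord. Qed.

Lemma end_label_embr ks ks' ls ls' p : size ks = size s -> size ls = size t ->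
  end_label (ks ++ ks') (ls ++ ls') (embr p) = end_label ks' ls' p.
Proof.
by move=> sk sl; case: p => i; rewrite /= nth_cat ?sk ?sl ltnNge leq_addr addKn.
Qed.

End BoundaryCat.

Lemma glowE (K : fieldType) : glow K = - gup K.
Proof.
have h : gup K *m (- gup K) = 1%:M.
  by apply: mx2_ext; rewrite mxE !big_ord_recl big_ord0 !mxE /=; ring.
by rewrite -[RHS]mul1mx -(mulVmx (gup_unit K)) -mulmxA h mulmx1.
Qed.

Lemma dual_basis0 (K : fieldType) : dual_basisV K 0 = - basisV K 1.
Proof.
rewrite /dual_basisV glowE !big_ord_recl big_ord0 (_ : lift ord0 ord0 = 1); last exact: val_inj.
by rewrite !mxE /= !subr0 oppr0 scale0r add0r addr0 scaleN1r.
Qed.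

Lemma dual_basis1 (K : fieldType) : dual_basisV K 1 = basisV K 0.
Proof.
rewrite /dual_basisV glowE !big_ord_recl big_ord0 (_ : lift ord0 ord0 = 1); last exact: val_inj.
by rewrite !mxE /= sub0r opprK subr0 oppr0 scale0r !addr0 scale1r.
Qed.

Section Values.
Variables (K : fieldType) (lambda : K) (M : sp2mod K).
Variables (c : mod_hom M (verma_model lambda)) (b : mod_hom (verma_model lambda) M).
Hypotheses (cK : cancel c b) (bK : cancel b c).

Local Notation wmod := (word_mod M).
Local Notation bvec := (@bvec K lambda M b).
Local Notation dgmap := (@dgmap K lambda M c b _ _).
Local Notation gform := (@gform K).

Lemma bvec_cat s s' ks ks' : size ks = size s ->
  bvec (s ++ s') (ks ++ ks') = join s (bvec s' ks') (bvec s ks).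
Proof.
elim: s ks => [|a s IH] [|k ks] //=; first by rewrite /scale_by scale1r.
by move=> [sz]; rewrite tens_mapE /= IH.
Qed.

(** By state_block the inner diagram factors out of the state, without a sign. *)
Lemma dgcoef_juxt s t s' t' (A : diagram s t) (B : diagram s' t') ks ks' ls ls' :
  size ks = size s -> size ls = size t ->
  dgcoef K (juxt_diagram A B) (ks ++ ks') (ls ++ ls') = dgcoef K A ks ls * dgcoef K B ks' ls'.
Proof.
move=> sk sl; rewrite /dgcoef boundary_cat.
have dl p : juxt_diagram A B (embl s' t' p) = embl s' t' (A p).
  by rewrite /= ffunE juxt_embl.
have dr p : juxt_diagram A B (embr s t p) = embr s t (B p).
  by rewrite /= ffunE juxt_embr.
have m := matched_diagram (juxt_diagram A B); rewrite boundary_cat in m.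
rewrite state_block ?mulrNN ?mulr1 //; last first.
  by move=> p /mapP[q _ ->]; rewrite dr; apply: map_f; exact: mem_boundary.
rewrite boundary_left mulrC; congr (_ * _).
- rewrite (@state_map _ _ _ (@colour s t) _ _ _ _ _ _ A); first last.
  + exact: matched_diagram.
  + by move=> p _; exact: dl.
  + by move=> p _; exact: colour_embl.
  + exact: embl_inj.
  by congr state; apply: boolp.funext => p; rewrite /= end_label_embl.
- rewrite (@state_map _ _ _ (@colour s' t') _ _ _ _ _ _ B); first last.
  + exact: matched_diagram.
  + by move=> p _; exact: dr.
  + by move=> p _; exact: colour_embr.
  + exact: embr_inj.
  by congr state; apply: boolp.funext => p; rewrite /= end_label_embr.
Qed.

Lemma common_bound (ks ks' : seq nat) : exists B, [/\ (1 < B)%N,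
  all (fun k => k < B)%N ks & all (fun k => k < B)%N ks'].
Proof.
exists (bound (ks ++ ks')); split=> //; have := boundP (ks ++ ks').
  by rewrite all_cat => /andP[].
by rewrite all_cat => /andP[].
Qed.

Lemma dgmap_juxt s t s' t' (A : diagram s t) (B : diagram s' t') x y :
  dgmap (juxt_diagram A B) (join s y x) = join t (dgmap B y) (dgmap A x).
Proof.
have lx y' : linear (fun x => dgmap (juxt_diagram A B) (join s y' x)).
  by move=> r u v; rewrite linearP (dgmap_linear c b _).
have lx2 y' : linear (fun x => join t (dgmap B y') (dgmap A x)).
  by move=> r u v; rewrite (dgmap_linear c b _) linearP.
move: x; apply: (word_ext cK (lx y) (lx2 y)) => ks sk.
have ly : linear (fun y => dgmap (juxt_diagram A B) (join s y (bvec s ks))).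
  by move=> r u v; rewrite join_linear_l (dgmap_linear c b _).
have ly2 : linear (fun y => join t (dgmap B y) (dgmap A (bvec s ks))).
  by move=> r u v; rewrite (dgmap_linear c b _) join_linear_l.
move: y {lx lx2}; apply: (word_ext cK ly ly2) => ks' sk'.
have [m [m1 ak ak']] := common_bound ks ks'.
rewrite -bvec_cat // (dgmap_bvec bK _ m1); last 2 first.
- by rewrite all_cat ak.
- by rewrite !size_cat sk sk'.
rewrite (dgmap_bvec bK A m1) // (dgmap_bvec bK B m1) //.
rewrite size_cat big_label_seqs_cat linear_sum; apply: eq_big_seq => ls /label_seqsP[sl _].
rewrite [in RHS]linearZ /= (linear_sumP (join_linear_l _)) scaler_sumr.
apply: eq_big_seq => ls' /label_seqsP[sl' _].
by rewrite dgcoef_juxt // bvec_cat // scalerA.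
Qed.

(** The coefficient of parallel through strands. *)
Definition strand_weight (s : word) (ks ls : seq nat) : K :=
  \prod_(i < size s) gform (nth Lm s i) (false, nth 0%N ks i) (true, nth 0%N ls i).

Lemma sum_strands B s ks : (1 < B)%N -> size ks = size s -> all (fun k => k < B)%N ks ->
  \sum_(ls <- label_seqs (iota 0 B) (size s)) strand_weight s ks ls *: bvec s ls = bvec s ks.
Proof.
move=> B1; elim: s ks => [|a s IH] [|k ks] //=.
  by rewrite big_seq1 /strand_weight big_ord0 scale1r.
move=> [sz] /andP[kB ak]; rewrite big_label_seqsS.
transitivity (\sum_(l <- iota 0 B) gform a (false, k) (true, l) *: pure (lbasis b a l) (bvec s ks)).
  apply: eq_bigr => l _; rewrite -(IH ks sz ak).
  have pr : linear (fun w : wmod s => pure (lbasis b a l) w) by move=> ? ? ?; rewrite pureDr.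
  rewrite (linear_sumP pr) scaler_sumr; apply: eq_bigr => ls _.
  by rewrite /strand_weight big_ord_recl /= -scalerA.
rewrite (@sum_iota_delta _ B k) // => [|r rk].
  case: a => /=; first by rewrite eqxx scale1r.
  by case: ltnP => h; rewrite /= ?eqxx ?mul1r ?scale1r // pure0l scaler0.
case: a => /=; first by rewrite eq_sym (negbTE rk) scale0r.
by rewrite [k == r]eq_sym (negbTE rk) mulr0; case: ifP; rewrite scale0r.
Qed.

Lemma dgcoef_id s ks ls : dgcoef K (id_diagram s) ks ls = strand_weight s ks ls.
Proof.
have m := matched_diagram (id_diagram s); rewrite /dgcoef.
pose r : seq (point s s) := [seq inl i | i <- enum 'I_(size s)].
have e : boundary s s = r ++ [::] ++ rev (map (id_diagram s) r) ++ [::].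
  rewrite /boundary /r cats0; congr (_ ++ rev _).
  move: (enum 'I_(size s)) => en; rewrite -map_comp; apply: eq_map => i /=.
  by rewrite ffunE.
rewrite e in m *; rewrite state_nest ?mulrNN ?mulr1 //.
rewrite /r /strand_weight big_map big_enum /=; apply: eq_bigr => i _.
by rewrite sign_past_nil mul1r ffunE.
Qed.

Lemma dgmap_id s x : dgmap (id_diagram s) x = x.
Proof.
have l2 : linear (fun x : wmod s => x) by [].
move: x; apply: (word_ext cK (dgmap_linear c b _) l2) => ks sk.
rewrite (dgmap_bvec bK _ _ (boundP ks)) //.
by under eq_bigr do rewrite dgcoef_id; rewrite sum_strands // boundP.
Qed.

Definition word_sign (s t : word) : K :=
  \prod_(a <- s) \prod_(e <- t) gsign (-1) a e.

(** In a block crossing, the chords of the first block are nested around those of the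
    second: each crossing of two strands gives its sign once. *)
Lemma dgcoef_crossing s t ks ks' ls ls' : size ks = size s -> size ks' = size t ->
  size ls = size s -> size ls' = size t ->
  dgcoef K (crossing_diagram s t) (ks ++ ks') (ls' ++ ls) =
  word_sign s t * (strand_weight s ks ls * strand_weight t ks' ls').
Proof.
move=> sk sk' sl sl'; have m := matched_diagram (crossing_diagram s t); rewrite /dgcoef.
pose r : seq (point (s ++ t) (t ++ s)) :=
  [seq inl (@gluep s t (inl i)) | i <- enum 'I_(size s)].
pose r' : seq (point (s ++ t) (t ++ s)) :=
  [seq inl (@gluep s t (inr j)) | j <- enum 'I_(size t)].
have dr (i : 'I_(size s)) : crossing_diagram s t (inl (@gluep s t (inl i))) = inr (@gluep t s (inr i)).
  by rewrite /= ffunE /= gluepK.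
have dr' (j : 'I_(size t)) : crossing_diagram s t (inl (@gluep s t (inr j))) = inr (@gluep t s (inl j)).
  by rewrite /= ffunE /= gluepK.
have e : boundary (s ++ t) (t ++ s) =
    r ++ r' ++ rev (map (crossing_diagram s t) r) ++ rev (map (crossing_diagram s t) r').
  rewrite /boundary !enum_cat /r /r'.
  move: (enum 'I_(size s)) (enum 'I_(size t)) => en en'.
  rewrite !map_cat rev_cat -!map_comp -!catA; congr (_ ++ (_ ++ (rev _ ++ rev _))).
    by apply: eq_map => i /=; rewrite dr.
  by apply: eq_map => i /=; rewrite dr'.
rewrite e in m *; rewrite state_nest ?mulrNN ?mulr1 //.
have m' : matched (@colour (s ++ t) (t ++ s)) (crossing_diagram s t)
    (r' ++ [::] ++ rev (map (crossing_diagram s t) r') ++ [::]).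
  rewrite cats0 /=; split.
    move: m.1; rewrite cat_uniq => /and3P[_ _]; rewrite !cat_uniq.
    case/and3P => -> h /andP[_ /andP[_ ->]]; rewrite andbT /=.
    by apply: contra h => /hasP[z zi zj]; apply/hasP; exists z; rewrite // mem_cat zi orbT.
  move=> p; rewrite mem_cat mem_rev => pr.
  have [h1 h2 h3 _] := mate_spec (crossing_diagram s t) p; split=> //.
  rewrite mem_cat mem_rev; case/orP: pr => [h|/mapP[q qr ->]].
    by rewrite map_f ?orbT.
  by have [_ -> _ _] := mate_spec (crossing_diagram s t) q; rewrite qr.
have cl (i : 'I_(size s)) : colour (inl (@gluep s t (inl i)) : point (s ++ t) (t ++ s)) = nth Lm s i.
  exact: nth_gluep.
have cr (j : 'I_(size t)) : colour (inl (@gluep s t (inr j)) : point (s ++ t) (t ++ s)) = nth Lm t j.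
  exact: nth_gluep.
have := @state_nest _ _ K _ (-1) gform _ _ _ [::] [::] (end_label (ks ++ ks') (ls' ++ ls)) m'.
rewrite mulrNN mulr1 => /(_ erefl); rewrite !cats0 !cat0s => ->.
rewrite state_nil mulr1 mulrA; congr (_ * _).
- rewrite big_split; congr (_ * _).
    rewrite /r big_map big_enum /word_sign (big_nth Lm) big_mkord.
    apply: eq_bigr => i _; rewrite /sign_past /r' big_map big_enum (big_nth Lm) big_mkord.
    by apply: eq_bigr => j _; rewrite cl cr.
  rewrite /r big_map big_enum; apply: eq_bigr => i _; rewrite cl dr /=.
  by rewrite !nth_cat sk sl' ltn_ord ltnNge leq_addr addKn.
- rewrite /r' big_map big_enum; apply: eq_bigr => i _; rewrite sign_past_nil mul1r cr dr' /=.
  by rewrite !nth_cat sk sl' ltn_ord ltnNge leq_addr addKn.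
Qed.

Lemma dgmap_crossing s t x y :
  dgmap (crossing_diagram s t) (join s y x) = word_sign s t *: join t x y.
Proof.
have lx y' : linear (fun x => dgmap (crossing_diagram s t) (join s y' x)).
  by move=> r u v; rewrite linearP (dgmap_linear c b _).
have lx2 y' : linear (fun x : wmod s => word_sign s t *: join t x y').
  by move=> r u v; rewrite join_linear_l scalerDr !scalerA mulrC.
move: x; apply: (word_ext cK (lx y) (lx2 y)) => ks sk.
have ly : linear (fun y => dgmap (crossing_diagram s t) (join s y (bvec s ks))).
  by move=> r u v; rewrite join_linear_l (dgmap_linear c b _).
have ly2 : linear (fun y => word_sign s t *: join t (bvec s ks) y).
  by move=> r u v; rewrite linearP scalerDr !scalerA mulrC.
move: y {lx lx2}; apply: (word_ext cK ly ly2) => ks' sk'.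
have [m [m1 ak ak']] := common_bound ks ks'.
rewrite -bvec_cat // (dgmap_bvec bK _ m1); last 2 first.
- by rewrite all_cat ak.
- by rewrite !size_cat sk sk'.
rewrite -(sum_strands m1 sk ak) -(sum_strands m1 sk' ak').
rewrite size_cat big_label_seqs_cat linear_sum scaler_sumr.
apply: eq_big_seq => ls' /label_seqsP[sl' _].
rewrite [in RHS]linearZ /= (linear_sumP (join_linear_l _)) !scaler_sumr.
apply: eq_big_seq => ls /label_seqsP[sl _].
rewrite dgcoef_crossing // bvec_cat // !scalerA; congr (_ *: _); ring.
Qed.

Lemma enum_ord0 : enum 'I_0 = [::].
Proof. by apply: size0nil; rewrite size_enum_ord. Qed.

Lemma dgcoef_cup l0 l1 : dgcoef K cup_diagram [::] [:: l0; l1] = gform Lv (true, l1) (true, l0).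
Proof.
rewrite /dgcoef.
pose p : point [::] [:: Lv; Lv] := inr (lift ord0 ord0).
have dp : cup_diagram p = inr ord0 by rewrite /= ffunE; congr inr; exact: val_inj.
have -> : boundary [::] [:: Lv; Lv] = p :: [::] ++ cup_diagram p :: [::].
  by rewrite /boundary !enum_ordSl enum_ord0 /= dp.
by rewrite state_split // dp sign_past_nil mul1r /= state_nil mulr1.
Qed.

Lemma dgcoef_cap k0 k1 : dgcoef K cap_diagram [:: k0; k1] [::] = gform Lv (false, k0) (false, k1).
Proof.
rewrite /dgcoef.
pose p : point [:: Lv; Lv] [::] := inl ord0.
have dp : cap_diagram p = inl (lift ord0 ord0) by rewrite /= ffunE; congr inl; exact: val_inj.
have -> : boundary [:: Lv; Lv] [::] = p :: [::] ++ cap_diagram p :: [::].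
  by rewrite /boundary !enum_ordSl enum_ord0 /= dp.
by rewrite state_split // dp sign_past_nil mul1r /= state_nil mulr1.
Qed.

Lemma lbasisV (i : 'I_2) : lbasis b Lv i = basisV K i.
Proof. by rewrite /= ltn_ord inord_val. Qed.

Lemma dgmap_cup : dgmap cup_diagram (1 : K^o) =
  \sum_a @pure2 K M Lv Lv (basisV K a) (dual_basisV K a).
Proof.
have e0 : (1 : K^o) = bvec [::] [::] by [].
rewrite e0 (dgmap_bvec bK cup_diagram (B := 2)) //.
have -> : label_seqs (iota 0 2) (size [:: Lv; Lv]) =
  [:: [:: 0; 0]; [:: 0; 1]; [:: 1; 0]; [:: 1; 1]]%N by [].
rewrite !big_cons !big_nil !dgcoef_cup /= !scale0r !add0r !addr0 scale1r scaleN1r.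
rewrite !big_ord_recl big_ord0 addr0 (_ : lift ord0 ord0 = 1) ?dual_basis0 ?dual_basis1; last exact: val_inj.
have i0 : inord 0 = 0 :> 'I_2 by apply: val_inj; rewrite /= inordK.
have i1 : inord 1 = 1 :> 'I_2 by apply: val_inj; rewrite /= inordK.
by rewrite i0 i1 /pure2 /= -!scaleN1r pureZl pureZr.
Qed.

Lemma dgmap_cap (v w : 'cV[K]_2) :
  dgmap cap_diagram (@pure2 K M Lv Lv v w) = omega v w :> K.
Proof.
have lv w' : linear (fun v : 'cV[K]_2 => dgmap cap_diagram (@pure2 K M Lv Lv v w')).
  move=> r u u'; rewrite -[X in _ = X](dgmap_linear c b); congr (dgmap _ _).
  exact: pureDl.
have lv2 w' : linear (fun v : 'cV[K]_2 => omega v w' : K^o).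
  by move=> r u u'; rewrite /omega linearP /= !mulmxDl -!scalemxAl !mxE.
move: v; apply: (letter_ext (a := Lv) cK (lv w) (lv2 w)) => k.
have lw : linear (fun w : 'cV[K]_2 => dgmap cap_diagram (@pure2 K M Lv Lv (lbasis b Lv k) w)).
  move=> r u u'; rewrite -[X in _ = X](dgmap_linear c b); congr (dgmap _ _).
  by rewrite /pure2 pureDl pureDr.
have lw2 : linear (fun w : 'cV[K]_2 => omega (lbasis b Lv k) w : K^o).
  by move=> r u u'; rewrite /omega mulmxDr -scalemxAr !mxE.
move: w {lv lv2}; apply: (letter_ext (a := Lv) cK lw lw2) => l.
have e : @pure2 K M Lv Lv (lbasis b Lv k) (lbasis b Lv l) = bvec [:: Lv; Lv] [:: k; l] by [].
rewrite e (dgmap_bvec bK cap_diagram _ (boundP _)) //.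
rewrite big_seq1 dgcoef_cap.
have [k2|k2] := ltnP k 2; last first.
  rewrite /= ltnNge k2 /= scale0r; symmetry.
  by rewrite /omega trmx0 !mul0mx mxE.
have [l2|l2] := ltnP l 2; last first.
  rewrite /= k2 ltnNge l2 /= scale0r; symmetry.
  by rewrite /omega mulmx0 mxE.
rewrite -[k]/(val (Ordinal k2)) -[l]/(val (Ordinal l2)) !lbasisV omega_basis.
rewrite -[RHS]mulr1; congr (_ * _).
by case: (ord2P (Ordinal k2)) => ->; case: (ord2P (Ordinal l2)) => ->; rewrite /= !mxE /=; ring.
Qed.

End Values.

(** * Maps out of a concatenated word module *)

Section JoinLift.
Variables (K : fieldType) (M : sp2mod K).
Local Notation wmod := (word_mod M).

(** The map out of F(s ++ t) given by a bilinear map on F(s) and F(t); the unit in the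
    first branch is the generator of F of the empty word. *)
Fixpoint join_lift (Z : lmodType K) (s t : word) : (wmod s -> wmod t -> Z) -> wmod (s ++ t) -> Z :=
  match s return (wmod s -> wmod t -> Z) -> wmod (s ++ t) -> Z with
  | [::] => fun beta y => beta (1 : K^o) y
  | a :: s' => fun beta => @tens_lift K (letter_mod M a) (wmod (s' ++ t)) Z
      (fun u z => @join_lift Z s' t (fun x y => beta (pure u x) y) z)
  end.

Lemma cons_bilinear (Z : lmodType K) a s t (f : wmod (a :: s) -> wmod t -> Z) u :
  bilinear_map f ->
  bilinear_map (fun (x : wmod s) y => f (pure u x : tens (letter_mod M a) (wmod s)) y).
Proof. by move=> [h1 h2]; split=> [x|y r x x']; [exact: h1|rewrite pureDr h2]. Qed.

(** The two linearities have to be proved together, because the induction step uses the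
    second one for a family of bilinear maps with a vector of the first letter fixed. *)
Lemma join_lift_spec (Z : lmodType K) s t :
  (forall f : wmod s -> wmod t -> Z, bilinear_map f -> linear (join_lift f)) /\
  (forall (r : K) (f g : wmod s -> wmod t -> Z), bilinear_map f -> bilinear_map g ->
     forall z, join_lift (fun x y => r *: f x y + g x y) z = r *: join_lift f z + join_lift g z).
Proof.
elim: s => [|a s [IH1 IH2]]; first by split=> [f [h _]|r f g _ _ z] //=; exact: h.
have bil := @cons_bilinear Z a s t.
have bil2 (f : wmod (a :: s) -> wmod t -> Z) : bilinear_map f ->
   bilinear_map (fun (u : letter_mod M a) z =>
     @join_lift Z s t (fun x y => f (pure u x : tens (letter_mod M a) (wmod s)) y) z).
  move=> hf; split=> [u|z r u u']; first exact/IH1/bil.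
  rewrite -(IH2 r _ _ (bil f u hf) (bil f u' hf)); congr (join_lift _ z).
  by apply: boolp.funext => x; apply: boolp.funext => y; rewrite pureDl hf.2.
split=> [f hf|r f g hf hg]; first exact/tens_lift_linear/bil2.
have hfg : bilinear_map (fun x y => r *: f x y + g x y).
  split=> [x q y y'|y q x x'].
    by rewrite hf.1 hg.1 !scalerDr !scalerA (mulrC r) addrACA.
  by rewrite hf.2 hg.2 !scalerDr !scalerA (mulrC r) addrACA.
have l1 := tens_lift_linear (bil2 _ hfg); have l2 := tens_lift_linear (bil2 _ hf).
have l3 := tens_lift_linear (bil2 _ hg).
apply: (tens_extP l1 (linear_addP (linear_scaleP r l2) l3)) => u z.
rewrite (tens_lift_pure u z (bil2 _ hfg)) (tens_lift_pure u z (bil2 _ hf)).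
by rewrite (tens_lift_pure u z (bil2 _ hg)); apply: IH2; exact: bil.
Qed.

Lemma join_lift_linear (Z : lmodType K) s t (f : wmod s -> wmod t -> Z) :
  bilinear_map f -> linear (join_lift f).
Proof. by have [h _] := join_lift_spec Z s t; exact: h. Qed.

Lemma join_lift_cons_bilinear (Z : lmodType K) a s t (f : wmod (a :: s) -> wmod t -> Z) :
  bilinear_map f ->
  bilinear_map (fun (u : letter_mod M a) z =>
     @join_lift Z s t (fun x y => f (pure u x : tens (letter_mod M a) (wmod s)) y) z).
Proof.
move=> hf; split=> [u|z r u u']; first exact/join_lift_linear/cons_bilinear.
have [_ h] := join_lift_spec Z s t.
rewrite -(h r _ _ (cons_bilinear u hf) (cons_bilinear u' hf)); congr (join_lift _ z).
by apply: boolp.funext => x; apply: boolp.funext => y; rewrite pureDl hf.2.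
Qed.

Lemma join_ext (Z : lmodType K) s t (f g : wmod (s ++ t) -> Z) : linear f -> linear g ->
  (forall x y, f (join s y x) = g (join s y x)) -> f =1 g.
Proof.
elim: s f g => [|a s IH] f g hf hg h.
  by move=> z; have := h (1 : K^o) z; rewrite /= /scale_by scale1r.
apply: (tens_extP hf hg) => u z.
have l (k : wmod ((a :: s) ++ t) -> Z) : linear k ->
    linear (fun z : wmod (s ++ t) => k (pure u z : tens (letter_mod M a) (wmod (s ++ t)))).
  by move=> hk r x y; rewrite pureDr hk.
apply: (IH _ _ (l f hf) (l g hg)) => x y.
by have := h (pure u x : tens (letter_mod M a) (wmod s)) y; rewrite /= tens_mapE.
Qed.

Lemma join_lift_join (Z : lmodType K) s t (f : wmod s -> wmod t -> Z) x y :
  bilinear_map f -> join_lift f (join s y x) = f x y.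
Proof.
elim: s f x => [|a s IH] f x hf.
  rewrite /= /scale_by (_ : x = (x : K) *: (1 : K^o)); last by rewrite -[RHS]/(_ * _) mulr1.
  rewrite -[RHS]/(mk_linear (hf.2 y) _) linearZ -[LHS]/(mk_linear (hf.1 1) _) linearZ /=.
  by rewrite -[_ *: 1]/(_ * _) mulr1.
have l2 : linear (f^~ y) by exact: hf.2.
have l1 := linear_compP (linear_prop (join (a :: s) y)) (join_lift_linear hf).
move: x; apply: (tens_extP l1 l2) => u z.
rewrite /= tens_mapE /= tens_lift_pure; last exact: join_lift_cons_bilinear.
by rewrite IH //; exact: cons_bilinear.
Qed.

End JoinLift.

(** * The tempered Casimir operator *)

Section PolyCombRules.
Variables (K : fieldType) (V : lmodType K) (f : nat -> V).

Lemma poly_comb_eq x y p q : x = poly_comb f p -> y = poly_comb f q -> p = q -> x = y.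
Proof. by move=> -> -> ->. Qed.
Lemma poly_combD x y p q : x = poly_comb f p -> y = poly_comb f q ->
  x + y = poly_comb f (p + q).
Proof. by move=> -> ->; rewrite linearD. Qed.
Lemma poly_combN x p : x = poly_comb f p -> - x = poly_comb f (- p).
Proof. by move=> ->; rewrite linearN. Qed.
Lemma poly_combZ a x p : x = poly_comb f p -> a *: x = poly_comb f (a%:P * p).
Proof. by move=> ->; rewrite mul_polyC linearZ. Qed.

End PolyCombRules.

Ltac modring_atoms f l k :=
  lazymatch l with
  | ?a :: ?l' =>
      let e := fresh "e" in
      (have e : a = poly_comb f 'X^k by symmetry; exact: (poly_combXn f k));
      modring_atoms f l' (S k)
  | _ => idtac
  end.

Ltac modring_quote f :=
  first [ lazymatch goal with e : ?a = poly_comb f _ |- ?a = _ => exact e end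
        | eapply (@poly_combD _ _ f); [modring_quote f | modring_quote f]
        | eapply (@poly_combN _ _ f); modring_quote f
        | eapply (@poly_combZ _ _ f); modring_quote f ].

(** Proves linear identities in a module: both sides are written as the images of
    polynomials under the map sending the k-th power of the variable to the k-th vector
    of the list, and the polynomials are compared by ring. *)
Ltac modring l :=
  let f := fresh "f" in
  pose f := nth 0 l; modring_atoms f l 0%N;
  eapply (@poly_comb_eq _ _ f); [modring_quote f | modring_quote f | clear; ring].

(** Replaces every elementary tensor of the goal by a variable and lets modring conclude. *)
Ltac gather_pure l :=
  lazymatch goal with
  | |- context [@pure ?k ?U ?W ?a ?b] =>
      let v := fresh "v" in generalize (@pure k U W a b); intro v; gather_pure (v :: l)
  | _ => modring l
  end.

Section Casimir.
Variable K : fieldType.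
Hypothesis char2 : 2 != 0 :> K.

Definition casimir (A N : sp2mod K) (z : tens A N) : tens A N :=
  - 2^-1 *: \sum_c \sum_d tens_map (act A (spX K c d)) (act N (spX K d c)) z.

Lemma linear_sumfP (U V : lmodType K) n (F : 'I_n -> U -> V) :
  (forall i, linear (F i)) -> linear (fun x => \sum_i F i x).
Proof.
move=> h r x y; rewrite scaler_sumr -big_split; apply: eq_bigr => i _; exact: h.
Qed.

Lemma casimir_linear (A N : sp2mod K) : linear (@casimir A N).
Proof.
apply: linear_scaleP; apply: linear_sumfP => i; apply: linear_sumfP => j.
exact: linear_prop.
Qed.

Lemma spX00 : spX K 0 0 = 1 *: sp2h K + 0.
Proof. by apply: mx2_ext; rewrite /spX glowE !mxE !big_ord_recl !big_ord0 !mxE /=; ring. Qed.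
Lemma spX11 : spX K 1 1 = -1 *: sp2h K + 0.
Proof. by apply: mx2_ext; rewrite /spX glowE !mxE !big_ord_recl !big_ord0 !mxE /=; ring. Qed.
Lemma spX01 : spX K 0 1 = 2 *: sp2x K + 0.
Proof. by apply: mx2_ext; rewrite /spX glowE !mxE !big_ord_recl !big_ord0 !mxE /=; ring. Qed.
Lemma spX10 : spX K 1 0 = 2 *: sp2y K + 0.
Proof. by apply: mx2_ext; rewrite /spX glowE !mxE !big_ord_recl !big_ord0 !mxE /=; ring. Qed.

Lemma casimir_pure (A N : sp2mod K) (u : A) (w : N) :
  casimir (pure u w) = - pure (act A (sp2h K) u) (act N (sp2h K) w)
    - 2 *: pure (act A (sp2x K) u) (act N (sp2y K) w)
    - 2 *: pure (act A (sp2y K) u) (act N (sp2x K) w).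
Proof.
have o1 : lift ord0 ord0 = 1 :> 'I_2 by exact: val_inj.
rewrite /casimir !big_ord_recl !big_ord0 !tens_mapE o1 -![ord0]/(0 : 'I_2).
rewrite !spX00 !spX01 !spX10 !spX11.
do ![rewrite act_lin ?sp2h_mem ?sp2x_mem ?sp2y_mem ?sp2_mem0 //].
rewrite !act0 !addr0 !pureZl !pureZr !scalerDr !scalerA.
set p := pure _ _; set q := pure _ _; set r := pure _ _.
have e1 : - (2 : K)^-1 * (1 * 1) + (- 2^-1 * (-1 * -1)) = -1 by field.
have e2 : - (2 : K)^-1 * (2 * 2) = - 2 by field.
have -> : - p = (- 2^-1 * (1 * 1)) *: p + (- 2^-1 * (-1 * -1)) *: p.
  by rewrite -scalerDl e1 scaleN1r.
rewrite e2; move: (_ * (1 * 1)) (_ * (-1 * -1)) => A1 B1.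
modring [:: p; q; r].
Qed.

Lemma linear3P (U V : lmodType K) (f : U -> V) : linear f -> forall a b d u v w,
  f (a *: u + (b *: v + d *: w)) = a *: f u + (b *: f v + d *: f w).
Proof. by move=> hf a b d u v w; rewrite -![f _]/(mk_linear hf _) !linearD !linearZ. Qed.

Lemma linearDP (U V : lmodType K) (f : U -> V) : linear f -> forall u v, f (u + v) = f u + f v.
Proof. by move=> hf u v; rewrite -![f _]/(mk_linear hf _) linearD. Qed.

Lemma linearZP (U V : lmodType K) (f : U -> V) : linear f -> forall a u, f (a *: u) = a *: f u.
Proof. by move=> hf a u; rewrite -![f _]/(mk_linear hf _) linearZ. Qed.

Lemma casimir_act (A N : sp2mod K) S (z : tens A N) : S \in sp2 (K:=K) ->
  casimir (act (tens_mod A N) S z) = act (tens_mod A N) S (casimir z).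
Proof.
move=> hS; rewrite !(act_sp2E _ hS) (linear3P (@casimir_linear A N)).
suff h T : T \in [:: sp2h K; sp2x K; sp2y K] ->
    casimir (act (tens_mod A N) T z) = act (tens_mod A N) T (casimir z).
  by congr (_ *: _ + (_ *: _ + _ *: _)); apply: h; rewrite !inE eqxx ?orbT.
have l1 : linear (fun z => casimir (act (tens_mod A N) T z)).
  exact: linear_compP (linear_prop _) (@casimir_linear A N).
have l2 : linear (fun z => act (tens_mod A N) T (casimir z)).
  exact: linear_compP (@casimir_linear A N) (linear_prop _).
move=> hT; move: z; apply: (tens_extP l1 l2) => u w.
have e u' w' : act (tens_mod A N) T (pure u' w') = pure (act A T u') w' + pure u' (act N T w').
  exact: tens_actE.
rewrite e (linearDP (@casimir_linear A N)) !casimir_pure.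
have e3 (p q r : tens A N) : act (tens_mod A N) T (- p - 2 *: q - 2 *: r) =
    - 1 *: act (tens_mod A N) T p + (- 2 *: act (tens_mod A N) T q +
    - 2 *: act (tens_mod A N) T r).
  rewrite -scaleN1r -!scaleNr -addrA.
  exact: (linear3P (linear_prop (act (tens_mod A N) T))).
rewrite e3 !e; clear e3 e l1 l2.
move: hT; rewrite !inE => /or3P[] /eqP -> {T}.
all: rewrite ?(act_hx, act_hy, act_xy) -?scaleNr !(pureAl, pureAr, pureZl, pureZr).
all: gather_pure (Nil (tens A N)).
Qed.

End Casimir.

(** * Evaluation of terms *)

Section WordCast.
Variables (K : fieldType) (M : sp2mod K).
Local Notation wmod := (word_mod M).

(** The transport along an equality of words; it only occurs in the associativity and
    unit relations, where join makes it invisible. *)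
Definition wcast s s' (e : s = s') (x : wmod s) : wmod s' := ecast w (wmod w) e x.

Lemma join_cons a s t (u : letter_mod M a) (x : wmod s) (y : wmod t) :
  join (a :: s) y (pure u x : tens (letter_mod M a) (wmod s)) = pure u (join s y x).
Proof. exact: tens_mapE. Qed.

Lemma wcast_linear s s' (e : s = s') : linear (wcast e).
Proof. by case: s' / e. Qed.

Lemma wcast_id s (e : s = s) x : wcast e x = x.
Proof. by rewrite (eq_irrelevance e erefl). Qed.

Lemma wcast_pure a s s' (e : s = s') (e' : a :: s = a :: s') (u : letter_mod M a) (x : wmod s) :
  wcast e' (pure u x : tens (letter_mod M a) (wmod s)) = pure u (wcast e x).
Proof. by case: s' / e in e' *; rewrite wcast_id. Qed.

Lemma wcast_join s1 s2 s3 (e : s1 ++ (s2 ++ s3) = (s1 ++ s2) ++ s3) x y z :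
  wcast e (join s1 (join s2 z y) x) = join (M := M) (s1 ++ s2) z (join s1 y x).
Proof.
elim: s1 e x => [|a s1 IH] e x; first by rewrite wcast_id /= /scale_by linearZ.
have l1 : linear (fun x => wcast e (join (a :: s1) (join s2 z y) x)).
  exact: linear_compP (linear_prop _) (@wcast_linear _ _ e).
have l2 : linear (fun x => join (M := M) ((a :: s1) ++ s2) z (join (a :: s1) y x)).
  exact: linear_compP (linear_prop _) (linear_prop _).
move: x; apply: (tens_extP l1 l2) => u x.
rewrite !join_cons -IH; exact: wcast_pure.
Qed.

Lemma wcast_join_nil s (e : s ++ [::] = s) (x : wmod s) : wcast e (join (t := [::]) s (1 : K^o) x) = x.
Proof.
elim: s e x => [|a s IH] e x.
  by rewrite wcast_id /= /scale_by -[LHS]/(_ * _) mulr1.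
have l1 : linear (fun x => wcast e (join (t := [::]) (a :: s) (1 : K^o) x)).
  exact: linear_compP (linear_prop _) (@wcast_linear _ _ e).
move: x; apply: (tens_extP l1 (fun _ _ _ => erefl)) => u x.
by rewrite join_cons (wcast_pure (cats0 s)) IH.
Qed.

End WordCast.

Section Eval.
Variables (K : fieldType) (lambda : K) (M : sp2mod K).
Variables (c : mod_hom M (verma_model lambda)) (b : mod_hom (verma_model lambda) M).
Hypotheses (cK : cancel c b) (bK : cancel b c) (char2 : 2 != 0 :> K).

Local Notation lmod := (letter_mod M).
Local Notation wmod := (word_mod M).
Local Notation dgmap := (@dgmap K lambda M c b _ _).

Definition H_map a e : wmod [:: a; e] -> wmod [:: a; e] := @casimir K (lmod a) (wmod [:: e]).

(** Diagrams act by their state sums and the chord H by the tempered Casimir operator;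
    everything else is forced by functoriality. *)
Fixpoint teval s t (f : term K s t) : wmod s -> wmod t :=
  match f in term _ s t return wmod s -> wmod t with
  | tdg s t d => dgmap d
  | tH a e => @H_map a e
  | tcomp s t u g f => fun x => teval g (teval f x)
  | ttens s t s' t' f g =>
      @join_lift K M _ s s' (fun x y => join t (teval g y) (teval f x))
  | tzero s t => fun=> 0
  | tadd s t f g => fun x => teval f x + teval g x
  | tscale s t a f => fun x => a *: teval f x
  end.

Lemma join_bilinear s t s' t' (f : wmod s -> wmod t) (g : wmod s' -> wmod t') :
  linear f -> linear g -> bilinear_map (fun x y => join t (g y) (f x)).
Proof.
move=> lf lg; split=> [x|y].
- exact: linear_compP lg (@join_linear_l _ _ _ _ _).
- exact: linear_compP lf (linear_prop _).
Qed.

Lemma teval_linear s t (f : term K s t) : linear (teval f).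
Proof.
elim: f => //= {s t}.
- by move=> *; exact: dgmap_linear.
- by move=> a e; exact: (@casimir_linear K (lmod a) (wmod [:: e])).
- by move=> s t u g IHg f IHf; exact: linear_compP.
- by move=> s t s' t' f IHf g IHg; exact/join_lift_linear/join_bilinear.
- by move=> s t r x y; rewrite scaler0 addr0.
- by move=> s t f IHf g IHg; exact: linear_addP.
- by move=> s t r f IHf; exact: linear_scaleP.
Qed.

Lemma teval_tens s t s' t' (f : term K s t) (g : term K s' t') x y :
  teval (ttens f g) (join s y x) = join t (teval g y) (teval f x).
Proof. by rewrite /= join_lift_join //; apply: join_bilinear; exact: teval_linear. Qed.

Lemma teval_act s t (f : term K s t) A x : A \in sp2 (K:=K) ->
  teval f (act (wmod s) A x) = act (wmod t) A (teval f x).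
Proof.
move=> hA; elim: f x => {s t}.
- by move=> s t d x; exact: dgmap_act.
- by move=> a e x; exact: casimir_act.
- by move=> s t u g IHg f IHf x /=; rewrite IHf IHg.
- move=> s t s' t' f IHf g IHg x.
  have l1 := linear_compP (linear_prop (act (wmod (s ++ s')) A)) (teval_linear (ttens f g)).
  have l2 := linear_compP (teval_linear (ttens f g)) (linear_prop (act (wmod (t ++ t')) A)).
  move: x; apply: (join_ext l1 l2) => x y.
  rewrite act_join (linearDP (teval_linear _)) !teval_tens IHf IHg act_join.
  by [].
- by move=> s t x /=; rewrite linear0.
- by move=> s t f IHf g IHg x /=; rewrite linearD IHf IHg.
- by move=> s t r f IHf x /=; rewrite linearZ IHf.
Qed.

Definition eval_hom s t (f : term K s t) : mod_hom (wmod s) (wmod t) :=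
  @ModHom _ (wmod s) (wmod t) (teval f) (@teval_linear _ _ f) (fun A x => @teval_act _ _ f A x).

Lemma teval_cast s s' t t' (es : s = s') (et : t = t') (f : term K s t) x :
  teval (tcast es et f) (wcast es x) = wcast et (teval f x).
Proof. by case: s' / es; case: t' / et. Qed.

Lemma teval_id s x : teval (tid K s) x = x.
Proof. exact: (dgmap_id cK bK). Qed.

Lemma join1 a (u : lmod a) t (z : wmod t) :
  join [:: a] z (pure u (1 : K^o) : tens (lmod a) K^o) = pure u z.
Proof. by rewrite (@join_cons _ _ a [::] t) /= /scale_by scale1r. Qed.

Lemma join2 a e (u : lmod a) (v : lmod e) t (z : wmod t) :
  join [:: a; e] z (pure2 u v) = pure u (pure v z).
Proof. by rewrite /pure2 (@join_cons _ _ a [:: e] t) (@join_cons _ _ e [::] t) /= /scale_by scale1r. Qed.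

Lemma teval_strand_l a t t' (g : term K t t') (u : lmod a) z :
  teval (ttens (tid K [:: a]) g) (pure u z : tens (lmod a) (wmod t)) = pure u (teval g z).
Proof. by rewrite -join1 (@teval_tens [:: a] [:: a]) teval_id join1. Qed.

Lemma act_word1 a A (u : lmod a) : act (wmod [:: a]) A (pure u (1 : K^o) : tens _ _) = pure (act _ A u) (1 : K^o).
Proof. by rewrite [LHS](@tens_actE K (lmod a) (triv_mod K)) /= pure0r addr0. Qed.

(** The tempered Casimir in the standard basis of sp_2. *)
Lemma H_mapE a e (u : lmod a) (w : lmod e) :
  H_map (pure2 u w) = - 1 *: pure2 (act _ (sp2h K) u) (act _ (sp2h K) w) +
    (- 2 *: pure2 (act _ (sp2x K) u) (act _ (sp2y K) w) +
     - 2 *: pure2 (act _ (sp2y K) u) (act _ (sp2x K) w)).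
Proof.
rewrite /H_map /pure2 (@casimir_pure _ char2 (lmod a) (wmod [:: e])) !act_word1.
by rewrite scaleN1r !scaleNr addrA.
Qed.

Lemma pure2_ext (Z : lmodType K) a e (f g : wmod [:: a; e] -> Z) : linear f -> linear g ->
  (forall u w, f (pure2 u w) = g (pure2 u w)) -> f =1 g.
Proof.
move=> lf lg h; apply: (tens_extP lf lg) => u.
have l (k : wmod [:: a; e] -> Z) : linear k ->
    linear (fun z : wmod [:: e] => k (pure u z : tens (lmod a) (wmod [:: e]))).
  by move=> hk r x y; rewrite pureDr hk.
apply: (tens_extP (l f lf) (l g lg)) => w r.
have -> : r = (r : K) *: (1 : K^o) by rewrite -[RHS]/(_ * _) mulr1.
by rewrite !pureZr (linearZP lf) (linearZP lg) h.
Qed.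

Lemma teval_X2 a e (u : lmod a) (w : lmod e) :
  teval (tX K a e) (pure2 u w) = gsign (-1) a e *: pure2 w u.
Proof.
have j a' e' (u' : lmod a') (w' : lmod e') : pure2 u' w' =
   join (M := M) [:: a'] (pure w' (1 : K^o) : wmod [:: e']) (pure u' (1 : K^o) : wmod [:: a']).
  by rewrite (@join1 a' u' [:: e']).
rewrite !j [LHS](@dgmap_crossing _ _ _ _ _ cK bK [:: a] [:: e]).
by rewrite /word_sign !big_seq1.
Qed.

End Eval.

(** * Slides, symmetry and the four-term relations *)

Section Relations.
Variables (K : fieldType) (lambda : K) (M : sp2mod K).
Variables (c : mod_hom M (verma_model lambda)) (b : mod_hom (verma_model lambda) M).
Hypotheses (cK : cancel c b) (bK : cancel b c) (char2 : 2 != 0 :> K).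

Local Notation lmod := (letter_mod M).
Local Notation wmod := (word_mod M).
Local Notation teval := (@teval K lambda M c b _ _).
Local Notation tlin := (@teval_linear K lambda M c b).
Local Notation ttE := (@teval_tens K lambda M c b).
Local Notation dgE := (@dgmap_crossing K lambda M c b cK bK).

Lemma tcE s t u (g : term K t u) (f : term K s t) x : teval (tcomp g f) x = teval g (teval f x).
Proof. by []. Qed.

Lemma teval_H a e (u : lmod a) (w : lmod e) : teval (tH a e) (pure2 u w) =
    - 1 *: pure2 (act _ (sp2h K) u) (act _ (sp2h K) w) +
    (- 2 *: pure2 (act _ (sp2x K) u) (act _ (sp2y K) w) +
     - 2 *: pure2 (act _ (sp2y K) u) (act _ (sp2x K) w)).
Proof. exact: H_mapE. Qed.

Lemma teval_XX s t x y :
  teval (tXX K s t) (join s y x) = word_sign K s t *: join t x y.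
Proof. exact: dgE. Qed.

(** The Casimir acts on two adjacent factors, so it commutes with moving them past w. *)
Lemma eval_slide_r w a e : teval (tcomp (tXX K w [:: a; e]) (ttens (tid K w) (tH a e))) =1
  teval (tcomp (ttens (tH a e) (tid K w)) (tXX K w [:: a; e])).
Proof.
apply: join_ext (tlin _) (tlin _) _ => x y.
rewrite !tcE ttE teval_id //.
rewrite !teval_XX.
by rewrite (linearZP (tlin _)) (@ttE [:: a; e] [:: a; e]) teval_id.
Qed.

Lemma eval_slide_l w a e : teval (tcomp (tXX K [:: a; e] w) (ttens (tH a e) (tid K w))) =1
  teval (tcomp (ttens (tid K w) (tH a e)) (tXX K [:: a; e] w)).
Proof.
apply: (join_ext (s := [:: a; e])) (tlin _) (tlin _) _ => x y.
rewrite !tcE (@ttE [:: a; e] [:: a; e]) teval_id //.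
rewrite !teval_XX.
by rewrite (linearZP (tlin _)) ttE teval_id.
Qed.

(** The tempered Casimir is symmetric in its two factors. *)
Lemma eval_sym a e : teval (tcomp (tX K e a) (tH e a)) =1 teval (tcomp (tH a e) (tX K e a)).
Proof.
apply: (pure2_ext (tlin _) (tlin _)) => u w.
rewrite !tcE.
rewrite teval_H teval_X2 // (linearZP (@tlin _ _ (tH a e))) teval_H.
rewrite (linear3P (@tlin _ _ (tX K e a))) !teval_X2 // !scalerDr !scalerA !(mulrC (gsign _ _ _)).
by congr (_ + _); exact: addrC.
Qed.

Local Notation triple u v w := (pure u (pure v (pure w (1 : K^o)))).

Lemma joinD s t (y : wmod t) : linear (@join K M s t y).
Proof. exact: linear_prop. Qed.

Lemma eval_H12 a e f (u : lmod a) (v : lmod e) (w : lmod f) :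
  teval (tH12 K a e f) (triple u v w) =
    - 1 *: triple (act _ (sp2h K) u) (act _ (sp2h K) v) w +
    (- 2 *: triple (act _ (sp2x K) u) (act _ (sp2y K) v) w +
     - 2 *: triple (act _ (sp2y K) u) (act _ (sp2x K) v) w).
Proof.
rewrite /tH12 -(@join2 K M a e u v [:: f]) (@ttE [:: a; e] [:: a; e] [:: f] [:: f]).
rewrite teval_id // teval_H (linear3P (joinD _)).
by rewrite !(@join2 K M a e _ _ [:: f]).
Qed.

Lemma eval_H23 a e f (u : lmod a) (v : lmod e) (w : lmod f) :
  teval (tH23 K a e f) (triple u v w) =
    - 1 *: triple u (act _ (sp2h K) v) (act _ (sp2h K) w) +
    (- 2 *: triple u (act _ (sp2x K) v) (act _ (sp2y K) w) +
     - 2 *: triple u (act _ (sp2y K) v) (act _ (sp2x K) w)).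
Proof.
rewrite /tH23 (@teval_strand_l _ _ _ _ _ cK bK a _ _ (tH e f)) (teval_H v w).
by rewrite !pureAr !pureZr.
Qed.

Lemma gsignK a e : gsign (-1) a e * gsign (-1) e a = 1 :> K.
Proof. by case: a; case: e; rewrite /gsign /= ?mulr1 ?mulrNN ?mulr1. Qed.

Lemma eval_strand_X a e f (u : lmod a) (v : lmod e) (w : lmod f) :
  teval (ttens (tid K [:: a]) (tX K e f)) (triple u v w) = gsign (-1) e f *: triple u w v.
Proof.
rewrite (@teval_strand_l _ _ _ _ _ cK bK a _ _ (tX K e f)).
by rewrite (@teval_X2 _ _ _ _ _ cK bK e f v w) pureZr.
Qed.

Lemma eval_H13 a e f (u : lmod a) (v : lmod e) (w : lmod f) :
  teval (tH13 K a e f) (triple u v w) =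
    - 1 *: triple (act _ (sp2h K) u) v (act _ (sp2h K) w) +
    (- 2 *: triple (act _ (sp2x K) u) v (act _ (sp2y K) w) +
     - 2 *: triple (act _ (sp2y K) u) v (act _ (sp2x K) w)).
Proof.
rewrite /tH13 !tcE eval_strand_X (linearZP (@tlin _ _ (ttens (tH a f) (tid K [:: e])))).
rewrite (@eval_H12 a f e) (linearZP (@tlin _ _ (ttens (tid K [:: a]) (tX K f e)))).
rewrite (linear3P (@tlin _ _ (ttens (tid K [:: a]) (tX K f e)))) !eval_strand_X.
have sc r (p : wmod [:: a; e; f]) : gsign (-1) e f *: (r *: (gsign (-1) f e *: p)) = r *: p.
  by rewrite !scalerA [_ * r]mulrC -mulrA gsignK mulr1.
by rewrite !scalerDr !sc.
Qed.

Lemma triple_ext (Z : lmodType K) a e f (g h : wmod [:: a; e; f] -> Z) : linear g -> linear h ->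
  (forall u v w, g (triple u v w) = h (triple u v w)) -> g =1 h.
Proof.
move=> lg lh H; apply: (tens_extP lg lh) => u.
have l (k : wmod [:: a; e; f] -> Z) : linear k ->
    linear (fun z : wmod [:: e; f] => k (pure u z : tens (lmod a) (wmod [:: e; f]))).
  by move=> hk r x y; rewrite pureDr hk.
move=> w; apply: (@pure2_ext K M Z e f _ _ (l g lg) (l h lh) _ w) => v {}w; exact: H.
Qed.

Lemma tDE s t (f g : term K s t) x : teval (tadd f g) x = teval f x + teval g x.
Proof. by []. Qed.

Section FourTerm.
Variables (a e f : letter) (F12 F13 F23 : wmod [:: a; e; f] -> wmod [:: a; e; f]).
Hypotheses (l12 : linear F12) (l13 : linear F13) (l23 : linear F23).
Hypothesis E12 : forall u v w, F12 (triple u v w) =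
    - 1 *: triple (act _ (sp2h K) u) (act _ (sp2h K) v) w +
    (- 2 *: triple (act _ (sp2x K) u) (act _ (sp2y K) v) w +
     - 2 *: triple (act _ (sp2y K) u) (act _ (sp2x K) v) w).
Hypothesis E13 : forall u v w, F13 (triple u v w) =
    - 1 *: triple (act _ (sp2h K) u) v (act _ (sp2h K) w) +
    (- 2 *: triple (act _ (sp2x K) u) v (act _ (sp2y K) w) +
     - 2 *: triple (act _ (sp2y K) u) v (act _ (sp2x K) w)).
Hypothesis E23 : forall u v w, F23 (triple u v w) =
    - 1 *: triple u (act _ (sp2h K) v) (act _ (sp2h K) w) +
    (- 2 *: triple u (act _ (sp2x K) v) (act _ (sp2y K) w) +
     - 2 *: triple u (act _ (sp2y K) v) (act _ (sp2x K) w)).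

(** The image of the infinitesimal braid relation: it only uses the commutators of h, x
    and y in the middle factor. *)
Lemma four_term u v w (t := triple u v w) :
  F12 (F13 t + F23 t) = F13 (F12 t) + F23 (F12 t) /\
  F12 (F23 t) + F13 (F23 t) = F23 (F12 t + F13 t).
Proof.
rewrite !(linearDP l12) !(linearDP l23) !E12 !E13 !E23.
rewrite !(linear3P l12) !(linear3P l13) !(linear3P l23) !E12 !E13 !E23.
rewrite !(act_hx, act_hy, act_xy) -?scaleNr !(pureAl, pureAr, pureZl, pureZr).
split; gather_pure (Nil (wmod [:: a; e; f])).
Qed.

End FourTerm.

Lemma eval_4term_l a e f :
  teval (tcomp (tH12 K a e f) (tadd (tH13 K a e f) (tH23 K a e f))) =1
  teval (tcomp (tadd (tH13 K a e f) (tH23 K a e f)) (tH12 K a e f)).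
Proof.
apply: (triple_ext (tlin _) (tlin _)) => u v w.
by have [h _] := four_term (tlin _) (tlin _) (tlin _) (@eval_H12 a e f) (@eval_H13 a e f)
  (@eval_H23 a e f) u v w.
Qed.

Lemma eval_4term_r a e f :
  teval (tcomp (tadd (tH12 K a e f) (tH13 K a e f)) (tH23 K a e f)) =1
  teval (tcomp (tH23 K a e f) (tadd (tH12 K a e f) (tH13 K a e f))).
Proof.
apply: (triple_ext (tlin _) (tlin _)) => u v w.
by have [_ h] := four_term (tlin _) (tlin _) (tlin _) (@eval_H12 a e f) (@eval_H13 a e f)
  (@eval_H23 a e f) u v w.
Qed.

End Relations.

(** * Bending and the chord between two strands *)

Section Bends.
Variables (K : fieldType) (lambda : K) (M : sp2mod K).
Variables (c : mod_hom M (verma_model lambda)) (b : mod_hom (verma_model lambda) M).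
Hypotheses (cK : cancel c b) (bK : cancel b c) (char2 : 2 != 0 :> K).

Local Notation lmod := (letter_mod M).
Local Notation wmod := (word_mod M).
Local Notation teval := (@teval K lambda M c b _ _).
Local Notation tlin := (@teval_linear K lambda M c b).
Local Notation ttE := (@teval_tens K lambda M c b).
Local Notation pVV := (@pure2 K M Lv Lv).
Local Notation e0 := (basisV K 0).
Local Notation e1 := (basisV K 1).

Lemma cV_basis (v : 'cV[K]_2) : v = v 0 0 *: e0 + v 1 0 *: e1.
Proof.
apply/matrixP => i j; rewrite !mxE ord1 /=.
by case: (ord2P i) => -> /=; rewrite ?mulr1 ?mulr0 ?addr0 ?add0r.
Qed.

Lemma cV_ext (Z : lmodType K) (f g : 'cV[K]_2 -> Z) : linear f -> linear g ->
  f e0 = g e0 -> f e1 = g e1 -> f =1 g.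
Proof.
move=> lf lg h0 h1 v; rewrite (cV_basis v).
by rewrite (linearDP lf) (linearDP lg) !(linearZP lf) !(linearZP lg) h0 h1.
Qed.

Lemma natural_act :
  [/\ sp2h K *m e0 = e0, sp2h K *m e1 = - e1, sp2x K *m e0 = 0 & sp2x K *m e1 = e0] /\
  (sp2y K *m e0 = e1 /\ sp2y K *m e1 = 0).
Proof.
by do ?split; apply/matrixP => i j; rewrite !ord1 !mxE !big_ord_recl big_ord0 !mxE;
  case: (ord2P i) => -> /=; ring.
Qed.

(** The copairing sum of e^a with its dual basis vector, in coordinates. *)
Lemma teval_cup : teval (tcup K) (1 : K^o) = pVV e1 e0 - pVV e0 e1.
Proof.
apply: etrans (dgmap_cup bK) _; rewrite !big_ord_recl big_ord0 addr0.
rewrite (_ : lift ord0 ord0 = 1); last exact: val_inj.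
rewrite dual_basis0 dual_basis1 addrC; congr (_ + _).
by rewrite /pure2 -!scaleN1r pureZl pureZr.
Qed.

Lemma teval_cap v w : teval (tcap K) (pVV v w) = omega v w :> K.
Proof. exact: (dgmap_cap cK bK). Qed.

Lemma pure2_lin_r a e (u : lmod a) : linear (fun w : lmod e => @pure2 K M a e u w).
Proof. by move=> r x y; rewrite /pure2 pureDl pureDr. Qed.

Lemma pure2_lin_l a e (w : lmod e) : linear (fun u : lmod a => @pure2 K M a e u w).
Proof. by move=> r x y; rewrite /pure2 pureDl. Qed.

Lemma pure20l a e (w : lmod e) : @pure2 K M a e 0 w = 0. Proof. exact: pure0l. Qed.
Lemma pure20r a e (u : lmod a) : @pure2 K M a e u 0 = 0.
Proof. by rewrite /pure2 pure0l pure0r. Qed.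
Lemma pure2Nl a e (u : lmod a) (w : lmod e) : @pure2 K M a e (- u) w = - @pure2 K M a e u w.
Proof. by rewrite -!scaleN1r -[LHS]/(pure _ _) pureZl. Qed.
Lemma pure2Nr a e (u : lmod a) (w : lmod e) : @pure2 K M a e u (- w) = - @pure2 K M a e u w.
Proof. by rewrite -!scaleN1r /pure2 pureZl pureZr. Qed.

Lemma tZE s t r (f : term K s t) x : teval (tscale r f) x = r *: teval f x.
Proof. by []. Qed.

(** On two copies of the natural module the tempered Casimir is the graded flip minus the
    projection cup-cap; it is enough to compare basis vectors. *)
Lemma eval_vv : teval (tH Lv Lv) =1
  teval (tadd (tX K Lv Lv) (tscale (-1) (tcomp (tcup K) (tcap K)))).
Proof.
pose X := tadd (tX K Lv Lv) (tscale (-1) (tcomp (tcup K) (tcap K))).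
apply: (pure2_ext (tlin _) (tlin X)) => u w; move: u.
have ll (w' : 'cV[K]_2) f : linear (fun u : 'cV[K]_2 => teval f (pVV u w')) := linear_compP (@pure2_lin_l Lv Lv w') (tlin f).
have lr (u' : 'cV[K]_2) f : linear (fun w : 'cV[K]_2 => teval f (pVV u' w)) := linear_compP (@pure2_lin_r Lv Lv u') (tlin f).
have E u w' : teval X (pVV u w') = - 1 *: pVV w' u + (- omega u w') *: (pVV e1 e0 - pVV e0 e1).
  rewrite /X tDE tZE tcE teval_cap teval_X2 //; congr (_ + _).
  have -> : omega u w' = omega u w' *: (1 : K^o) :> K^o by rewrite -[RHS]/(_ * _) mulr1.
  by rewrite (linearZP (tlin _)) teval_cup scalerA mulN1r -[_ *: (1 : K^o)]/(_ * _) mulr1.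
have [[h0 h1 x0 x1] [y0 y1]] := natural_act.
have H u' w' : teval (tH Lv Lv) (pVV u' w') =
    - 1 *: pVV (sp2h K *m u') (sp2h K *m w') + (- 2 *: pVV (sp2x K *m u') (sp2y K *m w') +
     - 2 *: pVV (sp2y K *m u') (sp2x K *m w')) := teval_H _ _ char2 u' w'.
suff h (u' w' : 'cV[K]_2) : teval (tH Lv Lv) (pVV u' w') = teval X (pVV u' w') by move=> u; exact: h.
clear w; rename w' into w; move: u'.
refine (@cV_ext _ _ _ (ll _ w (tH Lv Lv)) (ll _ w X) _ _); move: w;
  (refine (@cV_ext _ _ _ (lr _ _ (tH Lv Lv)) (lr _ _ X) _ _); rewrite H E omega_basis !mxE /=
    ?(h0, h1, x0, x1, y0, y1) ?(pure20l, pure20r, pure2Nl, pure2Nr)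
    ?(@pure20l Lv Lv, @pure20r Lv Lv, @pure2Nl Lv Lv, @pure2Nr Lv Lv)).
all: rewrite ?scaler0 ?scalerN ?opprK.
all: move: (pVV e0 e0) (pVV e0 e1) (pVV e1 e0) (pVV e1 e1) => p q r t.
all: try (rewrite ?addr0 ?add0r; modring [:: p; q; r; t]).
Qed.

Lemma teval_cup_tens t (z : wmod t) : teval (ttens (tcup K) (tid K t)) z =
  pure e1 (pure e0 z) - pure e0 (pure e1 z) :> wmod (Lv :: Lv :: t).
Proof.
have -> : z = join (M := M) [::] z (1 : K^o) by rewrite /= /scale_by scale1r.
rewrite (@ttE [::] [:: Lv; Lv] t t) teval_cup teval_id // /= /scale_by scale1r.
by rewrite linearB /= !(@join2 K M Lv Lv).
Qed.

Lemma teval_cap_tens t (v w : 'cV[K]_2) (z : wmod t) :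
  teval (ttens (tcap K) (tid K t)) (pure v (pure w z) : wmod (Lv :: Lv :: t)) = omega v w *: z.
Proof.
rewrite -(@join2 K M Lv Lv) (@ttE [:: Lv; Lv] [::] t t) teval_cap teval_id //.
Qed.

Lemma teval_XH a (y e d : 'cV[K]_2) (u : lmod a) :
  teval (ttens (tX K Lv Lv) (tH Lv a)) (pure y (pure e (@pure2 K M Lv a d u))) =
  - pure e (pure y (teval (tH Lv a) (@pure2 K M Lv a d u))).
Proof.
rewrite -(@join2 K M Lv Lv) (@ttE [:: Lv; Lv] [:: Lv; Lv]) teval_X2 //.
by rewrite (linearZP (linear_prop _)) scaleN1r (@join2 K M Lv Lv).
Qed.

Lemma teval_HX a (y e d : 'cV[K]_2) (u : lmod a) :
  teval (ttens (tH a Lv) (tX K Lv Lv)) (pure u (pure e (pVV d y)) : wmod [:: a; Lv; Lv; Lv]) =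
  - join [:: a; Lv] (pVV y d) (teval (tH a Lv) (@pure2 K M a Lv u e)).
Proof.
rewrite -(@join2 K M a Lv) (@ttE [:: a; Lv] [:: a; Lv]) teval_X2 //.
by rewrite (linearZP (join_linear_l _)) scaleN1r.
Qed.

Lemma omegaE (v w : 'cV[K]_2) : omega v w = v 0 0 * w 1 0 - v 1 0 * w 0 0.
Proof.
have o1 : lift ord0 ord0 = 1 :> 'I_2 by exact: val_inj.
rewrite /omega mxE !big_ord_recl big_ord0 !mxE !big_ord_recl !big_ord0 !mxE o1 -![ord0]/(0 : 'I_2) /=.
ring.
Qed.

Lemma natural_act_coord (v : 'cV[K]_2) : [/\ sp2h K *m v = v 0 0 *: e0 - v 1 0 *: e1,
  sp2x K *m v = v 1 0 *: e0 & sp2y K *m v = v 0 0 *: e1].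
Proof.
have [[h0 h1 x0 x1] [y0 y1]] := natural_act.
by rewrite {1 4 6}(cV_basis v) !mulmxDr -!scalemxAr h0 h1 x0 x1 y0 y1 !scaler0 scalerN add0r addr0.
Qed.

(** Bending a strand replaces the action on it by its transpose with respect to omega,
    which is minus the action because sp_2 preserves omega. *)
Lemma eval_bend_l a : teval (left_bend K a) =1 teval (tscale (-1) (tH Lv a)).
Proof.
have [[h0 h1 x0 x1] [y0 y1]] := natural_act.
pose T := ttens (tid K [:: Lv]) (ttens (tcap K) (tid K [:: a])).
have capE e y d u : teval T (pure e (pure y (@pure2 K M Lv a d u))) =
    omega y d *: @pure2 K M Lv a e u.
  rewrite (@teval_strand_l _ _ _ _ _ cK bK Lv [:: Lv; Lv; a] [:: a]).
  by rewrite (@teval_cap_tens [:: a]) pureZr.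
have H d u : teval (tH Lv a) (@pure2 K M Lv a d u) =
    - 1 *: @pure2 K M Lv a (sp2h K *m d) (act _ (sp2h K) u) +
    (- 2 *: @pure2 K M Lv a (sp2x K *m d) (act _ (sp2y K) u) +
     - 2 *: @pure2 K M Lv a (sp2y K *m d) (act _ (sp2x K) u)) := @teval_H _ _ _ _ _ char2 Lv a d u.
apply: (pure2_ext (tlin _) (tlin _)) => y u.
rewrite /left_bend !tcE tZE (@teval_strand_l _ _ _ _ _ cK bK Lv [:: a] [:: Lv; Lv; a]).
rewrite (@teval_cup_tens [:: a]) pureAr -scaleN1r pureZr addrC.
set X := ttens (tX K Lv Lv) (tH Lv a).
rewrite [in teval X _](tlin X) !(@teval_XH a) {X} !H !h0 !h1 !x0 !x1 !y0 !y1.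
rewrite (linearDP (tlin T)) (linearZP (tlin T)) -![- pure _ _]scaleN1r !(linearZP (tlin T)).
rewrite !(pureAr, pureZr) !(linear3P (tlin T)) !capE !omegaE !mxE /=.
have [-> -> ->] := natural_act_coord y.
rewrite -?scaleNr /pure2 !(pureAl, pureZl).
gather_pure (Nil (wmod [:: Lv; a])).
Qed.

Lemma eval_bend_r a : teval (right_bend K a) =1 teval (tscale (-1) (tH a Lv)).
Proof.
have [[h0 h1 x0 x1] [y0 y1]] := natural_act.
pose T := ttens (tid K [:: a]) (ttens (tcap K) (tid K [:: Lv])).
have capE y e d u : teval T (join [:: a; Lv] (pVV y d) (@pure2 K M a Lv u e)) =
    omega e y *: @pure2 K M a Lv u d.
  rewrite (@join2 K M a Lv u e [:: Lv; Lv] (pVV y d)).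
  rewrite (@teval_strand_l _ _ _ _ _ cK bK a [:: Lv; Lv; Lv] [:: Lv]).
  by rewrite (@teval_cap_tens [:: Lv]) pureZr.
have H d u : teval (tH a Lv) (@pure2 K M a Lv u d) =
    - 1 *: @pure2 K M a Lv (act _ (sp2h K) u) (sp2h K *m d) +
    (- 2 *: @pure2 K M a Lv (act _ (sp2x K) u) (sp2y K *m d) +
     - 2 *: @pure2 K M a Lv (act _ (sp2y K) u) (sp2x K *m d)) := @teval_H _ _ _ _ _ char2 a Lv u d.
apply: (pure2_ext (tlin _) (tlin _)) => u y.
rewrite /right_bend !tcE tZE (@teval_strand_l _ _ _ _ _ cK bK a [:: Lv] [:: Lv; Lv; Lv]).
rewrite (@teval_cup_tens [:: Lv]) pureAr -scaleN1r pureZr addrC.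
set X := ttens (tH a Lv) (tX K Lv Lv).
rewrite [in teval X _](tlin X) !(@teval_HX a) {X} !H !h0 !h1 !x0 !x1 !y0 !y1.
rewrite (linearDP (tlin T)) (linearZP (tlin T)) -![- join _ _ _]scaleN1r !(linearZP (tlin T)).
rewrite !(linear3P (linear_prop (join [:: a; Lv] _))) !(linear3P (tlin T)) !capE !omegaE !mxE /=.
have [-> -> ->] := natural_act_coord y.
rewrite -?scaleNr /pure2 !(pureAl, pureZl) !(pureAr, pureZr).
gather_pure (Nil (wmod [:: a; Lv])).
Qed.
End Bends.

(** * The functor on the multi-polar Brauer category *)

Local Open Scope quotient_scope.

Section Existence.
Variables (K : fieldType) (lambda : K) (M : sp2mod K).
Variables (c : mod_hom M (verma_model lambda)) (b : mod_hom (verma_model lambda) M).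
Hypotheses (cK : cancel c b) (bK : cancel b c) (char2 : 2 != 0 :> K).

Local Notation wmod := (word_mod M).
Local Notation teval := (@teval K lambda M c b _ _).
Local Notation tlin := (@teval_linear K lambda M c b).
Local Notation ttE := (@teval_tens K lambda M c b).

Lemma eval_ext_tens s t s' t' (f : term K s t) (g : term K s' t') (h : wmod (s ++ s') -> wmod (t ++ t')) :
  linear h -> (forall x y, join t (teval g y) (teval f x) = h (join s y x)) ->
  teval (ttens f g) =1 h.
Proof. by move=> lh H; apply: (join_ext (tlin _) lh) => x y; rewrite ttE H. Qed.

Lemma eval_tensA s1 t1 s2 t2 s3 t3 (f : term K s1 t1) (g : term K s2 t2) (h : term K s3 t3) :
  teval (tcast (catA s1 s2 s3) (catA t1 t2 t3) (ttens f (ttens g h))) =1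
  teval (ttens (ttens f g) h).
Proof.
move=> w; symmetry; move: w; apply: eval_ext_tens (tlin _) _ => xy z; move: xy.
have l1 : linear (fun xy => join (t1 ++ t2) (teval h z) (teval (ttens f g) xy)).
  exact: linear_compP (tlin _) (linear_prop _).
have l2 : linear (fun xy => teval (tcast (catA s1 s2 s3) (catA t1 t2 t3) (ttens f (ttens g h)))
    (join (s1 ++ s2) z xy)).
  exact: linear_compP (linear_prop _) (tlin _).
apply: (join_ext l1 l2) => x y.
by rewrite -(wcast_join (catA s1 s2 s3)) teval_cast !ttE wcast_join.
Qed.

Lemma eval_tens_id s t (f : term K s t) :
  teval (tcast (cats0 s) (cats0 t) (ttens f (tid K [::]))) =1 teval f.
Proof.
move=> x; rewrite -{1}(wcast_join_nil (cats0 s) x) teval_cast (@ttE _ _ [::] [::]).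
by rewrite teval_id // wcast_join_nil.
Qed.

Lemma eval_id_tens s t (f : term K s t) : teval (ttens (tid K [::]) f) =1 teval f.
Proof.
apply: (@eval_ext_tens [::] [::] s t _ _ _ (tlin f)) => x y.
by rewrite teval_id // /= /scale_by (linearZP (tlin f)).
Qed.

(** Each defining relation has been verified on vectors; the congruence rules hold
    because terms act by linear maps. *)
Lemma teval_eq s t (f g : term K s t) : mpb_eq (-2) f g -> teval f =1 teval g.
Proof.
elim=> {s t f g}.
- by [].
- by move=> s t f g _ IH x; rewrite IH.
- by move=> s t g f h _ IH1 _ IH2 x; rewrite IH1 IH2.
- by move=> s t u g g' f f' _ IH1 _ IH2 x; rewrite !tcE IH2 IH1.
- move=> s t s' t' f f' g g' _ IH1 _ IH2; apply: eval_ext_tens (tlin _) _ => x y.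
  by rewrite ttE IH1 IH2.
- by move=> s t f f' g g' _ IH1 _ IH2 x; rewrite !tDE IH1 IH2.
- by move=> s t a f f' _ IH x; rewrite !tZE IH.
- by move=> s t f g h x; rewrite !tDE addrA.
- by move=> s t f g x; rewrite !tDE addrC.
- by move=> s t f x; rewrite tDE add0r.
- by move=> s t f x; rewrite tDE tZE scaleN1r addNr.
- by move=> s t r r' f x; rewrite !tZE scalerA.
- by move=> s t f x; rewrite !tZE scale1r.
- by move=> s t r f g x; rewrite !(tZE, tDE) scalerDr.
- by move=> s t r r' f x; rewrite !(tZE, tDE) scalerDl.
- by [].
- by move=> s t u g f f' x; rewrite !(tcE, tDE) (linearDP (tlin g)).
- by [].
- by move=> s t u r g f x; rewrite !(tcE, tZE) (linearZP (tlin g)).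
- move=> s t s' t' f f' g; apply: eval_ext_tens (tlin _) _ => x y.
  by rewrite !tDE !ttE linearD.
- move=> s t s' t' f g g'; apply: eval_ext_tens (tlin _) _ => x y.
  by rewrite !tDE !ttE (linearDP (join_linear_l _)).
- move=> s t s' t' r f g; apply: eval_ext_tens (tlin _) _ => x y.
  by rewrite !tZE !ttE linearZ.
- move=> s t s' t' r f g; apply: eval_ext_tens (tlin _) _ => x y.
  by rewrite !tZE !ttE (linearZP (join_linear_l _)).
- by [].
- by move=> s t f x; rewrite tcE teval_id.
- by move=> s t f x; rewrite tcE teval_id.
- move=> s t u s' t' u' g f g' f'; apply: eval_ext_tens (tlin _) _ => x y.
  by rewrite !tcE !ttE.
- exact: eval_tensA.
- exact: eval_id_tens.
- exact: eval_tens_id.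
- by move=> s t u A B D st x; rewrite tZE; exact: (@dgmap_stack _ _ _ _ _ cK bK _ _ _ A B D x st).
- move=> s t s' t' A B; apply: eval_ext_tens (tlin _) _ => x y.
  by symmetry; exact: (dgmap_juxt cK bK).
- by move=> w a e; exact: eval_slide_r.
- by move=> w a e; exact: eval_slide_l.
- by move=> a e; exact: eval_sym.
- by move=> a; exact: eval_bend_l.
- by move=> a; exact: eval_bend_r.
- by move=> a e f; exact: eval_4term_l.
- by move=> a e f; exact: eval_4term_r.
- exact: eval_vv.
Qed.

Local Notation mpb := (mpb (-2 : K)).

Definition feval s t (f : mpb s t) : mod_hom (wmod s) (wmod t) :=
  eval_hom cK bK char2 (repr f).

Lemma feval_cls s t (f : term K s t) x : feval (cls (-2) f) x = teval f x.
Proof. exact: (teval_eq (repr_cls _ f)). Qed.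

Lemma feval_is_F_MPB : is_F_MPB feval.
Proof.
split; [split|split|..].
- by move=> s x; rewrite /mid feval_cls teval_id.
- by move=> s t u g f x; rewrite /mcomp feval_cls.
- by move=> s t r f g x; rewrite -[f]cls_repr -[g]cls_repr -clsZ -clsD !feval_cls.
- by move=> s t s' t' f g x y; rewrite /mtens feval_cls ttE.
- by move=> a e u w; rewrite /mX feval_cls teval_X2.
- split; first by rewrite /mcup feval_cls; exact: (dgmap_cup bK).
  by move=> v w; rewrite /mcap feval_cls; exact: (dgmap_cap cK bK).
- move=> a e u w; rewrite /mH feval_cls -[LHS]/(H_map _) /H_map /casimir.
  congr (_ *: _); apply: eq_bigr => i _; apply: eq_bigr => j _.
  by rewrite /pure2 tens_mapE act_word1.
Qed.

End Existence.

(** * Descent to the Temperley-Lieb quotient *)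

Local Open Scope quotient_scope.

(** The quadratic Casimir h^2 + 2h + 4yx is central and takes this value on the highest
    weight vector; here it is checked as an identity of differential operators. *)
Lemma verma_casimir (K : fieldType) (lambda : K) (p : verma_model lambda) :
  act _ (sp2h K) (act _ (sp2h K) p) + 2 *: act _ (sp2h K) p + 4 *: act _ (sp2y K) (act _ (sp2x K) p)
  = (lambda * (lambda + 2)) *: p.
Proof.
rewrite /= /verma_act_fun !mxE /=.
rewrite !(derivD, derivN, derivZ, derivM, derivX, mul1r) -!mul_polyC.
rewrite !(polyCD, polyCN, polyCM); ring.
Qed.

Section Properties.
Variables (K : fieldType) (lambda : K) (M : sp2mod K).
Hypothesis char2 : 2 != 0 :> K.
Hypothesis casM : forall u : M, act M (sp2h K) (act M (sp2h K) u) + 2 *: act M (sp2h K) u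
  + 4 *: act M (sp2y K) (act M (sp2x K) u) = (lambda * (lambda + 2)) *: u.

Local Notation lmod := (letter_mod M).
Local Notation wmod := (word_mod M).
Local Notation mpb := (mpb (-2 : K)).
Local Notation pVV := (@pure2 K M Lv Lv).
Local Notation e0 := (basisV K 0).
Local Notation e1 := (basisV K 1).

Variable F0 : forall s t, mpb s t -> mod_hom (wmod s) (wmod t).
Hypothesis HF : is_F_MPB F0.

Definition F s t (f : mpb s t) : wmod s -> wmod t := F0 f.

Lemma F_linear s t (f : mpb s t) : linear (F f).
Proof. exact: mfun_linear. Qed.
Lemma F_act s t (f : mpb s t) A x : A \in sp2 (K:=K) -> F f (act _ A x) = act _ A (F f x).
Proof. exact: mfun_act. Qed.
Lemma F_id s x : F (mid _ s) x = x. Proof. by case: HF => [[h _] _ _ _ _]; exact: h. Qed.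
Lemma F_comp s t u (g : mpb t u) (f : mpb s t) x : F (mcomp g f) x = F g (F f x).
Proof. by case: HF => [[_ h] _ _ _ _]; exact: h. Qed.
Lemma F_lin s t a (f g : mpb s t) x : F (a *: f + g) x = a *: F f x + F g x.
Proof. by case: HF => [_ [h _] _ _ _]; exact: h. Qed.
Lemma F_tens s t s' t' (f : mpb s t) (g : mpb s' t') x y :
  F (mtens f g) (join s y x) = join t (F g y) (F f x).
Proof. by case: HF => [_ [_ h] _ _ _]; exact: h. Qed.
Lemma F_X a e u w : F (mX _ a e) (pure2 u w) = gsign (-1) a e *: @pure2 K M e a w u.
Proof. by case: HF => [_ _ h _ _]; exact: h. Qed.
Lemma F_add s t (f g : mpb s t) x : F (f + g) x = F f x + F g x.
Proof. by have := F_lin 1 f g x; rewrite !scale1r. Qed.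
Lemma F_zero s t x : F (0 : mpb s t) x = 0.
Proof. by have := F_add (0 : mpb s t) 0 x; rewrite addr0 -{1}[F _ x]addr0 => /addrI <-. Qed.
Lemma F_scale s t a (f : mpb s t) x : F (a *: f) x = a *: F f x.
Proof. by rewrite -[a *: f]addr0 F_lin F_zero addr0. Qed.
Lemma F_opp s t (f : mpb s t) x : F (- f) x = - F f x.
Proof. by rewrite -scaleN1r F_scale scaleN1r. Qed.
Lemma F_sub s t (f g : mpb s t) x : F (f - g) x = F f x - F g x.
Proof. by rewrite F_add F_opp. Qed.
Lemma F_cup : F (mcup _) (1 : K^o) = pVV e1 e0 - pVV e0 e1.
Proof.
case: HF => [_ _ _ [h _] _]; apply: etrans h _.
rewrite !big_ord_recl big_ord0 addr0 (_ : lift ord0 ord0 = 1); last exact: val_inj.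
by rewrite dual_basis0 dual_basis1 addrC (@pure2Nr _ M Lv Lv).
Qed.
Lemma F_cap v w : F (mcap _) (pVV v w) = omega v w :> K.
Proof. by case: HF => [_ _ _ [_ h] _]; exact: h. Qed.
(** Any functor with the prescribed values sends the chord to the Casimir in the standard
    basis. *)
Lemma F_H a e (u : lmod a) (w : lmod e) : F (mH _ a e) (pure2 u w) =
    - 1 *: pure2 (act _ (sp2h K) u) (act _ (sp2h K) w) +
    (- 2 *: pure2 (act _ (sp2x K) u) (act _ (sp2y K) w) +
     - 2 *: pure2 (act _ (sp2y K) u) (act _ (sp2x K) w)).
Proof.
case: HF => [_ _ _ _ h]; apply: etrans (h a e u w) _.
rewrite -H_mapE // /H_map /casimir /pure2; congr (_ *: _).
by apply: eq_bigr => i _; apply: eq_bigr => j _; rewrite tens_mapE act_word1.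
Qed.

Lemma F_strand_l a t t' (g : mpb t t') (u : lmod a) z :
  F (mtens (mid _ [:: a]) g) (pure u z : tens (lmod a) (wmod t)) = pure u (F g z).
Proof. by rewrite -(@join1 K M a) (@F_tens [:: a] [:: a]) F_id join1. Qed.

Lemma F_cup_tens s t (g : mpb s t) (z : wmod s) : F (mtens (mcup _) g) z =
  pure e1 (pure e0 (F g z)) - pure e0 (pure e1 (F g z)) :> wmod (Lv :: Lv :: t).
Proof.
have -> : z = join (M := M) [::] z (1 : K^o) by rewrite /= /scale_by scale1r.
rewrite (@F_tens [::] [:: Lv; Lv] s t) F_cup /= /scale_by scale1r.
by rewrite linearB /= !(@join2 K M Lv Lv).
Qed.

Lemma F_cap_tens s t (g : mpb s t) (v w : 'cV[K]_2) (z : wmod s) :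
  F (mtens (mcap _) g) (pure v (pure w z) : wmod (Lv :: Lv :: s)) = omega v w *: F g z.
Proof. by rewrite -(@join2 K M Lv Lv) (@F_tens [:: Lv; Lv] [::] s t) F_cap. Qed.

Lemma pVV_ext (Z : lmodType K) (f g : wmod [:: Lv; Lv] -> Z) : linear f -> linear g ->
  (forall i j : 'I_2, f (pVV (basisV K i) (basisV K j)) = g (pVV (basisV K i) (basisV K j))) ->
  f =1 g.
Proof.
move=> lf lg h; apply: (pure2_ext lf lg).
suff H (u' w' : 'cV[K]_2) : f (pVV u' w') = g (pVV u' w') by [].
have ll (q : 'cV[K]_2) k : linear k -> linear (fun u : 'cV[K]_2 => k (pVV u q) : Z).
  by move=> lk; exact: (linear_compP (@pure2_lin_l _ M Lv Lv q) lk).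
have lr (q : 'cV[K]_2) k : linear k -> linear (fun w : 'cV[K]_2 => k (pVV q w) : Z).
  by move=> lk; exact: (linear_compP (@pure2_lin_r _ M Lv Lv q) lk).
suff {u'} H i : f (pVV (basisV K i) w') = g (pVV (basisV K i) w').
  by apply: (cV_ext (ll w' f lf) (ll w' g lg)).
by apply: (cV_ext (lr (basisV K i) f lf) (lr (basisV K i) g lg)).
Qed.

(** On two copies of the natural module the flip is minus the identity plus a multiple of
    the projection to the invariant line, with loop value -2. *)
Lemma F_Theta x : F (Theta (-2 : K)) x = 0.
Proof.
have l0 : linear (fun _ : wmod [:: Lv; Lv] => 0 : wmod [:: Lv; Lv]).
  by move=> r p q; rewrite scaler0 addr0.
move: x; apply: (pVV_ext (F_linear _) l0) => i j.
rewrite /Theta F_sub F_add F_id F_X F_scale F_comp F_cap omega_basis.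
have -> : 2 / -2 = - 1 :> K by rewrite invrN mulrN mulfV.
have -> : gup K i j = gup K i j *: (1 : K^o) :> K^o by rewrite -[RHS]/(_ * _) mulr1.
rewrite (linearZP (F_linear _)) F_cup.
by case: (ord2P i) => ->; case: (ord2P j) => ->; rewrite !mxE /=;
  move: (pVV e0 e0) (pVV e0 e1) (pVV e1 e0) (pVV e1 e1) => p q r t;
  rewrite -?scaleNr -[0](scale0r p);
  modring [:: p; q; r; t].
Qed.

Lemma F_tens_ext s t s' t' (f : mpb s t) (g : mpb s' t') :
  (forall x y, join t (F g y) (F f x) = 0) -> forall z, F (mtens f g) z = 0.
Proof.
move=> h; have l0 : linear (fun _ : wmod (s ++ s') => 0 : wmod (t ++ t')).
  by move=> r p q; rewrite scaler0 addr0.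
by apply: (join_ext (F_linear _) l0) => x y; rewrite F_tens.
Qed.

Lemma F_linear0 s t (f : mpb s t) : F f 0 = 0.
Proof. by have := linearZP (F_linear f) 0 0; rewrite !scale0r. Qed.

Lemma F_theta_ideal s t (f : mpb s t) : theta_ideal f -> forall x, F f x = 0.
Proof.
elim=> {s t f}.
- exact: F_Theta.
- by move=> s t x; rewrite F_zero.
- by move=> s t a f g _ IHf _ IHg x; rewrite F_lin IHf IHg scaler0 addr0.
- by move=> s t u v h f g _ IH x; rewrite !F_comp IH F_linear0.
- move=> s t s' t' h f _ IH; apply: F_tens_ext => x y; rewrite IH.
  by have := linearZP (join_linear_l (F h x)) 0 (0 : wmod t); rewrite !scale0r.
- by move=> s t s' t' f h _ IH; apply: F_tens_ext => x y; rewrite IH linear0.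
Qed.

(** Closing the square of the chord traces over the natural module and leaves the
    quadratic Casimir of M, which is a scalar. *)
Lemma F_Z2 (u : M) : F (Z2 (-2 : K)) (pure u (1 : K^o)) =
  (- 2 * (lambda * (lambda + 2))) *: pure u (1 : K^o) :> wmod [:: Lm].
Proof.
have [[h0 h1 x0 x1] [y0 y1]] := natural_act K.
have Hs u' w' : F (mH _ Lm Lv) (@pure2 K M Lm Lv u' w') =
    - 1 *: @pure2 K M Lm Lv (act M (sp2h K) u') (sp2h K *m w') +
    (- 2 *: @pure2 K M Lm Lv (act M (sp2x K) u') (sp2y K *m w') +
     - 2 *: @pure2 K M Lm Lv (act M (sp2y K) u') (sp2x K *m w')) := F_H (a := Lm) (e := Lv) u' w'.
rewrite /Z2 !F_comp (@F_strand_l Lm [::] [:: Lv; Lv]).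
have -> : F (mcup (-2)) (1 : K^o) = pVV e1 e0 - 1 *: pVV e0 e1 by rewrite F_cup scale1r.
rewrite pureAr -scaleNr pureZr.
have J w w' : pure u (pVV w w') = join (M := M) [:: Lm; Lv] (pure w' (1 : K^o) : wmod [:: Lv])
   (@pure2 K M Lm Lv u w) by rewrite (@join2 K M Lm Lv).
rewrite !J.
set G := mtens (mcomp _ _) _.
have EG z q : F G (join (t := [:: Lv]) [:: Lm; Lv] z q) =
    join (t := [:: Lv]) [:: Lm; Lv] z (F (mH _ Lm Lv) (F (mH _ Lm Lv) q)).
  by rewrite (@F_tens [:: Lm; Lv] [:: Lm; Lv] [:: Lv] [:: Lv]) F_id F_comp.
set C := mtens (mid _ [:: Lm]) (mcap _).
have EC u' v w : F C (join (t := [:: Lv]) [:: Lm; Lv] (pure w (1 : K^o)) (@pure2 K M Lm Lv u' v)) =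
    omega v w *: (pure u' (1 : K^o) : wmod [:: Lm]).
  rewrite (@join2 K M Lm Lv) (@F_strand_l Lm [:: Lv; Lv] [::] (mcap _)).
  rewrite -[pure v (pure w 1)]/(pVV v w) F_cap.
  have -> : omega v w = omega v w *: (1 : K^o) :> K^o by rewrite -[RHS]/(_ * _) mulr1.
  by rewrite pureZr -[omega v w *: 1]/(_ * _) mulr1.
rewrite (linearDP (F_linear G)) (linearZP (F_linear G)) !EG !Hs h0 h1 x0 x1 y0 y1.
rewrite !(linear3P (F_linear (mH _ Lm Lv))) !Hs h0 h1 x0 x1 y0 y1.
rewrite ?mulmxN ?mulmx0 ?h0 ?h1 ?x0 ?x1 ?y0 ?y1.
rewrite (linearDP (F_linear C)) (linearZP (F_linear C)).
rewrite !(linear3P (linear_prop (join (t := [:: Lv]) [:: Lm; Lv] _))).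
rewrite !(linear3P (F_linear C)) !EC !omegaE !mxE /=.
rewrite -[RHS]scalerA -[X in _ = _ *: X]pureZl -casM !act_xy ?(pureAl, pureZl).
gather_pure (Nil (wmod [:: Lm])).
Qed.

Lemma F_Z2_scalar (x : wmod [:: Lm]) : F (Z2 (-2 : K)) x = (- 2 * (lambda * (lambda + 2))) *: x.
Proof.
have l : linear (fun x : wmod [:: Lm] => (- 2 * (lambda * (lambda + 2))) *: x).
  exact: linear_scaleP (fun _ _ _ => erefl).
move: x; apply: (@tens_extP K M (triv_mod K) (wmod [:: Lm]) _ _ (F_linear (Z2 (-2))) l) => u r.
have -> : r = (r : K) *: (1 : K^o) by rewrite -[RHS]/(_ * _) mulr1.
by rewrite pureZr (linearZP (F_linear _)) F_Z2 !scalerA mulrC.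
Qed.

(** The functor factors through the quotient: Theta and the relation that fixes Z_2 are
    killed, and the ideal is generated from them by operations that the functor
    respects. *)
Lemma F_tlb_ideal r s (f : mpb (pole r) (pole s)) : tlb_ideal lambda f -> forall x, F f x = 0.
Proof.
elim=> {r s f}.
- by move=> r s f h x; exact: F_theta_ideal.
- move=> r x; rewrite F_sub F_scale F_id /Z2_at; apply/eqP; rewrite subr_eq0; apply/eqP.
  have l : linear (fun x : wmod (pole r) =>
      (-2 * - (lambda * ((-2 - 2) / 2 - lambda))) *: x).
    exact: linear_scaleP (fun _ _ _ => erefl).
  set w := mtens _ _; move: x; apply: (@join_ext K M _ [:: Lm] (nseq r Lv) _ _ (F_linear w) l) => y z.
  rewrite (@F_tens [:: Lm] [:: Lm]) F_id F_Z2_scalar (linearZP (linear_prop _)).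
  congr (_ *: _).
  have -> : (-2 - 2) / 2 = - 2 :> K by field.
  ring.
- by move=> r s a f g _ IHf _ IHg x; rewrite F_lin IHf IHg scaler0 addr0.
- by move=> r s t u h f g _ IH x; rewrite !F_comp IH F_linear0.
Qed.

Lemma F_tlb_eq r s (f g : mpb (pole r) (pole s)) : tlb_eq lambda f g -> F f =1 F g.
Proof. by move=> /F_tlb_ideal h x; apply/eqP; rewrite -subr_eq0 -F_sub h. Qed.

Definition tlb_map r s (f : tlb_hom (-2) lambda r s) : mod_hom (wmod (pole r)) (wmod (pole s)) :=
  F0 (repr f).

Lemma tlb_map_cls r s (f : mpb (pole r) (pole s)) : tlb_map (tlb_cls lambda f) = F0 f.
Proof. by apply: mod_hom_ext; apply: F_tlb_eq; apply/tlb_clsP; exact: reprK. Qed.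

Lemma tlb_functor_of : exists G : functor (TLB (-2) lambda) (TM M), is_F_TLB G.
Proof.
have F1 r : tlb_map (tlb_cls lambda (mid _ (pole r))) = mod_id _.
  by rewrite tlb_map_cls; apply: mod_hom_ext => x; exact: F_id.
have FM r s t (g : tlb_hom (-2) lambda s t) (f : tlb_hom (-2) lambda r s) :
    tlb_map (tlb_compose g f) = mod_comp (tlb_map g) (tlb_map f).
  by rewrite /tlb_compose tlb_map_cls; apply: mod_hom_ext => x; exact: F_comp.
exists (@Functor (TLB (-2) lambda) (TM M) id tlb_map F1 FM).
exists F0 => //; exists tlb_map, F1, FM; split=> // r s f; exact: tlb_map_cls.
Qed.

End Properties.

Theorem tlb_functor_exists (K : fieldType) (lambda : K) (M : sp2mod K) : 2 != 0 :> K ->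
  is_verma lambda M -> exists G : functor (TLB (-2) lambda) (TM M), is_F_TLB G.
Proof.
move=> char2 /verma_coordinates[c [b [_ cK bK]]].
apply: (tlb_functor_of char2 _ (feval_is_F_MPB cK bK char2)) => u.
have cE A w : A \in sp2 (K:=K) -> act M A (b w) = b (act _ A w) by move=> hA; rewrite mfun_act.
rewrite -[u]cK; move: (c u) => w {u}.
rewrite !cE ?sp2h_mem ?sp2x_mem ?sp2y_mem //.
by rewrite -!(linearZP (mfun_linear b)) -!(linearDP (mfun_linear b)) verma_casimir.
Qed.

(** * Calculus of morphisms up to associativity *)

Lemma diagram_ext s t (d d' : diagram s t) : d =1 d' -> d = d'.
Proof.
case: d d' => [d dP] [d' dP'] /= /ffunP e; move: dP dP'; rewrite e => dP dP'.
by rewrite (bool_irrelevance dP dP').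
Qed.

Lemma juxt_id s t : juxt_diagram (id_diagram s) (id_diagram t) = id_diagram (s ++ t).
Proof.
apply: diagram_ext; apply: emb_cases => p; rewrite !ffunE ?juxt_embl ?juxt_embr ffunE;
  by case: p.
Qed.

Section Calculus.
Variables (K : fieldType) (delta : K).
Local Notation mpb := (@mpb K delta).
Local Notation mid := (@mid K delta).

Definition mcast s s' t t' (es : s = s') (et : t = t') (f : mpb s t) : mpb s' t' :=
  ecast w (mpb w t') es (ecast w (mpb s w) et f).

Lemma mcast_id s t (es : s = s) (et : t = t) (f : mpb s t) : mcast es et f = f.
Proof. by rewrite (eq_irrelevance es erefl) (eq_irrelevance et erefl). Qed.

Lemma cls_cast s s' t t' (es : s = s') (et : t = t') (f : term K s t) :
  cls delta (tcast es et f) = mcast es et (cls delta f).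
Proof. by case: s' / es; case: t' / et. Qed.

(** Equality of morphisms whose source and target words are equal but not convertible,
    as happens with associativity of concatenation. *)
Definition heq s t s' t' (f : mpb s t) (g : mpb s' t') : Prop :=
  exists es et, mcast es et f = g.

Lemma heq_refl s t (f : mpb s t) : heq f f.
Proof. by exists erefl, erefl. Qed.

Lemma heq_sym s t s' t' (f : mpb s t) (g : mpb s' t') : heq f g -> heq g f.
Proof. by case=> es [et <-]; case: s' / es g; case: t' / et => g; exact: heq_refl. Qed.

Lemma heq_trans s t s' t' s'' t'' (f : mpb s t) (g : mpb s' t') (h : mpb s'' t'') :
  heq f g -> heq g h -> heq f h.
Proof.
case=> es [et <-] [es' [et' <-]].
by case: s'' / es' h; case: t'' / et' => h; exists es, et.
Qed.

Lemma heq_eq s t (f g : mpb s t) : heq f g -> f = g.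
Proof. by case=> es [et <-]; rewrite mcast_id. Qed.

Lemma heq_cast s s' t t' (es : s = s') (et : t = t') (f : mpb s t) : heq (mcast es et f) f.
Proof. by case: s' / es; case: t' / et; exact: heq_refl. Qed.

Lemma heq_mid s s' : s = s' -> heq (mid s) (mid s').
Proof. by move=> ->; exact: heq_refl. Qed.

Lemma heq_comp s t u s' t' u' (g : mpb t u) (f : mpb s t) (g' : mpb t' u') (f' : mpb s' t') :
  heq g g' -> heq f f' -> heq (mcomp g f) (mcomp g' f').
Proof.
case=> e1 [e2 <-] [e3 [e4 <-]].
case: s' / e3 f'; case: u' / e2 g'; case: t' / e1 e4 => e4 g' f'.
by rewrite !mcast_id; exact: heq_refl.
Qed.

Lemma heq_tens s t s1 t1 s' t' s1' t1' (f : mpb s t) (g : mpb s1 t1) (f' : mpb s' t') (g' : mpb s1' t1') :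
  heq f f' -> heq g g' -> heq (mtens f g) (mtens f' g').
Proof.
case=> e1 [e2 <-] [e3 [e4 <-]].
case: s' / e1 f'; case: t' / e2 => f'; case: s1' / e3 g'; case: t1' / e4 => g'.
exact: heq_refl.
Qed.

Lemma heq_scale s t s' t' a (f : mpb s t) (g : mpb s' t') : heq f g -> heq (a *: f) (a *: g).
Proof. by case=> es [et <-]; case: s' / es g; case: t' / et => g; exact: heq_refl. Qed.

Lemma heq_add s t s' t' (f f1 : mpb s t) (g g1 : mpb s' t') : heq f g -> heq f1 g1 ->
  heq (f + f1) (g + g1).
Proof.
case=> es [et <-] [es1 [et1 <-]]; case: s' / es es1 g g1 => es1; case: t' / et et1 => et1 g g1.
by rewrite !mcast_id; exact: heq_refl.
Qed.

Section Tensor.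
Variables s t s' t' : word.

Lemma mtensPl a (f f' : mpb s t) (g : mpb s' t') :
  mtens (a *: f + f') g = a *: mtens f g + mtens f' g.
Proof.
rewrite -[f]cls_repr -[f']cls_repr -[g]cls_repr -clsZ -clsD -!cls_tens -clsZ -clsD.
apply/clsP; apply: mpb_trans (mpb_tensDl _ _ _ _) _.
by apply: mpb_add; [exact: mpb_tensZl|exact: mpb_refl].
Qed.

Lemma mtensPr a (f : mpb s t) (g g' : mpb s' t') :
  mtens f (a *: g + g') = a *: mtens f g + mtens f g'.
Proof.
rewrite -[f]cls_repr -[g']cls_repr -[g]cls_repr -clsZ -clsD -!cls_tens -clsZ -clsD.
apply/clsP; apply: mpb_trans (mpb_tensDr _ _ _ _) _.
by apply: mpb_add; [exact: mpb_tensZr|exact: mpb_refl].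
Qed.

End Tensor.

Section Rules.
Variables (s t : word).

Lemma mtensDl s' t' (f f' : mpb s t) (g : mpb s' t') : mtens (f + f') g = mtens f g + mtens f' g.
Proof. by rewrite -[f]scale1r mtensPl !scale1r. Qed.
Lemma mtensDr s' t' (f : mpb s t) (g g' : mpb s' t') : mtens f (g + g') = mtens f g + mtens f g'.
Proof. by rewrite -[g]scale1r mtensPr !scale1r. Qed.
Lemma mtens0l s' t' (g : mpb s' t') : mtens (0 : mpb s t) g = 0.
Proof. by apply: (addrI (mtens 0 g)); rewrite -mtensDl !addr0. Qed.
Lemma mtens0r s' t' (f : mpb s t) : mtens f (0 : mpb s' t') = 0.
Proof. by apply: (addrI (mtens f 0)); rewrite -mtensDr !addr0. Qed.
Lemma mtensZl s' t' a (f : mpb s t) (g : mpb s' t') : mtens (a *: f) g = a *: mtens f g.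
Proof. by rewrite -[a *: f]addr0 mtensPl mtens0l addr0. Qed.
Lemma mtensZr s' t' a (f : mpb s t) (g : mpb s' t') : mtens f (a *: g) = a *: mtens f g.
Proof. by rewrite -[a *: g]addr0 mtensPr mtens0r addr0. Qed.
Lemma mtensNl s' t' (f : mpb s t) (g : mpb s' t') : mtens (- f) g = - mtens f g.
Proof. by rewrite -scaleN1r mtensZl scaleN1r. Qed.
Lemma mtensNr s' t' (f : mpb s t) (g : mpb s' t') : mtens f (- g) = - mtens f g.
Proof. by rewrite -scaleN1r mtensZr scaleN1r. Qed.

Lemma mcompDl u (g g' : mpb t u) (f : mpb s t) : mcomp (g + g') f = mcomp g f + mcomp g' f.
Proof. by rewrite -[g]scale1r mcompPl !scale1r. Qed.
Lemma mcompDr u (g : mpb t u) (f f' : mpb s t) : mcomp g (f + f') = mcomp g f + mcomp g f'.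
Proof. by rewrite -[f]scale1r mcompPr !scale1r. Qed.
Lemma mcomp0l u (f : mpb s t) : mcomp (0 : mpb t u) f = 0.
Proof. by apply: (addrI (mcomp 0 f)); rewrite -mcompDl !addr0. Qed.
Lemma mcomp0r u (g : mpb t u) : mcomp g (0 : mpb s t) = 0.
Proof. by apply: (addrI (mcomp g 0)); rewrite -mcompDr !addr0. Qed.
Lemma mcompZl u a (g : mpb t u) (f : mpb s t) : mcomp (a *: g) f = a *: mcomp g f.
Proof. by rewrite -[a *: g]addr0 mcompPl mcomp0l addr0. Qed.
Lemma mcompZr u a (g : mpb t u) (f : mpb s t) : mcomp g (a *: f) = a *: mcomp g f.
Proof. by rewrite -[a *: f]addr0 mcompPr mcomp0r addr0. Qed.
Lemma mcompNl u (g : mpb t u) (f : mpb s t) : mcomp (- g) f = - mcomp g f.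
Proof. by rewrite -scaleN1r mcompZl scaleN1r. Qed.
Lemma mcompNr u (g : mpb t u) (f : mpb s t) : mcomp g (- f) = - mcomp g f.
Proof. by rewrite -scaleN1r mcompZr scaleN1r. Qed.

End Rules.

Lemma mcomp_tens s t u s' t' u' (g : mpb t u) (f : mpb s t) (g' : mpb t' u') (f' : mpb s' t') :
  mcomp (mtens g g') (mtens f f') = mtens (mcomp g f) (mcomp g' f').
Proof.
rewrite -[g]cls_repr -[f]cls_repr -[g']cls_repr -[f']cls_repr -(cls_comp _ (repr g)) -(cls_comp _ (repr g')).
by rewrite -!cls_tens -cls_comp; symmetry; apply/clsP; exact: mpb_interchange.
Qed.

Lemma mdg_juxt s t s' t' (d : diagram s t) (d' : diagram s' t') :
  mtens (mdg delta d) (mdg delta d') = mdg delta (juxt_diagram d d').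
Proof. by rewrite -cls_tens; apply/clsP; exact: mpb_juxt. Qed.

Lemma mid_tens s t : mtens (mid s) (mid t) = mid (s ++ t).
Proof. by rewrite [LHS]mdg_juxt juxt_id. Qed.

Lemma mtensA_heq s1 t1 s2 t2 s3 t3 (f : mpb s1 t1) (g : mpb s2 t2) (h : mpb s3 t3) :
  heq (mtens f (mtens g h)) (mtens (mtens f g) h).
Proof.
exists (catA s1 s2 s3), (catA t1 t2 t3).
rewrite -[f]cls_repr -[g]cls_repr -[h]cls_repr -!cls_tens -cls_cast.
by apply/clsP; exact: mpb_tensA.
Qed.

Lemma mtens_mid0 s t (f : mpb s t) : mtens (mid [::]) f = f.
Proof. by rewrite -[f]cls_repr -cls_tens; apply/clsP; exact: mpb_id_tens. Qed.

Lemma mtens_id0_heq s t (f : mpb s t) : heq (mtens f (mid [::])) f.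
Proof.
exists (cats0 s), (cats0 t); rewrite -[f]cls_repr -cls_tens -cls_cast.
by apply/clsP; exact: mpb_tens_id.
Qed.

Lemma mdg_comp s t u (B : diagram t u) (A : diagram s t) :
  mcomp (mdg delta B) (mdg delta A) = delta ^+ nb_loops A B *: mdg delta (composite A B).
Proof.
by rewrite -cls_comp -clsZ; apply/clsP; apply: mpb_stack; exact: composite_stacking.
Qed.

(** The interchange law: two morphisms side by side may be performed one after the other. *)
Lemma mtens_split s t s' t' (f : mpb s t) (g : mpb s' t') :
  mtens f g = mcomp (mtens f (mid t')) (mtens (mid s) g).
Proof. by rewrite mcomp_tens mcompm1 mcomp1m. Qed.

(** Congruence modulo the tensor ideal generated by Theta. *)
Definition theta_cong s t (f g : mpb s t) : Prop := theta_ideal (f - g).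

Lemma theta_scale s t a (f : mpb s t) : theta_ideal f -> theta_ideal (a *: f).
Proof. by move=> h; rewrite -[_ *: _]addr0; apply: theta_lin => //; exact: theta_zero. Qed.

Lemma theta_add s t (f g : mpb s t) : theta_ideal f -> theta_ideal g -> theta_ideal (f + g).
Proof. by move=> hf hg; rewrite -[f]scale1r; exact: theta_lin. Qed.

Lemma th_refl s t (f : mpb s t) : theta_cong f f.
Proof. by rewrite /theta_cong subrr; exact: theta_zero. Qed.
Lemma th_sym s t (f g : mpb s t) : theta_cong f g -> theta_cong g f.
Proof. by move=> h; rewrite /theta_cong -opprB -scaleN1r; exact: theta_scale. Qed.
Lemma th_trans s t (g f h : mpb s t) : theta_cong f g -> theta_cong g h -> theta_cong f h.
Proof. by move=> h1 h2; rewrite /theta_cong -(subrKA g f (- h)); exact: theta_add. Qed.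
Lemma th_add s t (f f' g g' : mpb s t) : theta_cong f f' -> theta_cong g g' -> theta_cong (f + g) (f' + g').
Proof. by move=> h1 h2; rewrite /theta_cong opprD addrACA; exact: theta_add. Qed.
Lemma th_comp s t u (g g' : mpb t u) (f f' : mpb s t) :
  theta_cong g g' -> theta_cong f f' -> theta_cong (mcomp g f) (mcomp g' f').
Proof.
move=> h1 h2; apply: (@th_trans _ _ (mcomp g' f)).
- rewrite /theta_cong -mcompBl -[mcomp _ _]mcomp1m; exact: theta_comp.
- rewrite /theta_cong -mcompBr -[f - f']mcompm1; exact: theta_comp.
Qed.
Lemma th_tens s t s' t' (f f' : mpb s t) (g g' : mpb s' t') :
  theta_cong f f' -> theta_cong g g' -> theta_cong (mtens f g) (mtens f' g').
Proof.
move=> h1 h2; apply: (@th_trans _ _ (mtens f' g)).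
- by rewrite /theta_cong -mtensNl -mtensDl; exact: theta_tens_r.
- by rewrite /theta_cong -mtensNr -mtensDr; exact: theta_tens_l.
Qed.

End Calculus.

Section ConvertibleAssoc.
Variables (K : fieldType) (delta : K).
Local Notation mpb := (@mpb K delta).

(** When the first word is given letter by letter, both bracketings have convertible
    source and target, and no transport is needed. *)
Lemma mtensA1 a e s2 t2 s3 t3 (f : mpb [:: a] [:: e]) (g : mpb s2 t2) (h : mpb s3 t3) :
  mtens f (mtens g h) = mtens (mtens f g) h.
Proof. exact: (@heq_eq K delta (a :: (s2 ++ s3)) (e :: (t2 ++ t3)) _ _ (mtensA_heq f g h)). Qed.

Lemma mtensA2 a a' e e' s2 t2 s3 t3 (f : mpb [:: a; a'] [:: e; e']) (g : mpb s2 t2) (h : mpb s3 t3) :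
  mtens f (mtens g h) = mtens (mtens f g) h.
Proof.
exact: (@heq_eq K delta [:: a, a' & s2 ++ s3] [:: e, e' & t2 ++ t3] _ _ (mtensA_heq f g h)).
Qed.

Lemma mtensA_cup s2 t2 s3 t3 a e (f : mpb [::] [:: a; e]) (g : mpb s2 t2) (h : mpb s3 t3) :
  mtens f (mtens g h) = mtens (mtens f g) h.
Proof.
exact: (@heq_eq K delta (s2 ++ s3) [:: a, e & t2 ++ t3] _ _ (mtensA_heq f g h)).
Qed.

Lemma mtensA_cap s2 t2 s3 t3 a e (f : mpb [:: a; e] [::]) (g : mpb s2 t2) (h : mpb s3 t3) :
  mtens f (mtens g h) = mtens (mtens f g) h.
Proof.
exact: (@heq_eq K delta [:: a, e & s2 ++ s3] (t2 ++ t3) _ _ (mtensA_heq f g h)).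
Qed.

End ConvertibleAssoc.

Lemma cls_tens3 (K : fieldType) (delta : K) s t s' t' s1 t1 (f : term K s t) (g : term K s' t') (h : term K s1 t1) :
  cls delta (ttens f (ttens g h)) = mtens (cls delta f) (mtens (cls delta g) (cls delta h)).
Proof. by rewrite !cls_tens. Qed.

(** * Snakes, loops and the closed single chord *)

Lemma linear0P (K : fieldType) (U V : lmodType K) (f : U -> V) : linear f -> f 0 = 0.
Proof. by move=> hf; have := linearZP hf 0 0; rewrite !scale0r. Qed.

Lemma oppr_cancel (V : zmodType) (x z : V) : - x - (- z - x) = z.
Proof. by rewrite opprB opprK addKr. Qed.

Lemma strand_diagram_unique (d : diagram [:: Lv] [:: Lv]) : d = id_diagram [:: Lv].
Proof.
apply: diagram_ext => p; rewrite ffunE /=.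
have [h _ _ _] := mate_spec d p.
have all1 (i j : 'I_1) : i = j by rewrite !ord1.
case: p h => i h; case: (d _) h => j //; rewrite (all1 j i) ?eqxx //.
Qed.

Lemma empty_diagram_unique (d : diagram [::] [::]) : d = id_diagram [::].
Proof. by apply: diagram_ext => -[[]|[]]. Qed.

Section Relations.
Variables (K : fieldType) (lambda : K) (M : sp2mod K).
Hypothesis char0 : forall n, n.+1%:R != 0 :> K.
Local Notation wmod := (word_mod M).
Local Notation mpb := (@mpb K (-2)).
Local Notation mid := (@mid K (-2)).
Local Notation mcup := (@mcup K (-2)).
Local Notation mcap := (@mcap K (-2)).
Variable F0 : forall s t, mpb s t -> mod_hom (wmod s) (wmod t).
Hypothesis HF : is_F_MPB F0.
Local Notation F := (F F0).

Let char2 : 2 != 0 :> K := char0 1.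

Lemma loop_neq0 l : (-2) ^+ l != 0 :> K.
Proof. by rewrite expf_neq0 // oppr_eq0. Qed.

Lemma pure_e0_neq0 : pure (basisV K 0) (1 : K^o) != 0 :> wmod [:: Lv].
Proof.
pose f (u : 'cV[K]_2) (r : K^o) : K^o := r * u 0 0.
have bf : bilinear_map f.
  by split=> [u a r r'|r a u u']; rewrite /f ?mxE -[X in _ = X + _]/(a * (_ * _)) -?[a *: r]/(a * r); ring.
apply/negP => /eqP /(congr1 (tens_lift f)); rewrite tens_lift_pure // /f mxE /= mul1r.
rewrite (linear0P (tens_lift_linear bf)).
by move/eqP; rewrite oner_eq0.
Qed.

(** A scalar is read off from its effect on a nonzero vector. Together with the
    uniqueness of the diagram with one strand this determines composites of diagrams
    without counting loops. *)
Lemma strand_scalar (f : mpb [:: Lv] [:: Lv]) a : f = a *: mid [:: Lv] ->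
  F f (pure (basisV K 0) (1 : K^o)) = pure (basisV K 0) (1 : K^o) -> f = mid _.
Proof.
move=> -> ; rewrite F_scale // F_id // => /eqP; rewrite -subr_eq0 -[X in _ - X]scale1r -scalerBl.
rewrite scaler_eq0 (negbTE pure_e0_neq0) orbF subr_eq0 => /eqP ->; exact: scale1r.
Qed.

Lemma mcup_id0 : mtens mcup (mid [::]) = mcup.
Proof. exact: heq_eq (mtens_id0_heq _). Qed.
Lemma mcap_id0 : mtens mcap (mid [::]) = mcap.
Proof. exact: heq_eq (mtens_id0_heq _). Qed.

(** The composite diagram has one strand, so it is a multiple of the identity, and the
    functor shows that the factor is 1. *)
Lemma snake_l : mcomp (mtens mcap (mid [:: Lv])) (mtens (mid [:: Lv]) mcup) = mid [:: Lv].
Proof.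
apply: (@strand_scalar _ ((-2) ^+ nb_loops _ _)).
  rewrite -[mid [:: Lv]]/(mdg _ _) -[mcup]/(mdg _ _) -[mcap]/(mdg _ _) !mdg_juxt mdg_comp.
  by congr (_ *: mdg _ _); exact: strand_diagram_unique.
rewrite F_comp // (@F_strand_l _ _ _ HF Lv [::] [:: Lv; Lv]) F_cup // pureAr -scaleN1r pureZr addrC.
rewrite (F_linear F0) !(@F_cap_tens _ _ _ HF [:: Lv] [:: Lv]) !F_id // !omega_basis !mxE /=.
by rewrite !subr0 scale0r scaler0 add0r scale1r.
Qed.

Lemma snake_r : mcomp (mtens (mid [:: Lv]) mcap) (mtens mcup (mid [:: Lv])) = mid [:: Lv].
Proof.
apply: (@strand_scalar _ ((-2) ^+ nb_loops _ _)).
  rewrite -[mid [:: Lv]]/(mdg _ _) -[mcup]/(mdg _ _) -[mcap]/(mdg _ _) !mdg_juxt mdg_comp.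
  by congr (_ *: mdg _ _); exact: strand_diagram_unique.
rewrite F_comp // (@F_cup_tens _ _ _ HF [:: Lv] [:: Lv]) F_id //.
rewrite -scaleN1r addrC (F_linear F0).
rewrite !(@F_strand_l _ _ _ HF Lv [:: Lv; Lv] [::]).
rewrite -![pure _ (pure (basisV K 0) 1)]/(@pure2 K M Lv Lv _ _) !F_cap // !omega_basis !mxE /=.
rewrite -pureZr subrr sub0r (_ : -1 *: (-1 : K^o) = 1); last by rewrite -[LHS]/(_ * _) mulrNN mulr1.
by rewrite (@pure0r _ _ (triv_mod K)) addr0.
Qed.

(** A composite of diagrams without ends is a power of -2, hence invertible. *)
Lemma loop_scalar : exists2 c : K, c != 0 & mcomp mcap mcup = c *: mid [::].
Proof.
exists ((-2) ^+ nb_loops cup_diagram cap_diagram); first exact: loop_neq0.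
rewrite -[mcup]/(mdg _ _) -[mcap]/(mdg _ _) mdg_comp.
by congr (_ *: mdg _ _); exact: empty_diagram_unique.
Qed.

Local Notation E := (mcomp mcup mcap).
Local Notation X := (@mX K (-2) Lv Lv).
Local Notation th := (@theta_cong K (-2) _ _).

(** The relation Theta solved for the crossing: this is how crossings are eliminated. *)
Lemma th_X : th X (- mid _ - E).
Proof.
have e : X - (- mid _ - E) = Theta (-2 : K).
  rewrite /Theta (_ : 2 / -2 = -1 :> K); last by rewrite invrN mulrN mulfV.
  by rewrite scaleN1r opprK opprB opprK addrA addrAC.
rewrite /theta_cong e; exact: theta_gen.
Qed.

Section Prefix.

(** Tensoring on the left with typed letters keeps all source and target words
    convertible to explicit ones; the same holds for the variants below. *)
Definition pre1 a e (z : mpb [:: a] [:: e]) s t (f : mpb s t) : mpb (a :: s) (e :: t) := mtens z f.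
Definition pre2 a a' e e' (z : mpb [:: a; a'] [:: e; e']) s t (f : mpb s t) :
  mpb [:: a, a' & s] [:: e, e' & t] := mtens z f.
Definition strand a s t (f : mpb s t) : mpb (a :: s) (a :: t) := pre1 (mid [:: a]) f.
Definition cupx s t (f : mpb s t) : mpb s [:: Lv, Lv & t] := mtens mcup f.
Definition capx s t (f : mpb s t) : mpb [:: Lv, Lv & s] t := mtens mcap f.

Lemma pre1_comp a e i (z : mpb [:: e] [:: i]) (z' : mpb [:: a] [:: e]) s t u (g : mpb t u) (f : mpb s t) :
  mcomp (pre1 z g) (pre1 z' f) = pre1 (mcomp z z') (mcomp g f).
Proof. exact: (mcomp_tens z z' g f). Qed.
Lemma pre2_comp a e i a' e' i' (z : mpb [:: e; e'] [:: i; i']) (z' : mpb [:: a; a'] [:: e; e'])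
    s t u (g : mpb t u) (f : mpb s t) :
  mcomp (pre2 z g) (pre2 z' f) = pre2 (mcomp z z') (mcomp g f).
Proof. exact: (mcomp_tens z z' g f). Qed.
Lemma strand_comp a s t u (g : mpb t u) (f : mpb s t) :
  mcomp (strand a g) (strand a f) = strand a (mcomp g f).
Proof. by rewrite /strand pre1_comp mcompm1. Qed.
Lemma strand_id a s : strand a (mid s) = mid (a :: s).
Proof. exact: (mid_tens _ [:: a] s). Qed.
Lemma strand_strand a e s t (f : mpb s t) : strand a (strand e f) = pre2 (mid [:: a; e]) f.
Proof. by rewrite -(strand_id a [:: e]); exact: (mtensA1 (mid [:: a]) (mid [:: e]) f). Qed.
Lemma pre2_nil a a' e e' (z : mpb [:: a; a'] [:: e; e']) : pre2 z (mid [::]) = z.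
Proof. exact: (heq_eq (mtens_id0_heq z)). Qed.
Lemma pre1_nil a e (z : mpb [:: a] [:: e]) : pre1 z (mid [::]) = z.
Proof. exact: (heq_eq (mtens_id0_heq z)). Qed.
Lemma cupx_nil : cupx (mid [::]) = mcup. Proof. exact: mcup_id0. Qed.
Lemma capx_nil : capx (mid [::]) = mcap. Proof. exact: mcap_id0. Qed.
Lemma cupx_comp s t u (g : mpb t u) (f : mpb s t) : mcomp (cupx g) f = cupx (mcomp g f).
Proof. by rewrite -[X in mcomp _ X]mtens_mid0 [LHS](mcomp_tens mcup (mid [::]) g f) mcompm1. Qed.
Lemma capx_comp s t u (g : mpb t u) (f : mpb s t) : mcomp g (capx f) = capx (mcomp g f).
Proof. by rewrite -[X in mcomp X _]mtens_mid0 [LHS](mcomp_tens (mid [::]) mcap g f) mcomp1m. Qed.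
Lemma cupx_pre s t u (g : mpb t u) (f : mpb s t) :
  mcomp (strand Lv (strand Lv g)) (cupx f) = cupx (mcomp g f).
Proof. by rewrite strand_strand [LHS](mcomp_tens (mid [:: Lv; Lv]) mcup g f) mcomp1m. Qed.
Lemma capx_pre s t u (g : mpb t u) (f : mpb s t) :
  mcomp (capx g) (strand Lv (strand Lv f)) = capx (mcomp g f).
Proof. by rewrite strand_strand [LHS](mcomp_tens mcap (mid [:: Lv; Lv]) g f) mcompm1. Qed.
Lemma cup_capx s t u (g : mpb t u) (f : mpb s t) :
  mcomp (cupx g) (capx f) = pre2 (mcomp mcup mcap) (mcomp g f).
Proof. exact: (mcomp_tens mcup mcap g f). Qed.
Lemma cap_cupx s t u (g : mpb t u) (f : mpb s t) :
  mcomp (capx g) (cupx f) = mtens (mcomp mcap mcup) (mcomp g f).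
Proof. exact: (mcomp_tens mcap mcup g f). Qed.

Lemma snake_lx s t u (g : mpb t u) (f : mpb s t) :
  mcomp (capx (strand Lv g)) (strand Lv (cupx f)) = strand Lv (mcomp g f).
Proof.
have -> : capx (strand Lv g) = mtens (mtens mcap (mid [:: Lv])) g.
  exact: (mtensA_cap mcap (mid [:: Lv]) g).
have -> : strand Lv (cupx f) = mtens (mtens (mid [:: Lv]) mcup) f.
  exact: (mtensA1 (mid [:: Lv]) mcup f).
rewrite [LHS](mcomp_tens (mtens mcap (mid [:: Lv])) (mtens (mid [:: Lv]) mcup) g f).
by rewrite snake_l.
Qed.

Lemma snake_rx s t u (g : mpb t u) (f : mpb s t) :
  mcomp (strand Lv (capx g)) (cupx (strand Lv f)) = strand Lv (mcomp g f).
Proof.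
have -> : cupx (strand Lv f) = mtens (mtens mcup (mid [:: Lv])) f.
  exact: (mtensA_cup mcup (mid [:: Lv]) f).
have -> : strand Lv (capx g) = mtens (mtens (mid [:: Lv]) mcap) g.
  exact: (mtensA1 (mid [:: Lv]) mcap g).
rewrite [LHS](mcomp_tens (mtens (mid [:: Lv]) mcap) (mtens mcup (mid [:: Lv])) g f).
by rewrite snake_r.
Qed.

Lemma loopx : exists2 c : K, c != 0 & forall s t u (g : mpb t u) (f : mpb s t),
  mcomp (capx g) (cupx f) = c *: mcomp g f.
Proof.
have [c c0 hc] := loop_scalar; exists c => // s t u g f.
by rewrite cap_cupx hc mtensZl mtens_mid0.
Qed.

Local Notation H := (@mH K (-2) Lm Lv).
(** The chord H between the pole and the first strand. *)
Definition hop s t (f : mpb s t) : mpb [:: Lm, Lv & s] [:: Lm, Lv & t] := pre2 H f.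

Lemma hop_strands s t u (g : mpb t u) (f : mpb s t) :
  mcomp (hop g) (strand Lm (strand Lv f)) = hop (mcomp g f).
Proof. by rewrite strand_strand /hop pre2_comp mcompm1. Qed.
Lemma strands_hop s t u (g : mpb t u) (f : mpb s t) :
  mcomp (strand Lm (strand Lv g)) (hop f) = hop (mcomp g f).
Proof. by rewrite strand_strand /hop pre2_comp mcomp1m. Qed.

Lemma linear_pre a e (z : mpb [:: a] [:: e]) s t : linear (@pre1 a e z s t).
Proof. by move=> r f g; exact: (mtensPr r z f g). Qed.
Lemma hopD s t (f g : mpb s t) : hop (f + g) = hop f + hop g.
Proof. exact: (mtensDr H f g). Qed.
Lemma hopN s t (f : mpb s t) : hop (- f) = - hop f.
Proof. exact: (mtensNr H f). Qed.

(** The chord closed by one loop around the first strand. *)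
Definition Z1 : mpb [:: Lm] [:: Lm] :=
  mcomp (strand Lm mcap) (mcomp (hop (mid [:: Lv])) (strand Lm mcup)).

Lemma pre1_tens a e (z : mpb [:: a] [:: e]) s t s' t' (f : mpb s t) (g : mpb s' t') :
  pre1 z (mtens f g) = mtens (pre1 z f) g :> mpb (a :: (s ++ s')) (e :: (t ++ t')).
Proof. exact: (mtensA1 z f g). Qed.

(** A cap and a cup that enclose the chord on the first strand detach from the rest. *)
Lemma close_tail s t u v (k : mpb u v) (g : mpb t u) (f : mpb s t) :
  mcomp (strand Lm (capx k)) (mcomp (hop (strand Lv g)) (strand Lm (cupx f))) =
  pre1 Z1 (mcomp k (mcomp g f)).
Proof.
have -> : strand Lm (cupx f) = mtens (strand Lm mcup) f by exact: (pre1_tens _ mcup f).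
have -> : strand Lm (capx k) = mtens (strand Lm mcap) k by exact: (pre1_tens _ mcap k).
have -> : hop (strand Lv g) = mtens (hop (mid [:: Lv])) g.
  exact: (mtensA2 H (mid [:: Lv]) g).
rewrite (mcomp_tens (hop (mid [:: Lv])) (strand Lm mcup) g f).
exact: (mcomp_tens (strand Lm mcap) (mcomp (hop (mid [:: Lv])) (strand Lm mcup)) k (mcomp g f)).
Qed.

Lemma hop_nil : hop (mid [::]) = H. Proof. exact: pre2_nil. Qed.

(** The bending relation for the chord contains a crossing. Modulo Theta the crossing is
    minus the identity minus cup-cap; the second term straightens by a double snake to
    the chord itself, and the first leaves the closed chord next to a strand. The two
    copies of the chord cancel. *)
Lemma Z1_strand_theta : theta_ideal (pre1 Z1 (mid [:: Lv])).
Proof.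
(* The bending relation for the chord. *)
have rb : mcomp (strand Lm (capx (mid [:: Lv]))) (mcomp (hop X) (strand Lm (cupx (mid [:: Lv])))) = - H.
  have := proj2 (clsP _ _ _) (mpb_H_bend_r (-2 : K) Lm).
  rewrite clsZ scaleN1r => <-; rewrite /right_bend !cls_comp.
  rewrite (cls_tens3 _ (tid K [:: Lm]) (tcap K) (tid K [:: Lv])).
  rewrite (cls_tens3 _ (tid K [:: Lm]) (tcup K) (tid K [:: Lv])).
  by rewrite (cls_tens _ (tH Lm Lv) (tX K Lv Lv)).
(* The cup-cap part of the crossing: two snakes. *)
have hE : mcomp (strand Lm (capx (mid [:: Lv]))) (mcomp (hop E) (strand Lm (cupx (mid [:: Lv])))) = H.
  have -> : hop E = mcomp (strand Lm (strand Lv mcup)) (mcomp H (strand Lm (strand Lv mcap))).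
    by rewrite -hop_nil hop_strands strands_hop !mcomp1m.
  rewrite -!mcompA mcompA !strand_comp -cupx_nil -capx_nil.
  rewrite -[mid [:: Lv]](strand_id Lv [::]) snake_lx snake_rx !mcomp1m !strand_id.
  by rewrite mcomp1m mcompm1.
have t : th (- H) (- pre1 Z1 (mid [:: Lv]) - H).
  have -> : pre1 Z1 (mid [:: Lv]) = mcomp (strand Lm (capx (mid [:: Lv])))
      (mcomp (hop (mid [:: Lv; Lv])) (strand Lm (cupx (mid [:: Lv])))).
    by rewrite -(strand_id Lv [:: Lv]) close_tail !mcomp1m.
  rewrite -{1}rb -hE.
  have -> : forall A C, - mcomp A (mcomp (hop (mid [:: Lv; Lv])) C) - mcomp A (mcomp (hop E) C) =
      mcomp A (mcomp (hop (- mid [:: Lv; Lv] - E)) C) :> mpb [:: Lm; Lv] [:: Lm; Lv].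
    by move=> A C; rewrite hopD !hopN mcompDl mcompDr !mcompNl !mcompNr.
  apply: th_comp; first exact: th_refl.
  apply: th_comp; last exact: th_refl.
  exact: (th_tens (th_refl H) th_X).
by move: t; rewrite /theta_cong oppr_cancel.
Qed.

(** The strand next to Z_1 is closed into a loop, whose value is invertible. *)
Lemma Z1_theta : theta_ideal Z1.
Proof.
have [c c0 hc] := loopx.
have t : theta_ideal (mcomp (strand Lm (capx (mid [::])))
   (mcomp (mtens (pre1 Z1 (mid [:: Lv])) (mid [:: Lv])) (strand Lm (cupx (mid [::]))))).
  by apply: theta_comp; exact: (theta_tens_r (mid [:: Lv]) Z1_strand_theta).
move: t; have -> : mtens (pre1 Z1 (mid [:: Lv])) (mid [:: Lv]) = pre1 Z1 (mid [:: Lv; Lv]).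
  by rewrite -(strand_id Lv [:: Lv]); symmetry; exact: (pre1_tens Z1 (mid [:: Lv]) (mid [:: Lv])).
rewrite /strand !pre1_comp mcomp1m mcompm1 mcomp1m hc mcomp1m.
rewrite (linearZP (@linear_pre _ _ Z1 [::] [::])) pre1_nil => /(theta_scale c^-1).
by rewrite scalerA mulVf // scale1r.
Qed.

End Prefix.
End Relations.

(** * The quadratic relation of the chord *)

Section Quadratic.
Variables (K : fieldType) (lambda : K) (M : sp2mod K).
Hypothesis char0 : forall n, n.+1%:R != 0 :> K.
Local Notation wmod := (word_mod M).
Local Notation mpb := (@mpb K (-2)).
Local Notation mid := (@mid K (-2)).
Local Notation mcup := (@mcup K (-2)).
Local Notation mcap := (@mcap K (-2)).
Variable F0 : forall s t, mpb s t -> mod_hom (wmod s) (wmod t).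
Hypothesis HF : is_F_MPB F0.
Local Notation E := (mcomp mcup mcap).
Local Notation X := (@mX K (-2) Lv Lv).
Local Notation th := (@theta_cong K (-2) _ _).
Local Notation H := (@mH K (-2) Lm Lv).
Local Notation Z1 := (Z1 K).

Let h : mpb [:: Lm; Lv; Lv] [:: Lm; Lv; Lv] := hop (mid [:: Lv]).
Let x : mpb [:: Lm; Lv; Lv] [:: Lm; Lv; Lv] := strand Lm X.
Let cu : mpb [:: Lm] [:: Lm; Lv; Lv] := strand Lm mcup.
Let ca : mpb [:: Lm; Lv; Lv] [:: Lm] := strand Lm mcap.
Let e := mcomp cu ca.
Let one := mid [:: Lm; Lv; Lv].

Lemma eE : e = strand Lm E. Proof. exact: strand_comp. Qed.

Lemma H_vvE : mH (-2) Lv Lv = X - E.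
Proof.
have := proj2 (clsP _ _ _) (mpb_H_vv (-2 : K)).
by rewrite clsD clsZ scaleN1r cls_comp.
Qed.

Lemma strandD a s t (f g : mpb s t) : strand a (f + g) = strand a f + strand a g.
Proof. exact: (mtensDr (mid [:: a]) f g). Qed.
Lemma strandN a s t (f : mpb s t) : strand a (- f) = - strand a f.
Proof. exact: (mtensNr (mid [:: a]) f). Qed.
Lemma strandZ a r s t (f : mpb s t) : strand a (r *: f) = r *: strand a f.
Proof. exact: (mtensZr r (mid [:: a]) f). Qed.

(** The first four-term relation for the pole and two strands, with the chord between
    the strands replaced by the crossing minus cup-cap. *)
Lemma four_term_mvv : mcomp h (mcomp x (mcomp h x) + (x - e)) =
  mcomp (mcomp x (mcomp h x) + (x - e)) h.
Proof.
have E12 : cls (-2) (tH12 K Lm Lv Lv) = h by exact: (cls_tens _ (tH Lm Lv) (tid K [:: Lv])).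
have Ex : cls (-2) (ttens (tid K [:: Lm]) (tX K Lv Lv)) = x.
  exact: (cls_tens _ (tid K [:: Lm]) (tX K Lv Lv)).
have E13 : cls (-2) (tH13 K Lm Lv Lv) = mcomp x (mcomp h x).
  by rewrite /tH13 !cls_comp Ex; congr (mcomp _ (mcomp _ _)); exact: E12.
have E23 : cls (-2) (tH23 K Lm Lv Lv) = x - e.
  have -> : x - e = strand Lm (mH (-2) Lv Lv) by rewrite H_vvE strandD strandN eE.
  exact: (cls_tens _ (tid K [:: Lm]) (tH Lv Lv)).
have := proj2 (clsP _ _ _) (mpb_H_4term_l (-2 : K) Lm Lv Lv).
by rewrite !cls_comp clsD E12 E13 E23.
Qed.

Lemma th_x : th x (- one - e).
Proof.
have -> : - one - e = strand Lm (- mid _ - E) by rewrite strandD !strandN eE strand_id.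
exact: (th_tens (th_refl (mid [:: Lm])) (th_X char0)).
Qed.

Let P := h + mcomp e h + mcomp h e + mcomp e (mcomp h e) - one - e - e.

(** The chord to the second strand is the chord to the first one conjugated by the
    crossing, and th_x removes the crossings. *)
Lemma th_P : th (mcomp x (mcomp h x) + (x - e)) P.
Proof.
have -> : P = mcomp (- one - e) (mcomp h (- one - e)) + ((- one - e) - e).
  rewrite /P mcompBr !mcompBl !mcompNr !mcompNl ?mcompBr ?mcompBl ?mcompNr ?mcompNl ?mcomp1m ?mcompm1.
  move: h one e (mcomp e h) (mcomp h e) (mcomp e (mcomp h e)) => a1 a2 a3 a4 a5 a6.
  modring [:: a1; a2; a3; a4; a5; a6].
apply: th_add; first by apply: th_comp th_x _; apply: th_comp (th_refl _) th_x.
by apply: th_add th_x (th_refl _).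
Qed.

Let Z2' : mpb [:: Lm] [:: Lm] := mcomp ca (mcomp h (mcomp h cu)).

Lemma ca_h_cu : mcomp ca (mcomp h cu) = Z1.
Proof. by []. Qed.

Lemma theta_compl s t u (g : mpb t u) (f : mpb s t) : theta_ideal f -> theta_ideal (mcomp g f).
Proof. by move=> hf; rewrite -[f]mcompm1; exact: theta_comp. Qed.
Lemma theta_opp s t (f : mpb s t) : theta_ideal f -> theta_ideal (- f).
Proof. by move=> hf; rewrite -scaleN1r; exact: theta_scale. Qed.

(** The four-term relation says that h commutes with P modulo Theta. Applied to a cup,
    all terms containing the closed chord Z_1 vanish, and there remains a quadratic
    equation for h on the cup with Z_2 in its constant term. *)
Lemma quadratic_cup : exists2 c : K, c != 0 &
  theta_ideal (c *: mcomp h (mcomp h cu) - (c + c) *: mcomp h cu - mcomp cu Z2').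
Proof.
have [c c0 hc] := loopx char0; exists c => //.
have cacu : mcomp ca cu = c *: mid [:: Lm].
  rewrite /ca /cu strand_comp -cupx_nil -capx_nil hc strandZ mcompm1 strand_id.
  by [].
have Z1t := Z1_theta char0 HF.
have t1 : th (mcomp h (mcomp P cu)) (mcomp P (mcomp h cu)).
  apply: th_trans (_ : th _ (mcomp (mcomp h (mcomp x (mcomp h x) + (x - e))) cu)) _.
    rewrite -mcompA; exact: (th_comp (th_refl h) (th_comp (th_sym th_P) (th_refl cu))).
  rewrite four_term_mvv -mcompA; exact: (th_comp th_P (th_refl (mcomp h cu))).
have Py y : mcomp P y = mcomp h y + mcomp cu (mcomp ca (mcomp h y)) + mcomp h (mcomp cu (mcomp ca y))
   + mcomp cu (mcomp (mcomp ca (mcomp h cu)) (mcomp ca y)) - y - mcomp cu (mcomp ca y) - mcomp cu (mcomp ca y)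
   :> mpb [:: Lm] [:: Lm; Lv; Lv].
  by rewrite /P !(mcompDl, mcompNl) mcomp1m /e -!mcompA.
move: t1; rewrite /theta_cong !Py ca_h_cu cacu !mcompZr !mcompm1.
rewrite !(mcompDr, mcompNr, mcompZr) -/Z2'.
(* D - D' expresses that h commutes with P on the cup; the difference between it and
   the claim consists of terms through Z_1. *)
set D := (X in theta_ideal (X - _)); set D' := (X in theta_ideal (_ - X)).
move=> t2.
have -> : c *: mcomp h (mcomp h cu) - (c + c) *: mcomp h cu - mcomp cu Z2' = (D - D') +
    (- c *: mcomp h (mcomp cu Z1) + (mcomp cu (mcomp Z1 Z1) - (mcomp cu Z1 + mcomp cu Z1))).
  rewrite /D /D'; move: (mcomp h cu) (mcomp cu Z1) (mcomp cu Z2') (mcomp cu (mcomp Z1 Z1))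
    (mcomp h (mcomp cu Z1)) (mcomp h (mcomp h cu)) => a1 a2 a3 a4 a5 a6.
  modring [:: a1; a2; a3; a4; a5; a6].
have tz : theta_ideal (mcomp cu Z1) by exact: theta_compl.
apply: theta_add => //; apply: theta_add.
  by apply: theta_scale; exact: theta_compl.
apply: theta_add; first by apply: theta_compl; exact: theta_compl.
by apply: theta_opp; exact: theta_add.
Qed.

Lemma Z2E : Z2 (-2 : K) = Z2'.
Proof.
rewrite /Z2' mcompA /Z2 (_ : mtens (mcomp H H) (mid [:: Lv]) = mcomp h h); last first.
  by rewrite /h /hop pre2_comp mcomp1m.
by rewrite -!mcompA.
Qed.

(** Bending the second leg of the cup down turns the equation on the cup into one for the
    chord itself. *)
Lemma quadratic : exists2 c : K, c != 0 & forall s, theta_ideal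
  (c *: mcomp (hop (mid s)) (hop (mid s)) - (c + c) *: hop (mid s) - pre1 (Z2 (-2)) (mid (Lv :: s))
   : mpb [:: Lm, Lv & s] [:: Lm, Lv & s]).
Proof.
have [c c0] := quadratic_cup; rewrite -Z2E; move: (Z2 (-2)) => z t; exists c => // s.
pose tail s' t' (f : mpb s' t') := mtens f (mid (Lv :: s)).
have tailD s' t' (f g : mpb s' t') : tail _ _ (f + g) = tail _ _ f + tail _ _ g by exact: mtensDl.
have tailN s' t' (f : mpb s' t') : tail _ _ (- f) = - tail _ _ f by exact: mtensNl.
have tailZ r s' t' (f : mpb s' t') : tail _ _ (r *: f) = r *: tail _ _ f by exact: mtensZl.
have tailM s' t' u' (g : mpb t' u') (f : mpb s' t') : tail _ _ (mcomp g f) = mcomp (tail _ _ g) (tail _ _ f).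
  by rewrite /tail mcomp_tens mcompm1.
have th1 : tail _ _ h = hop (strand Lv (mid (Lv :: s))).
  by symmetry; exact: (mtensA2 H (mid [:: Lv]) (mid (Lv :: s))).
have tcu : tail _ _ cu = strand Lm (cupx (mid (Lv :: s))).
  by symmetry; exact: (pre1_tens (mid [:: Lm]) mcup (mid (Lv :: s))).
have t2 := theta_tens_r (mid (Lv :: s)) t.
have {t2} := theta_compl (strand Lm (strand Lv (capx (mid s)))) t2.
rewrite -[mtens _ _]/(tail _ _ _) !(tailD, tailN, tailZ, tailM) th1 tcu.
rewrite !(mcompDr, mcompNr, mcompZr).
rewrite -(strand_id K Lv s) !(mcompA (strand Lm _)).
set A := strand Lm (strand Lv (capx (mid s))).
set hh := hop (strand Lv (strand Lv (mid s))); set C := strand Lm (cupx _).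
have Ah : mcomp A hh = mcomp (hop (mid s)) A.
  rewrite /A /hh strands_hop hop_strands mcomp1m.
  by rewrite (strand_id K Lv s) (strand_id K Lv (Lv :: s)) mcompm1.
have AC : mcomp A C = mid [:: Lm, Lv & s].
  by rewrite /A /C strand_comp (snake_rx HF) mcomp1m !strand_id.
rewrite AC Ah -!mcompA (mcompA A) Ah -!mcompA AC !mcompm1 !strand_id.
have -> : mcomp (mid [:: Lm, Lv & s]) (tail _ _ z) = pre1 z (mid (Lv :: s)) by exact: mcomp1m.
by [].
Qed.

(** In the quotient Z_2 is a scalar, so the square of the chord is a combination of the
    chord and the identity. *)
Lemma tlb_quadratic : exists k : K, forall n, tlb_ideal lambda
  (mcomp (hop (mid (nseq n Lv))) (hop (mid (nseq n Lv))) - (2 *: hop (mid (nseq n Lv)) + k *: mid (pole n.+1))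
   : mpb (pole n.+1) (pole n.+1)).
Proof.
have [c c0 t] := quadratic.
(* The value of Z_2 prescribed by the quotient. *)
pose k0 : K := -2 * - (lambda * ((-2 - 2) / 2 - lambda)).
exists (c^-1 * k0) => n; set hh := mcomp _ _; set h1 := hop _.
have t1 := tlb_theta lambda (t (nseq n Lv) : @theta_ideal K (-2) (pole n.+1) (pole n.+1) _).
have t2 := tlb_gen (-2) lambda n.+1.
have z0 : tlb_ideal lambda (0 : mpb (pole n.+1) (pole n.+1)) by apply: tlb_theta; exact: theta_zero.
have t3 := tlb_lin c^-1 t1 (tlb_lin c^-1 t2 z0).
suff e1 (z o a1 a2 : mpb (pole n.+1) (pole n.+1)) :
    a1 - (2 *: a2 + (c^-1 * k0) *: o) =
    c^-1 *: (c *: a1 - (c + c) *: a2 - z) + (c^-1 *: (z - k0 *: o) + 0).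
  by rewrite (e1 (Z2_at (-2) n.+1) (mid (pole n.+1)) hh h1).
have e2 : 2 = c^-1 * (c + c) by rewrite mulrDr mulVf.
rewrite addr0 !scalerBr !scalerA -e2 mulVf // scale1r.
by modring [:: z; o; a1; a2].
Qed.

End Quadratic.

(** * A span stable under the elementary morphisms *)

Section Words.
Variables (K : fieldType) (lambda : K) (M : sp2mod K).
Hypothesis char0 : forall n, n.+1%:R != 0 :> K.
Local Notation wmod := (word_mod M).
Local Notation mpb := (@mpb K (-2)).
Local Notation mid := (@mid K (-2)).
Local Notation mcup := (@mcup K (-2)).
Local Notation mcap := (@mcap K (-2)).
Local Notation X := (@mX K (-2) Lv Lv).
Local Notation th := (@theta_cong K (-2) _ _).
Variable F0 : forall s t, mpb s t -> mod_hom (wmod s) (wmod t).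
Hypothesis HF : is_F_MPB F0.
Local Notation vv n := (nseq n Lv).
Local Notation ideal := (tlb_ideal lambda).

(** The cup whose left leg is in position i. The value is zero when i exceeds n, so that
    the index needs no proof; the same convention holds for capv and Xv. *)
Fixpoint cupv (i n : nat) : mpb (vv n) (vv n.+2) :=
  match i with
  | 0 => cupx (mid (vv n))
  | i'.+1 => match n return mpb (vv n) (vv n.+2) with
             | 0 => 0
             | n'.+1 => strand Lv (cupv i' n')
             end
  end.

Fixpoint capv (i n : nat) : mpb (vv n.+2) (vv n) :=
  match i with
  | 0 => capx (mid (vv n))
  | i'.+1 => match n return mpb (vv n.+2) (vv n) with
             | 0 => 0
             | n'.+1 => strand Lv (capv i' n')
             end
  end.

Fixpoint Xv (i n : nat) : mpb (vv n.+2) (vv n.+2) :=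
  match i with
  | 0 => pre2 X (mid (vv n))
  | i'.+1 => match n return mpb (vv n.+2) (vv n.+2) with
             | 0 => 0
             | n'.+1 => strand Lv (Xv i' n')
             end
  end.

Lemma strand0 a s t : strand a (0 : mpb s t) = 0.
Proof. exact: (@mtens0r K (-2) [:: a] [:: a] s t (mid [:: a])). Qed.

Lemma vvS n : mid (vv n.+1) = strand Lv (mid (vv n)).
Proof. by rewrite strand_id. Qed.

(** The possible results of a cap above a cup, up to scalars. *)
Inductive cap_cup_spec : forall n, mpb (vv n) (vv n) -> Prop :=
| cap_cup_scalar n c : cap_cup_spec (c *: mid (vv n))
| cap_cup_far n i j : @cap_cup_spec n.+2 (mcomp (cupv i n) (capv j n)).

Lemma cap_cup0 n : cap_cup_spec (0 : mpb (vv n) (vv n)).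
Proof. by rewrite -(scale0r (mid (vv n))); exact: cap_cup_scalar. Qed.

Lemma cap_cup_strand n f : cap_cup_spec f -> @cap_cup_spec n.+1 (strand Lv f).
Proof.
case: n f / => [n c|n i j]; first by rewrite strandZ strand_id; exact: (cap_cup_scalar n.+1).
by rewrite -strand_comp; exact: (cap_cup_far n.+1 i.+1 j.+1).
Qed.

(** A cap on a cup is a loop, a snake, or disjoint from it; in the last case the cap can
    be moved below the cup. *)
Lemma cap_cup n i j : cap_cup_spec (mcomp (capv i n) (cupv j n)).
Proof.
elim: n i j => [|n IH] i j.
  case: i j => [|i] [|j] /=; rewrite ?mcomp0l ?mcomp0r; try exact: (cap_cup0 0).
  have [c _ ->] := loopx char0; rewrite mcomp1m; exact: (cap_cup_scalar 0).
case: i j => [|i] [|j].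
- have [c _ hc] := loopx char0; rewrite /= hc mcomp1m; exact: (cap_cup_scalar n.+1).
- case: j => [|j] /=.
    by rewrite [mid (Lv :: vv n)]vvS (snake_lx HF) mcomp1m strand_id -[mid _]scale1r; exact: (cap_cup_scalar n.+1).
  case: n IH => [|n] IH /=; first by rewrite strand0 mcomp0r; exact: (cap_cup0 1).
  by rewrite capx_pre mcomp1m -[X in capx X]mcompm1 -capx_comp; exact: (cap_cup_far n j 0).
- case: i => [|i] /=.
    by rewrite [mid (Lv :: vv n)]vvS (snake_rx HF) mcomp1m strand_id -[mid _]scale1r; exact: (cap_cup_scalar n.+1).
  case: n IH => [|n] IH /=; first by rewrite strand0 mcomp0l; exact: (cap_cup0 1).
  by rewrite cupx_pre mcompm1 -[X in cupx X]mcomp1m -cupx_comp; exact: (cap_cup_far n 0 i).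
- by rewrite /= strand_comp; exact: cap_cup_strand.
Qed.

Lemma th_Xv i n : (i <= n)%N -> th (Xv i n) (- mid (vv n.+2) - mcomp (cupv i n) (capv i n)).
Proof.
elim: i n => [|i IH] n.
  move=> _ /=; rewrite cup_capx mcomp1m.
  have -> : - mid (vv n.+2) - pre2 (mcomp mcup mcap) (mid (vv n)) =
      mtens (- mid [:: Lv; Lv] - mcomp mcup mcap) (mid (vv n)).
    rewrite (mtensDl (- mid [:: Lv; Lv])) !mtensNl; congr (- _ - _).
    by rewrite [RHS](mid_tens _ [:: Lv; Lv] (vv n)).
  exact: (th_tens (th_X char0) (th_refl (mid (vv n)))).
case: n => [//|n] /IH t /=; rewrite strand_comp.
have -> : - mid [:: Lv, Lv, Lv & vv n] - strand Lv (mcomp (cupv i n) (capv i n)) =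
   strand Lv (- mid (vv n.+2) - mcomp (cupv i n) (capv i n)).
  by rewrite strandD !strandN strand_id.
exact: (th_tens (th_refl (mid [:: Lv])) t).
Qed.

Lemma Xv_out i n : (n < i)%N -> Xv i n = 0.
Proof. by elim: i n => [|i IH] [|n] //= /IH ->; rewrite strand0. Qed.

(** The span of the words in cups and dotted cups, a dotted cup being a cup next to the
    pole followed by a chord, modulo the ideal. *)
Inductive spanned : forall n, mpb (pole 0) (pole n) -> Prop :=
| spanned_ideal n f : ideal f -> @spanned n f
| spanned_lin n a f g : spanned f -> spanned g -> @spanned n (a *: f + g)
| spanned_id : @spanned 0 (mid (pole 0))
| spanned_cup n i w : @spanned n w -> @spanned n.+2 (mcomp (strand Lm (cupv i n)) w)
| spanned_dot n w : @spanned n w ->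
    @spanned n.+2 (mcomp (hop (mid (vv n.+1))) (mcomp (strand Lm (cupv 0 n)) w)).

Lemma ideal_compl r s t (g : mpb (pole s) (pole t)) (f : mpb (pole r) (pole s)) :
  ideal f -> ideal (mcomp g f).
Proof. by move=> h; rewrite -[f]mcompm1; exact: tlb_comp. Qed.
Lemma ideal_compr r s t (g : mpb (pole s) (pole t)) (f : mpb (pole r) (pole s)) :
  ideal g -> ideal (mcomp g f).
Proof. by move=> h; rewrite -[mcomp _ _]mcomp1m; exact: tlb_comp. Qed.
Lemma ideal0 r s : ideal (0 : mpb (pole r) (pole s)).
Proof. by apply: tlb_theta; exact: theta_zero. Qed.
Lemma Sw0 n : @spanned n 0. Proof. by apply: spanned_ideal; exact: ideal0. Qed.
Lemma spanned_scale n a f : @spanned n f -> spanned (a *: f).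
Proof. by move=> h; rewrite -[_ *: _]addr0; apply: spanned_lin => //; exact: Sw0. Qed.
Lemma spanned_add n f g : @spanned n f -> spanned g -> spanned (f + g).
Proof. by move=> h1 h2; rewrite -[f]scale1r; exact: spanned_lin. Qed.

(** The chord between the pole and the first strand, zero if there is no strand. *)
Definition hopn n : mpb (pole n) (pole n) :=
  match n return mpb (pole n) (pole n) with 0 => 0 | n'.+1 => hop (mid (vv n')) end.

(** The cap in position i to the right of the pole, zero if there are too few strands. *)
Definition capn i n : mpb (pole n) (pole n.-2) :=
  match n return mpb (pole n) (pole n.-2) with
  | n'.+2 => strand Lm (capv i n') | _ => 0 end.

(** The chord commutes with the cups away from the pole, meeting a cup next to the pole
    it produces a dotted cup, and on a dotted cup the quadratic relation applies. *)
Lemma spanned_h n w : @spanned n w -> spanned (mcomp (hopn n) w).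
Proof.
elim=> {n w}.
- by move=> n f h; apply: spanned_ideal; exact: ideal_compl.
- by move=> n a f g _ IHf _ IHg; rewrite mcompDr mcompZr; exact: spanned_lin.
- by rewrite mcomp0l; exact: Sw0.
- move=> n [|i] w hw IH; first exact: spanned_dot.
  case: n w hw IH => [|n] w hw IH /=; first by rewrite strand0 mcomp0l mcomp0r; exact: Sw0.
  rewrite mcompA [mid _]/(mid (vv n.+2)) hop_strands mcomp1m -[X in hop X]mcompm1 -strands_hop -mcompA.
  exact: (@spanned_cup n.+1 i.+1 _ IH).
- move=> n w hw IH; have [k hk] := tlb_quadratic lambda char0 HF.
  set v := mcomp (strand _ _) w.
  have -> : mcomp (hopn n.+2) (mcomp (hop (mid (vv n.+1))) v) =
    mcomp (mcomp (hopn n.+2) (hopn n.+2) - (2 *: hopn n.+2 + k *: mid (pole n.+2))) v +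
    (2 *: mcomp (hopn n.+2) v + k *: v).
    rewrite mcompBl mcompDl !mcompZl mcomp1m subrK mcompA //.
  apply: spanned_add; first by apply: spanned_ideal; apply: ideal_compr; exact: (hk n.+1).
  by apply: spanned_lin; [exact: spanned_dot|apply: spanned_scale; exact: spanned_cup].
Qed.

Lemma spanned_spec n (f : mpb (vv n) (vv n)) : cap_cup_spec f -> forall w, @spanned n w ->
  (forall i, spanned (mcomp (capn i n) w)) -> spanned (mcomp (strand Lm f) w).
Proof.
case: n f / => [n c|n i j] w hw IH.
  by rewrite strandZ strand_id mcompZl mcomp1m; exact: spanned_scale.
by rewrite -strand_comp -mcompA; apply: spanned_cup; exact: IH.
Qed.

(** A cap on a plain cup is settled by cap_cup. A cap on a dotted cup closes it to Z_1,
    which is zero modulo the ideal; or joins its right leg to the next strand and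
    straightens it, leaving a chord; or passes below it. *)
Lemma spanned_cap n w i : @spanned n w -> spanned (mcomp (capn i n) w).
Proof.
move=> hw; elim: hw i => {n w}.
- by move=> n f h i; apply: spanned_ideal; exact: ideal_compl.
- by move=> n a f g _ IHf _ IHg i; rewrite mcompDr mcompZr; exact: spanned_lin.
- by move=> i; rewrite mcomp0l; exact: Sw0.
- move=> n j w hw IH i; rewrite mcompA strand_comp.
  by apply: spanned_spec => //; exact: cap_cup.
- move=> n w hw IH [|[|i]].
  + rewrite vvS /= !mcompA -(mcompA _ (hop _)) close_tail !mcomp1m.
    apply: spanned_ideal; apply: ideal_compr; apply: tlb_theta.
    exact: (theta_tens_r (mid (vv n)) (Z1_theta char0 HF)).
  + case: n w hw IH => [|n] w hw IH; first by rewrite /= strand0 mcomp0l; exact: Sw0.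
    set c := capv 0 n.
    (* The cap does not touch the strand that carries the chord. *)
    have e1 : mcomp (strand Lm (strand Lv c)) (hop (mid (vv n.+2))) =
        mcomp (hop (mid (vv n))) (strand Lm (strand Lv c)).
      by rewrite strands_hop hop_strands mcompm1 mcomp1m.
    have e2 : mcomp (strand Lm (strand Lv c)) (strand Lm (cupv 0 n.+1)) = mid (pole n.+1).
      rewrite strand_comp [cupv 0 n.+1]/(cupx (mid (vv n.+1))) vvS (snake_rx HF).
      by rewrite mcomp1m !strand_id.
    rewrite [capn _ _]/(strand Lm (strand Lv c)) mcompA e1 -mcompA [X in mcomp _ X]mcompA e2.
    by rewrite mcomp1m; exact: (spanned_h hw).
  + case: n w hw IH => [|[|n]] w hw IH; try by rewrite /= ?strand0 mcomp0l; exact: Sw0.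
    set c := capv i n.
    have e1 : mcomp (strand Lm (strand Lv (strand Lv c))) (hop (mid (vv n.+3))) =
        mcomp (hop (mid (vv n.+1))) (strand Lm (strand Lv (strand Lv c))).
      by rewrite strands_hop hop_strands mcompm1 mcomp1m.
    have e2 : mcomp (strand Lm (strand Lv (strand Lv c))) (strand Lm (cupv 0 n.+2)) =
        mcomp (strand Lm (cupv 0 n)) (strand Lm c).
      rewrite !strand_comp [cupv 0 n.+2]/(cupx (mid (vv n.+2))) [cupv 0 n]/(cupx (mid (vv n))).
      by rewrite cupx_pre cupx_comp mcompm1 mcomp1m.
    rewrite [capn _ _]/(strand Lm (strand Lv (strand Lv c))) mcompA e1 -mcompA [X in mcomp _ X]mcompA e2.
    rewrite -[X in mcomp _ X]mcompA; apply: spanned_dot; exact: IH.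
Qed.

(** Crossings are eliminated by the relation Theta. *)
Lemma spanned_X n w i : @spanned n.+2 w -> spanned (mcomp (strand Lm (Xv i n)) w).
Proof.
move=> hw; case: (leqP i n) => [lin|/Xv_out ->]; last by rewrite strand0 mcomp0l; exact: Sw0.
have t := th_tens (th_refl (mid [:: Lm])) (th_Xv lin).
have {t} t : ideal (strand Lm (Xv i n) - (- mid (pole n.+2) - mcomp (strand Lm (cupv i n)) (strand Lm (capv i n)))).
  have -> : - mid (pole n.+2) - mcomp (strand Lm (cupv i n)) (strand Lm (capv i n)) =
     strand Lm (- mid (vv n.+2) - mcomp (cupv i n) (capv i n)).
    by rewrite strandD !strandN strand_id strand_comp.
  exact: tlb_theta.
rewrite -[strand Lm (Xv i n)](subrK (- mid (pole n.+2) - mcomp (strand Lm (cupv i n)) (strand Lm (capv i n)))).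
rewrite mcompDl; apply: spanned_add; first by apply: spanned_ideal; exact: ideal_compr.
rewrite mcompBl mcompNl mcomp1m -mcompA -scaleN1r; apply: spanned_lin => //.
rewrite -scaleN1r; apply: spanned_scale; apply: spanned_cup; exact: (spanned_cap i hw).
Qed.

(** The span of the words in cups, caps and crossings. *)
Inductive layered : forall n n', mpb (vv n) (vv n') -> Prop :=
| layered_id n : layered (mid (vv n))
| layered_scale n n' c (f : mpb (vv n) (vv n')) : layered f -> layered (c *: f)
| layered_comp n n' n'' (g : mpb (vv n') (vv n'')) (f : mpb (vv n) (vv n')) :
    layered g -> layered f -> layered (mcomp g f)
| layered_cup n i : layered (cupv i n)
| layered_cap n i : layered (capv i n)
| layered_X n i : layered (Xv i n).

Lemma layered_strand n n' (f : mpb (vv n) (vv n')) : layered f -> @layered n.+1 n'.+1 (strand Lv f).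
Proof.
elim=> {n n' f}.
- by move=> n; rewrite strand_id; exact: (layered_id n.+1).
- by move=> n n' c f _ IH; rewrite strandZ; exact: layered_scale.
- by move=> n n' n'' g f _ IHg _ IHf; rewrite -strand_comp; exact: layered_comp IHg IHf.
- by move=> n i; exact: (layered_cup n.+1 i.+1).
- by move=> n i; exact: (layered_cap n.+1 i.+1).
- by move=> n i; exact: (layered_X n.+1 i.+1).
Qed.

Lemma spanned_Lay n n' (f : mpb (vv n) (vv n')) : layered f -> forall w, @spanned n w -> spanned (mcomp (strand Lm f) w).
Proof.
elim=> {n n' f}.
- by move=> n w hw; rewrite strand_id mcomp1m.
- by move=> n n' c f _ IH w hw; rewrite strandZ mcompZl; apply: spanned_scale; exact: IH.
- by move=> n n' n'' g f _ IHg _ IHf w hw; rewrite -strand_comp -mcompA; apply: IHg; exact: IHf.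
- by move=> n i w; exact: spanned_cup.
- by move=> n i w hw; exact: (spanned_cap i hw).
- by move=> n i w; exact: spanned_X.
Qed.

End Words.

(** * Explicit composites of diagrams *)

Section Unjuxt.
Variables (s1 t1 s t : word) (d : diagram (s1 ++ s) (t1 ++ t)) (d1 : diagram s1 t1).
Hypothesis h : forall p, d (embl s t p) = embl s t (d1 p).

Definition right_part (q0 : point s t) (P : point (s1 ++ s) (t1 ++ t)) : point s t :=
  match P with
  | inl i => if @cutp s1 s i is inr k then inl k else q0
  | inr j => if @cutp t1 t j is inr k then inr k else q0
  end.

Lemma right_part_embr q0 q : right_part q0 (embr s1 t1 q) = q.
Proof. by case: q => i /=; rewrite gluepK. Qed.

Lemma right_mateE q : d (embr s1 t1 q) = embr s1 t1 (right_part q (d (embr s1 t1 q))).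
Proof.
have : exists q', d (embr s1 t1 q) = embr s1 t1 q'.
  move: (mate_spec d (embr s1 t1 q)) => [_ dd _ _]; move: dd.
  move: (d (embr s1 t1 q)); apply: emb_cases => p; last by exists p.
  rewrite h => /esym e; exfalso; move: e.
  by case: (d1 p) q => i [] j //= [] e; have := ltn_ord i; rewrite -e ltnNge leq_addr.
by case=> q' ->; rewrite right_part_embr.
Qed.

Lemma right_mateP : is_matching [ffun q => right_part q (d (embr s1 t1 q))].
Proof.
apply: matchingP => q; set q' := right_part q _.
have e : d (embr s1 t1 q) = embr s1 t1 q' by exact: right_mateE.
have [n dd cc sr] := mate_spec d (embr s1 t1 q).
split.
- by apply: contra n => /eqP n; rewrite e n.
- have e2 := right_mateE q'; rewrite -e dd in e2.
  by rewrite -e dd right_part_embr.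
- by rewrite -(colour_embr s1 t1) -e cc colour_embr.
- by rewrite -(same_row_embr s1 t1) -e => /sr; rewrite colour_embr.
Qed.

(** A diagram that preserves a block on its left is a juxtaposition: the partner of a
    point of the right block is again in the right block. *)
Lemma unjuxt : exists d2 : diagram s t, d = juxt_diagram d1 d2.
Proof.
exists (Diagram right_mateP); apply: diagram_ext; apply: emb_cases => p.
  by rewrite ffunE juxt_embl h.
by rewrite ffunE juxt_embr ffunE right_mateE right_part_embr.
Qed.

End Unjuxt.

Section Paths.
Variables (s t u : word) (A : diagram s t) (B : diagram t u).
Local Notation conn := (connect (stack_edge A B)).

Lemma lower_step p : conn (lower u p) (lower u (A p)).
Proof. by apply: connect1; apply/orP; left; apply/existsP; exists p; rewrite !eqxx. Qed.
Lemma upper_step p : conn (upper s p) (upper s (B p)).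
Proof. by apply: connect1; apply/orP; right; apply/existsP; exists p; rewrite !eqxx. Qed.

(** The composite is characterised by connectivity, so exhibiting a path computes it. *)
Lemma composite_path p q : q != p -> conn (outer t p) (outer t q) -> composite A B p = q.
Proof.
move=> n /outer_connect[e|->]; first by rewrite e eqxx in n.
exact: compositeE.
Qed.

(** The four lemmas that follow list the paths that visit the middle row at most twice. *)
Lemma composite_through i k l : A (inl i) = inr k -> B (inl k) = inr l ->
  composite A B (inl i) = inr l.
Proof.
move=> hA hB; apply: composite_path => //.
apply: connect_trans (_ : conn _ (lower u (inr k))) _; first by rewrite -hA; exact: lower_step.
by have := upper_step (inl k); rewrite hB.
Qed.

Lemma composite_top_bottom l k i : B (inr l) = inl k -> A (inr k) = inl i ->
  composite A B (inr l) = inl i.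
Proof.
move=> hB hA; apply: composite_path => //.
apply: connect_trans (_ : conn _ (upper s (inl k))) _; first by rewrite -hB; exact: upper_step.
by have := lower_step (inr k); rewrite hA.
Qed.

Lemma composite_top_top l k k' l' : l' != l -> B (inr l) = inl k -> A (inr k) = inr k' ->
  B (inl k') = inr l' -> composite A B (inr l) = inr l'.
Proof.
move=> n hB hA hB'; apply: composite_path.
  by apply: contra n => /eqP[->].
apply: connect_trans (_ : conn _ (upper s (inl k))) _; first by rewrite -hB; exact: upper_step.
apply: connect_trans (_ : conn _ (lower u (inr k'))) _; first by rewrite -hA; exact: lower_step.
by have := upper_step (inl k'); rewrite hB'.
Qed.

Lemma composite_bottom_bottom i k k' i' : i' != i -> A (inl i) = inr k -> B (inl k) = inl k' ->
  A (inr k') = inl i' -> composite A B (inl i) = inl i'.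
Proof.
move=> n hA hB hA'; apply: composite_path.
  by apply: contra n => /eqP[->].
apply: connect_trans (_ : conn _ (lower u (inr k))) _; first by rewrite -hA; exact: lower_step.
apply: connect_trans (_ : conn _ (upper s (inl k'))) _; first by rewrite -hB; exact: upper_step.
by have := lower_step (inr k'); rewrite hA'.
Qed.

End Paths.

Local Notation vv n := (nseq n Lv).

(** The crossing of the strands i and i + 1 among n + 2 strands. The identity is a filler
    for indices out of range. *)
Fixpoint xdg (i n : nat) : diagram (vv n.+2) (vv n.+2) :=
  match i with
  | 0 => juxt_diagram (crossing_diagram [:: Lv] [:: Lv]) (id_diagram (vv n))
  | i'.+1 => match n return diagram (vv n.+2) (vv n.+2) with
             | 0 => id_diagram _
             | n'.+1 => juxt_diagram (id_diagram [:: Lv]) (xdg i' n')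
             end
  end.

(** The permutation of positions made by xdg i n. *)
Definition swap_at (i k : nat) : nat := if k == i then i.+1 else if k == i.+1 then i else k.

Lemma juxt_bottom s t s' t' (d : diagram s t) (d' : diagram s' t') k l :
  d' (inl k) = inr l -> juxt_diagram d d' (inl (@gluep s s' (inr k))) = inr (@gluep t t' (inr l)).
Proof. by move=> h; rewrite ffunE -[inl _]/(embr s t (inl k)) juxt_embr h. Qed.

Lemma juxt_bottom_l s t s' t' (d : diagram s t) (d' : diagram s' t') k l :
  d (inl k) = inr l -> juxt_diagram d d' (inl (@gluep s s' (inl k))) = inr (@gluep t t' (inl l)).
Proof. by move=> h; rewrite ffunE -[inl _]/(embl s' t' (inl k)) juxt_embl h. Qed.

Lemma crossing_bottom j : exists l, crossing_diagram [:: Lv] [:: Lv] (inl j) = inr l /\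
  val l = swap_at 0 (val j).
Proof.
rewrite ffunE /=; exists (@gluep [:: Lv] [:: Lv] (swap_sum (@cutp [:: Lv] [:: Lv] j))); split=> //.
case: (@cutp [:: Lv] [:: Lv] j) (@cutpK [:: Lv] [:: Lv] j) => j0 <- /=;
  by rewrite (ord1 j0).
Qed.

Lemma xdg_bottom i n k : (i <= n)%N -> exists l, xdg i n (inl k) = inr l /\ val l = swap_at i (val k).
Proof.
elim: i n k => [|i IH] n k.
  move=> _; rewrite -(@cutpK [:: Lv; Lv] (vv n) k).
  case: (@cutp [:: Lv; Lv] (vv n) k) => j.
    have [l [e vl]] := crossing_bottom j; exists (@gluep [:: Lv; Lv] (vv n) (inl l)).
    by split; first exact: (@juxt_bottom_l _ _ _ _ _ (id_diagram (vv n)) j l e).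
  exists (@gluep [:: Lv; Lv] (vv n) (inr j)); split; last by [].
  by apply: (@juxt_bottom _ _ _ _ (crossing_diagram [:: Lv] [:: Lv]) (id_diagram (vv n)) j j); rewrite ffunE.
case: n k => [//|n] k lin; rewrite -(@cutpK [:: Lv] (vv n.+2) k).
case: (@cutp [:: Lv] (vv n.+2) k) => j.
  exists (@gluep [:: Lv] (vv n.+2) (inl j)); split; last by rewrite /= (ord1 j).
  by apply: (@juxt_bottom_l _ _ _ _ (id_diagram [:: Lv]) (xdg i n) j j); rewrite ffunE.
have [l [e vl]] := IH n j lin; exists (@gluep [:: Lv] (vv n.+2) (inr l)).
split; first exact: (@juxt_bottom _ _ _ _ (id_diagram [:: Lv]) (xdg i n) j l e).
rewrite /= !add1n -[nat_of_ord l]/(val l) vl /swap_at !eqSS.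
by case: eqP => // _; case: eqP.
Qed.

Lemma swap_atK i k : swap_at i (swap_at i k) = k.
Proof.
rewrite /swap_at; case: (k =P i) => [->|n1].
  by rewrite eqxx -[i.+1 == i]/(_ == _) (gtn_eqF (ltnSn i)).
case: (k =P i.+1) => [->|n2]; first by rewrite eqxx.
by move/eqP/negbTE: n1 => ->; move/eqP/negbTE: n2 => ->.
Qed.

Lemma swap_at_lt i n k : (i <= n)%N -> (k < n.+2)%N -> (swap_at i k < n.+2)%N.
Proof.
rewrite /swap_at => lin lk; case: ifP => _; first by rewrite !ltnS.
by case: ifP => _ //; rewrite ltnS leqW.
Qed.

Lemma ord_vv n (k : 'I_(size (vv n))) : (val k < n)%N.
Proof. by case: k => k /=; rewrite size_nseq. Qed.

Lemma xdg_top i n k : (i <= n)%N -> exists l, xdg i n (inr k) = inl l /\ val l = swap_at i (val k).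
Proof.
move=> lin.
have lk : (swap_at i (val k) < size (vv n.+2))%N.
  by apply: leq_trans (swap_at_lt lin (ord_vv k)) _; rewrite size_nseq.
exists (Ordinal lk); split=> //; have [l [e vl]] := xdg_bottom (Ordinal lk) lin.
have ek : l = k by apply: val_inj; rewrite vl /= swap_atK.
rewrite ek in e; by rewrite -e; have [_ -> _ _] := mate_spec (xdg i n) (inl (Ordinal lk)).
Qed.

Lemma xdg_involution i n : (i <= n)%N -> composite (xdg i n) (xdg i n) = id_diagram _.
Proof.
move=> lin; apply: diagram_ext.
have b k : composite (xdg i n) (xdg i n) (inl k) = inr k.
  have [l [e vl]] := xdg_bottom k lin; have [m [e' vm]] := xdg_bottom l lin.
  have em : m = k by apply: val_inj; rewrite vm vl swap_atK.
  by apply: composite_through e _; rewrite e' em.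
case=> k; rewrite [RHS]ffunE; first exact: b.
have [_ dd _ _] := mate_spec (composite (xdg i n) (xdg i n)) (inl k).
by rewrite b in dd.
Qed.

(** * Brauer diagrams as words in cups, caps and crossings *)

Section Decomposition.
Variables (K : fieldType).
Hypothesis char0 : forall n, n.+1%:R != 0 :> K.
Local Notation mpb := (@mpb K (-2)).
Local Notation mid := (@mid K (-2)).
Local Notation mdg := (@mdg K (-2) _ _).
Local Notation vv n := (nseq n Lv).
Local Notation layered := (@layered K _ _).

Lemma mdg_xdg i n : (i <= n)%N -> mdg (xdg i n) = Xv K i n.
Proof.
elim: i n => [|i IH] n; first by move=> _; symmetry; exact: (mdg_juxt _ (crossing_diagram [:: Lv] [:: Lv]) (id_diagram (vv n))).
case: n => [//|n] /IH /= <-; symmetry; exact: (mdg_juxt _ (id_diagram [:: Lv]) (xdg i n)).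
Qed.

Lemma Xv_involution i n : (i <= n)%N ->
  exists2 c, c != 0 & mcomp (Xv K i n) (Xv K i n) = c *: mid (vv n.+2).
Proof.
move=> lin; exists ((-2) ^+ nb_loops (xdg i n) (xdg i n)); first exact: loop_neq0.
by rewrite -mdg_xdg // mdg_comp xdg_involution.
Qed.

(** A crossing is invertible up to a nonzero scalar, so it can be removed from the
    diagram that it was composed with. *)
Lemma layered_uncross_r i n n' (f : mpb (vv n.+2) (vv n')) : (i <= n)%N ->
  layered (mcomp f (Xv K i n)) -> layered f.
Proof.
move=> lin h; have [c c0 e] := Xv_involution lin.
have -> : f = c^-1 *: mcomp (mcomp f (Xv K i n)) (Xv K i n).
  by rewrite -mcompA e mcompZr mcompm1 scalerA mulVf // scale1r.
by apply: layered_scale; apply: (layered_comp h); exact: layered_X.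
Qed.

Lemma layered_uncross_l i n n' (f : mpb (vv n') (vv n.+2)) : (i <= n)%N ->
  layered (mcomp (Xv K i n) f) -> layered f.
Proof.
move=> lin h; have [c c0 e] := Xv_involution lin.
have -> : f = c^-1 *: mcomp (Xv K i n) (mcomp (Xv K i n) f).
  by rewrite mcompA e mcompZl mcomp1m scalerA mulVf // scale1r.
by apply: layered_scale; apply: (layered_comp _ h); exact: layered_X.
Qed.

(** If the first strand of the top row ends at position j of the bottom row, a crossing
    moves this end one step to the left; at j = 0 the strand splits off. *)
Lemma layered_through j n n' (d : diagram (vv n.+1) (vv n'.+1)) k :
  (forall d' : diagram (vv n) (vv n'), layered (mdg d')) ->
  d (inr ord0) = inl k -> val k = j -> layered (mdg d).
Proof.
move=> small; elim: j n n' d k small => [|j IH] n n' d k small dk vk.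
  have ek : k = ord0 by exact: val_inj.
  have db : d (inl ord0) = inr ord0 by rewrite -ek -dk; have [_ -> _ _] := mate_spec d (inr ord0).
  rewrite ek in dk.
  have [p|d2 ->] := @unjuxt [:: Lv] [:: Lv] (vv n) (vv n') d (id_diagram [:: Lv]).
    case: p => i; rewrite ffunE (ord1 i) /=.
      have -> : @gluep [:: Lv] (vv n) (inl ord0) = ord0 by exact: val_inj.
      by rewrite db; congr inr; exact: val_inj.
    have -> : @gluep [:: Lv] (vv n') (inl ord0) = ord0 by exact: val_inj.
    by rewrite dk; congr inl; exact: val_inj.
  have -> : mdg (juxt_diagram (id_diagram [:: Lv]) d2) = strand Lv (mdg d2).
    by symmetry; exact: (mdg_juxt _ (id_diagram [:: Lv]) d2).
  by apply: layered_strand; exact: small.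
case: n d k small dk vk => [|n] d k small dk vk.
  by have := ord_vv k; rewrite vk.
have lin : (j <= n)%N by have := ord_vv k; rewrite vk.
(* The crossing of the strands j and j + 1 at the bottom brings the end to position j. *)
have [l [el vl]] := xdg_top k lin.
apply: (layered_uncross_r lin); rewrite -mdg_xdg // mdg_comp; apply: layered_scale.
apply: (IH _ _ _ l small (composite_top_bottom dk el)).
by rewrite vl vk /swap_at eqxx (gtn_eqF (ltnSn j)).
Qed.

(** The same movement for a strand that returns to its own row, until its two ends are
    neighbours and form a cup. *)
Lemma layered_cup_top j n n' (d : diagram (vv n) (vv n'.+2)) k :
  (forall d' : diagram (vv n) (vv n'), layered (mdg d')) ->
  d (inr ord0) = inr k -> val k = j.+1 -> layered (mdg d).
Proof.
move=> small; elim: j d k => [|j IH] d k dk vk.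
  have db : d (inr k) = inr ord0 by rewrite -dk; have [_ -> _ _] := mate_spec d (inr ord0).
  have [p|d2 ->] := @unjuxt [::] [:: Lv; Lv] (vv n) (vv n') d cup_diagram.
    case: p => [[]//|i]; rewrite ffunE /=.
    have [->|->] := ord2P i.
      rewrite (_ : @gluep [:: Lv; Lv] (vv n') (inl 0) = ord0); last exact: val_inj.
      by rewrite dk; congr inr; apply: val_inj; rewrite vk.
    rewrite (_ : @gluep [:: Lv; Lv] (vv n') (inl 1) = k); last by apply: val_inj; rewrite vk.
    by rewrite db; congr inr; exact: val_inj.
  have -> : mdg (juxt_diagram cup_diagram d2) = mcomp (cupv K 0 n') (mdg d2).
    by rewrite /= cupx_comp mcomp1m; symmetry; exact: (mdg_juxt _ cup_diagram d2).
  by apply: layered_comp; [exact: layered_cup|exact: small].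
have lin : (j.+1 <= n')%N.
  by have := ord_vv k; rewrite vk !ltnS.
have [l [el vl]] := xdg_bottom k lin; have [l0 [el0 vl0]] := xdg_bottom ord0 lin.
have e0 : l0 = ord0 by apply: val_inj; rewrite vl0.
rewrite e0 in el0.
have e1 : xdg j.+1 n' (inr ord0) = inl ord0.
  by rewrite -el0; have [_ -> _ _] := mate_spec (xdg j.+1 n') (inl ord0).
have vl' : val l = j.+1 by rewrite vl vk /swap_at eqxx (gtn_eqF (ltnSn _)).
apply: (layered_uncross_l lin); rewrite -mdg_xdg // mdg_comp; apply: layered_scale.
apply: (IH _ l) => //; apply: (composite_top_top _ e1 dk el).
by rewrite -val_eqE vl'.
Qed.

Lemma layered_cap_bottom j n n' (d : diagram (vv n.+2) (vv n')) k :
  (forall d' : diagram (vv n) (vv n'), layered (mdg d')) ->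
  d (inl ord0) = inl k -> val k = j.+1 -> layered (mdg d).
Proof.
move=> small; elim: j d k => [|j IH] d k dk vk.
  have db : d (inl k) = inl ord0 by rewrite -dk; have [_ -> _ _] := mate_spec d (inl ord0).
  have [p|d2 ->] := @unjuxt [:: Lv; Lv] [::] (vv n) (vv n') d cap_diagram.
    case: p => [i|[]//]; rewrite ffunE /=.
    have [->|->] := ord2P i.
      rewrite (_ : @gluep [:: Lv; Lv] (vv n) (inl 0) = ord0); last exact: val_inj.
      by rewrite dk; congr inl; apply: val_inj; rewrite vk.
    rewrite (_ : @gluep [:: Lv; Lv] (vv n) (inl 1) = k); last by apply: val_inj; rewrite vk.
    by rewrite db; congr inl; exact: val_inj.
  have -> : mdg (juxt_diagram cap_diagram d2) = mcomp (mdg d2) (capv K 0 n).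
    by rewrite /= capx_comp mcompm1; symmetry; exact: (mdg_juxt _ cap_diagram d2).
  by apply: layered_comp; [exact: small|exact: layered_cap].
have lin : (j.+1 <= n)%N.
  by have := ord_vv k; rewrite vk !ltnS.
have [l [el vl]] := xdg_top k lin; have [l0 [el0 vl0]] := xdg_bottom ord0 lin.
have e0 : l0 = ord0 by apply: val_inj; rewrite vl0.
rewrite e0 in el0.
have vl' : val l = j.+1 by rewrite vl vk /swap_at eqxx (gtn_eqF (ltnSn _)).
apply: (layered_uncross_r lin); rewrite -mdg_xdg // mdg_comp; apply: layered_scale.
apply: (IH _ l) => //; apply: (composite_bottom_bottom _ el0 dk el).
by rewrite -val_eqE vl'.
Qed.

(** Induction on the number of points, according to the partner of the first point of the
    top row. *)
Lemma layered_diagram n n' (d : diagram (vv n) (vv n')) : layered (mdg d).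
Proof.
have [N] := ubnP (n + n'); elim: N n n' d => // N IH n n' d lN.
case: n' d lN => [|n'] d lN; first case: n d lN => [|n] d lN.
- by rewrite (empty_diagram_unique d); exact: (layered_id K 0).
- case e : (d (inl ord0)) => [k|[]//].
  have k0 : k != ord0.
    by have [+ _ _ _] := mate_spec d (inl ord0); rewrite e; apply: contra => /eqP ->.
  case vk : (val k) k0 => [|j]; first by rewrite -val_eqE vk.
  move=> _; case: n d k lN e vk => [|n] d k lN e vk; first by have := ord_vv k; rewrite vk.
  apply: (layered_cap_bottom _ e vk) => d'; apply: IH.
  by move: lN; rewrite !addSn !ltnS => /ltnW.
- case e : (d (inr ord0)) => [k|k].
    case: n d k lN e => [|n] d k lN e; first by case: k {e}.
    apply: (layered_through _ e erefl) => d'; apply: IH.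
    by move: lN; rewrite addSn addnS !ltnS => /ltnW.
  have k0 : k != ord0.
    by have [+ _ _ _] := mate_spec d (inr ord0); rewrite e; apply: contra => /eqP ->.
  case vk : (val k) k0 => [|j]; first by rewrite -val_eqE vk.
  move=> _; case: n' d k lN e vk => [|n'] d k lN e vk; first by have := ord_vv k; rewrite vk.
  apply: (layered_cup_top _ e vk) => d'; apply: IH.
  by move: lN; rewrite !addnS !ltnS => /ltnW.
Qed.

(** The two pole letters can only be joined to each other, and they stand in the first
    place, so the rest of the diagram is to the right of the pole strand. *)
Lemma pole_diagram n n' (d : diagram (pole n) (pole n')) :
  exists d2, mdg d = strand Lm (mdg d2).
Proof.
have m0 r : nth Lm (pole r) 0 = Lm by [].
have uniqm r (i : 'I_(size (pole r))) : nth Lm (pole r) i = Lm -> i = ord0.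
  move=> h; apply: val_inj; case: i h => [[//|i] lt] /=.
  by rewrite nth_nseq; move: lt; rewrite /= size_nseq ltnS => ->.
have db : d (inl ord0) = inr ord0.
  have [n1 _ cc sr] := mate_spec d (inl ord0); move: cc n1 sr; case: (d (inl ord0)) => k /= cc n1 sr.
    by rewrite (uniqm _ _ cc) eqxx in n1.
  by rewrite (uniqm _ _ cc).
have dt : d (inr ord0) = inl ord0 by rewrite -db; have [_ -> _ _] := mate_spec d (inl ord0).
have [p|d2 ->] := @unjuxt [:: Lm] [:: Lm] (vv n) (vv n') d (id_diagram [:: Lm]).
  case: p => i; rewrite ffunE (ord1 i) /=.
    have -> : @gluep [:: Lm] (vv n) (inl ord0) = ord0 by exact: val_inj.
    by rewrite db; congr inr; exact: val_inj.
  have -> : @gluep [:: Lm] (vv n') (inl ord0) = ord0 by exact: val_inj.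
  by rewrite dt; congr inl; exact: val_inj.
by exists d2; symmetry; exact: (mdg_juxt _ (id_diagram [:: Lm]) d2).
Qed.

End Decomposition.

(** * The span exhausts the morphisms out of the pole *)

Lemma crossing_involution s t :
  composite (crossing_diagram s t) (crossing_diagram t s) = id_diagram (s ++ t).
Proof.
apply: diagram_ext.
have b k : composite (crossing_diagram s t) (crossing_diagram t s) (inl k) = inr k.
  apply: (@composite_through _ _ _ _ _ k (@gluep t s (swap_sum (@cutp s t k))) k); rewrite ffunE //=.
  by rewrite gluepK; case: (@cutp s t k) (cutpK k) => j /= ->.
case=> k; rewrite [RHS]ffunE; first exact: b.
have [_ dd _ _] := mate_spec (composite (crossing_diagram s t) (crossing_diagram t s)) (inl k).
by rewrite b in dd.
Qed.

(** Each pole letter of the bottom row is joined to the only pole letter of the top row. *)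
Lemma pole_letter_unique s n (e : diagram s (pole n)) (i j : nat) :
  (i < size s)%N -> (j < size s)%N -> nth Lm s i = Lm -> nth Lm s j = Lm -> i = j.
Proof.
move=> li lj ci cj.
have H k (lk : (k < size s)%N) : nth Lm s k = Lm -> e (inl (Ordinal lk)) = inr ord0.
  move=> ck; have [_ _ cc sr] := mate_spec e (inl (Ordinal lk)).
  move: cc sr; case: (e _) => r /= cc sr; first by move: (sr isT); rewrite ck.
  congr inr; apply: val_inj; case: r cc {sr} => [[//|r] lr] /=.
  by rewrite nth_nseq ck; move: lr; rewrite /= size_nseq ltnS => ->.
have [_ e1 _ _] := mate_spec e (inl (Ordinal li)); have [_ e2 _ _] := mate_spec e (inl (Ordinal lj)).
by move: e1 e2; rewrite (H i li ci) (H j lj cj) => -> [].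
Qed.

Section Spanning.
Variables (K : fieldType) (lambda : K) (M : sp2mod K).
Hypothesis char0 : forall n, n.+1%:R != 0 :> K.
Local Notation wmod := (word_mod M).
Local Notation mpb := (@mpb K (-2)).
Local Notation mid := (@mid K (-2)).
Local Notation mdg := (@mdg K (-2) _ _).
Variable F0 : forall s t, mpb s t -> mod_hom (wmod s) (wmod t).
Hypothesis HF : is_F_MPB F0.
Local Notation vv n := (nseq n Lv).
Local Notation spanned := (@spanned K lambda).
Local Notation H := (@mH K (-2) Lm Lv).

Lemma spanned_diagram k n (e : diagram (pole k) (pole n)) w : spanned w -> spanned (mcomp (mdg e) w).
Proof.
have [d ->] := pole_diagram K e => hw.
exact: (spanned_Lay char0 HF (layered_diagram char0 d)).
Qed.

(** The words of the category mix the pole with the strands, whereas the span is defined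
    for words with the pole in front. A morphism is tested after every diagram that
    restores that order. *)
Definition reach (s : word) (f : mpb [:: Lm] s) : Prop :=
  forall n (e : diagram s (pole n)), spanned (mcomp (mdg e) f).

Lemma reach_lin s a (f g : mpb [:: Lm] s) : reach f -> reach g -> reach (a *: f + g).
Proof. by move=> hf hg n e; rewrite mcompDr mcompZr; apply: spanned_lin; [exact: hf|exact: hg]. Qed.

Lemma reach0 s : reach (0 : mpb [:: Lm] s).
Proof. by move=> n e; rewrite mcomp0r; exact: Sw0. Qed.

Lemma reach_diagram s t (d : diagram s t) f : reach f -> reach (mcomp (mdg d) f).
Proof.
by move=> hf n e; rewrite mcompA mdg_comp mcompZl; apply: spanned_scale; exact: hf.
Qed.

Definition keeps s t (g : mpb s t) : Prop := forall x, reach x -> reach (mcomp g x).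

Lemma keeps_heq s t s' t' (g : mpb s t) (g' : mpb s' t') : heq g g' -> keeps g -> keeps g'.
Proof. by case=> es [et <-] {g'}; case: s' / es; case: t' / et. Qed.

Lemma keeps_comp s t u (g : mpb t u) (f : mpb s t) : keeps g -> keeps f -> keeps (mcomp g f).
Proof. by move=> hg hf x hx; rewrite -mcompA; apply: hg; exact: hf. Qed.

Lemma keeps_lin s t a (f g : mpb s t) : keeps f -> keeps g -> keeps (a *: f + g).
Proof.
by move=> hf hg x hx; rewrite mcompDl mcompZl; apply: reach_lin; [exact: hf|exact: hg].
Qed.

Lemma keeps0 s t : keeps (0 : mpb s t).
Proof. by move=> x _; rewrite mcomp0l; exact: reach0. Qed.

Lemma keeps_diagram s t (d : diagram s t) : keeps (mdg d).
Proof. by move=> x; exact: reach_diagram. Qed.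

(** A morphism is good if applying it anywhere inside a word preserves reach; this is
    stable under composition and tensor products, hence can be proved on generators. *)
Definition good s t (f : mpb s t) : Prop :=
  forall u w, keeps (mtens (mid u) (mtens f (mid w))).

Lemma good_diagram s t (d : diagram s t) : good (mdg d).
Proof.
move=> u w; rewrite (mdg_juxt _ d (id_diagram w)) (mdg_juxt _ (id_diagram u) _).
exact: keeps_diagram.
Qed.

Lemma good_lin s t a (f g : mpb s t) : good f -> good g -> good (a *: f + g).
Proof. by move=> hf hg u w; rewrite mtensPl mtensPr; apply: keeps_lin. Qed.

Lemma good0 s t : good (0 : mpb s t).
Proof. by move=> u w; rewrite mtens0l mtens0r; exact: keeps0. Qed.

Lemma good_scale s t a (f : mpb s t) : good f -> good (a *: f).
Proof. by move=> hf; rewrite -[_ *: _]addr0; apply: good_lin => //; exact: good0. Qed.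

Lemma good_comp s t u (g : mpb t u) (f : mpb s t) : good g -> good f -> good (mcomp g f).
Proof.
move=> hg hf u' w.
have -> : mtens (mid u') (mtens (mcomp g f) (mid w)) =
  mcomp (mtens (mid u') (mtens g (mid w))) (mtens (mid u') (mtens f (mid w))).
  by rewrite !mcomp_tens !mcomp1m.
by apply: keeps_comp.
Qed.

Lemma good_tens s t s' t' (f : mpb s t) (g : mpb s' t') : good f -> good g -> good (mtens f g).
Proof.
move=> hf hg; rewrite mtens_split; apply: good_comp => u w.
- refine (keeps_heq _ (hf u (t' ++ w))); apply: heq_tens (heq_refl _) _.
  by rewrite -mid_tens; exact: mtensA_heq.
- refine (keeps_heq _ (hg (u ++ s) w)); rewrite -mid_tens.
  apply: heq_trans (heq_sym (mtensA_heq _ _ _)) _; apply: heq_tens (heq_refl _) _.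
  exact: mtensA_heq.
Qed.

(** A diagram to a word with a single pole exists only if the letters in r are all v, and
    then spanned_h applies. *)
Lemma keeps_hop r : keeps (mtens H (mid r)).
Proof.
move=> y hy n e.
have rE : r = vv (size r).
  apply/all_pred1P/allP => a /(nthP Lm)[i li <-] /=.
  case ca : (nth Lm r i) => //; exfalso.
  have := @pole_letter_unique ([:: Lm; Lv] ++ r) n e 0 i.+2; rewrite /= !ltnS ca.
  by move=> /(_ isT li erefl erefl).
move: (size r) rE => k rE; subst r.
have hw : spanned (n := k.+1) (mcomp (mid (pole k.+1)) y) := hy k.+1 (id_diagram (pole k.+1)).
rewrite mcomp1m in hw; exact: (@spanned_diagram k.+1 n e _ (spanned_h char0 HF hw)).
Qed.

Lemma crossing_scalar s t : exists2 c : K, c != 0 &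
  mcomp (mdg (crossing_diagram t s)) (mdg (crossing_diagram s t)) = c *: mid (s ++ t).
Proof.
exists ((-2) ^+ nb_loops (crossing_diagram s t) (crossing_diagram t s)); first exact: loop_neq0.
by rewrite mdg_comp crossing_involution.
Qed.

Lemma slide_H u : mcomp (mdg (crossing_diagram u [:: Lm; Lv])) (mtens (mid u) H) =
  mcomp (mtens H (mid u)) (mdg (crossing_diagram u [:: Lm; Lv])).
Proof.
have := proj2 (clsP _ _ _) (mpb_H_slide_r (-2 : K) u Lm Lv).
by rewrite !cls_comp (cls_tens _ (tid K u) (tH Lm Lv)) (cls_tens _ (tH Lm Lv) (tid K u)).
Qed.

(** A chord in the middle of a word is conjugated to the front by a block crossing, which
    it commutes with by the slide relation. *)
Lemma good_mv : good H.
Proof.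
move=> u w; apply: keeps_heq (heq_sym (mtensA_heq _ _ _)) _.
have [c c0 hc] := crossing_scalar u [:: Lm; Lv].
have -> : mtens (mid u) H = c^-1 *: mcomp (mdg (crossing_diagram [:: Lm; Lv] u))
    (mcomp (mtens H (mid u)) (mdg (crossing_diagram u [:: Lm; Lv]))).
  by rewrite -slide_H mcompA hc mcompZl mcomp1m scalerA mulVf // scale1r.
rewrite mtensZl -[_ *: _]addr0; apply: keeps_lin; last exact: keeps0.
rewrite -[mid w]mcomp1m -mcomp_tens -[mid w in X in mcomp _ X]mcomp1m -mcomp_tens.
apply: keeps_comp; first by rewrite mdg_juxt; exact: keeps_diagram.
apply: keeps_comp; last by rewrite mdg_juxt; exact: keeps_diagram.
refine (keeps_heq _ (@keeps_hop (u ++ w))); rewrite -mid_tens; exact: mtensA_heq.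
Qed.

Lemma good_vm : good (@mH K (-2) Lv Lm).
Proof.
have [c c0 hc] := crossing_scalar [:: Lv] [:: Lm].
have -> : mH (-2) Lv Lm = c^-1 *: mcomp (mdg (crossing_diagram [:: Lm] [:: Lv]))
   (mcomp H (mdg (crossing_diagram [:: Lv] [:: Lm]))).
  have := proj2 (clsP _ _ _) (mpb_H_sym (-2 : K) Lm Lv); rewrite !cls_comp => e.
  rewrite -[X in mcomp _ X]e mcompA [X in mcomp X _]hc.
  by rewrite mcompZl mcomp1m scalerA mulVf // scale1r.
apply: good_scale; apply: good_comp; first exact: good_diagram.
by apply: good_comp; [exact: good_mv|exact: good_diagram].
Qed.

(** Two pole letters in a word leave no diagram to a word with one pole, so there is
    nothing to test. *)
Lemma good_mm (f : mpb [:: Lm; Lm] [:: Lm; Lm]) : good f.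
Proof.
move=> u w x _ n e; exfalso.
have c0 : nth Lm (u ++ ([:: Lm; Lm] ++ w)) (size u) = Lm by rewrite nth_cat ltnn subnn.
have c1 : nth Lm (u ++ ([:: Lm; Lm] ++ w)) (size u).+1 = Lm.
  by rewrite nth_cat ltnNge leqnSn /= subSnn.
have := @pole_letter_unique _ n e (size u) (size u).+1.
have l0 : (size u < size (u ++ [:: Lm; Lm] ++ w))%N by rewrite size_cat -[X in (X < _)%N]addn0 ltn_add2l.
have l1 : ((size u).+1 < size (u ++ [:: Lm; Lm] ++ w))%N by rewrite size_cat -addn1 ltn_add2l.
move=> /(_ l0 l1 c0 c1) /eqP; by rewrite -[X in X == _]addn0 -addn1 eqn_add2l.
Qed.

Lemma good_cls s t (f : term K s t) : good (cls (-2) f).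
Proof.
elim: f => {s t}.
- by move=> s t d; exact: good_diagram.
- case=> [] [].
  + exact: good_mm.
  + exact: good_mv.
  + exact: good_vm.
  + rewrite -[cls _ _]/(mH (-2) Lv Lv) H_vvE -[X in good (X - _)]scale1r.
    apply: good_lin; first exact: good_diagram.
    rewrite -scaleN1r; apply: good_scale; apply: good_comp; exact: good_diagram.
- by move=> s t u g IHg f IHf; rewrite cls_comp; exact: good_comp.
- by move=> s t s' t' f IHf g IHg; rewrite cls_tens; exact: good_tens.
- by move=> s t; exact: good0.
- by move=> s t f IHf g IHg; rewrite clsD -[X in good (X + _)]scale1r; exact: good_lin.
- by move=> s t a f IHf; rewrite clsZ; exact: good_scale.
Qed.

Lemma reach_id : reach (mid [:: Lm]).
Proof. move=> n e; exact: (@spanned_diagram 0 n e _ (spanned_id lambda)). Qed.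

(** Every generator is good, and the identity of the pole is in reach. *)
Lemma pole_span n (f : mpb (pole 0) (pole n)) : spanned f.
Proof.
have h : keeps (mtens (mid [::]) (mtens f (mid [::]))).
  by rewrite -[f]cls_repr; exact: good_cls.
have hf : keeps f by refine (keeps_heq _ h); rewrite mtens_mid0; exact: mtens_id0_heq.
have := hf _ reach_id; rewrite mcompm1 => /(_ n (id_diagram _)).
by rewrite -[mdg _]/(mid _) mcomp1m.
Qed.

End Spanning.

(** * Cap-free normal forms and highest weight vectors *)

Lemma scale_sub (K : fieldType) (V : lmodType K) a (f g x y : V) :
  a *: f + g - (a *: x + y) = a *: (f - x) + (g - y).
Proof. by rewrite scalerBr opprD addrACA. Qed.

Section NormalForm.
Variables (K : fieldType) (lambda : K) (M : sp2mod K).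
Hypothesis char0 : forall n, n.+1%:R != 0 :> K.
Local Notation wmod := (word_mod M).
Local Notation mpb := (@mpb K (-2)).
Local Notation mid := (@mid K (-2)).
Variable F0 : forall s t, mpb s t -> mod_hom (wmod s) (wmod t).
Hypothesis HF : is_F_MPB F0.
Local Notation F := (F F0).
Local Notation vv n := (nseq n Lv).
Local Notation ideal := (tlb_ideal lambda).
Local Notation cupv := (@cupv K).
Local Notation e0 := (basisV K 0).
Local Notation e1 := (basisV K 1).

(** The normal forms of cap-free planar morphisms from k to n strands. The first top strand
    is either the first through strand or the left leg of a cup; in the second case
    bending that leg down gives a morphism with one more strand at the bottom. The
    recursion mirrors the branching of highest weight vectors in hw_coord. *)
Fixpoint noncap n : forall k, mpb (vv k) (vv n) -> Prop :=
  match n return forall k, mpb (vv k) (vv n) -> Prop with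
  | 0 => fun k => match k return mpb (vv k) (vv 0) -> Prop with
         | 0 => fun f => exists c, f = c *: mid (vv 0)
         | k'.+1 => fun f => f = 0
         end
  | n'.+1 => fun k => match k return mpb (vv k) (vv n'.+1) -> Prop with
         | 0 => fun f => exists2 g, @noncap n' 1 g &
                  f = mcomp (strand Lv g) (cupv 0 0)
         | k'.+1 => fun f => exists2 g1, @noncap n' k' g1 & exists2 g, @noncap n' k'.+2 g &
                  f = strand Lv g1 + mcomp (strand Lv g) (cupv 0 k'.+1)
         end
  end.

Lemma noncap0 n k : @noncap n k 0.
Proof.
elim: n k => [|n IH] [|k] //=; first by exists 0; rewrite scale0r.
  by exists 0; rewrite ?strand0 ?mcomp0l.
by exists 0 => //; exists 0; rewrite ?strand0 ?mcomp0l ?addr0.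
Qed.

Lemma noncap_lin n k a (f g : mpb (vv k) (vv n)) : noncap f -> noncap g -> noncap (a *: f + g).
Proof.
elim: n k f g => [|n IH] [|k] f g /=.
- by case=> x -> [y ->]; exists (a * x + y); rewrite scalerDl scalerA.
- by move=> -> ->; rewrite scaler0 addr0.
- case=> f1 hf -> [g1 hg ->]; exists (a *: f1 + g1); first exact: IH.
  by rewrite strandD strandZ mcompDl mcompZl.
- case=> f1 hf1 [f2 hf2 ->] [g1 hg1 [g2 hg2 ->]].
  exists (a *: f1 + g1); first exact: IH.
  exists (a *: f2 + g2); first exact: IH.
  by rewrite !strandD !strandZ mcompDl mcompZl scalerDr addrACA.
Qed.

Lemma noncap_strand n k (f : mpb (vv k) (vv n)) : noncap f -> @noncap n.+1 k.+1 (strand Lv f).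
Proof.
by move=> hf; exists f => //; exists 0; [exact: noncap0|rewrite strand0 mcomp0l addr0].
Qed.

(** A cup added in position 0 is the second case of the recursion with a doubled strand in
    front; a cup in another position acts on the remaining strands. *)
Lemma noncap_cup i n k (f : mpb (vv k) (vv n)) : noncap f -> noncap (mcomp (cupv i n) f).
Proof.
elim: i n k f => [|i IH] n k f hf.
  have e : mcomp (cupv 0 n) f = mcomp (strand Lv (strand Lv f)) (cupv 0 k).
    by rewrite /= cupx_comp cupx_pre mcomp1m mcompm1.
  have h := noncap_strand hf; rewrite e.
  case: k f hf e h => [|k] f hf e h; first by exists (strand Lv f).
  by exists 0; [exact: noncap0|exists (strand Lv f); rewrite ?strand0 ?add0r].
case: n f hf => [|n] f hf; first by rewrite mcomp0l; exact: noncap0.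
rewrite [cupv _ _]/(strand Lv (cupv i n)).
case: k f hf => [|k] f.
  case=> g hg ->; exists (mcomp (cupv i n) g); first exact: IH.
  by rewrite mcompA strand_comp.
case=> g1 hg1 [g hg ->]; exists (mcomp (cupv i n) g1); first exact: IH.
exists (mcomp (cupv i n) g); first exact: IH.
by rewrite mcompDr mcompA !strand_comp.
Qed.

(** The word of j dotted cups, each placed next to the pole in front of the earlier ones. *)
Fixpoint dots (j : nat) : mpb (pole 0) (pole j.*2) :=
  match j return mpb (pole 0) (pole j.*2) with
  | 0 => mid (pole 0)
  | j'.+1 => mcomp (hop (mid (vv (j'.*2).+1))) (mcomp (strand Lm (cupv 0 j'.*2)) (dots j'))
  end.

Definition dot_sum n (f : forall j, mpb (vv j.*2) (vv n)) (J : nat) : mpb (pole 0) (pole n) :=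
  \sum_(j < J) mcomp (strand Lm (f j)) (dots j).

(** Up to the ideal, a combination of cap-free morphisms applied to stacks of dotted cups.
    Truncations are allowed from some point on, so that two normal forms can be added
    without comparing lengths. *)
Definition normal n (w : mpb (pole 0) (pole n)) : Prop :=
  exists2 f : forall j, mpb (vv j.*2) (vv n), forall j, noncap (f j) &
  exists J, forall J', (J <= J')%N -> ideal (w - dot_sum f J').

Lemma mcomp_sumr s t u n (g : mpb t u) (f : 'I_n -> mpb s t) :
  mcomp g (\sum_i f i) = \sum_i mcomp g (f i).
Proof.
elim: n f => [|n IH] f; first by rewrite !big_ord0 mcomp0r.
by rewrite !big_ord_recr /= mcompDr IH.
Qed.

(** A cup is absorbed by the cap-free part. A dotted cup is slid below the cap-free part,
    which moves two strands to the right. *)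
Lemma spanned_normal n w : @spanned K lambda n w -> normal w.
Proof.
elim=> {n w}.
- move=> n f h; exists (fun=> 0) => [j|]; first exact: noncap0.
  exists 0%N => J _; rewrite /dot_sum big1 ?subr0 // => j _.
  by rewrite strand0 mcomp0l.
- move=> n a f g _ [f' hf [J hJ]] _ [g' hg [J' hJ']].
  exists (fun j => a *: f' j + g' j) => [j|]; first exact: noncap_lin.
  exists (maxn J J') => N; rewrite geq_max => /andP[h1 h2].
  have -> : a *: f + g - dot_sum (fun j => a *: f' j + g' j) N =
      a *: (f - dot_sum f' N) + (g - dot_sum g' N).
    have -> : dot_sum (fun j => a *: f' j + g' j) N = a *: dot_sum f' N + dot_sum g' N.
      rewrite /dot_sum scaler_sumr -big_split; apply: eq_bigr => j _.
      by rewrite strandD strandZ mcompDl mcompZl.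
    exact: scale_sub.
  by apply: tlb_lin; [exact: hJ|exact: hJ'].
- exists (fun j => match j return mpb (vv j.*2) (vv 0) with 0 => mid (vv 0) | _ => 0 end) => [[|j]|].
  + by exists 1; rewrite scale1r.
  + by [].
  + exists 1%N => -[//|J] _; rewrite /dot_sum big_ord_recl big1 ?addr0 => [|j _]; last first.
      by rewrite strand0 mcomp0l.
    by rewrite strand_id mcomp1m subrr; exact: ideal0.
- move=> n i w _ [f hf [J hJ]]; exists (fun j => mcomp (cupv i n) (f j)) => [j|]; first exact: noncap_cup.
  exists J => N /hJ h.
  have -> : dot_sum (fun j => mcomp (cupv i n) (f j)) N = mcomp (strand Lm (cupv i n)) (dot_sum f N).
    by rewrite /dot_sum mcomp_sumr; apply: eq_bigr => j _; rewrite mcompA strand_comp.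
  by rewrite -mcompBr; exact: (ideal_compl _ h).
- move=> n w _ [f hf [J hJ]].
  exists (fun j => match j return mpb (vv j.*2) (vv n.+2) with
     | 0 => 0 | j'.+1 => strand Lv (strand Lv (f j')) end) => [[|j]|].
  + exact: noncap0.
  + by do 2!apply: noncap_strand.
  + exists J.+1 => -[//|N] /hJ h.
    rewrite /dot_sum big_ord_recl strand0 mcomp0l add0r.
    have -> : \sum_(i < N) mcomp (strand Lm (strand Lv (strand Lv (f i)))) (dots i.+1) =
      mcomp (hop (mid (vv n.+1))) (mcomp (strand Lm (cupv 0 n)) (dot_sum f N)).
      rewrite /dot_sum !mcomp_sumr; apply: eq_bigr => j _ /=.
      rewrite !mcompA; congr (mcomp _ _).
      rewrite strands_hop mcompm1 -mcompA strand_comp cupx_comp mcomp1m.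
      have -> : cupx (f j) = mcomp (strand Lv (strand Lv (f j))) (cupx (mid (vv j.*2))).
        by rewrite cupx_pre mcompm1.
      by rewrite -strand_comp mcompA hop_strands mcomp1m.
    rewrite -!mcompBr.
    exact: (@ideal_compl K lambda 0 n.+2 n.+2 (hop (mid (vv n.+1))) _
      (@ideal_compl K lambda 0 n n.+2 (strand Lm (cupv 0 n)) _ h)).
Qed.

Lemma pole_normal n (w : mpb (pole 0) (pole n)) : normal w.
Proof. by apply: spanned_normal; exact: (pole_span lambda char0 HF). Qed.

(** The vector e_0 tensored k times, of weight k. *)
Fixpoint top_vec (k : nat) : wmod (vv k) :=
  match k return wmod (vv k) with 0 => (1 : K^o) | k'.+1 => pure e0 (top_vec k') end.

Lemma coord_bilinear (W : lmodType K) i : bilinear_map (fun (u : 'cV[K]_2) (z : W) => u i 0 *: z).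
Proof.
split=> [u a z z'|z a u u'].
  by rewrite scalerDr !scalerA mulrC.
by rewrite !mxE scalerDl scalerA.
Qed.

(** The component along the first tensor factor. *)
Definition coord n i : wmod (vv n.+1) -> wmod (vv n) := tens_lift (fun (u : 'cV[K]_2) (z : wmod (vv n)) => u i 0 *: z).

Lemma coord_linear n i : linear (@coord n i).
Proof. exact: tens_lift_linear (coord_bilinear _ i). Qed.

Lemma coord_pure n i u z : @coord n i (pure u z) = u i 0 *: z.
Proof. exact: tens_lift_pure (coord_bilinear _ i). Qed.

Lemma coord_basis n (z : wmod (vv n)) :
  [/\ coord 0 (pure e0 z) = z, coord 1 (pure e0 z) = 0, coord 0 (pure e1 z) = 0
    & coord 1 (pure e1 z) = z].
Proof. by rewrite !coord_pure !mxE /= !scale1r !scale0r. Qed.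

Lemma coord00 n (z : wmod (vv n)) : coord 0 (pure e0 z) = z. Proof. by have [] := coord_basis z. Qed.
Lemma coord10 n (z : wmod (vv n)) : coord 1 (pure e0 z) = 0. Proof. by have [] := coord_basis z. Qed.
Lemma coord11 n (z : wmod (vv n)) : coord 1 (pure e1 z) = z. Proof. by have [] := coord_basis z. Qed.

Lemma coordE n (z : wmod (vv n.+1)) : z = pure e0 (coord 0 z) + pure e1 (coord 1 z).
Proof.
have l : linear (fun z : wmod (vv n.+1) => pure e0 (coord 0 z) + pure e1 (coord 1 z) : wmod (vv n.+1)).
  by move=> a x y; rewrite !coord_linear !pureDr scalerDr addrACA.
move: z; apply: (@tens_extP K 'cV[K]_2 (wmod (vv n)) _ _ _ (fun _ _ _ => erefl) l) => u z.
by rewrite !coord_pure !pureZr -!pureZl -pureAl -cV_basis.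
Qed.

Lemma F_strand_cupv n k (g : mpb (vv k.+1) (vv n)) z :
  F (mcomp (strand Lv g) (cupv 0 k)) z = pure e1 (F g (pure e0 z)) - pure e0 (F g (pure e1 z)).
Proof.
rewrite F_comp // [cupv 0 k]/(cupx (mid (vv k))) (@F_cup_tens _ _ _ HF (vv k) (vv k)) F_id //.
rewrite -[X in F (strand _ _) (_ + X)]scaleN1r addrC (F_linear F0).
by rewrite !(@F_strand_l _ _ _ HF Lv (vv k.+1) (vv n)) scaleN1r addrC.
Qed.

Lemma coord_sub n i (x y : wmod (vv n.+1)) : coord i (x - y) = coord i x - coord i y.
Proof. by rewrite -scaleN1r addrC coord_linear scaleN1r addrC. Qed.

(** Of the two terms of a cup, the coordinate along e_1 in the first factor keeps one. *)
Lemma coord_step n k (g : mpb (vv k.+1) (vv n)) z :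
  coord 1 (F (mcomp (strand Lv g) (cupv 0 k)) z) = F g (pure e0 z).
Proof.
rewrite F_strand_cupv coord_sub.
have [_ _ _ ->] := coord_basis (F g (pure e0 z)); have [_ -> _ _] := coord_basis (F g (pure e1 z)).
by rewrite subr0.
Qed.

Lemma coord0 n i : coord i (0 : wmod (vv n.+1)) = 0.
Proof. exact: linear0P (@coord_linear n i). Qed.

(** The coordinate along e_1 in the first factor isolates the part with a cup, and then the
    coordinate along e_0 the part with a through strand. *)
Lemma noncap_inj n k (f : mpb (vv k) (vv n)) : noncap f -> F f (top_vec k) = 0 -> f = 0.
Proof.
elim: n k f => [|n IH] [|k] f.
- case=> a ->; rewrite F_scale // F_id // -[_ *: _]/(a * 1) mulr1 => ->; exact: scale0r.
- by [].
- case=> g hg -> h.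
  have g0 : g = 0 by apply: IH => //; rewrite -[RHS](coord0 _ 1) -h coord_step.
  by rewrite g0 strand0 mcomp0l.
- case=> g1 hg1 [g hg ->]; rewrite F_add // => h.
  have e : F (strand Lv g1) (top_vec k.+1) = pure e0 (F g1 (top_vec k)).
    exact: (@F_strand_l _ _ _ HF Lv (vv k) (vv n)).
  have g0 : g = 0.
    apply: IH => //; move/(congr1 (coord 1)): h; rewrite (linearDP (@coord_linear _ _)).
    by rewrite coord_step e coord0 => <-; have [_ -> _ _] := coord_basis (F g1 (top_vec k)); rewrite add0r.
  rewrite g0 strand0 mcomp0l addr0; move: h; rewrite g0 strand0 mcomp0l F_zero // addr0 e.
  move/(congr1 (coord 0)); have [-> _ _ _] := coord_basis (F g1 (top_vec k)).
  by rewrite coord0 => /(IH _ _ hg1) ->; rewrite strand0.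
Qed.

Lemma act_pure a s A (u : letter_mod M a) (z : wmod s) :
  act (wmod (a :: s)) A (pure u z) = pure (act _ A u) z + pure u (act _ A z).
Proof. exact: (@tens_actE K (letter_mod M a) (wmod s)). Qed.

Lemma act_strand n A (z : wmod (vv n)) i :
  act (wmod (vv n.+1)) A (pure (basisV K i) z) = pure (A *m basisV K i) z + pure (basisV K i) (act _ A z).
Proof. exact: (@act_pure Lv). Qed.

Lemma top_vec_hw k : highest_weight_vector k%:R (top_vec k : wmod (vv k)).
Proof.
have [[h0 h1 x0 x1] _] := natural_act K.
elim: k => [|k [IHx IHh]]; first by split=> //=; rewrite scale0r.
split; rewrite act_strand ?x0 ?h0; first by rewrite pure0l IHx pure0r add0r.
by rewrite IHh pureZr -natr1 addrC scalerDl scale1r.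
Qed.

(** Each tensor factor can be lowered only once. *)
Lemma y_nilpotent n (z : wmod (vv n)) : iter n.+1 (act (wmod (vv n)) (sp2y K)) z = 0.
Proof.
have [_ [y0 y1]] := natural_act K.
elim: n z => [|n IH] z //.
have e_1 j (w : wmod (vv n)) : iter j (act (wmod (vv n.+1)) (sp2y K)) (pure e1 w) =
    pure e1 (iter j (act (wmod (vv n)) (sp2y K)) w).
  by elim: j => [//|j IHj]; rewrite !iterS IHj act_strand y1 pure0l add0r.
have e_0 j (w : wmod (vv n)) : iter j (act (wmod (vv n.+1)) (sp2y K)) (pure e0 w) =
    pure e0 (iter j (act (wmod (vv n)) (sp2y K)) w) +
    j%:R *: pure e1 (iter j.-1 (act (wmod (vv n)) (sp2y K)) w).
  elim: j => [|j IHj]; first by rewrite scale0r addr0.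
  rewrite !iterS IHj (linearDP (linear_prop _)) (linearZP (linear_prop _)) !act_strand y0 y1.
  rewrite pure0l add0r -[j.+1.-1]/j; case: j {IHj} => [|j].
    by rewrite scale0r addr0 scale1r addrC.
  by rewrite -[j.+1.-1]/j -iterS -[X in X + _ + _]scale1r addrAC -scalerDl nat1r addrC.
have lit j (w w' : wmod (vv n.+1)) : iter j (act (wmod (vv n.+1)) (sp2y K)) (w + w') =
   iter j (act _ (sp2y K)) w + iter j (act _ (sp2y K)) w'.
  by elim: j => [//|j IHj]; rewrite !iterS IHj (linearDP (linear_prop _)).
rewrite (coordE z) lit e_1 e_0 -[n.+2.-1]/n.+1 [iter n.+2 _ (coord 0 z)]iterS [iter n.+2 _ (coord 1 z)]iterS.
by rewrite !IH !(linear0P (linear_prop _)) !pure0r scaler0 !addr0.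
Qed.

(** Otherwise y would act injectively on the powers y^j u, the scalars of act_x_ypow being
    nonzero for a negative weight, against y_nilpotent. *)
Lemma hw_neg n k (u : wmod (vv n)) : highest_weight_vector (- k.+1%:R) u -> u = 0.
Proof.
move=> hu; suff H j : iter j (act (wmod (vv n)) (sp2y K)) u = 0 -> u = 0 by exact: (H n.+1 (y_nilpotent u)).
elim: j => // j IH hj; apply: IH.
have := act_x_ypow hu j.+1; rewrite /ypow hj linear0 /= => /esym/eqP.
rewrite scaler_eq0 mulf_eq0 -opprD -natrD addSn oppr_eq0 !(negbTE (char0 _)) /=.
by move/eqP.
Qed.

(** The branching rule for the tensor product with the natural module: of
    u = e_0 u_0 + e_1 u_1 the vector u_1 is a highest weight vector of weight c + 1, and
    if it vanishes so is u_0, of weight c - 1. *)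
Lemma hw_coord n (c : K) (u : wmod (vv n.+1)) : highest_weight_vector c u ->
  highest_weight_vector (c + 1) (coord 1 u) /\
  (coord 1 u = 0 -> highest_weight_vector (c - 1) (coord 0 u)).
Proof.
have [[h0 h1 x0 x1] _] := natural_act K.
set u0 := coord 0 u; set u1 := coord 1 u.
rewrite /highest_weight_vector (coordE u) -/u0 -/u1.
rewrite !(linearDP (linear_prop (act (wmod (vv n.+1)) _))) !act_strand h0 h1 x0 x1.
rewrite pure0l add0r scalerDr => -[hx hh].
have x1' : act _ (sp2x K) u1 = 0.
  move/(congr1 (coord 1)): hx; rewrite !(linearDP (@coord_linear _ _)) coord0.
  by rewrite !coord10 coord11 !add0r.
have hh1 : act _ (sp2h K) u1 = (c + 1) *: u1.
  move/(congr1 (coord 1)): hh; rewrite !(linearDP (@coord_linear _ _)) !(linearZP (@coord_linear _ _)).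
  have -> : pure (- e1) u1 = -1 *: pure e1 u1 :> wmod (vv n.+1) by rewrite -(scaleN1r e1) pureZl.
  rewrite (linearZP (@coord_linear _ _)).
  rewrite !coord10 !coord11.
  rewrite scaler0 !add0r scaleN1r => e.
  by rewrite -[LHS](addKr (- u1)) opprK e addrC scalerDl scale1r.
split=> // z1; rewrite z1 !(linear0P (linear_prop (act (wmod (vv n)) _))) !pure0r !addr0 in hx hh.
rewrite scaler0 addr0 in hh.
split.
  by move/(congr1 (coord 0)): hx; rewrite coord0 coord00.
move/(congr1 (coord 0)): hh; rewrite (linearDP (@coord_linear _ _)) (linearZP (@coord_linear _ _)).
rewrite !coord00.
by move=> e; rewrite -[LHS](addKr u0) e addrC scalerBl scale1r.
Qed.

Lemma F_hw s t c (f : mpb s t) z : highest_weight_vector c z -> highest_weight_vector c (F f z).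
Proof.
by case=> hx hh; split; rewrite -F_act ?sp2x_mem ?sp2h_mem // ?hx ?hh ?F_linear0 // (linearZP (F_linear F0 f)).
Qed.

Lemma hw_sub (N : sp2mod K) c (x y : N) : highest_weight_vector c x -> highest_weight_vector c y ->
  highest_weight_vector c (x - y).
Proof. by case=> hx hh [hx' hh']; split; rewrite linearB ?hx ?hx' ?hh ?hh' ?subr0 ?scalerBr. Qed.

(** The component u_1 is reached by the induction hypothesis and lifted by a cup. After
    subtracting the result, the component u_0 alone is left and is reached by a through
    strand. For k = 0 it would have weight -1 and is zero by hw_neg. *)
Lemma noncap_surj n k (u : wmod (vv n)) : highest_weight_vector k%:R u ->
  exists2 f, @noncap n k f & F f (top_vec k) = u.
Proof.
elim: n k u => [|n IH] k u hu.
  case: k hu => [|k] [_ /= hh].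
    exists ((u : K) *: mid (vv 0)); first by exists (u : K).
    by rewrite F_scale // F_id // -[_ *: _]/(_ * _) mulr1.
  exists 0 => //; rewrite F_zero //.
  by move/esym/eqP: hh; rewrite scaler_eq0 (negbTE (char0 k)) => /eqP ->.
have [h1 h0] := hw_coord hu; rewrite natr1 in h1.
have [g hg eg] := IH k.+1 _ h1.
(* The cup part has u_1 as its second component, so d lies in e_0 (x) W. *)
pose d := u - F (mcomp (strand Lv g) (cupv 0 k)) (top_vec k).
have hd : highest_weight_vector k%:R d by apply: hw_sub => //; apply: F_hw; exact: top_vec_hw.
have d1 : coord 1 d = 0 by rewrite /d coord_sub coord_step -[pure e0 _]/(top_vec k.+1) eg subrr.
have dE : d = pure e0 (coord 0 d) by rewrite {1}(coordE d) d1 pure0r addr0.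
have [_ /(_ d1) hd0] := hw_coord hd.
have du : d + F (mcomp (strand Lv g) (cupv 0 k)) (top_vec k) = u by rewrite subrK.
case: k u hu h1 h0 g hg eg d hd d1 dE hd0 du => [|k] u hu h1 h0 g hg eg d hd d1 dE hd0 du.
  exists (mcomp (strand Lv g) (cupv 0 0)); first by exists g.
  rewrite sub0r in hd0; have := hw_neg (k := 0) hd0 => z0.
  by move: du; rewrite dE z0 pure0r add0r.
rewrite -natr1 addrK in hd0; have [g1 hg1 eg1] := IH k (coord 0 d) hd0.
exists (strand Lv g1 + mcomp (strand Lv g) (cupv 0 k.+1)); first by exists g1 => //; exists g.
by rewrite F_add // (@F_strand_l _ _ _ HF Lv (vv k) (vv n)) eg1 -dE.
Qed.

End NormalForm.

(** * Morphisms out of the bare pole *)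

Section PoleZero.
Variables (K : fieldType) (lambda : K) (M : sp2mod K).
Hypothesis char0 : forall n, n.+1%:R != 0 :> K.
Variables (c : mod_hom M (verma_model lambda)) (b : mod_hom (verma_model lambda) M).
Hypotheses (cK : cancel c b) (bK : cancel b c).
Local Notation wmod := (word_mod M).
Local Notation mpb := (@mpb K (-2)).
Local Notation mid := (@mid K (-2)).
Variable F0 : forall s t, mpb s t -> mod_hom (wmod s) (wmod t).
Hypothesis HF : is_F_MPB F0.
Local Notation F := (F F0).
Local Notation vv n := (nseq n Lv).
Local Notation ideal := (tlb_ideal lambda).
Local Notation cupv := (@cupv K).
Local Notation e0 := (basisV K 0).
Local Notation e1 := (basisV K 1).
Local Notation noncap := (@noncap K _ _).
Local Notation dots := (@dots K).
Local Notation top_vec := (@top_vec K M).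

(** The coefficient of y^l v in the tensor factor M. It is the filtration by this degree
    that separates the numbers of dotted cups. *)
Definition height (W : lmodType K) (l : nat) : tens M W -> W :=
  tens_lift (fun (u : M) (z : W) => (c u : {poly K})`_l *: z).

Lemma height_bilinear (W : lmodType K) l :
  bilinear_map (fun (u : M) (z : W) => (c u : {poly K})`_l *: z).
Proof.
split=> [u a z z'|z a u u']; first by rewrite scalerDr !scalerA mulrC.
by rewrite mod_homP coefD coefZ scalerDl scalerA.
Qed.

Lemma height_linear (W : lmodType K) l : linear (@height W l).
Proof. exact: tens_lift_linear (height_bilinear W l). Qed.

Lemma height_pure (W : lmodType K) l u (z : W) : height l (pure u z) = (c u : {poly K})`_l *: z.
Proof. exact: tens_lift_pure (height_bilinear W l). Qed.

Lemma c_act A u : A \in sp2 (K:=K) -> c (act M A u) = verma_act_fun lambda A (c u).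
Proof. by move=> hA; rewrite mfun_act. Qed.

Lemma c_h u l : (c (act M (sp2h K) u) : {poly K})`_l = (lambda - l.*2%:R) * (c u : {poly K})`_l.
Proof.
rewrite c_act ?sp2h_mem // /verma_act_fun !mxE /= !(coefD, coefN, coefZ, coefXM, coef_deriv).
case: l => [|l] /=; first by rewrite -[0.*2]/0%N; ring.
by rewrite -mulr_natr -[in RHS]muln2 natrM; ring.
Qed.

Lemma c_x u l : (c (act M (sp2x K) u) : {poly K})`_l =
  (l.+1%:R * (lambda - l%:R)) * (c u : {poly K})`_l.+1.
Proof.
rewrite c_act ?sp2x_mem // /verma_act_fun !mxE /= !(coefD, coefN, coefZ, coefXM, coef_deriv).
case: l => [|l] /=; first by ring.
by ring.
Qed.

Lemma c_yS u l : (c (act M (sp2y K) u) : {poly K})`_l.+1 = (c u : {poly K})`_l.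
Proof.
rewrite c_act ?sp2y_mem // /verma_act_fun !mxE /= !(coefD, coefN, coefZ, coefXM, coef_deriv) /=.
ring.
Qed.

Lemma height_x (W : sp2mod K) l (z : tens_mod M W) : height l (act (tens_mod M W) (sp2x K) z) =
  (l.+1%:R * (lambda - l%:R)) *: height l.+1 z + act W (sp2x K) (height l z).
Proof.
have l1 := linear_compP (linear_prop (act (tens_mod M W) (sp2x K))) (@height_linear W l).
have l2 := linear_addP (linear_scaleP (l.+1%:R * (lambda - l%:R)) (@height_linear W l.+1))
  (linear_compP (@height_linear W l) (linear_prop (act W (sp2x K)))).
move: z; apply: (@tens_extP K M W W _ _ l1 l2) => u z.
rewrite [act (tens_mod M W) _ _](@tens_actE K M W) (linearDP (@height_linear W l)) !height_pure.
by rewrite c_x scalerA linearZ.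
Qed.

Lemma height_h (W : sp2mod K) l (z : tens_mod M W) : height l (act (tens_mod M W) (sp2h K) z) =
  (lambda - l.*2%:R) *: height l z + act W (sp2h K) (height l z).
Proof.
have l1 := linear_compP (linear_prop (act (tens_mod M W) (sp2h K))) (@height_linear W l).
have l2 := linear_addP (linear_scaleP (lambda - l.*2%:R) (@height_linear W l))
  (linear_compP (@height_linear W l) (linear_prop (act W (sp2h K)))).
move: z; apply: (@tens_extP K M W W _ _ l1 l2) => u z.
rewrite [act (tens_mod M W) _ _](@tens_actE K M W) (linearDP (@height_linear W l)) !height_pure.
by rewrite c_h scalerA linearZ.
Qed.

Lemma height_finite (W : lmodType K) (z : tens M W) : exists L, forall L', (L <= L')%N ->
  height L' z = 0 /\ z = \sum_(l < L') pure (b ('X^l : {poly K})) (height l z).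
Proof.
have h0 (l : nat) : height l (0 : tens M W) = 0 by exact: linear0P (@height_linear W l).
rewrite (tens_span z); elim/big_ind: _ => [|x y [L hL] [L' hL']|[u w] _] /=.
- by exists 0%N => L' _; rewrite h0 big1 // => l _; rewrite h0 pure0r.
- exists (maxn L L') => N; rewrite geq_max => /andP[/hL[a1 a2] /hL'[b1 b2]].
  rewrite (linearDP (@height_linear W _)) a1 b1 addr0; split=> //.
  rewrite {1}a2 {1}b2 -big_split; apply: eq_bigr => l _ /=.
  by rewrite (linearDP (@height_linear W _)) pureAr.
- exists (size (c u : {poly K})) => N hN; rewrite height_pure nth_default // scale0r; split=> //.
  transitivity (pure (b (\sum_(l < N) (c u : {poly K})`_l *: 'X^l)) w).
    congr pure; rewrite -{1}[u]cK; congr (b _); rewrite -[LHS]coefK poly_def.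
    rewrite (big_ord_widen N (fun i => (c u : {poly K})`_i *: 'X^i) hN) big_mkcond.
    by apply: eq_bigr => i _; case: ltnP => // hi; rewrite nth_default ?scale0r.
  rewrite (linear_sumP (mfun_linear b)).
  have lp : linear (fun u : M => pure u w : tens M W) by move=> r x y; exact: pureDl.
  rewrite (linear_sumP lp); apply: eq_bigr => l _.
  by rewrite height_pure pureZr.
Qed.

Lemma height_strand n k (f : mpb (vv k) (vv n)) l (z : wmod (pole k)) :
  height l (F (strand Lm f) z) = F f (height l z).
Proof.
have l1 := linear_compP (F_linear F0 (strand Lm f)) (@height_linear (wmod (vv n)) l).
have l2 := linear_compP (@height_linear (wmod (vv k)) l) (F_linear F0 f).
move: z; apply: (@tens_extP K M (wmod (vv k)) _ _ _ l1 l2) => u z.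
rewrite (@F_strand_l _ _ _ HF Lm (vv k) (vv n)) !height_pure.
by rewrite (linearZP (F_linear F0 f)).
Qed.

Lemma F_hop n (u : M) (e : 'cV[K]_2) (t : wmod (vv n)) :
  F (hop (mid (vv n))) (pure u (pure e t)) =
    - 1 *: pure (act M (sp2h K) u) (pure (sp2h K *m e) t) +
    (- 2 *: pure (act M (sp2x K) u) (pure (sp2y K *m e) t) +
     - 2 *: pure (act M (sp2y K) u) (pure (sp2x K *m e) t)) :> wmod (pole n.+1).
Proof.
rewrite -(@join2 K M Lm Lv) (@F_tens _ _ _ HF [:: Lm; Lv] [:: Lm; Lv] (vv n) (vv n)) F_id //.
rewrite (F_H (char0 1) HF) (linear3P (linear_prop (join (M := M) [:: Lm; Lv] t))).
by rewrite !(@join2 K M Lm Lv).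
Qed.

Definition cup_hop n (z : wmod (pole n)) : wmod (pole n.+2) :=
  F (hop (mid (vv n.+1))) (F (strand Lm (cupv 0 n)) z).

Lemma cup_hop_linear n : linear (@cup_hop n).
Proof. exact: (linear_compP (F_linear F0 (strand Lm (cupv 0 n))) (F_linear F0 (hop (mid (vv n.+1))))). Qed.

(** A dotted cup raises the degree by one: if z has degree l, the new leading coefficient
    is -2 e_0 (x) e_0 (x) height l z. *)
Lemma height_cup_hop n l (z : wmod (pole n)) : height l.+1 (cup_hop z) =
  (lambda - (l.+1).*2%:R) *: pure e1 (pure e0 (height l.+1 z)) +
  (lambda - (l.+1).*2%:R) *: pure e0 (pure e1 (height l.+1 z)) +
  (2 * (l.+2%:R * (lambda - l.+1%:R))) *: pure e1 (pure e1 (height l.+2 z)) -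
  2 *: pure e0 (pure e0 (height l z)) :> wmod (vv n.+2).
Proof.
have [[h0 h1 x0 x1] [y0 y1]] := natural_act K.
pose A := lambda - (l.+1).*2%:R; pose B := 2 * (l.+2%:R * (lambda - l.+1%:R)).
pose R (z : wmod (pole n)) : wmod (vv n.+2) := A *: pure e1 (pure e0 (height l.+1 z)) +
  A *: pure e0 (pure e1 (height l.+1 z)) + B *: pure e1 (pure e1 (height l.+2 z)) +
  - 2 *: pure e0 (pure e0 (height l z)).
have lp (e e' : 'cV[K]_2) (k : nat) : linear (fun z : wmod (pole n) => pure e (pure e' (height k z)) : wmod (vv n.+2)).
  by move=> r x y; rewrite height_linear !pureDr.
have lR : linear R.
  by do ![apply: linear_addP]; apply: linear_scaleP; exact: lp.
have l1 := linear_compP (@cup_hop_linear n) (@height_linear (wmod (vv n.+2)) l.+1).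
rewrite -scaleNr -[RHS]/(R z); move: z.
apply: (@tens_extP K M (wmod (vv n)) (wmod (vv n.+2)) _ _ l1 lR) => u t.
rewrite /cup_hop (@F_strand_l _ _ _ HF Lm (vv n) (vv n.+2)) [cupv 0 n]/(cupx (mid (vv n))).
rewrite (@F_cup_tens _ _ _ HF (vv n) (vv n)) F_id //.
rewrite -[X in pure u (_ + X)]scaleN1r addrC pureDr (F_linear F0) !(@F_hop n.+1) h0 h1 x0 x1 y0 y1.
rewrite !pure0l !pure0r !scaler0 ?addr0 ?add0r.
rewrite !(linearDP (@height_linear (wmod (vv n.+2)) _), linearZP (@height_linear (wmod (vv n.+2)) _)) !height_pure.
rewrite c_h c_x c_yS /R !height_pure -/A -[- e1]scaleN1r !(pureZl, pureZr).
rewrite /B; move: (pure e1 (pure e0 t)) (pure e0 (pure e1 t)) (pure e1 (pure e1 t)) (pure e0 (pure e0 t)) => t1 t2 t3 t4.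
modring [:: t1; t2; t3; t4].
Qed.

Lemma pure_pure0 n (e e' : 'cV[K]_2) : pure e (pure e' (0 : wmod (vv n))) = 0 :> wmod (vv n.+2).
Proof. by rewrite (@pure0r K 'cV[K]_2 (wmod (vv n))) (@pure0r K 'cV[K]_2 (wmod (vv n.+1))). Qed.

Lemma pure_pureZ n a (e e' : 'cV[K]_2) (z : wmod (vv n)) :
  pure e (pure e' (a *: z)) = a *: pure e (pure e' z) :> wmod (vv n.+2).
Proof. by rewrite (@pureZr K 'cV[K]_2 (wmod (vv n))) (@pureZr K 'cV[K]_2 (wmod (vv n.+1))). Qed.

Definition hgt n l (z : wmod (pole n)) : wmod (vv n) := height (W := wmod (vv n)) l z.

Lemma hgt_linear n l : linear (@hgt n l).
Proof. exact: (@height_linear (wmod (vv n)) l). Qed.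

Lemma hgt_strand n k (f : mpb (vv k) (vv n)) l (z : wmod (pole k)) :
  hgt l (F (strand Lm f) z) = F f (hgt l z).
Proof. exact: height_strand. Qed.

Lemma hgt_cup_hop n l (z : wmod (pole n)) : hgt l.+1 z = 0 -> hgt l.+2 z = 0 ->
  hgt l.+1 (cup_hop z) = - 2 *: pure e0 (pure e0 (hgt l z)) :> wmod (vv n.+2).
Proof.
move=> h1 h2; apply: etrans (@height_cup_hop n l z) _.
rewrite -[height l.+1 z]/(hgt l.+1 z) -[height l.+2 z]/(hgt l.+2 z) h1 h2.
by rewrite !(@pure_pure0 n) !scaler0 !add0r scaleNr.
Qed.

Definition base : wmod (pole 0) := pure (b (1 : {poly K})) (1 : K^o).

Lemma base_height l : hgt l base = if l == 0%N then (1 : K^o) else 0.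
Proof.
rewrite [hgt l base]height_pure bK -[_ *: _]/(_ * _) mulr1 coef1.
by case: eqP.
Qed.

(** The leading coefficient of j dotted cups applied to the highest weight vector is a
    nonzero multiple of the highest weight vector on the 2j strands. *)
Lemma dots_height j : hgt j (F (dots j) base) = (-2) ^+ j *: top_vec j.*2 /\
  forall l, (j < l)%N -> hgt l (F (dots j) base) = 0.
Proof.
elim: j => [|j [IH1 IH2]].
  rewrite /= F_id // base_height /= expr0 scale1r; split=> // -[//|l] _.
  exact: base_height.
have e : F (dots j.+1) base = cup_hop (F (dots j) base) by rewrite /= !F_comp.
rewrite e; split.
  apply: etrans (@hgt_cup_hop j.*2 j _ (IH2 _ (ltnSn _)) (IH2 _ (leqnSn _))) _.
  by rewrite IH1 (@pure_pureZ j.*2) scalerA exprS.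
case=> [//|l]; rewrite ltnS => lj.
apply: etrans (@hgt_cup_hop j.*2 l _ (IH2 _ _) (IH2 _ _)) _; rewrite ?ltnS ?(ltnW lj) //.
  by rewrite leqW // ltnW.
by rewrite IH2 // (@pure_pure0 j.*2) scaler0.
Qed.

Lemma pow_neq0 j : (-2) ^+ j != 0 :> K. Proof. exact: loop_neq0. Qed.

(** The leading degree of a normal form is read off first: it is the image of top_vec
    under a cap-free morphism, and noncap_inj makes it vanish. Descending induction on
    the number of dotted cups. *)
Lemma dot_sum_inj n (f : forall j, mpb (vv j.*2) (vv n)) J : (forall j, noncap (f j)) ->
  F (dot_sum f J) base = 0 -> dot_sum f J = 0.
Proof.
move=> hf; elim: J => [|J IH] h; first by rewrite /dot_sum big_ord0.
have rec : dot_sum f J.+1 = dot_sum f J + mcomp (strand Lm (f J)) (dots J).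
  by rewrite /dot_sum big_ord_recr.
have low : hgt J (F (dot_sum f J) base) = 0.
  rewrite /dot_sum; elim/big_ind: _ => [|x y hx hy|j _].
  - by rewrite F_zero // (linear0P (@hgt_linear _ _)).
  - by rewrite F_add // (linearDP (@hgt_linear _ _)) hx hy addr0.
  - rewrite F_comp // hgt_strand; have [_ ->] := dots_height j; last exact: ltn_ord.
    exact: F_linear0.
have fJ : f J = 0.
  apply: (noncap_inj HF (hf J)).
  have := congr1 (hgt J) h; rewrite rec F_add // (linearDP (@hgt_linear _ _)) low add0r.
  rewrite F_comp // hgt_strand (linear0P (@hgt_linear _ _)).
  have [-> _] := dots_height J; rewrite (linearZP (F_linear F0 _)) => /eqP.
  by rewrite scaler_eq0 (negbTE (pow_neq0 J)) => /eqP.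
rewrite rec fJ strand0 mcomp0l addr0; apply: IH.
by move: h; rewrite rec fJ strand0 mcomp0l addr0.
Qed.

Lemma act_base A (u : M) : act (wmod (pole 0)) A (pure u (1 : K^o)) = pure (act M A u) (1 : K^o).
Proof. exact: (@act_word1 K M Lm). Qed.

Hypothesis hb : highest_weight_vector lambda (b (1 : {poly K})).

Lemma base_hw : highest_weight_vector lambda base.
Proof.
case: hb => hx hh; split; rewrite /base (act_base _ (b 1)) ?hx ?hh; first exact: pure0l.
exact: pureZl.
Qed.

(** The value of the Casimir is transported from the polynomial model. *)
Lemma module_casimir (u : M) : act M (sp2h K) (act M (sp2h K) u) + 2 *: act M (sp2h K) u
  + 4 *: act M (sp2y K) (act M (sp2x K) u) = (lambda * (lambda + 2)) *: u.
Proof.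
have cE A w : A \in sp2 (K:=K) -> act M A (b w) = b (act _ A w) by move=> hA; rewrite mfun_act.
rewrite -[u]cK; move: (c u) => w {u}.
rewrite !cE ?sp2h_mem ?sp2x_mem ?sp2y_mem //.
by rewrite -!(linearZP (mfun_linear b)) -!(linearDP (mfun_linear b)) verma_casimir.
Qed.

Lemma F_ideal0 r s (f : mpb (pole r) (pole s)) : ideal f -> forall x, F f x = 0.
Proof. exact: (F_tlb_ideal (char0 1) module_casimir HF). Qed.

(** A morphism killed on the highest weight vector has, by its normal form, a vanishing
    combination of dotted cups modulo the ideal. *)
Lemma faithful0 n (w : mpb (pole 0) (pole n)) : F w base = 0 -> ideal w.
Proof.
have [f hf [J /(_ J (leqnn J)) hJ]] := pole_normal lambda char0 HF w => h.
have h0 : F (dot_sum f J) base = 0.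
  by have := F_ideal0 hJ base; rewrite F_sub // h sub0r => /eqP; rewrite oppr_eq0 => /eqP.
by rewrite (dot_sum_inj hf h0) subr0 in hJ.
Qed.

(** The leading coefficient of a highest weight vector of weight lambda in degree L is a
    highest weight vector of weight 2L in the strands; noncap_surj produces it from L
    dotted cups, and the difference has lower degree. *)
Lemma hw_surj n (z : wmod (pole n)) : highest_weight_vector lambda z -> exists w, F w base = z.
Proof.
have [L hL] := height_finite (W := wmod (vv n)) z.
have {hL} : forall l, (L <= l)%N -> hgt l z = 0 by move=> l /hL[].
elim: L z => [|L IH] z hz hw.
  exists 0; rewrite F_zero //; have [N /(_ N (leqnn N))[_ ->]] := height_finite (W := wmod (vv n)) z.
  by rewrite big1 // => l _; rewrite (_ : height (W := wmod (vv n)) l z = 0) ?pure0r //; exact: hz.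
have [hx hh] := hw.
have hL : highest_weight_vector (L.*2%:R) (hgt L z).
  split.
    have : act (wmod (vv n)) (sp2x K) (hgt L z) = hgt L (act (wmod (pole n)) (sp2x K) z).
      rewrite [RHS](@height_x (wmod (vv n)) L z) -[height L.+1 z]/(hgt L.+1 z) (hz L.+1 (ltnSn L)) scaler0 add0r //.
    by rewrite hx (linear0P (@hgt_linear _ _)).
  have e : lambda *: hgt L z = (lambda - L.*2%:R) *: hgt L z + act (wmod (vv n)) (sp2h K) (hgt L z).
    rewrite -(linearZP (@hgt_linear n L)) -hh.
    exact: (@height_h (wmod (vv n)) L z).
  by rewrite -[LHS](addKr ((lambda - L.*2%:R) *: hgt L z)) -e -scaleNr -scalerDl; congr (_ *: _); ring.
have [f hf ef] := noncap_surj char0 HF hL.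
(* The scalar compensates the leading coefficient of L dotted cups. *)
pose w1 := ((-2) ^+ L)^-1 *: mcomp (strand Lm f) (dots L).
have hw1 : highest_weight_vector lambda (z - F w1 base).
  by apply: hw_sub => //; apply: F_hw => //; exact: base_hw.
have heights l : hgt l (F w1 base) = ((-2) ^+ L)^-1 *: F f (hgt l (F (dots L) base)).
  by rewrite F_scale // (linearZP (@hgt_linear _ _)) F_comp // hgt_strand.
have [w2 e2] : exists w, F w base = z - F w1 base.
  apply: IH => // l Ll.
  have -> : hgt l (z - F w1 base) = hgt l z - hgt l (F w1 base).
    by rewrite -scaleN1r addrC hgt_linear scaleN1r addrC.
  move: Ll; rewrite heights leq_eqVlt => /orP[/eqP <-|Ll].
    have [-> _] := dots_height L; rewrite (linearZP (F_linear F0 f)) ef scalerA mulVf ?pow_neq0 //.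
    by rewrite scale1r subrr.
  have [_ /(_ l Ll) ->] := dots_height L.
  by rewrite F_linear0 // scaler0 subr0 hz.
by exists (w2 + w1); rewrite F_add // e2 subrK.
Qed.

(** The Verma module is generated by its highest weight vector under y. *)
Lemma pole0_ext (N : sp2mod K) (g1 g2 : mod_hom (wmod (pole 0)) N) : g1 base = g2 base -> g1 =1 g2.
Proof.
move=> e; apply: (@tens_extP K M (triv_mod K) N _ _ (mfun_linear g1) (mfun_linear g2)) => u r.
have -> : r = (r : K) *: (1 : K^o) by rewrite -[RHS]/(_ * _) mulr1.
rewrite pureZr (linearZP (mfun_linear g1)) (linearZP (mfun_linear g2)); congr (_ *: _).
rewrite -[u]cK; move: (c u) => p {u r}.
have lg (g : mod_hom (wmod (pole 0)) N) : linear (fun p : {poly K} => g (pure (b p) (1 : K^o)) : N).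
  by move=> a x y; rewrite (mfun_linear b) pureDl (mfun_linear g).
move: p; apply: (@poly_linear_ext K N (mk_linear (lg g1)) (mk_linear (lg g2))) => k /=.
elim: k => [|k IHk]; first exact: e.
have -> : b ('X^(k.+1) : {poly K}) = act M (sp2y K) (b ('X^k : {poly K})).
  rewrite -mfun_act ?sp2y_mem //; congr (b _).
  by rewrite [RHS]verma_actXn !mxE /= !mul0r !scale0r !add0r scale1r.
by rewrite -(act_base _ (b 'X^k)) !mfun_act ?sp2y_mem // IHk.
Qed.

(** A homomorphism out of M is the choice of a highest weight vector of weight lambda. *)
Lemma full0 n (phi : mod_hom (wmod (pole 0)) (wmod (pole n))) : exists w, F w =1 phi.
Proof.
have hz : highest_weight_vector lambda (phi base).
  have [hx hh] := base_hw; split; rewrite -mfun_act ?sp2x_mem ?sp2h_mem // ?hx ?hh.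
    exact: (linear0P (mfun_linear phi)).
  exact: (linearZP (mfun_linear phi)).
have [w e] := hw_surj hz; exists w.
exact: (@pole0_ext (wmod (pole n)) (F0 w) phi e).
Qed.

End PoleZero.

(** * Faithfulness, by bending the last strand *)

Lemma pole_snoc r : pole r ++ [:: Lv] = pole r.+1.
Proof. by rewrite /pole cat_cons cats1 -[in RHS]addn1 nseqD cats1. Qed.

Lemma pole_snoc2 r : pole r ++ [:: Lv; Lv] = pole r.+2.
Proof. by rewrite -[[:: Lv; Lv]]/([:: Lv] ++ [:: Lv]) catA !pole_snoc. Qed.

Section RightStrand.
Variables (K : fieldType) (lambda : K).
Local Notation mpb := (@mpb K (-2)).
Local Notation mid := (@mid K (-2)).
Local Notation mcup := (mcup (-2 : K)).
Local Notation mcap := (mcap (-2 : K)).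
Local Notation ideal := (tlb_ideal lambda).

(** A strand added on the right, far from the pole, where it does not disturb Z_2; the
    price is a transport along an equality of words. *)
Definition rstrand r s (f : mpb (pole r) (pole s)) : mpb (pole r.+1) (pole s.+1) :=
  mcast (pole_snoc r) (pole_snoc s) (mtens f (mid [:: Lv])).

Lemma rstrand_heq r s (f : mpb (pole r) (pole s)) : heq (rstrand f) (mtens f (mid [:: Lv])).
Proof. exact: heq_cast. Qed.

Lemma rstrandP r s a (f g : mpb (pole r) (pole s)) :
  rstrand (a *: f + g) = a *: rstrand f + rstrand g.
Proof.
apply: heq_eq; apply: heq_trans (rstrand_heq _) _; rewrite mtensDl mtensZl.
apply: heq_sym; apply: heq_add; last exact: rstrand_heq.
exact: heq_scale (rstrand_heq f).
Qed.

Lemma rstrand_comp r s t (g : mpb (pole s) (pole t)) (f : mpb (pole r) (pole s)) :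
  rstrand (mcomp g f) = mcomp (rstrand g) (rstrand f).
Proof.
apply: heq_eq; apply: heq_trans (rstrand_heq _) _.
rewrite -[mid [:: Lv] in X in heq X]mcomp1m -mcomp_tens.
exact: heq_sym (heq_comp (rstrand_heq g) (rstrand_heq f)).
Qed.

Lemma rstrand_id r : rstrand (mid (pole r)) = mid (pole r.+1).
Proof.
apply: heq_eq; apply: heq_trans (rstrand_heq _) _; rewrite mid_tens.
exact/heq_mid/pole_snoc.
Qed.

Lemma rstrand_Z2 r : rstrand (Z2_at (-2 : K) r) = Z2_at (-2 : K) r.+1.
Proof.
apply: heq_eq; apply: heq_trans (rstrand_heq _) _.
have h : heq (mtens (Z2 (-2 : K)) (mtens (mid (nseq r Lv)) (mid [:: Lv])))
    (mtens (Z2 (-2 : K)) (mid (nseq r.+1 Lv))).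
  apply: heq_tens; first exact: heq_refl.
  by rewrite mid_tens; apply: heq_mid; rewrite cats1 -[in RHS]addn1 nseqD cats1.
exact: (heq_trans (heq_sym (mtensA_heq (Z2 (-2 : K)) (mid (nseq r Lv)) (mid [:: Lv]))) h).
Qed.

Lemma theta_cast s s' t t' (es : s = s') (et : t = t') (f : mpb s t) :
  theta_ideal f -> theta_ideal (mcast es et f).
Proof. by case: s' / es; case: t' / et. Qed.

(** Tensoring preserves the tensor ideal, and Z_2 next to r strands becomes Z_2 next to
    r + 1 strands. *)
Lemma rstrand_ideal r s (f : mpb (pole r) (pole s)) : ideal f -> ideal (rstrand f).
Proof.
elim=> {r s f} [r s f hf|r|r s a f g _ IHf _ IHg|r s t u h f g _ IH].
- by apply: tlb_theta; apply: theta_cast; exact: theta_tens_r.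
- rewrite addrC -scaleNr rstrandP rstrand_id rstrand_Z2 scaleNr addrC.
  exact: tlb_gen.
- by rewrite rstrandP; exact: tlb_lin.
- by rewrite !rstrand_comp; exact: tlb_comp.
Qed.

Definition cup_end r : mpb (pole r) (pole r.+2) :=
  mcast (cats0 _) (pole_snoc2 r) (mtens (mid (pole r)) mcup).
Definition cap_end r : mpb (pole r.+2) (pole r) :=
  mcast (pole_snoc2 r) (cats0 _) (mtens (mid (pole r)) mcap).

(** The cap is to the right of f, so they can be performed in either order. *)
Lemma cap_end_rstrand r s (f : mpb (pole r) (pole s)) :
  mcomp (cap_end s) (rstrand (rstrand f)) = mcomp f (cap_end r).
Proof.
have h1 : heq (rstrand (rstrand f)) (mtens f (mid [:: Lv; Lv])).
  apply: heq_trans (rstrand_heq _) _.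
  apply: heq_trans (heq_tens (rstrand_heq _) (heq_refl _)) _.
  apply: heq_trans (heq_sym (mtensA_heq _ _ _)) _.
  by rewrite (mid_tens _ [:: Lv] [:: Lv]); exact: heq_refl.
apply: heq_eq; apply: heq_trans (heq_comp (heq_cast _ _ _) h1) _.
rewrite (mcomp_tens (mid (pole s)) f mcap (mid [:: Lv; Lv])) mcomp1m mcompm1.
apply: heq_sym; apply: heq_trans (heq_comp (heq_sym (mtens_id0_heq f)) (heq_cast _ _ _)) _.
rewrite (mcomp_tens f (mid (pole r)) (mid [::]) mcap) mcomp1m mcompm1.
exact: heq_refl.
Qed.

(** The snake identity at the right end of the word. *)
Lemma cap_end_cup_end (M : sp2mod K) (F0 : forall s t, mpb s t -> mod_hom (word_mod M s) (word_mod M t))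
  (HF : is_F_MPB F0) r : mcomp (cap_end r.+1) (rstrand (cup_end r)) = mid (pole r.+1).
Proof.
have h1 : heq (rstrand (cup_end r)) (mtens (mid (pole r)) (mtens mcup (mid [:: Lv]))).
  apply: heq_trans (rstrand_heq _) _.
  apply: heq_trans (heq_tens (heq_cast _ _ _) (heq_refl _)) _.
  exact: heq_sym (mtensA_heq _ _ _).
have h2 : heq (cap_end r.+1) (mtens (mid (pole r)) (mtens (mid [:: Lv]) mcap)).
  apply: heq_trans (heq_cast _ _ _) _; apply: heq_sym.
  apply: heq_trans (mtensA_heq _ _ _) _; apply: heq_tens; last exact: heq_refl.
  by rewrite mid_tens; exact/heq_mid/pole_snoc.
apply: heq_eq; apply: heq_trans (heq_comp h2 h1) _.
rewrite (mcomp_tens (mid (pole r)) (mid (pole r)) (mtens (mid [:: Lv]) mcap) (mtens mcup (mid [:: Lv]))).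
rewrite mcomp1m (snake_r HF) mid_tens.
exact/heq_mid/pole_snoc.
Qed.

Section Functor.
Variables (M : sp2mod K) (F0 : forall s t, mpb s t -> mod_hom (word_mod M s) (word_mod M t)).
Hypothesis HF : is_F_MPB F0.
Local Notation F := (F F0).

Lemma F_cast s s' t t' (es : s = s') (et : t = t') (f : mpb s t) :
  (forall x, F f x = 0) -> forall x, F (mcast es et f) x = 0.
Proof. by case: s' / es; case: t' / et. Qed.

Lemma F_rstrand r s (f : mpb (pole r) (pole s)) :
  (forall x, F f x = 0) -> forall x, F (rstrand f) x = 0.
Proof.
move=> h; apply: F_cast; apply: (F_tens_ext HF) => x y.
by rewrite h linear0.
Qed.

Hypothesis faithful0 : forall n (w : mpb (pole 0) (pole n)), (forall x, F w x = 0) -> ideal w.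

(** Bending the last bottom strand up turns a morphism killed by the functor into one with
    fewer bottom strands, also killed, hence in the ideal. Bending it back down
    recovers the morphism, and the ideal is stable under these operations. *)
Lemma faithful r s (f : mpb (pole r) (pole s)) : (forall x, F f x = 0) -> ideal f.
Proof.
elim: r s f => [|r IH] s f hf; first exact: faithful0.
have hb : ideal (mcomp (rstrand f) (cup_end r)).
  by apply: IH => x; rewrite F_comp // F_rstrand.
have := ideal_compl (cap_end s) (rstrand_ideal hb).
by rewrite rstrand_comp mcompA cap_end_rstrand -mcompA (cap_end_cup_end HF) mcompm1.
Qed.

End Functor.
End RightStrand.

(** * Fullness, by bending the first strand *)

Lemma linearBP (K : fieldType) (U V : lmodType K) (f : U -> V) : linear f ->
  forall u v, f (u - v) = f u - f v.
Proof. by move=> lf u v; rewrite -scaleN1r addrC lf scaleN1r addrC. Qed.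

Section LeftStrand.
Variables (K : fieldType) (M : sp2mod K).
Local Notation wmod := (word_mod M).
Local Notation vv n := (nseq n Lv).
Local Notation mpb := (@mpb K (-2)).
Local Notation mid := (@mid K (-2)).
Local Notation e0 := (basisV K 0).
Local Notation e1 := (basisV K 1).
Variable F0 : forall s t, mpb s t -> mod_hom (wmod s) (wmod t).
Hypothesis HF : is_F_MPB F0.
Local Notation F := (F F0).

Section TensHom.
Variables (N W W' : sp2mod K) (phi : mod_hom W W').

Lemma tens_hom_bilinear : bilinear_map (fun (u : N) (w : W) => pure u (phi w) : tens N W').
Proof.
split=> [u a w w'|w a u u']; first by rewrite mfun_linear pureDr.
by rewrite pureDl.
Qed.

Definition tens_hom_fun : tens_mod N W -> tens_mod N W' :=
  tens_lift (fun (u : N) (w : W) => pure u (phi w) : tens N W').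

Lemma tens_hom_linear : linear tens_hom_fun.
Proof. exact: tens_lift_linear tens_hom_bilinear. Qed.

Lemma tens_hom_pure u w : tens_hom_fun (pure u w) = pure u (phi w).
Proof. exact: tens_lift_pure tens_hom_bilinear. Qed.

Lemma tens_hom_act A x : A \in sp2 (K:=K) ->
  tens_hom_fun (act (tens_mod N W) A x) = act (tens_mod N W') A (tens_hom_fun x).
Proof.
move=> hA.
have l1 := linear_compP (linear_prop (act (tens_mod N W) A)) tens_hom_linear.
have l2 := linear_compP tens_hom_linear (linear_prop (act (tens_mod N W') A)).
move: x; apply: (tens_extP l1 l2) => u w.
rewrite tens_hom_pure [act (tens_mod N W) _ _](@tens_actE K N W).
rewrite [act (tens_mod N W') _ _](@tens_actE K N W') (linearDP tens_hom_linear) !tens_hom_pure.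
by rewrite mfun_act.
Qed.

(** The homomorphism id (x) phi. *)
Definition tens_hom : mod_hom (tens_mod N W) (tens_mod N W') :=
  @ModHom _ (tens_mod N W) (tens_mod N W') tens_hom_fun tens_hom_linear tens_hom_act.

End TensHom.

(** A strand on the left of the pole is carried to its right by a crossing. Bending strands
    there needs no transport, and on modules it is the functor id (x) -. *)
Definition strand_in n : mpb (Lv :: pole n) (pole n.+1) := mtens (mX _ Lv Lm) (mid (vv n)).
Definition strand_out n : mpb (pole n.+1) (Lv :: pole n) := mtens (mX _ Lm Lv) (mid (vv n)).

Lemma F_XX a e (x : wmod [:: a; e]) : (a == Lv) && (e == Lv) = false ->
  F (mX _ e a) (F (mX _ a e) x) = x.
Proof.
move=> h.
have l1 := linear_compP (F_linear F0 (mX _ a e)) (F_linear F0 (mX _ e a)).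
have l2 : linear (fun x : wmod [:: a; e] => x) by [].
move: x; apply: (pure2_ext l1 l2) => u w.
by rewrite (F_X HF) /gsign h scale1r (F_X HF) /gsign andbC h scale1r.
Qed.

(** Crossings of the pole with a strand carry no sign, so they cancel in pairs. *)
Lemma F_XX_tens a e s (x : wmod [:: a, e & s]) : (a == Lv) && (e == Lv) = false ->
  F (mtens (mX _ e a) (mid s)) (F (mtens (mX _ a e) (mid s)) x) = x.
Proof.
move=> h.
have l1 := linear_compP (F_linear F0 (mtens (mX _ a e) (mid s))) (F_linear F0 (mtens (mX _ e a) (mid s))).
have l2 : linear (fun x : wmod ([:: a; e] ++ s) => x) by [].
move: x; apply: (@join_ext K M _ [:: a; e] s _ _ l1 l2) => y z.
rewrite (@F_tens _ _ _ HF [:: a; e] [:: e; a] s s) (@F_tens _ _ _ HF [:: e; a] [:: a; e] s s).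
by rewrite !F_id // F_XX.
Qed.

Definition bend_down r s (g : mpb (pole r) (pole s.+1)) : mpb (pole r.+1) (pole s) :=
  mcomp (capx (mid (pole s))) (mcomp (strand Lv (mcomp (strand_out s) g)) (strand_out r)).

Definition cup_in r : mpb (pole r) (Lv :: pole r.+1) :=
  mcomp (strand Lv (strand_in r)) (cupx (mid (pole r))).

Lemma F_cup_in r (z : wmod (pole r)) : F (cup_in r) z =
  pure e1 (F (strand_in r) (pure e0 z : wmod (Lv :: pole r)) : wmod (pole r.+1)) -
  pure e0 (F (strand_in r) (pure e1 z : wmod (Lv :: pole r))) :> wmod (Lv :: pole r.+1).
Proof.
have lS := F_linear F0 (strand Lv (strand_in r)).
rewrite F_comp // (@F_cup_tens _ _ _ HF (pole r) (pole r)) F_id // -scaleN1r addrC lS addrC scaleN1r.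
by rewrite !(@F_strand_l _ _ _ HF Lv (Lv :: pole r) (pole r.+1)).
Qed.

(** The snake identity on vectors: expanding v in the basis e_0, e_1 by means of omega
    recovers phi. *)
Lemma F_bend_down r s (phi : mod_hom (wmod (pole r.+1)) (wmod (pole s))) (g : mpb (pole r) (pole s.+1)) :
  (forall z, F g z = F (strand_in s) (tens_hom (natural_mod K) phi (F (cup_in r) z))) ->
  F (bend_down g) =1 phi.
Proof.
move=> hg x; rewrite /bend_down !F_comp //.
rewrite -[x in RHS](@F_XX_tens Lm Lv (vv r)) //; move: (F (strand_out r) x) => y {x}.
have l1 := linear_compP (F_linear F0 (strand Lv (mcomp (strand_out s) g)))
  (F_linear F0 (capx (mid (pole s)))).
have l2 := linear_compP (F_linear F0 (strand_in r)) (mfun_linear phi).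
move: y; apply: (@tens_extP K 'cV[K]_2 (wmod (pole r)) (wmod (pole s)) _ _ l1 l2) => v z.
rewrite (@F_strand_l _ _ _ HF Lv (pole r) (Lv :: pole s)) F_comp // hg.
rewrite (@F_XX_tens Lv Lm (vv s)) // F_cup_in.
set a0 := F (strand_in r) _; set a1 := F (strand_in r) (pure e1 z).
have -> : tens_hom (natural_mod K) phi (pure e1 a0 - pure e0 a1 : wmod (Lv :: pole r.+1)) =
    pure e1 (phi a0) - pure e0 (phi a1) :> wmod (Lv :: pole s).
  apply: etrans (linearBP (@tens_hom_linear (natural_mod K) _ _ phi) _ _) _.
  by congr (_ - _); exact: (@tens_hom_pure (natural_mod K)).
have -> : pure v (pure e1 (phi a0) - pure e0 (phi a1)) =
    -1 *: pure v (pure e0 (phi a1) : wmod (Lv :: pole s)) + pure v (pure e1 (phi a0) : wmod (Lv :: pole s))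
    :> wmod [:: Lv, Lv & pole s].
  rewrite [pure e1 _ - _]addrC -[- pure e0 (phi a1)]scaleN1r.
  exact: (@pureDr K 'cV[K]_2 (wmod (Lv :: pole s))).
rewrite (F_linear F0) !(@F_cap_tens _ _ _ HF (pole s) (pole s)) !F_id //.
have ev : pure v z = v 0 0 *: pure e0 z + v 1 0 *: pure e1 z :> wmod (Lv :: pole r).
  by rewrite {1}[v]cV_basis (@pureDl K 'cV[K]_2 (wmod (pole r))) (@pureZl K 'cV[K]_2 (wmod (pole r))).
rewrite ev (F_linear F0) (linearZP (F_linear F0 _)) -/a0 -/a1.
rewrite (mfun_linear phi) (linearZP (mfun_linear phi)) addrC !omegaE !mxE /=.
by rewrite scalerA; congr (_ *: _ + _ *: _); ring.
Qed.

Hypothesis full0 : forall n (phi : mod_hom (wmod (pole 0)) (wmod (pole n))), exists w, F w =1 phi.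

(** Bending the first strand at the source of phi gives a homomorphism with one strand
    less at the source, which is the image of a morphism by induction; bending that
    morphism back down gives one that maps to phi. *)
Lemma full r s (phi : mod_hom (wmod (pole r)) (wmod (pole s))) : exists w, F w =1 phi.
Proof.
elim: r s phi => [|r IH] s phi; first exact: full0.
have [g hg] := IH s.+1 (mod_comp (F0 (strand_in s))
  (mod_comp (tens_hom (natural_mod K) phi : mod_hom (wmod (Lv :: pole r.+1)) (wmod (Lv :: pole s)))
     (F0 (cup_in r)))).
by exists (bend_down g); apply: F_bend_down => z; rewrite hg.
Qed.

End LeftStrand.

Section Isomorphism.
Variables (C D : category).

Lemma functor_eq (o : ob C -> ob D) (m m' : forall x y, hom x y -> hom (o x) (o y)) p q p' q' :
  m = m' -> @Functor C D o m p q = @Functor C D o m' p' q'.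
Proof. by move=> e; case: m' / e p' q' => p' q'; congr Functor; exact: Prop_irrelevance. Qed.

End Isomorphism.

(** A functor that is the identity on objects is an isomorphism as soon as it is bijective
    on each space of morphisms. *)
Lemma tlb_isomorphism (K : fieldType) (lambda : K) (M : sp2mod K) : (forall n, n.+1%:R != 0 :> K) ->
  is_verma lambda M -> forall G : functor (TLB (-2) lambda) (TM M), is_F_TLB G -> is_isomorphism G.
Proof.
move=> char0 hM G [F0 HF [Fm [F1 [FM [-> FmE]]]]].
have [c [b [hb cK bK]]] := verma_coordinates hM.
have fl r s : forall phi : mod_hom (word_mod M (pole r)) (word_mod M (pole s)),
    exists w, F0 (pole r) (pole s) w =1 phi.
  exact: (full HF (full0 char0 cK bK HF hb)).
have fa r s (f : mpb (-2 : K) (pole r) (pole s)) : (forall x, F0 _ _ f x = 0) -> tlb_ideal lambda f.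
  apply: (faithful HF) => n w hw; exact: (faithful0 char0 cK bK HF (hw _)).
pose Gm r s (phi : mod_hom (word_mod M (pole r)) (word_mod M (pole s))) : tlb_hom (-2) lambda r s :=
  tlb_cls lambda (sval (cid (fl r s phi))).
have FG r s phi : Fm r s (Gm r s phi) = phi.
  by rewrite FmE; apply: mod_hom_ext; exact: svalP (cid (fl r s phi)).
have inj r s : injective (Fm r s).
  move=> f g; rewrite -[f]tlb_cls_repr -[g]tlb_cls_repr !FmE => e.
  apply/tlb_clsP; apply: fa => x.
  by rewrite [LHS](F_sub HF) /F e subrr.
have GF r s f : Gm r s (Fm r s f) = f by apply: inj; rewrite FG.
have G1 r : Gm r r (mod_id _) = tlb_cls lambda (mid _ (pole r)).
  by apply: inj; rewrite FG; exact: esym (F1 r).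
have GM r s t (g : hom (c := TM M) s t) (f : hom (c := TM M) r s) :
    Gm r t (mod_comp g f) = tlb_compose (Gm s t g) (Gm r s f).
  by apply: inj; rewrite FG [RHS]FM /= !FG.
exists (@Functor (TM M) (TLB (-2) lambda) id Gm G1 GM); split.
- apply: (@functor_eq (TLB (-2) lambda) (TLB (-2) lambda) id).
  by apply: functional_extensionality_dep => r; apply: functional_extensionality_dep => s; apply/funext => f; exact: GF.
- apply: (@functor_eq (TM M) (TM M) id).
  by apply: functional_extensionality_dep => r; apply: functional_extensionality_dep => s; apply/funext => f; exact: FG.
Qed.

(** * Isomorphism of the two categories *)

Unset Implicit Arguments.

Theorem theorem7p3 (R : realType) (lambda : R[i])
    (hlambda : forall k : nat, lambda <> - k.+2%:R)
    (M : sp2mod R[i]) (hM : is_verma lambda M) :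
  (exists F : functor (TLB (-2) lambda) (TM M), is_F_TLB F) /\
  (forall F : functor (TLB (-2) lambda) (TM M), is_F_TLB F -> is_isomorphism F).
Proof.
have char0 n : n.+1%:R != 0 :> R[i] by rewrite Num.Theory.pnatr_eq0.
split; first exact: (tlb_functor_exists (char0 1) hM).
exact: tlb_isomorphism char0 hM.
Qed.
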